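(* Assume that $m_{\beta_1}$ is odd and $m_{\beta_2}$ is even. Let $f\in C_c^\infty(\mathsf X)$ and $y\in\mathsf X$ be fixed, and let $N$ be a positive integer. Then, in the notation of the context, the function $F$ (which depends on $f$ and $y$) admits a holomorphic extension $\widetilde F$ to $\mathrm M_{\gamma_N}$, given for $m\in\{-1,0,\dots,N\}$, $\varepsilon\in\{\pm1\}^{N+1}$ and $(z,\zeta)\in U_{\varepsilon(m^\vee)}\cup U_{m,\varepsilon}$ by $$\widetilde F(z,\zeta)=F_{(m)}(z)+2\sum_{\ell=0}^m\widetilde G_{(N,\ell)}(z,\zeta)+2\sum_{\substack{m<\ell\le N\\ \varepsilon_\ell=-1}}\big[\widetilde G_{(N,\ell)}(z,\zeta)-\widetilde G_{(N,\ell)}(z,-\zeta)\big]$$ (empty sums are $0$). The resolvent $R(z)=[R(z)f](y)$ of the Laplacian lifts and extends holomorphically to the function $\widetilde R_{(N)}$ given on $\mathrm M_{\gamma_N}$ by $$\widetilde R_{(N)}(z,\zeta)=\widetilde H(z,\zeta)+i\pi\,\widetilde F(z,\zeta),$$ where $\widetilde H(z,\zeta)=H(z)$ is a lift of the holomorphic function $H$ of the context. Consequently, the Laplacian has no resonances.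
   Context: **Setting.** $\mathsf X=\mathsf X_1\times\mathsf X_2$, where $\mathsf X_j=\mathrm G_j/\mathrm K_j$ ($j=1,2$) is a Riemannian symmetric space of the noncompact type and rank one. $\mathfrak a_j^*$ is the (one-dimensional) dual of a Cartan subspace, with inner product $\langle\cdot,\cdot\rangle$ induced by the Killing form; $\beta_j$ is the unique positive restricted root such that $2\beta_j$ is not a root; $m_{\beta_j},m_{\beta_j/2}$ are the multiplicities of $\beta_j,\beta_j/2$ (0 if not a root); $b_j=\sqrt{\langle\beta_j,\beta_j\rangle}$, $\rho_{\beta_j}=\frac12(m_{\beta_j}+\frac{m_{\beta_j/2}}2)$. For $\lambda\in(\mathfrak a_1^*\oplus\mathfrak a_2^* )_{\mathbb C}$, $\varphi_\lambda$ is the spherical function on $\mathsf X$ with spectral parameter $\lambda$ (the positive Laplacian $\Delta$ has eigenvalue $\langle\rho,\rho\rangle-\langle\lambda,\lambda\rangle$ on it, $\rho=\rho_{\beta_1}\beta_1+\rho_{\beta_2}\beta_2$). $f\times\varphi_\lambda$ is convolution on $\mathsf X$. $P_1(x)=\prod_{k=0}^{2\rho_{\beta_1}-2}(x-(\rho_{\beta_1}-1)+k)\prod_{k=0}^{m_{\beta_1/2}/2-1}\big(x-(\frac{m_{\beta_1/2}}4-\frac12)+k\big)$, $Q_1(x)=\cot(\pi(x-\rho_{\beta_1}))$; $P_2(x)=\prod_{k=0}^{2(\rho_{\beta_2}-1)}(x-(\rho_{\beta_2}-1)+k)$, $Q_2=1$; $p_j(x)=P_j(ix/b_j)$, $q_j(x)=Q_j(ix/b_j)$.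 $L_{1,\ell}=b_1(\rho_{\beta_1}+\ell)$ ($\ell\in\mathbb Z_{\ge0}$), $L_{1,-1}=0$, $S_1=\{\pm iL_{1,\ell}:\ell\ge0\}$, $L=L_{1,0}$. $\mathrm c(w)=\frac{w+w^{-1}}2$, $\mathrm s(w)=\frac{w-w^{-1}}2$; $\partial\mathrm E_{a,b}=\{\xi+i\eta:(\xi/a)^2+(\eta/b)^2=1\}$. For fixed $f,y$ (suppressed from notation): $$\psi_z(w)=\big(f\times\varphi_{i\frac z{b_1}\mathrm c(w)\beta_1+i\frac z{b_2}\mathrm c(-iw)\beta_2}\big)(y),\quad\phi_z(w)=-z^2\mathrm c(w)\tfrac{\mathrm s(w)}w\,p_1(z\mathrm c(w))q_1(z\mathrm c(w))\,p_2(z\mathrm c(-iw))q_2(z\mathrm c(-iw)),$$ $F(z)=\int_{|w|=1}\psi_z\phi_z\,dw$, holomorphic on $\mathbb C\setminus i((-\infty,-L]\cup[L,\infty))$. **Resolvent and $H$.** For $\operatorname{Im}z>0$, $R(z)=[(\Delta-\langle\rho,\rho\rangle-z^2)^{-1}f](y)$, equal up to a nonzero constant multiple to $\int_0^\infty\frac{F(r)\,r}{r^2-z^2}\,dr$; resolvent identities are understood up to such nonzero constants. $R$ extends holomorphically to $\mathbb C\setminus((-\infty,0]\cup i(-\infty,-L])$. For fixed $x_0,y_0>0$ and $Q=\{\operatorname{Re}z>x_0,\ y_0>\operatorname{Im}z\ge0\}$, $H$ is a holomorphic function on $Q\cup\{\operatorname{Im}z<0\}$ with $R(z)=H(z)+\pi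 i\,F(z)$ for $z\in Q$. **Riemann surfaces.** $\mathrm M_{1,\ell}=\{(z,\zeta)\in\mathbb C^\times\times(\mathbb C\setminus\{\pm i\}):\zeta^2=(iL_{1,\ell}/z)^2-1\}$; $\mathrm M_{(N)}=\{(z,\zeta):\operatorname{Im}z<0,\ \zeta=(\zeta_0,\dots,\zeta_N)\in\mathbb C^{N+1},\ (z,\zeta_\ell)\in\mathrm M_{1,\ell},\ 0\le\ell\le N\}$, $\pi_{(N)}(z,\zeta)=z$. $\zeta_\ell^+(z)=\sqrt{\frac{iL_{1,\ell}}z+1}\sqrt{\frac{iL_{1,\ell}}z-1}$, where $\sqrt{u+1}\sqrt{u-1}$ (principal branches) is extended holomorphically to $\mathbb C\setminus[-1,1]$, and $\zeta_\ell^+(-iv)=\zeta_\ell^+(-iv+0)$ for $v>0$. For $\varepsilon=(\varepsilon_0,\dots,\varepsilon_N)\in\{\pm1\}^{N+1}$, $\sigma_\varepsilon(z)=(z,\varepsilon_0\zeta_0^+(z),\dots,\varepsilon_N\zeta_N^+(z))$. Lifts are with respect to the section $\sigma_{(1,\dots,1)}$. On $\mathrm M_{1,\ell}$, $$\widetilde G_{1,\ell}(z,\zeta)=\tfrac{b_1}\pi L_{1,\ell}\,p_1(iL_{1,\ell})\,p_2(-z\zeta)\,\psi_z\big(\tfrac{iL_{1,\ell}}z-\zeta\big),$$ and $\widetilde G_{(N,\ell)}(z,\zeta)=\widetilde G_{1,\ell}(z,\zeta_\ell)$ on $\mathrm M_{(N)}$. **Open sets and $F_{(m)}$.** For $v>0$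 let $m\ge-1$ be such that $L_{1,m}\le v<L_{1,m+1}$. If $m=-1$, $W_v$ is an open disc centered at $-iv$ with $W_v\cap i\mathbb R\subset-i(0,L_{1,0})$. If $m\ge0$, fix $0<r_v<1$ with $v\,\mathrm c(r_v)\notin\{L_{1,\ell}:\ell\ge0\}$ and $\mathrm c(r_v)<\frac{\rho_{\beta_1}+m+\frac12}{\rho_{\beta_1}+m}$, and an open disc $W_v$ centered at $-iv$ with $S_1\cap\{zu:z\in W_v,\,u\in\partial\mathrm E_{\mathrm c(r_v),\mathrm s(r_v)}\}=\emptyset$ and $W_v\cap i\mathbb R$ contained in $-i[L_{1,m},L_{1,m+1})$ if $v>L_{1,m}$ and in $-i[L_{1,m}-\frac{b_1}2,L_{1,m}+\frac{b_1}2)$ if $v=L_{1,m}$. $W_{(m)}$ (resp. $W'_{(m)}$) is the union of the $W_v$ with $v>0$ and $L_{1,m}\le v<L_{1,m+1}$ (resp. $L_{1,m}<v<L_{1,m+1}$). $F_{(-1)}=F$ on $W_{(-1)}$; for $m\ge0$, $F_{(m)}$ is the holomorphic function on $W_{(m)}$ with $F_{(m)}(z)=\int_{|w|=r_v}\psi_z(w)\phi_z(w)\,dw$ for $z\in W_v$, $L_{1,m}\le v<L_{1,m+1}$. $\mathrm M_{\gamma_N}=\pi_{(N)}^{-1}\big(\bigcup_{m=-1}^NW_{(m)}\big)$ is an open neighborhood of the branched curve $\gamma_N$ lifting $-i(0,L_{1,N+1})$ to $\mathrm M_{(N)}$. The discs are small enough that $\pi_{(N)}^{-1}(W'_{(m)})$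 is a disjoint union of $2^{N+1}$ homeomorphic copies of $W'_{(m)}$ and $\pi_{(N)}^{-1}(W_{L_{1,m}})$ ($0\le m\le N$) has $2^N$ connected components. $U_{m,\varepsilon}$ is the copy of $W'_{(m)}$ containing the points $\sigma_\varepsilon(-iv)$, $L_{1,m}<v<L_{1,m+1}$; for $m\ge0$, $U_{\varepsilon(m^\vee)}$ is the component of $\pi_{(N)}^{-1}(W_{L_{1,m}})$ containing $\sigma_\varepsilon(-iL_{1,m})$; $U_{\varepsilon(m^\vee)}=\emptyset$ for $m=-1$.
   Formalization: The formula for G̃_{1,ℓ} is corrected: it gains a factor 2πi and p₂(−zζ) becomes p₂(−izζ); with the printed formula the pieces of F̃ disagree on overlaps (for example for H²×H³, by a factor −2π in G̃). *)

(* Defs.v *)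
From mathcomp Require Export all_boot all_order all_algebra.
From mathcomp Require Export all_classical all_reals all_analysis.
From mathcomp Require Export complex.

Set Implicit Arguments.
Unset Strict Implicit.
Unset Printing Implicit Defensive.

Import Order.TTheory GRing.Theory Num.Theory.
Import numFieldNormedType.Exports.

Local Open Scope classical_set_scope.
Local Open Scope complex_scope.
Local Open Scope ring_scope.

Section ComplexCalculus.
Variable R : realType.
Local Notation C := R[i].

Definition imag_unit : C := 0 +i* 1.

Definition holomorphic_on (U : set C) (f : C -> C) : Prop :=
  forall z, U z -> derivable (f : C^o -> C^o) z 1.

Definition Cintegral d (T : measurableType d)
    (mu : {measure set T -> \bar R}) (A : set T) (f : T -> C) : C :=
  Rintegral mu A (fun x => complex.Re (f x)) +i*
  Rintegral mu A (fun x => complex.Im (f x)).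

Definition Cexp (z : C) : C :=
  (expR (complex.Re z))%:C * (cos (complex.Im z) +i* sin (complex.Im z)).

Definition Ccot (z : C) : C :=
  imag_unit * (Cexp (imag_unit * z) + Cexp (- imag_unit * z))
  / (Cexp (imag_unit * z) - Cexp (- imag_unit * z)).

(* the integral of h(w) dw over |w| = r, counterclockwise *)
Definition circle_integral (r : R) (h : C -> C) : C :=
  Cintegral lebesgue_measure `[0, 2 * pi]
    (fun t => let w := r%:C * Cexp (imag_unit * t%:C) in
              h w * (imag_unit * w)).

Definition Rderivable (h : R -> C) (t : R) : Prop :=
  derivable (fun s => complex.Re (h s)) t 1 /\
  derivable (fun s => complex.Im (h s)) t 1.

Definition Rderive (h : R -> C) (t : R) : C :=
  derive1 (fun s => complex.Re (h s)) t +i*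
  derive1 (fun s => complex.Im (h s)) t.

Definition cfun (w : C) : C := (w + w^-1) / 2.
Definition sfun (w : C) : C := (w - w^-1) / 2.

End ComplexCalculus.

Section MatrixLie.
Variables (R : realType) (n : nat).
Local Notation M := 'M[R]_n.+1.
Implicit Types (g : {vspace M}) (X Y H : M).

Definition expm X : M := limn (series (fun k => (k`!%:R)^-1 *: X ^+ k)).

Definition bracket X Y : M := X * Y - Y * X.

(* the trace of ad X \o ad Y on g *)
Definition killing g X Y : R :=
  \sum_(i < \dim g) coord (vbasis g) i (bracket X (bracket Y (vbasis g)`_i)).

(* the Cartan decomposition of g for the Cartan involution X |-> - X^T *)
Definition compact_part g : {vspace M} :=
  (g :&: lker (linfun (fun X : M => (X^T + X)%R)))%VS.
Definition noncompact_part g : {vspace M} :=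
  (g :&: lker (linfun (fun X : M => (X^T - X)%R)))%VS.

Definition root_space g H (c : R) : {vspace M} :=
  (g :&: lker (linfun (fun X : M => (bracket H X - c *: X)%R)))%VS.

End MatrixLie.

(* X = G/K, with G a closed connected semisimple group of real matrices stable
   under transposition and K := G :&: O(n).  Every Riemannian symmetric space of
   the noncompact type is of this form: take for G the adjoint group of its
   isometry group, in an orthonormal basis for the inner product
   - B(X, theta Y) on the Lie algebra. *)
Record rank_one_space (R : realType) := RankOneSpace {
  sdim : nat ;
  grp : set 'M[R]_sdim.+1 ;
  lie : {vspace 'M[R]_sdim.+1} ;
  cartan : 'M[R]_sdim.+1 ;
  beta_cartan : R ; (* the value of the root beta at the vector cartan *)
  grp1 : grp 1 ;
  grpM : forall A B, grp A -> grp B -> grp (A * B) ;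
  grpV : forall A, grp A -> A \in unitmx /\ grp A^-1 ;
  grp_trmx : forall A, grp A -> grp A^T ;
  grp_closed : forall A, closure grp A -> A \in unitmx -> grp A ;
  grp_connected : connected grp ;
  lieP : forall X, X \in lie <-> forall t : R, grp (expm (t *: X)) ;
  lie_semisimple : forall X, X \in lie ->
    (forall Y, Y \in lie -> killing lie X Y = 0) -> X = 0 ;
  lie_noncompact : forall I : {vspace 'M[R]_sdim.+1},
    (I <= compact_part lie)%VS ->
    (forall X Y, X \in lie -> Y \in I -> bracket X Y \in I) -> I = 0%VS ;
  cartan_p : cartan \in noncompact_part lie ;
  cartan_neq0 : cartan != 0 ;
  (* the line of cartan is maximal abelian in p *)
  rank_one : forall X, X \in noncompact_part lie ->
    bracket cartan X = 0 -> exists c : R, X = c *: cartan ;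
  beta_gt0 : 0 < beta_cartan ;
  beta_root : root_space lie cartan beta_cartan != 0%VS ;
  beta2_notroot : root_space lie cartan (2 * beta_cartan) = 0%VS
}.

Arguments grp {R} r _.

Section RankOneData.
Variables (R : realType) (S : rank_one_space R).

Definition mult_beta : nat :=
  \dim (root_space (lie S) (cartan S) (beta_cartan S)).
Definition mult_half : nat :=
  \dim (root_space (lie S) (cartan S) (beta_cartan S / 2)).

(* the length of beta for the inner product on a^* dual to the Killing form *)
Definition blen : R :=
  Num.sqrt (beta_cartan S ^+ 2 / killing (lie S) (cartan S) (cartan S)).

Definition rhob : R := (mult_beta%:R + mult_half%:R / 2) / 2.

(* The first product has 2 rhob - 1 factors.  When mult_beta is even, mult_half
   is 0 and the second product is empty. *)
Definition Ppol (x : R[i]) : R[i] :=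
  (\prod_(0 <= k < (mult_beta + mult_half./2).-1)
     (x - (rhob - 1)%:C + k%:R)) *
  (\prod_(0 <= k < mult_half./2)
     (x - (mult_half%:R / 4 - 1 / 2)%:C + k%:R)).

Definition ppol (x : R[i]) : R[i] := Ppol (imag_unit R * x / blen%:C).

(* the factor attached to an odd mult_beta; it is 1 for an even mult_beta *)
Definition qcot (x : R[i]) : R[i] :=
  Ccot (pi%:C * (imag_unit R * x / blen%:C - rhob%:C)).

(* L_l = b (rho + l) for l >= 0, and L_(-1) = 0 *)
Definition Lval (l : int) : R := if l < 0 then 0 else blen * (rhob + l%:~R).

End RankOneData.

Notation ambient X1 X2 :=
  ('M[_]_((sdim X1).+1) * 'M[_]_((sdim X2).+1))%type (only parsing).

(* Functions on X1 x X2 are right K-invariant functions on G = G1 x G2, and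
   points of X1 x X2 are represented by elements of G.  The values of such
   functions outside G are irrelevant. *)
Section Product.
Variables (R : realType) (X1 X2 : rank_one_space R).
Local Notation C := R[i].
Local Notation T := ('M[R]_((sdim X1).+1) * 'M[R]_((sdim X2).+1))%type.
Implicit Types (u f phi : T -> C) (g k X : T).

Definition prodG : set T := grp X1 `*` grp X2.
Definition prodK : set T :=
  [set k | prodG k /\ k.1 * (k.1)^T = 1 /\ k.2 * (k.2)^T = 1].
Definition prod_lie : set T := [set X | X.1 \in lie X1 /\ X.2 \in lie X2].

Definition right_K_invariant u :=
  forall g k, prodG g -> prodK k -> u (g * k) = u g.
Definition left_K_invariant u :=
  forall k g, prodK k -> prodG g -> u (k * g) = u g.

Definition along X u g (t : R) : C :=
  u (g.1 * expm (t *: X.1), g.2 * expm (t *: X.2)).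

Definition lder X u g : C := Rderive (along X u g) 0.

(* C^infty on G: all iterated derivatives along left-invariant vector fields
   exist and are continuous *)
Definition smooth u : Prop :=
  forall s : seq T, (forall X, X \in s -> prod_lie X) ->
  let v := foldr lder u s in
  {within prodG, continuous (v : T -> C^o)} /\
  forall X g, prod_lie X -> prodG g -> Rderivable (along X v g) 0.

Definition smooth_on_X u := smooth u /\ right_K_invariant u.

Definition Cc_infty f : Prop :=
  smooth_on_X f /\
  exists B : set T, [/\ compact B, B `<=` prodG &
    forall g, prodG g -> ~ B g -> f g = 0].

(* Minus the sum of the squares of an orthonormal basis of p for the Killing
   form: on right K-invariant functions this is the positive Laplacian of the
   metric induced by the Killing form.  It is written here in the basis vbasis p,
   with the inverse of its Gram matrix. *)
Definition half_laplacian n (l : {vspace 'M[R]_n.+1}) (emb : 'M[R]_n.+1 -> T)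
    u g : C :=
  let p := noncompact_part l in
  let gram := \matrix_(i < \dim p, j < \dim p)
                killing l (vbasis p)`_i (vbasis p)`_j in
  - \sum_(i < \dim p) \sum_(j < \dim p)
      (invmx gram i j)%:C *
      lder (emb (vbasis p)`_i) (lder (emb (vbasis p)`_j) u) g.

Definition laplacian1 u g := half_laplacian (lie X1) (fun A => (A, 0)) u g.
Definition laplacian2 u g := half_laplacian (lie X2) (fun A => (0, A)) u g.
Definition laplacian u g := laplacian1 u g + laplacian2 u g.

Definition rho_sq : R :=
  (rhob X1 * blen X1) ^+ 2 + (rhob X2 * blen X2) ^+ 2.

(* The algebra of invariant differential operators of X1 x X2 is generated by
   the Laplacians of the two factors.  The spectral parameter is
   s1 beta_1 + s2 beta_2. *)
Definition spherical (s1 s2 : C) phi : Prop :=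
  [/\ smooth_on_X phi, left_K_invariant phi, phi 1 = 1,
      forall g, prodG g -> laplacian1 phi g =
        (((rhob X1)%:C ^+ 2 - s1 ^+ 2) * (blen X1)%:C ^+ 2) * phi g &
      forall g, prodG g -> laplacian2 phi g =
        (((rhob X2)%:C ^+ 2 - s2 ^+ 2) * (blen X2)%:C ^+ 2) * phi g].

(* The first two clauses determine phi on G.  The other ones are the standard
   continuity of the family in all its variables and its holomorphy in the
   spectral parameter, which the integral representation of spherical functions
   makes apparent. *)
Definition spherical_family (phi : C -> C -> T -> C) : Prop :=
  [/\ forall s1 s2, spherical s1 s2 (phi s1 s2),
      forall s1 s2 (phi' : T -> C), spherical s1 s2 phi' ->
        forall g, prodG g -> phi' g = phi s1 s2 g,
      {within [set x : (C^o * C^o) * T | prodG x.2],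
         continuous (fun x => phi x.1.1 x.1.2 x.2 : C^o)},
      forall s2 g, prodG g -> holomorphic_on setT (fun s1 => phi s1 s2 g) &
      forall s1 g, prodG g -> holomorphic_on setT (fun s2 => phi s1 s2 g)].

Definition borelT := g_sigma_algebraType (@open T).

Definition haar_measure (mu : {measure set borelT -> \bar R}) : Prop :=
  [/\ mu (~` prodG) = 0%E, mu prodG != 0%E,
      forall B : set T, compact B -> B `<=` prodG -> (mu B < +oo)%E &
      forall (g : T) (A : set borelT), prodG g -> measurable A ->
        mu ((fun h : T => g * h) @^-1` A) = mu A].

Definition convolution (mu : {measure set borelT -> \bar R}) f phi y : C :=
  Cintegral mu (prodG : set borelT) (fun g : T => f g * phi (g^-1 * y)).

(* u = (Delta - <rho, rho> - z^2)^{-1} f.  The L^2 resolvent maps C_c^infty into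
   C^infty, and for Im z > 0 the function u is uniquely determined. *)
Definition resolvent (mu : {measure set borelT -> \bar R}) (z : C) f u : Prop :=
  [/\ smooth_on_X u,
      mu.-integrable (prodG : set borelT)
        (fun g : T => (complex.Re (u g) ^+ 2 + complex.Im (u g) ^+ 2)%:E) &
      forall g, prodG g -> laplacian u g - (rho_sq%:C + z ^+ 2) * u g = f g].

End Product.

Section Functions.
Variables (R : realType) (X1 X2 : rank_one_space R).
Local Notation C := R[i].
Local Notation T := ('M[R]_((sdim X1).+1) * 'M[R]_((sdim X2).+1))%type.
Variable mu : {measure set (borelT X1 X2) -> \bar R}.
Variable phi : C -> C -> T -> C.
Local Notation L := (Lval X1).
Local Notation ii := (imag_unit R).

Definition psi (f : T -> C) (y : T) (z w : C) : C :=
  convolution mu f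
    (phi (ii * (z / (blen X1)%:C) * cfun w)
         (ii * (z / (blen X2)%:C) * cfun (- ii * w))) y.

Definition phiz (z w : C) : C :=
  - z ^+ 2 * cfun w * (sfun w / w) * ppol X1 (z * cfun w) *
  qcot X1 (z * cfun w) * ppol X2 (z * cfun (- ii * w)).

Definition Fcirc (f : T -> C) (y : T) (r : R) (z : C) : C :=
  circle_integral r (fun w => psi f y z w * phiz z w).

Definition Ffun (f : T -> C) (y : T) : C -> C := Fcirc f y 1.

(* 2 pi i times the residue of psi_z phi_z at w = iL/z - zeta, where
   zeta^2 = (iL/z)^2 - 1: there z c(w) = iL, c(-iw) = i zeta, and the residue of
   qcot X1 at iL is - i b1 / pi.  As ppol X2 is odd, the minus sign is moved into
   ppol X2 (i z zeta).  The pole at - w has the same residue.  The formula in the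
   literature has neither the factor 2 pi i nor the i in the argument of ppol X2;
   with those omitted, it does not match the unnormalized integrals dw defining
   F and F_(m). *)
Definition Gfun (f : T -> C) (y : T) (l : int) (z zeta : C) : C :=
  2 * pi%:C * ii *
  ((blen X1 / pi)%:C * (L l)%:C * ppol X1 (ii * (L l)%:C) *
   ppol X2 (- ii * z * zeta) * psi f y z (ii * (L l)%:C / z - zeta)).

Definition neg_imag_cut : set C :=
  [set z | complex.Re z = 0 /\ complex.Im z <= - L 0].

Definition neg_real_cut : set C :=
  [set z | complex.Im z = 0 /\ complex.Re z <= 0].

(* For all f and y, Rs f y is the holomorphic extension of the resolvent
   z |-> [R(z) f](y), normalized by a nonzero constant kappa. *)
Definition resolvent_family (kappa : C) (Rs : (T -> C) -> T -> C -> C) : Prop :=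
  kappa <> 0 /\
  forall f, Cc_infty f ->
    (forall y, prodG y ->
       holomorphic_on (~` (neg_real_cut `|` neg_imag_cut)) (Rs f y)) /\
    (forall z, 0 < complex.Im z ->
       exists2 u, resolvent mu z f u &
         forall y, prodG y -> Rs f y z = kappa * u y).

Definition Qstrip (x0 y0 : R) : set C :=
  [set z | x0 < complex.Re z /\ 0 <= complex.Im z < y0].

Definition lower_half_plane : set C := [set z | complex.Im z < 0].

Definition H_family (x0 y0 : R) (Rs H : (T -> C) -> T -> C -> C) : Prop :=
  forall f y, Cc_infty f -> prodG y ->
    holomorphic_on (Qstrip x0 y0 `|` lower_half_plane) (H f y) /\
    forall z, Qstrip x0 y0 z ->
      Rs f y z = H f y z + pi%:C * ii * Ffun f y z.

Section Discs.
Variables (rr dd : R -> R). (* the r_v and the radii of the discs W_v *)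

Definition ibelow (v : R) : C := - (ii * v%:C).

Definition Wdisc (v : R) : set C := [set z | `|z - ibelow v| < (dd v)%:C].

Definition cR (r : R) : R := (r + r^-1) / 2.
Definition sR (r : R) : R := (r - r^-1) / 2.

Definition ellipse (a b : R) : set C :=
  [set u | (complex.Re u / a) ^+ 2 + (complex.Im u / b) ^+ 2 = 1].

Definition sing1 : set C :=
  [set s | exists l : nat, s = ii * (L l)%:C \/ s = - (ii * (L l)%:C)].

Definition axis_in (A : set C) (I : set R) : Prop :=
  forall z, A z -> complex.Re z = 0 -> I (- complex.Im z).

Definition disc_data : Prop :=
  forall (v : R) (m : int), 0 < v -> -1 <= m -> L m <= v < L (m + 1) ->
  0 < dd v /\
  (m = -1 -> axis_in (Wdisc v) [set t | 0 < t < L 0]) /\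
  (0 <= m ->
   [/\ 0 < rr v < 1,
       forall l : nat, v * cR (rr v) <> L l,
       cR (rr v) < (rhob X1 + m%:~R + 1 / 2) / (rhob X1 + m%:~R),
       sing1 `&` [set z * u | z in Wdisc v & u in
                              ellipse (cR (rr v)) (sR (rr v))] = set0 &
       (L m < v -> axis_in (Wdisc v) [set t | L m <= t < L (m + 1)]) /\
       (v = L m -> axis_in (Wdisc v)
          [set t | L m - blen X1 / 2 <= t < L m + blen X1 / 2])]).

Definition Wm (m : int) : set C :=
  \bigcup_(v in [set v | 0 < v /\ L m <= v < L (m + 1)]) Wdisc v.
Definition Wm' (m : int) : set C :=
  \bigcup_(v in [set v | L m < v < L (m + 1)]) Wdisc v.

Definition Fm_family (Fm : (T -> C) -> T -> int -> C -> C) : Prop :=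
  forall f y, Cc_infty f -> prodG y ->
  (forall z, Wm (-1) z -> Fm f y (-1) z = Ffun f y z) /\
  (forall m : int, 0 <= m -> holomorphic_on (Wm m) (Fm f y m) /\
     forall v z, L m <= v < L (m + 1) -> Wdisc v z ->
       Fm f y m z = Fcirc f y (rr v) z).

End Discs.

End Functions.

Notation surface_point R N :=
  ((R[i])^o * 'rV[(R[i])^o]_N.+1)%type (only parsing).

Section Surfaces.
Variables (R : realType) (X1 : rank_one_space R) (N : nat).
Local Notation C := R[i].
Local Notation L := (Lval X1).
Local Notation ii := (imag_unit R).

Local Notation surf_pt := (surface_point R N).

Definition MN : set surf_pt :=
  [set p : surf_pt | complex.Im p.1 < 0 /\ forall l : 'I_N.+1,
     [/\ p.2 0 l <> ii, p.2 0 l <> - ii &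
         (p.2 0 l : C) ^+ 2 = (ii * (L l)%:C / p.1) ^+ 2 - 1]].

(* sqrtc is the principal square root, with sqrtc (- x) = i sqrt x for x >= 0.
   Since iL/z approaches the real axis from above when z tends to -iv from the
   right, this gives zeta_plus (-iv) = zeta_plus (-iv + 0). *)
Definition zeta_plus (l : int) (z : C) : C :=
  let u := ii * (L l)%:C / z in sqrtc (u + 1) * sqrtc (u - 1).

(* the sign vector epsilon is coded by eps, with eps l = true for epsilon_l = -1 *)
Definition sigma (eps : {ffun 'I_N.+1 -> bool}) (z : C) : surf_pt :=
  (z, \row_l ((-1) ^+ (eps l : nat) * zeta_plus l z)).

Definition all_plus : {ffun 'I_N.+1 -> bool} := [ffun=> false].

Definition piN_inv (A : set C) : set surf_pt := [set p : surf_pt | MN p /\ A p.1].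

(* Holomorphic functions on the regular curve MN, through local holomorphic
   parametrizations gamma : D -> MN. *)
Definition parametrization (D : set C^o) (gamma : C^o -> surf_pt) : Prop :=
  [/\ open D,
      forall t, D t -> derivable (fun s => (gamma s).1) t 1 /\
        forall l, derivable (fun s => (gamma s).2 0 l : C^o) t 1,
      forall t, D t -> 'D_1 (fun s => (gamma s).1) t <> 0 \/
        exists l, 'D_1 (fun s => (gamma s).2 0 l : C^o) t <> 0,
      forall s t, D s -> D t -> gamma s = gamma t -> s = t &
      exists2 V : set surf_pt, open V & gamma @` D = MN `&` V].

Definition holomorphic_on_surf (U : set surf_pt) (h : surf_pt -> C) : Prop :=
  forall p, U p -> exists D gamma t0,
    [/\ parametrization D gamma, D t0, gamma t0 = p &
        holomorphic_on D (h \o gamma)].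

Variable dd : R -> R.
Local Notation W := (Wdisc dd).
Local Notation Wmm := (Wm X1 dd).
Local Notation Wm'm := (Wm' X1 dd).

Definition Wall : set C :=
  \bigcup_(m in [set m : int | -1 <= m <= N%:Z]) Wmm m.

Definition Mgamma : set surf_pt := piN_inv Wall.

Definition Ueps (m : int) (eps : {ffun 'I_N.+1 -> bool}) : set surf_pt :=
  \bigcup_(v in [set v | L m < v < L (m + 1)])
     connected_component (piN_inv (Wm'm m)) (sigma eps (ibelow v)).

Definition Uvee (m : int) (eps : {ffun 'I_N.+1 -> bool}) : set surf_pt :=
  [set p : surf_pt | 0 <= m /\ connected_component (piN_inv (W (L m)))
                       (sigma eps (ibelow (L m))) p].

Definition components (A : set surf_pt) : set (set surf_pt) :=
  [set connected_component A p | p in A].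

Definition small_discs : Prop :=
  (forall m : int, -1 <= m <= N%:Z ->
     (components (piN_inv (Wm'm m)) #= `I_(2 ^ N.+1))%card /\
     forall U, components (piN_inv (Wm'm m)) U ->
       exists s : C^o -> surf_pt,
         [/\ {within (Wm'm m : set C^o), continuous s}, s @` Wm'm m = U &
             forall z, Wm'm m z -> (s z).1 = z]) /\
  (forall m : int, 0 <= m <= N%:Z ->
     (components (piN_inv (W (L m))) #= `I_(2 ^ N))%card).

(* h is a lift of k with respect to the section sigma_(1, ..., 1), off E *)
Definition lifts_off (E : set surf_pt) (h : surf_pt -> C) (k : C -> C) : Prop :=
  forall z, Wall z -> ~ neg_imag_cut X1 z -> ~ E (sigma all_plus z) ->
    h (sigma all_plus z) = k z.

Definition lifts := lifts_off set0.

Definition has_pole (h : surf_pt -> C) (p : surf_pt) : Prop :=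
  forall A : R, exists2 V : set surf_pt, open V /\ V p &
    forall q, MN q -> V q -> q <> p -> A%:C < `|h q|.

Definition discrete_in (E U : set surf_pt) : Prop :=
  E `<=` U /\ forall p, U p ->
    exists2 V : set surf_pt, open V /\ V p & E `&` V `<=` [set p].

(* the poles of the meromorphic continuations to Mgamma of the lifted functions
   z |-> [R(z) f](y) *)
Definition resonance (X2 : rank_one_space R)
    (Rs : (ambient X1 X2 -> C) -> ambient X1 X2 -> C -> C)
    (p : surf_pt) : Prop :=
  exists f y (Rt : surf_pt -> C) (E : set surf_pt),
    [/\ Cc_infty f /\ prodG y, discrete_in E Mgamma,
        holomorphic_on_surf (Mgamma `\` E) Rt, lifts_off E Rt (Rs f y) &
        E p /\ has_pole Rt p].

End Surfaces.

(* Main.v *)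
Require Import Defs.
From HB Require Import structures.
From mathcomp Require Import all_boot all_order all_algebra.
From mathcomp Require Import all_classical all_reals all_analysis complex.
From mathcomp Require Import ring lra zify.

Set Implicit Arguments.
Unset Strict Implicit.
Unset Printing Implicit Defensive.

Import Order.TTheory GRing.Theory Num.Theory.
Import numFieldNormedType.Exports.

Local Open Scope classical_set_scope.
Local Open Scope complex_scope.
Local Open Scope ring_scope.

(* For |w| = 1 the integrand psi_z phi_z is a quotient of functions holomorphic in
   w; the zeros of the Plancherel polynomial cancel the poles of the cotangent
   with |x| < rho.  The remaining poles are the w with c(w) = +- iL_l/z, and their
   moduli are read off the confocal ellipses c(|w| = r).  Shrinking the contour to
   |w| = r_m crosses exactly the poles with l <= m, hence
   F = F_m + 2 sum_(l <= m) G_l(z, zeta_l^+) on the disc centered at -iL_m, off the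
   cut, and on all of W_m by the identity theorem.  It follows that
   K := F_m - 2 sum_(m < l <= N) G_l(z, zeta_l^+) does not depend on m and is
   holomorphic around -i(0, L_(N+1)), and K + 2 sum_(l <= N) G_l(z, zeta_l) is the
   extension of F.  The spherical functions are even in the spectral parameter,
   which makes the poles w and -w contribute equally.

   The parity of the Plancherel polynomials requires m_(beta/2) to be even: a root
   vector of beta induces a nondegenerate alternating form on the root space of
   beta/2.

   A meromorphic continuation of the lifted resolvent agrees with the holomorphic
   one near the base point.  The set of points around which they agree is open and
   closed, and every point is joined to the base point by crossing a half disc
   radially, moving along the axis, and changing the sign of zeta_l at the
   branch point -iL_l, where zeta_l = 0.  Hence there is no pole. *)

(** * Holomorphic functions of one complex variable *)

(** Three obstacles shape the development. The cotangent takes the default value 0 at its poles, so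
    where its poles are removable the integrand of [Fcirc] need not have the value of its
    holomorphic extension; it equals the holomorphic quotient [numer / denom] outside a finite set,
    which the integral ignores. The branch [zeta_plus] jumps across the cut, so identities are
    spread along the imaginary axis in the right and left half discs separately, and sheets are
    joined through sections that are continuous on one closed half plane only. Holomorphy on the
    surface allows an arbitrary parametrization at each point, while computations use explicit
    charts (coordinate [z], or [zeta_l] at the branch point of index [l]); the two are compared at
    unramified points, which is enough to exclude poles. The positivity of [b_1] is read off the
    number of components over the small discs, since the sign of the Killing form on the Cartan line
    is not computed. *)

Section Modulus.
Variable R : realType.
Local Notation C := R[i].
Implicit Types (z w : C) (r : R).

Definition cabs z : R := complex.Re `|z|.

Lemma cabsE z : `|z| = (cabs z)%:C.
Proof. by rewrite /cabs normc_def. Qed.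

Lemma cabs_ge0 z : 0 <= cabs z.
Proof. by rewrite -lecR -cabsE normr_ge0. Qed.

Lemma cabsM z w : cabs (z * w) = cabs z * cabs w.
Proof. by apply: complexI; rewrite rmorphM /= -!cabsE normrM. Qed.

Lemma cabsD z w : cabs (z + w) <= cabs z + cabs w.
Proof. by rewrite -lecR rmorphD /= -!cabsE ler_normD. Qed.

Lemma cabsN z : cabs (- z) = cabs z.
Proof. by apply: complexI; rewrite -!cabsE normrN. Qed.

Lemma cabsB z w : cabs (z - w) <= cabs z + cabs w.
Proof. by rewrite -(cabsN w) cabsD. Qed.

Lemma cabs_sub z w : cabs (z - w) = cabs (w - z).
Proof. by rewrite -cabsN opprB. Qed.

Lemma cabs0 : cabs 0 = 0. Proof. by apply: complexI; rewrite -cabsE normr0. Qed.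
Lemma cabs1 : cabs 1 = 1. Proof. by apply: complexI; rewrite -cabsE normr1. Qed.

Lemma cabs_eq0 z : (cabs z == 0) = (z == 0).
Proof. by rewrite -(normr_eq0 z) cabsE -(inj_eq (@complexI R)). Qed.

Lemma cabs_gt0 z : (0 < cabs z) = (z != 0).
Proof. by rewrite lt_neqAle cabs_ge0 andbT eq_sym cabs_eq0. Qed.

Lemma cabsV z : cabs z^-1 = (cabs z)^-1.
Proof. by apply: complexI; rewrite fmorphV /= -!cabsE normfV. Qed.

Lemma cabsX z n : cabs (z ^+ n) = cabs z ^+ n.
Proof. by elim: n => [|n IH]; rewrite ?expr0 ?cabs1 // !exprS cabsM IH. Qed.

Lemma cabs_real r : cabs r%:C = `|r|.
Proof. by rewrite /cabs normc_def /= expr0n addr0 sqrtr_sqr. Qed.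

Lemma cabs_pos r : 0 <= r -> cabs r%:C = r.
Proof. by move=> h; rewrite cabs_real ger0_norm. Qed.

Lemma cabs_i : cabs (imag_unit R) = 1.
Proof. by rewrite /cabs normc_def /= expr0n expr1n add0r sqrtr1. Qed.

Lemma Re_le_cabs z : `|complex.Re z| <= cabs z.
Proof. by have := normc_ge_Re z; rewrite cabsE lecR. Qed.

Lemma Im_le_cabs z : `|complex.Im z| <= cabs z.
Proof.
rewrite /cabs normc_def /= -sqrtr_sqr ler_wsqrtr // lerDr; exact: sqr_ge0.
Qed.

Lemma cabs_le_ReIm z : cabs z <= `|complex.Re z| + `|complex.Im z|.
Proof.
case: z => a b; have -> : a +i* b = a%:C + imag_unit R * b%:C.
  by rewrite /imag_unit; simpc.
by rewrite (le_trans (cabsD _ _)) // cabsM cabs_i mul1r !cabs_real /=; simpc.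
Qed.

Lemma ler_cabs_dist z w : cabs z - cabs w <= cabs (z - w).
Proof. by have := cabsD (z - w) w; rewrite subrK; lra. Qed.

Lemma cReD z w : complex.Re (z + w) = complex.Re z + complex.Re w.
Proof. by case: z; case: w. Qed.
Lemma cImD z w : complex.Im (z + w) = complex.Im z + complex.Im w.
Proof. by case: z; case: w. Qed.
Lemma cReN z : complex.Re (- z) = - complex.Re z.
Proof. by case: z. Qed.
Lemma cImN z : complex.Im (- z) = - complex.Im z.
Proof. by case: z. Qed.
Lemma cReM z w : complex.Re (z * w) =
  complex.Re z * complex.Re w - complex.Im z * complex.Im w.
Proof. by case: z; case: w. Qed.
Lemma cImM z w : complex.Im (z * w) =
  complex.Re z * complex.Im w + complex.Im z * complex.Re w.
Proof. by case: z => a b; case: w => c d /=; ring. Qed.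
Definition ReImE := (cReD, cImD, cReN, cImN, cReM, cImM).

Lemma cabs_sqr z : cabs z ^+ 2 = complex.Re z ^+ 2 + complex.Im z ^+ 2.
Proof. by rewrite /cabs normc_def /= sqr_sqrtr // addr_ge0 ?sqr_ge0. Qed.

Lemma complex_ext z w : complex.Re z = complex.Re w -> complex.Im z = complex.Im w -> z = w.
Proof. by case: z => a b; case: w => c d /= -> ->. Qed.

End Modulus.

Section Derivatives.
Variable R : realType.
Local Notation C := R[i].
Implicit Types (f g : C -> C) (z w l m : C).

Definition ccont f z := forall e : R, 0 < e -> exists2 d : R, 0 < d &
  forall w, cabs (w - z) < d -> cabs (f w - f z) < e.

(** Differentiability in the form of Caratheodory: the slope [q] is total and continuous at [z].
    Product, chain and quotient rules become algebra on slopes, without limits. *)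
Definition cderiv f z l := exists q, [/\ ccont q z, q z = l &
  forall w, f w - f z = q w * (w - z)].

Definition hol f z := exists l, cderiv f z l.

(** Balls of [C^o] have complex radii, but a positive element of [R[i]] is real, so real radii
    suffice. *)
Lemma cnbhsP z (P : set C) : nbhs (z : C^o) P <->
  exists2 d : R, 0 < d & forall w, cabs (w - z) < d -> P w.
Proof.
split.
- move=> /nbhs_ballP[e /= e0 H]; exists (complex.Re e).
    by move: e0; case: (e) => a b; rewrite ltcE /= => /andP[].
  move=> w hw; apply: H; rewrite -ball_normE /= distrC cabsE.
  by move: e0 hw; case: (e) => a b; rewrite !ltcE /= => /andP[/eqP -> _] ->; rewrite eqxx.
- move=> [d d0 H]; apply/nbhs_ballP; exists d%:C; first by rewrite /= ltcR.
  by move=> w; rewrite -ball_normE /= cabsE ltcR cabs_sub; exact: H.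
Qed.

(** Intersects two neighborhoods; the form lets [hd] be applied as a view to the distance bound. *)
Lemma min2_gt0 (a b : R) : 0 < a -> 0 < b ->
  exists2 d : R, 0 < d & forall x, x < d -> x < a /\ x < b.
Proof.
move=> a0 b0; exists (Num.min a b); first by rewrite lt_min a0.
by move=> x; rewrite lt_min => /andP.
Qed.

Lemma ccont_cst l z : ccont (fun=> l) z.
Proof. by move=> e e0; exists 1 => // w _; rewrite subrr cabs0. Qed.

Lemma ccont_id z : ccont id z.
Proof. by move=> e e0; exists e. Qed.

Lemma ccontD f g z : ccont f z -> ccont g z -> ccont (fun w => f w + g w) z.
Proof.
move=> hf hg e e0.
have e2 : 0 < e / 2 by rewrite divr_gt0.
have [d1 d10 h1] := hf _ e2; have [d2 d20 h2] := hg _ e2.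
have [d d0 hd] := min2_gt0 d10 d20; exists d => // w /hd[/h1 k1 /h2 k2].
have -> : f w + g w - (f z + g z) = (f w - f z) + (g w - g z) by ring.
by apply: le_lt_trans (cabsD _ _) _; lra.
Qed.

Lemma ccontM f g z : ccont f z -> ccont g z -> ccont (fun w => f w * g w) z.
Proof.
move=> hf hg e e0.
set M := 1 + cabs (f z) + cabs (g z).
have M1 : 1 <= M by rewrite /M; have := cabs_ge0 (f z); have := cabs_ge0 (g z); lra.
have e2 : 0 < Num.min 1 (e / (2 * M)).
  by rewrite lt_min ltr01 divr_gt0 //; lra.
have [d1 d10 h1] := hf _ e2; have [d2 d20 h2] := hg _ e2.
have [d d0 hd] := min2_gt0 d10 d20; exists d => // w /hd[/h1 k1 /h2 k2].
move: k1 k2; rewrite !lt_min => /andP[k1 k1'] /andP[k2 k2'].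
have -> : f w * g w - f z * g z = (f w - f z) * g w + f z * (g w - g z) by ring.
apply: le_lt_trans (cabsD _ _) _; rewrite !cabsM.
have kg : cabs (g w) <= M.
  by have := cabsD (g w - g z) (g z); rewrite subrK /M; have := cabs_ge0 (f z); lra.
have kf : cabs (f z) <= M by rewrite /M; have := cabs_ge0 (g z); lra.
have p1 : cabs (f w - f z) * cabs (g w) <= cabs (f w - f z) * M.
  by rewrite ler_wpM2l // cabs_ge0.
have p2 : cabs (f z) * cabs (g w - g z) <= M * cabs (g w - g z).
  by rewrite ler_wpM2r // cabs_ge0.
have M0 : 0 < M by lra.
have q1 : cabs (f w - f z) * M < e / 2.
  by rewrite -ltr_pdivlMr //; move: k1'; rewrite invfM mulrA.
have q2 : M * cabs (g w - g z) < e / 2.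
  by rewrite mulrC -ltr_pdivlMr //; move: k2'; rewrite invfM mulrA.
lra.
Qed.

Lemma ccont_comp f g z : ccont f z -> ccont g (f z) -> ccont (fun w => g (f w)) z.
Proof.
move=> hf hg e e0; have [d d0 hd] := hg _ e0.
by have [d' d'0 hd'] := hf _ d0; exists d' => // w /hd' /hd.
Qed.

Lemma ccont_neq0 f z : ccont f z -> f z != 0 ->
  exists2 d : R, 0 < d & forall w, cabs (w - z) < d -> cabs (f z) / 2 < cabs (f w).
Proof.
rewrite -cabs_gt0 => hf f0; have [|d d0 hd] := hf (cabs (f z) / 2).
  by rewrite divr_gt0.
exists d => // w /hd k; have := ler_cabs_dist (f z) (f w).
rewrite cabs_sub; lra.
Qed.

Lemma ccontV f z : f z != 0 -> ccont f z -> ccont (fun w => (f w)^-1) z.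
Proof.
move=> f0 hf e e0; have F0 : 0 < cabs (f z) by rewrite cabs_gt0.
have [d1 d10 h1] := ccont_neq0 hf f0.
have [|d2 d20 h2] := hf (e * cabs (f z) ^+ 2 / 2).
  by rewrite divr_gt0 // mulr_gt0 // exprn_gt0.
have [d d0 hd] := min2_gt0 d10 d20; exists d => // w /hd[/h1 k1 /h2 k2].
have fw0 : f w != 0 by rewrite -cabs_gt0; lra.
have -> : (f w)^-1 - (f z)^-1 = - ((f w - f z) / (f w * f z)).
  by field; rewrite ?fw0 ?f0.
rewrite cabsN cabsM cabsV cabsM ltr_pdivrMr; last by rewrite mulr_gt0 //; lra.
apply: lt_le_trans k2 _; rewrite expr2 -!mulrA ler_pM2l // .
by rewrite [leRHS]mulrC ler_pM2l //; lra.
Qed.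

Lemma near_ccont f g z (d : R) : 0 < d ->
  (forall w, cabs (w - z) < d -> g w = f w) -> ccont f z -> ccont g z.
Proof.
move=> d0 H hf e e0; have [d1 d10 h1] := hf _ e0.
have [d2 d20 hd] := min2_gt0 d0 d10; exists d2 => // w /hd[k1 k2].
rewrite !H ?subrr ?cabs0 //; exact: h1.
Qed.

Lemma cderivP f z l : cderiv f z l <-> forall e : R, 0 < e -> exists2 d : R, 0 < d &
  forall w, cabs (w - z) < d -> cabs (f w - f z - l * (w - z)) <= e * cabs (w - z).
Proof.
split.
- move=> [q [hq <- hf]] e e0; have [d d0 hd] := hq _ e0; exists d => // w hw.
  by rewrite hf -mulrBl cabsM ler_wpM2r ?cabs_ge0 // ltW // hd.
- move=> H; exists (fun w => if w == z then l else (f w - f z) / (w - z)); split.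
  + move=> e e0; have e2 : 0 < e / 2 by rewrite divr_gt0.
    have [d d0 hd] := H _ e2; exists d => // w hw; rewrite eqxx.
    case: eqP => [_|/eqP wz]; first by rewrite subrr cabs0.
    have wz0 : w - z != 0 by rewrite subr_eq0.
    have -> : (f w - f z) / (w - z) - l = (f w - f z - l * (w - z)) / (w - z).
      by field.
    rewrite cabsM cabsV ltr_pdivrMr ?cabs_gt0 //.
    apply: le_lt_trans (hd _ hw) _; rewrite ltr_pM2r ?cabs_gt0 //; lra.
  + by rewrite eqxx.
  + move=> w; case: eqP => [->|/eqP wz]; first by rewrite !subrr mulr0.
    by rewrite divfK // subr_eq0.
Qed.

Lemma cderiv_ccont f z l : cderiv f z l -> ccont f z.
Proof.
move=> [q [hq _ hf]].
have : ccont (fun w => f z + q w * (w - z)) z.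
  apply: ccontD; first exact: ccont_cst.
  by apply: ccontM => //; apply: ccontD; [exact: ccont_id|exact: ccont_cst].
by apply: (@near_ccont _ _ _ 1) => // w _; rewrite -hf; ring.
Qed.

Lemma hol_ccont f z : hol f z -> ccont f z.
Proof. by case=> l /cderiv_ccont. Qed.

Lemma near_cderiv f g z l (d : R) : 0 < d ->
  (forall w, cabs (w - z) < d -> g w = f w) -> cderiv f z l -> cderiv g z l.
Proof.
move=> d0 H /cderivP hf; apply/cderivP => e e0; have [d1 d10 h1] := hf _ e0.
have [d2 d20 hd] := min2_gt0 d0 d10; exists d2 => // w /hd[k1 k2].
rewrite !H ?subrr ?cabs0 //; exact: h1.
Qed.

Lemma near_hol f g z (d : R) : 0 < d ->
  (forall w, cabs (w - z) < d -> g w = f w) -> hol f z -> hol g z.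
Proof. by move=> d0 H [l hl]; exists l; exact: near_cderiv d0 H hl. Qed.

Lemma derivable_hol f z : derivable (f : C^o -> C^o) z 1 <-> hol f z.
Proof.
split.
- move=> /cvg_ex[/= l Hl]; exists l; apply/cderivP => e e0.
  move/cvgrPdist_le : Hl => /(_ e%:C); rewrite ltcR => /(_ e0).
  move=> /cnbhsP[d d0 hd]; exists d => // w hw.
  have [->|wz] := eqVneq w z; first by rewrite !subrr mulr0 subrr cabs0 mulr0.
  have wz0 : w - z != 0 by rewrite subr_eq0.
  have := hd (w - z); rewrite subr0 => /(_ hw wz0).
  rewrite /GRing.scale /= mulr1 subrK cabsE lecR (cabs_sub l).
  have -> : (w - z)^-1 * (f w - f z) - l = (f w - f z - l * (w - z)) / (w - z).
    by field.
  by rewrite cabsM cabsV ler_pdivrMr ?cabs_gt0.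
- move=> [l /cderivP H]; apply/cvg_ex; exists l; apply/cvgrPdist_le => e.
  case: e => a b; rewrite ltcE /= => /andP[/eqP -> a0]; apply/cnbhsP.
  have [d d0 hd] := H _ a0; exists d => // h; rewrite subr0 => hh h0.
  rewrite /GRing.scale /= mulr1 cabsE lecR (cabs_sub l).
  have := hd (h + z); rewrite addrK => /(_ hh).
  rewrite -ler_pdivrMr ?cabs_gt0 // -cabsV -cabsM => H1.
  apply: le_trans H1; rewrite [X in cabs X <= _](_ : _ = (f (h + z) - f z - l * h) / h) //.
  by field.
Qed.

Lemma cderiv_cst l z : cderiv (fun=> l) z 0.
Proof. by exists (fun=> 0); split=> // [|w]; [exact: ccont_cst|rewrite mul0r subrr]. Qed.

Lemma cderiv_id z : cderiv id z 1.
Proof. by exists (fun=> 1); split=> // [|w]; [exact: ccont_cst|rewrite mul1r]. Qed.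

Lemma cderivD f g z l m : cderiv f z l -> cderiv g z m ->
  cderiv (fun w => f w + g w) z (l + m).
Proof.
move=> [q [hq <- hf]] [p [hp <- hg]]; exists (fun w => q w + p w); split=> //.
  exact: ccontD.
by move=> w; rewrite mulrDl -hf -hg; ring.
Qed.

Lemma cderivM f g z l m : cderiv f z l -> cderiv g z m ->
  cderiv (fun w => f w * g w) z (l * g z + f z * m).
Proof.
move=> hf0 [p [hp <- hg]]; have [q [hq <- hf]] := hf0.
exists (fun w => q w * g z + f w * p w); split=> //.
  apply: ccontD; apply: ccontM => //; [exact: ccont_cst|exact: cderiv_ccont hf0].
move=> w.
have -> : (q w * g z + f w * p w) * (w - z) =
    g z * (q w * (w - z)) + f w * (p w * (w - z)) by ring.
by rewrite -hf -hg; ring.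
Qed.

Lemma cderiv_comp f g z l m : cderiv f z l -> cderiv g (f z) m ->
  cderiv (fun w => g (f w)) z (m * l).
Proof.
move=> hf0 [p [hp <- hg]]; have [q [hq <- hf]] := hf0.
exists (fun w => p (f w) * q w); split=> //.
  by apply: ccontM => //; apply: ccont_comp => //; exact: cderiv_ccont hf0.
by move=> w; rewrite hg hf mulrA.
Qed.

Lemma cderivV z : z != 0 -> cderiv (fun w => w^-1) z (- (z ^- 2)).
Proof.
move=> z0; apply: (@near_cderiv (fun w => if w == 0 then 0 else w^-1) _ _ _ 1) => //.
  by move=> w _; case: eqP => // ->; rewrite invr0.
(* The factorization through the slope must hold at every [w], also at [w = 0], where the inverse is
   0 by default; this dictates the value there. *)
exists (fun w => if w == 0 then z^-1 * z^-1 else - (w^-1 * z^-1)); split.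
- have h : ccont (fun w => - (1) * (w^-1 * z^-1)) z.
    apply: ccontM; first exact: ccont_cst.
    apply: ccontM; last exact: ccont_cst.
    by apply: ccontV => //; exact: ccont_id.
  apply: (near_ccont (d := cabs z) _ _ h); first by rewrite cabs_gt0.
  move=> w hw; case: eqP => [w0|_]; last by rewrite mulN1r.
  by move: hw; rewrite w0 sub0r cabsN ltxx.
- by rewrite (negbTE z0) -invfM expr2.
- move=> w; rewrite (negbTE z0); case: eqP => [->|/eqP w0]; last by field; rewrite ?w0 ?z0.
  by rewrite !sub0r; field.
Qed.

Lemma hol_cst l z : hol (fun=> l) z. Proof. by exists 0; exact: cderiv_cst. Qed.
Lemma hol_id z : hol id z. Proof. by exists 1; exact: cderiv_id. Qed.

Lemma holD f g z : hol f z -> hol g z -> hol (fun w => f w + g w) z.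
Proof. by move=> [l hl] [m hm]; exists (l + m); exact: cderivD. Qed.

Lemma holM f g z : hol f z -> hol g z -> hol (fun w => f w * g w) z.
Proof. by move=> [l hl] [m hm]; exists (l * g z + f z * m); exact: cderivM. Qed.

Lemma holN f z : hol f z -> hol (fun w => - f w) z.
Proof.
move=> hf; apply: (@near_hol (fun w => -1 * f w) _ _ 1) => //.
  by move=> w _; rewrite mulN1r.
by apply: holM => //; exact: hol_cst.
Qed.

Lemma holB f g z : hol f z -> hol g z -> hol (fun w => f w - g w) z.
Proof. by move=> hf hg; apply: holD => //; exact: holN. Qed.

Lemma hol_comp f g z : hol f z -> hol g (f z) -> hol (fun w => g (f w)) z.
Proof. by move=> [l hl] [m hm]; exists (m * l); exact: cderiv_comp. Qed.

Lemma holV f z : f z != 0 -> hol f z -> hol (fun w => (f w)^-1) z.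
Proof.
move=> f0 hf; apply: (@hol_comp f (fun w => w^-1)) => //.
by exists (- ((f z) ^- 2)); exact: cderivV.
Qed.

Lemma hol_div f g z : g z != 0 -> hol f z -> hol g z -> hol (fun w => f w / g w) z.
Proof. by move=> g0 hf hg; apply: holM => //; exact: holV. Qed.

Lemma holX f n z : hol f z -> hol (fun w => f w ^+ n) z.
Proof.
move=> hf; elim: n => [|n IH]; first by under eq_fun do rewrite expr0; exact: hol_cst.
by under eq_fun do rewrite exprS; exact: holM.
Qed.

Lemma hol_sum (I : Type) (s : seq I) (P : pred I) (F : I -> C -> C) z :
  (forall i, P i -> hol (F i) z) -> hol (fun w => \sum_(i <- s | P i) F i w) z.
Proof.
move=> H; elim: s => [|i s IH].
  by under eq_fun do rewrite big_nil; exact: hol_cst.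
have [Pi|Pi] := boolP (P i).
  by under eq_fun do rewrite big_cons Pi; apply: holD => //; exact: H.
by under eq_fun do rewrite big_cons (negbTE Pi).
Qed.

Lemma hol_prod (I : Type) (s : seq I) (F : I -> C -> C) z :
  (forall i, hol (F i) z) -> hol (fun w => \prod_(i <- s) F i w) z.
Proof.
move=> H; elim: s => [|i s IH].
  by under eq_fun do rewrite big_nil; exact: hol_cst.
under eq_fun do rewrite big_cons; by apply: holM => //; exact: H.
Qed.

End Derivatives.

#[export] Hint Resolve hol_cst hol_id : core.

(** * Complex exponential and line integrals *)

Section RealBridge.
Variable R : realType.
Local Notation C := R[i].

Lemma is_derive_eps (u : R -> R) (x l : R) : is_derive x 1 u l <->
  forall e : R, 0 < e -> exists2 d : R, 0 < d &
  forall y, `|y - x| < d -> `|u y - u x - l * (y - x)| <= e * `|y - x|.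
Proof.
split.
- move=> [ud ul] e e0; move: ud => /cvg_ex[/= l' Hl'].
  have <- : l' = l.
    by rewrite -ul /derive; apply/esym/cvg_lim.
  move/cvgrPdist_le : Hl' => /(_ _ e0)/nbhs_ballP[d /= d0 hd].
  exists d => // y yx; have [->|yx0] := eqVneq y x.
    by rewrite !subrr mulr0 subrr normr0 mulr0.
  have yx1 : y - x != 0 by rewrite subr_eq0.
  have := hd (y - x); rewrite -ball_normE /= sub0r normrN => /(_ yx yx1).
  rewrite /GRing.scale /= mulr1 subrK (distrC l').
  have -> : (y - x)^-1 * (u y - u x) - l' = (u y - u x - l' * (y - x)) / (y - x).
    by field.
  by rewrite normrM normfV ler_pdivrMr ?normr_gt0.
- move=> H.
  have K : (h^-1 *: ((u \o shift x) (h *: 1) - u x))%R @[h --> (0 : R)%R^'] --> l.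
    apply/cvgrPdist_le => e e0; have [d d0 hd] := H _ e0.
    apply/nbhs_ballP; exists d => // h; rewrite -ball_normE /= sub0r normrN => hh h0.
    rewrite /GRing.scale /= mulr1 (distrC l).
    have := hd (h + x); rewrite addrK => /(_ hh).
    rewrite -ler_pdivrMr ?normr_gt0 // -normfV -normrM => H1.
    apply: le_trans H1; rewrite [X in `|X| <= _](_ : _ = (u (h + x) - u x - l * h) / h) //.
    by field.
  split; first by apply/cvg_ex; exists l.
  exact/cvg_lim.
Qed.

Lemma Cexp0 : Cexp 0 = 1 :> C.
Proof. by rewrite /Cexp /= expR0 cos0 sin0 mul1r. Qed.

Lemma CexpD (z w : C) : Cexp (z + w) = Cexp z * Cexp w.
Proof.
rewrite /Cexp cReD cImD expRD cosD sinD; apply: complex_ext; rewrite !ReImE /=; ring.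
Qed.

Lemma cabs_Cexp (z : C) : cabs (Cexp z) = expR (complex.Re z).
Proof.
rewrite /Cexp cabsM cabs_pos ?expR_ge0 //.
by rewrite /cabs normc_def /= cos2Dsin2 sqrtr1 mulr1.
Qed.

Lemma Cexp_neq0 (z : C) : Cexp z != 0.
Proof. by rewrite -cabs_gt0 cabs_Cexp expR_gt0. Qed.

(** The first-order expansions of the real functions exp, sin and cos at 0 are multiplied out; the
    functional equation then moves the derivative to every point. *)
Lemma cderiv_Cexp0 : cderiv (@Cexp R) 0 1.
Proof.
apply/cderivP => e0 e00; rewrite Cexp0.
(* The four error terms below are at most 1, 2, 3 and 2 times [e * m], which sums to 8; [e <= 1]
   bounds the cofactors [1 + x] and [expR x]. *)
have [e [e_gt0 ee0 e1]] : exists e : R, [/\ 0 < e, 8 * e <= e0 & e <= 1].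
  exists (Num.min 1 (e0 / 8)); split.
  - by rewrite lt_min ltr01 divr_gt0.
  - have : Num.min 1 (e0 / 8) <= e0 / 8 by rewrite ge_min lexx orbT.
    lra.
  - by rewrite ge_min lexx.
have [d1 d10 h1] := (is_derive_eps _ _ _).1 (is_derive_expR (0 : R)) _ e_gt0.
have [d2 d20 h2] := (is_derive_eps _ _ _).1 (is_derive_sin (0 : R)) _ e_gt0.
have [d3 d30 h3] := (is_derive_eps _ _ _).1 (is_derive_cos (0 : R)) _ e_gt0.
have [d4 d40 hd4] := min2_gt0 d10 d20; have [d5 d50 hd5] := min2_gt0 d30 e_gt0.
have [d d0 hd] := min2_gt0 d40 d50; exists d => // -[x y]; rewrite subr0 mul1r => hw.
have hx : `|x| <= cabs (x +i* y) by exact: (Re_le_cabs (x +i* y)).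
have hy : `|y| <= cabs (x +i* y) by exact: (Im_le_cabs (x +i* y)).
have [/hd4[k1 k2] /hd5[k3 k4]] := hd _ hw.
have {}h1 := h1 x; have {}h2 := h2 y; have {}h3 := h3 y.
rewrite !subr0 in h1 h2 h3.
have {}h1 := h1 (le_lt_trans hx k1).
have {}h2 := h2 (le_lt_trans hy k2).
have {}h3 := h3 (le_lt_trans hy k3).
move: h1 h2 h3; rewrite expR0 sin0 cos0 subr0 oppr0 mul0r subr0 !mul1r => h1 h2 h3.
set m := cabs (x +i* y) in hx hy k4 hw k1 k2 k3 *.
have m0 : 0 <= m by exact: cabs_ge0.
have cb : `|cos y| <= 1 by rewrite ler_norml cos_geN1 cos_le1.
rewrite /Cexp /=; apply: le_trans (cabs_le_ReIm _) _.
rewrite !ReImE /= !mul0r subr0 addr0 oppr0 !addr0.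
have -> : expR x * cos y - 1 - x = (expR x - 1 - x) * cos y + (1 + x) * (cos y - 1) by ring.
have -> : expR x * sin y - y = expR x * (sin y - y) + (expR x - 1) * y by ring.
have b1 : `|(expR x - 1 - x) * cos y| <= e * m.
  rewrite normrM -[leRHS]mulr1 ler_pM //; apply: le_trans h1 _.
  by rewrite ler_pM2l.
have x1 : `|x| <= e by exact: (le_trans hx (ltW k4)).
have b2 : `|(1 + x) * (cos y - 1)| <= 2 * (e * m).
  rewrite normrM ler_pM //.
    by apply: le_trans (ler_normD _ _) _; rewrite normr1; lra.
  by apply: le_trans h3 _; rewrite ler_pM2l.
have b4 : `|expR x - 1| <= 2 * e.
  have -> : expR x - 1 = (expR x - 1 - x) + x by ring.
  apply: le_trans (ler_normD _ _) _.
  have : e * `|x| <= 1 * e by rewrite ler_pM // ltW.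
  lra.
have b3 : `|expR x * (sin y - y)| <= 3 * (e * m).
  rewrite normrM ler_pM //.
    have -> : expR x = (expR x - 1) + 1 by ring.
    by apply: le_trans (ler_normD _ _) _; rewrite normr1; lra.
  by apply: le_trans h2 _; rewrite ler_pM2l.
have b5 : `|(expR x - 1) * y| <= 2 * e * m by rewrite normrM ler_pM.
have := ler_normD ((expR x - 1 - x) * cos y) ((1 + x) * (cos y - 1)).
have := ler_normD (expR x * (sin y - y)) ((expR x - 1) * y).
have : 8 * e * m <= e0 * m by rewrite ler_wpM2r.
lra.
Qed.

Lemma cderiv_Cexp (z : C) : cderiv (@Cexp R) z (Cexp z).
Proof.
have h : cderiv (fun w => Cexp z * Cexp (w - z)) z (0 * Cexp (z - z) + Cexp z * (1 * (1 + 0))).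
  apply: cderivM; first exact: cderiv_cst.
  apply: (@cderiv_comp _ (fun w => w - z)).
    by apply: cderivD; [exact: cderiv_id|exact: cderiv_cst].
  by rewrite subrr; exact: cderiv_Cexp0.
rewrite mul0r add0r mul1r addr0 mulr1 in h.
apply: (near_cderiv (d := 1) _ _ h) => // w _.
by rewrite -CexpD; congr Cexp; ring.
Qed.

Lemma hol_Cexp (f : C -> C) z : hol f z -> hol (fun w => Cexp (f w)) z.
Proof. by move=> hf; apply: (hol_comp hf); exists (Cexp (f z)); exact: cderiv_Cexp. Qed.

End RealBridge.

(** * Complex-valued integrals over a measure space and over real segments *)

Section MeasureIntegral.
Variables (R : realType) (d : measure_display) (T : measurableType d).
Variable (mu : {measure set T -> \bar R}) (D : set T).
Hypothesis mD : measurable D.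
Local Notation C := R[i].
Implicit Types f g : T -> C.

Definition cintble f := mu.-integrable D (EFin \o (fun t => complex.Re (f t))) /\
  mu.-integrable D (EFin \o (fun t => complex.Im (f t))).

Lemma Cintegral_congr f g : (forall t, D t -> f t = g t) ->
  Cintegral mu D f = Cintegral mu D g.
Proof.
by move=> H; congr (_ +i* _); apply: eq_Rintegral => t /[!inE] /H ->.
Qed.

Lemma Cintegral_supp (E : set T) f : D `<=` E -> (forall t, E t -> ~ D t -> f t = 0) ->
  Cintegral mu E f = Cintegral mu D f.
Proof.
move=> DE f0; have aux (u : T -> R) : (forall t, E t -> ~ D t -> u t = 0) ->
    Rintegral mu E u = Rintegral mu D u.
  move=> u0; rewrite Rintegral_mkcond [RHS]Rintegral_mkcond; apply: eq_Rintegral => t _.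
  rewrite !patchE; case: ifPn => Et; case: ifPn => Dt //.
    by apply: u0; [exact: set_mem|move=> /mem_set; exact/negP].
  by exfalso; move: Et; rewrite (mem_set (DE _ (set_mem Dt))).
by congr (_ +i* _); apply: aux => t Et /(f0 _ Et) ->.
Qed.

Lemma CintegralD f g : cintble f -> cintble g ->
  Cintegral mu D (fun t => f t + g t) = Cintegral mu D f + Cintegral mu D g.
Proof.
move=> [f1 f2] [g1 g2]; apply: complex_ext; rewrite !ReImE /= -RintegralD //.
  by apply: eq_Rintegral => t _; rewrite cReD.
by apply: eq_Rintegral => t _; rewrite cImD.
Qed.

Lemma CintegralZ f (c : C) : cintble f ->
  Cintegral mu D (fun t => c * f t) = c * Cintegral mu D f.
Proof.
move=> [f1 f2].
have iZ (k : R) (u : T -> R) : mu.-integrable D (EFin \o u) ->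
    mu.-integrable D (EFin \o (fun t => k * u t)).
  move=> iu; rewrite (_ : _ \o _ = (fun t => k%:E * (EFin \o u) t)%E).
    exact: integrableZl.
  by apply/funext.
apply: complex_ext; rewrite !ReImE /= -!RintegralZl //.
  rewrite -RintegralB //; [|exact: iZ|exact: iZ].
  by apply: eq_Rintegral => t _; rewrite cReM.
rewrite -RintegralD //; [|exact: iZ|exact: iZ].
by apply: eq_Rintegral => t _; rewrite cImM.
Qed.

Lemma cintbleD f g : cintble f -> cintble g -> cintble (fun t => f t + g t).
Proof.
move=> [f1 f2] [g1 g2]; split.
  rewrite (_ : _ \o _ = (EFin \o (fun t => complex.Re (f t))) \+ (EFin \o (fun t => complex.Re (g t))))%E.
    exact: integrableD.
  by apply/funext => t /=; rewrite cReD.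
rewrite (_ : _ \o _ = (EFin \o (fun t => complex.Im (f t))) \+ (EFin \o (fun t => complex.Im (g t))))%E.
  exact: integrableD.
by apply/funext => t /=; rewrite cImD.
Qed.

Lemma cintbleZ f (c : C) : cintble f -> cintble (fun t => c * f t).
Proof.
move=> [f1 f2]; split.
  rewrite (_ : _ \o _ = (fun t => (complex.Re c)%:E * (EFin \o (fun t => complex.Re (f t))) t) \+ (fun t => (- complex.Im c)%:E * (EFin \o (fun t => complex.Im (f t))) t))%E.
    by apply: integrableD => //; exact: integrableZl.
  by apply/funext => t /=; rewrite cReM -!EFinM -EFinD mulNr.
rewrite (_ : _ \o _ = (fun t => (complex.Re c)%:E * (EFin \o (fun t => complex.Im (f t))) t) \+ (fun t => (complex.Im c)%:E * (EFin \o (fun t => complex.Re (f t))) t))%E.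
  by apply: integrableD => //; exact: integrableZl.
by apply/funext => t /=; rewrite cImM -!EFinM -EFinD.
Qed.

Lemma cintbleN f : cintble f -> cintble (fun t => - f t).
Proof.
move=> /(cintbleZ (-1)); congr cintble.
by apply/funext => t; rewrite mulN1r.
Qed.

Lemma CintegralN f : cintble f -> Cintegral mu D (fun t => - f t) = - Cintegral mu D f.
Proof.
move=> hf; rewrite -[RHS]mulN1r -CintegralZ //.
by apply: Cintegral_congr => t _; rewrite mulN1r.
Qed.

Lemma CintegralB f g : cintble f -> cintble g ->
  Cintegral mu D (fun t => f t - g t) = Cintegral mu D f - Cintegral mu D g.
Proof. by move=> hf hg; rewrite -CintegralN // -CintegralD //; exact: cintbleN. Qed.

(** Real and imaginary parts are bounded separately, hence the factor 2. It survives in all later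
    Cauchy estimates, where only the order of magnitude counts. *)
Lemma Cintegral_le f (M : R) : (mu D < +oo)%E -> cintble f ->
  (forall t, D t -> cabs (f t) <= M) ->
  cabs (Cintegral mu D f) <= 2 * M * fine (mu D).
Proof.
move=> muD [f1 f2] H.
have iM : mu.-integrable D (EFin \o (cst M)).
  apply: measurable_bounded_integrable => //.
  exists `|M|; split; [exact: num_real|by move=> x xM t _ /=; exact: ltW].
have aux (u : T -> R) : mu.-integrable D (EFin \o u) ->
    (forall t, D t -> `|u t| <= M) -> `|Rintegral mu D u| <= M * fine (mu D).
  move=> iu hu; apply: le_trans (le_normr_Rintegral mD iu) _.
  rewrite -Rintegral_cst //; apply: le_Rintegral => //.
  exact: integrable_norm.
apply: le_trans (cabs_le_ReIm _) _ => /=.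
have -> : 2 * M * fine (mu D) = M * fine (mu D) + M * fine (mu D) by ring.
apply: lerD; apply: aux => // t Dt; apply: le_trans (H _ Dt).
  exact: Re_le_cabs.
exact: Im_le_cabs.
Qed.

End MeasureIntegral.

Section LineIntegral.
Variable R : realType.
Local Notation C := R[i].
Local Notation leb := (@lebesgue_measure R).
Implicit Types (h g G : C -> C) (a b : R).

(** The integrand is a function on [C] restricted to the reals: curves such as [cis] are entire, so
    the calculus of [cderiv] applies along them. *)
Definition cint h a b : C := Cintegral leb `[a, b] (fun t => h t%:C).

Definition icont h a b := forall t, a <= t <= b -> ccont h t%:C.

Lemma icont_within h a b : icont h a b ->
  {within `[a, b], continuous (fun t => complex.Re (h t%:C))} /\
  {within `[a, b], continuous (fun t => complex.Im (h t%:C))}.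
Proof.
move=> H; split; apply/subspace_continuousP => t /=; rewrite in_itv /= => /H K;
  apply/cvgrPdist_lt => e e0; have [d d0 hd] := K _ e0;
  apply/nbhs_ballP; exists d => // s; rewrite -ball_normE /= => hs _.
- rewrite distrC -cReN -cReD; apply: le_lt_trans (Re_le_cabs _) (hd _ _).
  by rewrite -rmorphB cabs_real distrC.
- rewrite distrC -cImN -cImD; apply: le_lt_trans (Im_le_cabs _) (hd _ _).
  by rewrite -rmorphB cabs_real distrC.
Qed.

Lemma icont_cintble h a b : icont h a b -> cintble leb `[a, b] (fun t => h t%:C).
Proof.
move=> /icont_within[h1 h2]; split.
  apply: (@continuous_compact_integrable R (fun t => complex.Re (h t%:C))) => //.
  exact: segment_compact.
apply: (@continuous_compact_integrable R (fun t => complex.Im (h t%:C))) => //.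
exact: segment_compact.
Qed.

Lemma leb_itv a b : a <= b -> leb `[a, b] = (b - a)%:E.
Proof.
rewrite le_eqVlt lebesgue_measure_itv /= lte_fin => /predU1P[->|->//].
by rewrite ltxx subrr.
Qed.

Lemma cint_le h a b M : a <= b -> icont h a b ->
  (forall t, a <= t <= b -> cabs (h t%:C) <= M) ->
  cabs (cint h a b) <= 2 * M * (b - a).
Proof.
move=> ab hh H; have lab := leb_itv ab.
have -> : b - a = fine (leb `[a, b]) by rewrite lab.
apply: Cintegral_le => //; first by have := ltry (b - a); rewrite -lab.
  exact: icont_cintble.
Qed.

Lemma cint_split h a b c : a <= b -> b <= c -> icont h a c ->
  cint h a c = cint h a b + cint h b c.
Proof.
move=> ab bc hh; have [h1 h2] := icont_cintble hh.
have aux (u : R -> R) : leb.-integrable `[a, c] (EFin \o u) ->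
  Rintegral leb `[a, c] u = Rintegral leb `[a, b] u + Rintegral leb `[b, c] u.
  move=> iu; have := @Rintegral_itvB _ u (BLeft a) (BRight c) b iu.
  rewrite !bnd_simp => /(_ ab bc) /eqP; rewrite subr_eq addrC => /eqP ->; congr (_ + _).
  apply: Rintegral_itv_obnd_cbnd; apply: integrableS iu => //.
  move=> x /=; rewrite !in_itv /= => /andP[bx ->]; rewrite andbT.
  exact: le_trans ab (ltW bx).
by apply: complex_ext; rewrite !ReImE /= aux.
Qed.

Lemma cint_FTC g G a b : a <= b -> (forall t, a <= t <= b -> cderiv G t%:C (g t%:C)) ->
  icont g a b -> cint g a b = G b%:C - G a%:C.
Proof.
rewrite le_eqVlt => /predU1P[<-|ab] HG hg.
  rewrite subrr /cint set_itv1.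
  by apply: complex_ext; rewrite /= Rintegral_set1.
have [g1 g2] := icont_within hg.
have dRe t : a <= t <= b -> is_derive t 1 (fun s => complex.Re (G s%:C)) (complex.Re (g t%:C)).
  move=> /HG/cderivP K; apply/is_derive_eps => e /K[d d0 hd]; exists d => // y hy.
  have := hd y%:C; rewrite -rmorphB !cabs_real => /(_ hy) /(le_trans _); apply.
  by apply: le_trans (Re_le_cabs _); rewrite !ReImE /= mulr0 subr0.
have dIm t : a <= t <= b -> is_derive t 1 (fun s => complex.Im (G s%:C)) (complex.Im (g t%:C)).
  move=> /HG/cderivP K; apply/is_derive_eps => e /K[d d0 hd]; exists d => // y hy.
  have := hd y%:C; rewrite -rmorphB !cabs_real => /(_ hy) /(le_trans _); apply.
  by apply: le_trans (Im_le_cabs _); rewrite !ReImE /= mulr0 add0r.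
have aux (u U : R -> R) : {within `[a, b], continuous u} ->
    (forall t, a <= t <= b -> is_derive t 1 U (u t)) ->
    Rintegral leb `[a, b] u = U b - U a.
  move=> cu dU; rewrite /Rintegral (@continuous_FTC2 _ u U a b ab cu).
  - by rewrite -EFinB.
  - have dc t : a <= t <= b -> {for t, continuous U}.
      by move=> /dU [dt _]; apply: differentiable_continuous; exact/derivable1_diffP.
    split.
    + move=> t; rewrite in_itv /= => /andP[at_ tb].
      by have [] := dU t; rewrite ?(ltW at_) ?(ltW tb).
    + by apply: cvg_at_right_filter; apply: dc; rewrite lexx ltW.
    + by apply: cvg_at_left_filter; apply: dc; rewrite lexx ltW.
  - move=> t; rewrite in_itv /= => /andP[at_ tb].
    have [] := dU t; rewrite ?(ltW at_) ?(ltW tb) // => dt <-.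
    by rewrite derive1E.
by apply: complex_ext; rewrite !ReImE /= (aux _ _ _ dRe, aux _ _ _ dIm).
Qed.

Lemma cint_congr h g a b : (forall t, a <= t <= b -> h t%:C = g t%:C) ->
  cint h a b = cint g a b.
Proof. by move=> H; apply: Cintegral_congr => t /=; rewrite in_itv /=; exact: H. Qed.

Lemma cintD h g a b : icont h a b -> icont g a b ->
  cint (fun t => h t + g t) a b = cint h a b + cint g a b.
Proof. by move=> hh hg; apply: CintegralD => //; exact: icont_cintble. Qed.

Lemma cintB h g a b : icont h a b -> icont g a b ->
  cint (fun t => h t - g t) a b = cint h a b - cint g a b.
Proof. by move=> hh hg; apply: CintegralB => //; exact: icont_cintble. Qed.

Lemma cintZ h a b (c : C) : icont h a b -> cint (fun t => c * h t) a b = c * cint h a b.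
Proof. by move=> hh; apply: CintegralZ => //; exact: icont_cintble. Qed.

End LineIntegral.

Section UnitCircle.
Variable R : realType.
Local Notation C := R[i].
Local Notation ii := (imag_unit R).

(* Locked: otherwise rewriting with [cabsM] unfolds it to a product. *)
Fact cis_key : unit. Proof. by []. Qed.
Definition cis : C -> C := locked_with cis_key (fun t => Cexp (ii * t)).

Lemma cisdef t : cis t = Cexp (ii * t).
Proof. by rewrite /cis unlock. Qed.

Lemma cderiv_cis t : cderiv cis t (ii * cis t).
Proof.
have -> : cis = fun t => Cexp (ii * t) by apply/funext => s; exact: cisdef.
rewrite mulrC; apply: (@cderiv_comp _ (fun w => ii * w)); last exact: cderiv_Cexp.
by have := cderivM (cderiv_cst ii t) (cderiv_id t); rewrite mul0r add0r mulr1.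
Qed.

Lemma hol_cis t : hol cis t. Proof. by exists (ii * cis t); exact: cderiv_cis. Qed.

Lemma cisE (t : R) : cis t%:C = cos t +i* sin t.
Proof.
rewrite cisdef /Cexp !ReImE /= !(mul0r, mul1r, mulr0, subr0, add0r, addr0).
by rewrite expR0 mul1r.
Qed.

Lemma cabs_cis (t : R) : cabs (cis t%:C) = 1.
Proof. by rewrite cisdef cabs_Cexp !ReImE /= mul0r mul1r subr0 expR0. Qed.

Lemma cis_lip (t t' : R) : cabs (cis t%:C - cis t'%:C) <= 2 * `|t - t'|.
Proof.
wlog tt : t t' / t' <= t.
  by move=> W; case/orP: (le_total t' t) => /W //; rewrite cabs_sub distrC.
rewrite -(@cint_FTC _ (fun s => ii * cis s)) //.
- rewrite ger0_norm ?subr_ge0 // -[2]mulr1; apply: cint_le => //.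
    by move=> s _; apply: hol_ccont; apply: holM => //; exact: hol_cis.
  by move=> s _; rewrite cabsM cabs_i cabs_cis mulr1.
- by move=> s _; exact: cderiv_cis.
- by move=> s _; apply: hol_ccont; apply: holM => //; exact: hol_cis.
Qed.

End UnitCircle.

#[global] Opaque cabs Cexp cint Cintegral.

Ltac gen_cint := repeat match goal with
  | |- context [cint ?h ?a ?b] => generalize (cint h a b); intro
  end.

Section Intervals.
Variable R : realType.
Implicit Types (a b c d s x : R).

Lemma itv_sub a b c d s : a <= c -> d <= b -> c <= s <= d -> a <= s <= b.
Proof. by move=> ac db /andP[cs sd]; rewrite (le_trans ac cs) (le_trans sd db). Qed.

Lemma itv_dist x a s c : x <= c <= x + a -> x <= s <= x + a -> `|s - c| <= a.
Proof. by move=> /andP[? ?] /andP[? ?]; rewrite ler_norml; apply/andP; split; lra. Qed.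

End Intervals.

(** * Cauchy theory *)

Section Goursat.
Variable R : realType.
Local Notation C := R[i].
Local Notation ii := (imag_unit R).
Variables c0 c1 r0 r1 : C.
Implicit Types (f g : C -> C).

(** A linear family of circles with moving center and radius. One theorem of Goursat for this map
    covers concentric annuli, the move of the center in the Cauchy formula, and the contraction of a
    circle to a point. *)
Definition annmap (s t : C) : C := c0 + s * c1 + (r0 + s * r1) * cis t.
Definition annmap_s (t : C) : C := c1 + r1 * cis t.
Definition annmap_t (s t : C) : C := (r0 + s * r1) * (ii * cis t).

Lemma cderiv_annmap_s (s t : C) : cderiv (annmap^~ t) s (annmap_s t).
Proof.
have : cderiv (annmap^~ t) s (0 + (1 * c1 + s * 0) + ((0 + (1 * r1 + s * 0)) * cis t + (r0 + s * r1) * 0)).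
  apply: cderivD.
    apply: cderivD; first exact: cderiv_cst.
    by apply: cderivM; [exact: cderiv_id|exact: cderiv_cst].
  apply: cderivM; last exact: cderiv_cst.
  apply: cderivD; first exact: cderiv_cst.
  by apply: cderivM; [exact: cderiv_id|exact: cderiv_cst].
by congr cderiv; rewrite /annmap_s; ring.
Qed.

Lemma cderiv_annmap_t (s t : C) : cderiv (annmap s) t (annmap_t s t).
Proof.
have : cderiv (annmap s) t (0 + (0 * cis t + (r0 + s * r1) * (ii * cis t))).
  apply: cderivD; first exact: cderiv_cst.
  by apply: cderivM; [exact: cderiv_cst|exact: cderiv_cis].
by congr cderiv; rewrite /annmap_t; ring.
Qed.

(** The integral of [f] along the image under [annmap] of the oriented boundary of a parameter
    rectangle. *)
Definition annbd f (s0 s1 t0 t1 : R) : C :=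
  cint (fun t => f (annmap s1%:C t) * annmap_t s1%:C t) t0 t1
  - cint (fun t => f (annmap s0%:C t) * annmap_t s0%:C t) t0 t1
  - cint (fun s => f (annmap s t1%:C) * annmap_s t1%:C) s0 s1
  + cint (fun s => f (annmap s t0%:C) * annmap_s t0%:C) s0 s1.

Definition contrect f (s0 s1 t0 t1 : R) := forall s t : R,
  s0 <= s <= s1 -> t0 <= t <= t1 -> ccont f (annmap s%:C t%:C).

Lemma icont_edge_t f (s0 s1 t0 t1 s : R) : contrect f s0 s1 t0 t1 -> s0 <= s <= s1 ->
  icont (fun t => f (annmap s%:C t) * annmap_t s%:C t) t0 t1.
Proof.
move=> H hs t ht; apply: ccontM.
  apply: (@ccont_comp _ (annmap s%:C)); last exact: H.
  exact: cderiv_ccont (cderiv_annmap_t _ _).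
apply: hol_ccont; apply: holM => //; apply: holM => //; exact: hol_cis.
Qed.

Lemma icont_edge_s f (s0 s1 t0 t1 t : R) : contrect f s0 s1 t0 t1 -> t0 <= t <= t1 ->
  icont (fun s => f (annmap s t%:C) * annmap_s t%:C) s0 s1.
Proof.
move=> H ht s hs; apply: ccontM; last exact: ccont_cst.
apply: (@ccont_comp _ (annmap^~ t%:C)); last exact: H.
exact: cderiv_ccont (cderiv_annmap_s _ _).
Qed.

Lemma annbd_split_s f (s0 s1 s2 t0 t1 : R) : s0 <= s1 -> s1 <= s2 -> t0 <= t1 ->
  contrect f s0 s2 t0 t1 -> annbd f s0 s2 t0 t1 = annbd f s0 s1 t0 t1 + annbd f s1 s2 t0 t1.
Proof.
move=> s01 s12 t01 H; rewrite /annbd.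
rewrite (cint_split s01 s12 (icont_edge_s H _)) ?lexx ?t01 //.
rewrite (cint_split s01 s12 (icont_edge_s H _)) ?lexx ?andbT ?t01 //; gen_cint; ring.
Qed.

Lemma annbd_split_t f (s0 s1 t0 t1 t2 : R) : t0 <= t1 -> t1 <= t2 -> s0 <= s1 ->
  contrect f s0 s1 t0 t2 -> annbd f s0 s1 t0 t2 = annbd f s0 s1 t0 t1 + annbd f s0 s1 t1 t2.
Proof.
move=> t01 t12 s01 H; rewrite /annbd.
rewrite (cint_split t01 t12 (icont_edge_t H _)) ?lexx ?andbT ?s01 //.
rewrite (cint_split t01 t12 (icont_edge_t H _)) ?lexx ?s01 //; gen_cint; ring.
Qed.

(** A primitive exists, so each edge contributes the difference of its values at two corners and the
    four differences cancel. This disposes of the first-order part of [f] in [goursat]. *)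
Lemma annbd_affine (a b : C) (s0 s1 t0 t1 : R) : s0 <= s1 -> t0 <= t1 ->
  annbd (fun w => a + b * w) s0 s1 t0 t1 = 0.
Proof.
move=> s01 t01; pose A (w : C) := a * w + b / 2 * (w * w).
have dA w : cderiv A w (a + b * w).
  have : cderiv A w ((0 * w + a * 1) + (0 * (w * w) + b / 2 * (1 * w + w * 1))).
    apply: cderivD; (apply: cderivM; first exact: cderiv_cst).
      exact: cderiv_id.
    by apply: cderivM; exact: cderiv_id.
  by congr cderiv; field.
have hc : contrect (fun w => a + b * w) s0 s1 t0 t1.
  by move=> s t _ _; apply: hol_ccont; apply: holD => //; exact: holM.
have et (s : R) : s0 <= s <= s1 ->
    cint (fun t => (a + b * annmap s%:C t) * annmap_t s%:C t) t0 t1 =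
    A (annmap s%:C t1%:C) - A (annmap s%:C t0%:C).
  move=> hs; apply: (@cint_FTC _ _ (fun t => A (annmap s%:C t))) => //.
    by move=> t _; apply: cderiv_comp (dA _); exact: cderiv_annmap_t.
  exact: icont_edge_t hc hs.
have es (t : R) : t0 <= t <= t1 ->
    cint (fun s => (a + b * annmap s t%:C) * annmap_s t%:C) s0 s1 =
    A (annmap s1%:C t%:C) - A (annmap s0%:C t%:C).
  move=> ht; apply: (@cint_FTC _ _ (fun s => A (annmap s t%:C))) => //.
    by move=> s _; apply: (@cderiv_comp _ (annmap^~ t%:C)) (dA _); exact: cderiv_annmap_s.
  exact: icont_edge_s hc ht.
rewrite /annbd !et ?es ?lexx ?s01 ?t01 //; ring.
Qed.

Lemma annbdB f g (s0 s1 t0 t1 : R) : s0 <= s1 -> t0 <= t1 ->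
  contrect f s0 s1 t0 t1 -> contrect g s0 s1 t0 t1 ->
  annbd (fun w => f w - g w) s0 s1 t0 t1 = annbd f s0 s1 t0 t1 - annbd g s0 s1 t0 t1.
Proof.
move=> s01 t01 hf hg; rewrite /annbd.
have et (s : R) : s0 <= s <= s1 ->
    cint (fun t => (f (annmap s%:C t) - g (annmap s%:C t)) * annmap_t s%:C t) t0 t1 =
    cint (fun t => f (annmap s%:C t) * annmap_t s%:C t) t0 t1 -
    cint (fun t => g (annmap s%:C t) * annmap_t s%:C t) t0 t1.
  move=> hs; rewrite -cintB; [|exact: icont_edge_t hf hs|exact: icont_edge_t hg hs].
  by apply: cint_congr => t _; ring.
have es (t : R) : t0 <= t <= t1 ->
    cint (fun s => (f (annmap s t%:C) - g (annmap s t%:C)) * annmap_s t%:C) s0 s1 =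
    cint (fun s => f (annmap s t%:C) * annmap_s t%:C) s0 s1 -
    cint (fun s => g (annmap s t%:C) * annmap_s t%:C) s0 s1.
  move=> hs; rewrite -cintB; [|exact: icont_edge_s hf hs|exact: icont_edge_s hg hs].
  by apply: cint_congr => u _; ring.
rewrite !et ?es ?lexx ?s01 ?t01 //; gen_cint; ring.
Qed.

Lemma annbd_le f (s0 s1 t0 t1 M K : R) : s0 <= s1 -> t0 <= t1 -> 0 <= M -> 0 <= K ->
  contrect f s0 s1 t0 t1 ->
  (forall s t : R, s0 <= s <= s1 -> t0 <= t <= t1 -> cabs (f (annmap s%:C t%:C)) <= M) ->
  (forall s t : R, s0 <= s <= s1 -> t0 <= t <= t1 ->
     cabs (annmap_s t%:C) <= K /\ cabs (annmap_t s%:C t%:C) <= K) ->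
  cabs (annbd f s0 s1 t0 t1) <= 4 * M * K * (s1 - s0 + (t1 - t0)).
Proof.
move=> s01 t01 M0 K0 hc hM hK; rewrite /annbd.
have et (s : R) : s0 <= s <= s1 ->
    cabs (cint (fun t => f (annmap s%:C t) * annmap_t s%:C t) t0 t1) <= 2 * (M * K) * (t1 - t0).
  move=> hs; apply: cint_le => //; first exact: icont_edge_t hc hs.
  move=> t ht; rewrite cabsM ler_pM ?cabs_ge0 //; first exact: hM.
  by have [] := hK _ _ hs ht.
have es (t : R) : t0 <= t <= t1 ->
    cabs (cint (fun s => f (annmap s t%:C) * annmap_s t%:C) s0 s1) <= 2 * (M * K) * (s1 - s0).
  move=> ht; apply: cint_le => //; first exact: icont_edge_s hc ht.
  move=> s hs; rewrite cabsM ler_pM ?cabs_ge0 //; first exact: hM.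
  by have [] := hK _ _ hs ht.
apply: le_trans (cabsD _ _) _; apply: le_trans (lerD (cabsB _ _) (lexx _)) _.
apply: le_trans (lerD (lerD (cabsB _ _) (lexx _)) (lexx _)) _.
have := et s0; have := et s1; have := es t0; have := es t1.
rewrite !lexx s01 t01 /= => /(_ isT) a1 /(_ isT) a2 /(_ isT) a3 /(_ isT) a4.
apply: le_trans (lerD (lerD (lerD a3 a4) a1) a2) _.
by rewrite le_eqVlt; apply/orP; left; apply/eqP; ring.
Qed.

Opaque annbd.

(** Bisection takes place in the parameter rectangle, not in the plane. On the [n]-th rectangle the
    integral keeps a share [4^-n] of [X], whereas the first-order expansion of [f] at the common
    point makes it smaller than any [e] times [4^-n], up to a fixed constant. *)
Lemma goursat f (s0 s1 t0 t1 : R) : s0 <= s1 -> t0 <= t1 ->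
  (forall s t : R, s0 <= s <= s1 -> t0 <= t <= t1 -> hol f (annmap s%:C t%:C)) ->
  annbd f s0 s1 t0 t1 = 0.
Proof.
move=> s01 t01 hf; apply/eqP; rewrite -cabs_eq0; apply/eqP.
set X := cabs _; set A := s1 - s0; set B := t1 - t0.
have A0 : 0 <= A by rewrite subr_ge0.
have B0 : 0 <= B by rewrite subr_ge0.
pose h n : R := 2^-1 ^+ n.
have h0 n : 0 < h n by rewrite exprn_gt0.
have hS n : h n = 2 * h n.+1 by rewrite /h exprS mulrA divff ?mul1r.
have hc (a b c d : R) : s0 <= a -> b <= s1 -> t0 <= c -> d <= t1 -> contrect f a b c d.
  move=> ? ? ? ? s t /andP[? ?] /andP[? ?]; apply: hol_ccont; apply: hf; lra.
(* [p] is the lower left corner of a rectangle with sides [A * h n] and [B * h n]. *)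
pose P n (p : R * R) := [/\ s0 <= p.1, p.1 + A * h n <= s1, t0 <= p.2, p.2 + B * h n <= t1 &
  X * (h n * h n) <= cabs (annbd f p.1 (p.1 + A * h n) p.2 (p.2 + B * h n))].
pose Nx n (p p' : R * R) := [/\ P n.+1 p', p.1 <= p'.1, p.2 <= p'.2,
   p'.1 + A * h n.+1 <= p.1 + A * h n & p'.2 + B * h n.+1 <= p.2 + B * h n].
(* The premise stands under the existential so that [choice] yields a total successor function. *)
have step (np : nat * (R * R)) : exists p', P np.1 np.2 -> Nx np.1 np.2 p'.
  case: np => n [s t] /=; rewrite /P /=.
  have [[q1 q2 q3 q4 q5]|] := pselect (P n (s, t)); last by move=> nP; exists (s, t) => /nP.
  rewrite /= in q1 q2 q3 q4 q5.
  set a := A * h n.+1; set b := B * h n.+1.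
  have Aa : A * h n = a + a by rewrite /a (hS n); ring.
  have Bb : B * h n = b + b by rewrite /b (hS n); ring.
  have a0 : 0 <= a by rewrite mulr_ge0 // ltW.
  have b0 : 0 <= b by rewrite mulr_ge0 // ltW.
  move: q2 q4 q5; rewrite Aa Bb => q2 q4 q5.
  have e1 : annbd f s (s + (a + a)) t (t + (b + b)) =
     (annbd f s (s + a) t (t + b) + annbd f s (s + a) (t + b) (t + b + b)) +
     (annbd f (s + a) (s + a + a) t (t + b) + annbd f (s + a) (s + a + a) (t + b) (t + b + b)).
    have [i1 i2 i3 i4] : [/\ s <= s + a, s + a <= s + a + a, t <= t + b & t + b <= t + b + b].
      by rewrite !lerDl.
    have -> : s + (a + a) = s + a + a by ring.
    have -> : t + (b + b) = t + b + b by ring.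
    have [j1 j2] : s + a <= s1 /\ s + a + a <= s1 by clear q5; lra.
    have j3 : t + b + b <= t1 by clear q5; lra.
    have [j4 j5] : s0 <= s + a /\ t <= t + b + b by clear q5; lra.
    rewrite (annbd_split_s i1 i2 j5); last by apply: hc => //.
    rewrite (annbd_split_t i3 i4 i1); last by apply: hc => //.
    rewrite (annbd_split_t i3 i4 i2) //; by apply: hc => //.
  have hh : X * (h n * h n) = 4 * (X * (h n.+1 * h n.+1)) by rewrite (hS n); ring.
  suff : exists p', [/\ (p'.1 = s \/ p'.1 = s + a), (p'.2 = t \/ p'.2 = t + b) &
      X * (h n.+1 * h n.+1) <= cabs (annbd f p'.1 (p'.1 + a) p'.2 (p'.2 + b))].
    move=> [p' [p1 p2 p3]]; exists p' => _; rewrite /Nx /P /= -/a -/b Aa Bb.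
    clear q5 e1 hh hc.
    by case: p1 p2 p3 => -> [] -> p3; (split; first split=> //); clear p3; lra.
  set Y := X * (h n.+1 * h n.+1) in hh *.
  have [k1|k1] := leP Y (cabs (annbd f s (s + a) t (t + b))).
    by exists (s, t); split; [left|left|].
  have [k2|k2] := leP Y (cabs (annbd f s (s + a) (t + b) (t + b + b))).
    by exists (s, t + b); split; [left|right|].
  have [k3|k3] := leP Y (cabs (annbd f (s + a) (s + a + a) t (t + b))).
    by exists (s + a, t); split; [right|left|].
  have [k4|k4] := leP Y (cabs (annbd f (s + a) (s + a + a) (t + b) (t + b + b))).
    by exists (s + a, t + b); split; [right|right|].
  exfalso; move: q5; rewrite hh e1.
  move: k1 k2 k3 k4.
  move: (annbd f s (s + a) t (t + b)) (annbd f s (s + a) (t + b) (t + b + b))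
    (annbd f (s + a) (s + a + a) t (t + b)) (annbd f (s + a) (s + a + a) (t + b) (t + b + b)).
  move=> u1 u2 u3 u4 k1 k2 k3 k4; clear -k1 k2 k3 k4.
  by have := cabsD (u1 + u2) (u3 + u4); have := cabsD u1 u2; have := cabsD u3 u4; lra.
have [nx hnx] := choice step.
pose p := fix p n := if n is n'.+1 then nx (n', p n') else (s0, t0).
have hP n : P n (p n).
  elim: n => [|n IH]; last by have [] := hnx (n, p n) IH.
  rewrite /P /= /h expr0 !mulr1 /A /B !lexx; split=> //; try lra.
  by rewrite ![_ + (_ - _)]addrC !subrK.
have hN n : Nx n (p n) (p n.+1) by exact: (hnx (n, p n) (hP n)).
clearbody p.
have mono m n : [/\ (p m).1 <= (p (m + n)%N).1, (p m).2 <= (p (m + n)%N).2,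
    (p (m + n)%N).1 + A * h (m + n)%N <= (p m).1 + A * h m &
    (p (m + n)%N).2 + B * h (m + n)%N <= (p m).2 + B * h m].
  elim: n => [|n [i1 i2 i3 i4]]; first by rewrite addn0 !lexx.
  have [_ j1 j2 j3 j4] := hN (m + n)%N; rewrite addnS; split; lra.
have Ah n : 0 <= A * h n by rewrite mulr_ge0 // ltW.
have Bh n : 0 <= B * h n by rewrite mulr_ge0 // ltW.
have cross m n : (p m).1 <= (p n).1 + A * h n /\ (p m).2 <= (p n).2 + B * h n.
  have [mn|nm] := leqP m n.
    have [] := mono m (n - m)%N; rewrite subnKC // => *; have := Ah n; have := Bh n; lra.
  have [] := mono n (m - n)%N; rewrite subnKC ?(ltnW nm) // => *; have := Ah m; have := Bh m; lra.
(* The common point of the nested rectangles: every left end lies below every right end, by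
   [cross]. *)
pose sS := sup (range (fun n => (p n).1)); pose tS := sup (range (fun n => (p n).2)).
have supP (u : nat -> R) (v : nat -> R) : (forall m n, u m <= v n) ->
    forall n, u n <= sup (range u) <= v n.
  move=> uv n; apply/andP; split.
    apply: ub_le_sup; first by exists (v 0%N) => _ [m _ <-]; exact: uv.
    by exists n.
  apply: ge_sup; first by exists (u 0%N); exists 0%N.
  by move=> _ [m _ <-]; exact: uv.
have hs n : (p n).1 <= sS <= (p n).1 + A * h n by apply: (supP (fun n => (p n).1) (fun n => (p n).1 + A * h n)) => a b; have [] := cross a b.
have ht n : (p n).2 <= tS <= (p n).2 + B * h n by apply: (supP (fun n => (p n).2) (fun n => (p n).2 + B * h n)) => a b; have [] := cross a b.
clearbody sS tS.
have sS01 : s0 <= sS <= s1.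
  have := hs 0%N; have [] := hP 0%N => *; lra.
have tS01 : t0 <= tS <= t1.
  have := ht 0%N; have [] := hP 0%N => *; lra.
have [l /cderivP hl] := hf _ _ sS01 tS01.
set w0 := annmap sS%:C tS%:C in hl.
(* A common bound for both partial derivatives of [annmap] on the rectangle. *)
set K := cabs c1 + cabs r1 + cabs r0 + (`|s0| + `|s1|) * cabs r1 + 1.
have [k1 k2 k3] : [/\ 0 <= cabs c1, 0 <= cabs r1 & 0 <= cabs r0] by rewrite !cabs_ge0.
have k4 : 0 <= (`|s0| + `|s1|) * cabs r1 by rewrite mulr_ge0 ?addr_ge0.
have K0 : 0 < K by rewrite /K; lra.
have hKs (t : R) : cabs (annmap_s t%:C) <= K.
  by apply: le_trans (cabsD _ _) _; rewrite cabsM cabs_cis mulr1 /K; lra.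
have hKr (s : R) : s0 <= s <= s1 -> cabs (r0 + s%:C * r1) <= K.
  move=> hs0; apply: le_trans (cabsD _ _) _; rewrite cabsM cabs_real /K.
  have : `|s| * cabs r1 <= (`|s0| + `|s1|) * cabs r1.
    rewrite ler_wpM2r // ler_norml.
    by have := ler_norm s1; have := ler_norm (- s0); have := normr_ge0 s0; have := normr_ge0 s1;
      rewrite normrN; lra.
  lra.
have hKt (s t : R) : s0 <= s <= s1 -> cabs (annmap_t s%:C t%:C) <= K.
  move=> h1; rewrite /annmap_t cabsM (cabsM ii) cabs_i.
  by rewrite cabs_cis !mulr1; exact: hKr.
have lip (s t : R) : s0 <= s <= s1 ->
    cabs (annmap s%:C t%:C - w0) <= 2 * K * (`|s - sS| + `|t - tS|).
  move=> hs1.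
  have -> : annmap s%:C t%:C - w0 = (s - sS)%:C * annmap_s tS%:C
      + (r0 + s%:C * r1) * (cis t%:C - cis tS%:C).
    by rewrite /w0 /annmap /annmap_s rmorphB /=; ring.
  apply: le_trans (cabsD _ _) _; rewrite !cabsM cabs_real.
  have e1 : `|s - sS| * cabs (annmap_s tS%:C) <= `|s - sS| * K by rewrite ler_wpM2l.
  have e2 : cabs (r0 + s%:C * r1) * cabs (cis t%:C - cis tS%:C) <= K * (2 * `|t - tS|).
    by rewrite ler_pM ?cabs_ge0 ?cis_lip // hKr.
  have e3 : 0 <= `|s - sS| * K by rewrite mulr_ge0 // ltW.
  lra.
(* By [lip], the image of the [n]-th rectangle lies within [L * h n] of [w0]; the summand 1 keeps
   [L] positive. *)
set L := 2 * K * (A + B) + 1.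
have AB0 : 0 <= A + B by rewrite addr_ge0.
have KAB0 : 0 <= 2 * K * (A + B) by apply: mulr_ge0 => //; apply: mulr_ge0 => //; exact: ltW.
have L0 : 0 < L by rewrite /L; lra.
have X0 : 0 <= X by exact: cabs_ge0.
suff H e : 0 < e -> X <= e * (4 * L * K * (A + B)).
  set Q := 4 * L * K * (A + B) in H.
  have Q0 : 0 <= Q.
    apply: mulr_ge0 => //; apply: mulr_ge0; last exact: ltW.
    by apply: mulr_ge0 => //; exact: ltW.
  apply/eqP; rewrite eq_le X0 andbT leNgt; apply/negP => Xp.
  have e0 : 0 < X / (2 * (Q + 1)) by rewrite divr_gt0 // mulr_gt0 //; lra.
  have := H _ e0; rewrite -mulrA leNgt => /negP; apply.
  rewrite -[X in _ < X]mulr1 ltr_pM2l // mulrC ltr_pdivrMr ?mul1r; last by rewrite mulr_gt0 //; lra.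
  lra.
move=> e0; have [d d0 hd] := hl _ e0.
have [n hn] : exists n, L * h n < d.
  exists (Num.Def.archi_bound (L / d)).
  have := upper_nthrootP (leqnn (Num.Def.archi_bound (L / d))).
  by rewrite /h exprVn ltr_pdivrMr ?exprn_gt0 // ltr_pdivrMr // mulrC.
have [q1 q2 q3 q4 q5] := hP n.
set hn' := h n in hn q2 q4 q5 *; have hn0 : 0 < hn' by exact: h0.
pose aff (w : C) := (f w0 - l * w0) + l * w.
have hca (a b c u : R) : contrect aff a b c u.
  by move=> s t _ _; apply: hol_ccont; apply: holD => //; exact: holM.
have An : 0 <= A * hn' by exact: Ah.
have Bn : 0 <= B * hn' by exact: Bh.
have ss : (p n).1 <= (p n).1 + A * hn' by rewrite lerDl.
have tt : (p n).2 <= (p n).2 + B * hn' by rewrite lerDl.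
have hcf : contrect f (p n).1 ((p n).1 + A * hn') (p n).2 ((p n).2 + B * hn') by apply: hc.
have eq : annbd f (p n).1 ((p n).1 + A * hn') (p n).2 ((p n).2 + B * hn') =
    annbd (fun w => f w - aff w) (p n).1 ((p n).1 + A * hn') (p n).2 ((p n).2 + B * hn').
  by rewrite annbdB // annbd_affine // subr0.
have hcd : contrect (fun w => f w - aff w) (p n).1 ((p n).1 + A * hn') (p n).2 ((p n).2 + B * hn').
  move=> s t hs1 ht1; apply: hol_ccont; apply: holB; last by apply: holD => //; exact: holM.
  by apply: hf; [exact: itv_sub q1 q2 hs1 | exact: itv_sub q3 q4 ht1].
have := @annbd_le _ _ _ _ _ (e * (L * hn')) K ss tt _ (ltW K0) hcd.
have -> : (p n).1 + A * hn' - (p n).1 + ((p n).2 + B * hn' - (p n).2) = (A + B) * hn' by ring.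
rewrite -eq => H.
have {}H : X * (hn' * hn') <= 4 * (e * (L * hn')) * K * ((A + B) * hn').
  apply: le_trans q5 _; apply: H.
  - by apply: mulr_ge0; [exact: ltW|apply: mulr_ge0; exact: ltW].
  - move=> s t hs1 ht1.
    clear eq; have hs2 := hs n; have ht2 := ht n.
    have z1 : `|s - sS| <= A * hn' by exact: itv_dist hs2 hs1.
    have z2 : `|t - tS| <= B * hn' by exact: itv_dist ht2 ht1.
    have z3 : cabs (annmap s%:C t%:C - w0) <= L * hn'.
      apply: le_trans (lip _ _ (itv_sub q1 q2 hs1)) _.
      have : 2 * K * (`|s - sS| + `|t - tS|) <= 2 * K * (A * hn' + B * hn').
        by apply: ler_wpM2l; [apply: mulr_ge0 => //; exact: ltW|exact: lerD].
      move=> /le_trans; apply.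
      have -> : 2 * K * (A * hn' + B * hn') = L * hn' - hn' by rewrite /L; ring.
      by rewrite lerBlDr lerDl ltW.
    have -> : f (annmap s%:C t%:C) - aff (annmap s%:C t%:C) =
        f (annmap s%:C t%:C) - f w0 - l * (annmap s%:C t%:C - w0) by rewrite /aff; ring.
    apply: le_trans (hd _ (le_lt_trans z3 hn)) _.
    by rewrite ler_pM2l.
  - by move=> s t hs1 ht1; split => //; apply: hKt; exact: itv_sub q1 q2 hs1.
have hh0 : 0 < hn' * hn' by rewrite mulr_gt0.
rewrite -(ler_pM2r hh0); apply: le_trans H _.
by rewrite le_eqVlt; apply/orP; left; apply/eqP; ring.
Qed.

Transparent annbd.

End Goursat.

Section HolNear.
Variable R : realType.
Local Notation C := R[i].
Implicit Types (f g : C -> C) (z : C).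

Definition hol_near f z := exists2 d : R, 0 < d & forall w, cabs (w - z) < d -> hol f w.

Lemma hol_near_hol f z : hol_near f z -> hol f z.
Proof. by case=> d d0; apply; rewrite subrr cabs0. Qed.

Lemma hol_near2 f g h z : (forall w, hol f w -> hol g w -> hol h w) ->
  hol_near f z -> hol_near g z -> hol_near h z.
Proof.
move=> H [d1 d10 h1] [d2 d20 h2]; have [d d0 hd] := min2_gt0 d10 d20.
by exists d => // w /hd[/h1 k1 /h2 k2]; exact: H.
Qed.

Lemma holn_all f z : (forall w, hol f w) -> hol_near f z.
Proof. by exists 1. Qed.

Lemma holnD f g z : hol_near f z -> hol_near g z -> hol_near (fun w => f w + g w) z.
Proof. by apply: hol_near2 => w; exact: holD. Qed.

Lemma holnM f g z : hol_near f z -> hol_near g z -> hol_near (fun w => f w * g w) z.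
Proof. by apply: hol_near2 => w; exact: holM. Qed.

Lemma holnB f g z : hol_near f z -> hol_near g z -> hol_near (fun w => f w - g w) z.
Proof. by apply: hol_near2 => w; exact: holB. Qed.

Lemma holn_comp f g z : hol_near f z -> hol_near g (f z) -> hol_near (fun w => g (f w)) z.
Proof.
move=> hf [d2 d20 h2]; have [d1 d10 h1] := hf.
have [d3 d30 h3] := hol_ccont (hol_near_hol hf) d20.
have [d d0 hd] := min2_gt0 d10 d30; exists d => // w /hd[/h1 k1 /h3 k2].
by apply: (hol_comp k1); exact: h2.
Qed.

Lemma holnV f z : f z != 0 -> hol_near f z -> hol_near (fun w => (f w)^-1) z.
Proof.
move=> f0 hf; apply: (@holn_comp f (fun w => w^-1)) => //.
exists (cabs (f z)); first by rewrite cabs_gt0.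
move=> w hw; apply: holV => //; apply/eqP => w0.
by move: hw; rewrite w0 sub0r cabsN ltxx.
Qed.

Lemma holn_sum (I : Type) (s : seq I) (P : pred I) (F : I -> C -> C) z :
  (forall i, P i -> hol_near (F i) z) -> hol_near (fun w => \sum_(i <- s | P i) F i w) z.
Proof.
move=> H; elim: s => [|i s IH].
  by under eq_fun do rewrite big_nil; exact: holn_all.
have [Pi|Pi] := boolP (P i).
  by under eq_fun do rewrite big_cons Pi; apply: holnD => //; exact: H.
by under eq_fun do rewrite big_cons (negbTE Pi).
Qed.

Lemma near_holn f g z (d : R) : 0 < d ->
  (forall w, cabs (w - z) < d -> g w = f w) -> hol_near f z -> hol_near g z.
Proof.
move=> d0 H [d1 d10 h1]; have [d2 d20 hd] := min2_gt0 d0 d10; exists d2 => // w hw.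
have [_ /h1 k] := hd _ hw.
apply: (@near_hol _ f g w (d2 - cabs (w - z))) => //; first by rewrite subr_gt0.
move=> v hv; apply: H; have -> : v - z = (v - w) + (w - z) by ring.
have hv' : cabs (v - w + (w - z)) < d2 by apply: le_lt_trans (cabsD _ _) _; lra.
by have [] := hd _ hv'.
Qed.

End HolNear.

Section Cauchy.
Variable R : realType.
Local Notation C := R[i].
Local Notation ii := (imag_unit R).
Implicit Types (f g : C -> C) (a c z w : C) (r M : R).

Definition circ a (r : C) f : C :=
  cint (fun t => f (a + r * cis t) * (r * (ii * cis t))) 0 (2 * pi).

Lemma pi2_gt0 : 0 < 2 * pi :> R. Proof. by rewrite mulr_gt0 // pi_gt0. Qed.
Lemma pi2_ge0 : 0 <= 2 * pi :> R. Proof. exact: ltW pi2_gt0. Qed.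

Lemma ii_neq0 : ii != 0. Proof. by rewrite -cabs_eq0 cabs_i oner_eq0. Qed.

Lemma cis_neq0 (t : R) : cis (t%:C : C) != 0.
Proof. by rewrite -cabs_eq0 cabs_cis oner_eq0. Qed.

Lemma cis_2pi : cis ((2 * pi : R)%:C) = cis (0%:C : C).
Proof. by rewrite !cisE mulrC mulr_natr cos2pi sin2pi cos0 sin0. Qed.

Lemma circle_integralE r f : circle_integral r f = circ 0 r%:C f.
Proof.
apply: Cintegral_congr => t _ /=; rewrite add0r cisdef; congr (_ * _).
by rewrite mulrCA.
Qed.

Lemma circ_icont a (r : C) f : (forall t : R, 0 <= t <= 2 * pi -> ccont f (a + r * cis t%:C)) ->
  icont (fun t => f (a + r * cis t) * (r * (ii * cis t))) 0 (2 * pi).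
Proof.
move=> H t ht; apply: ccontM.
  apply: (@ccont_comp _ (fun t => a + r * cis t)); last exact: H.
  by apply: hol_ccont; apply: holD => //; apply: holM => //; exact: hol_cis.
by apply: hol_ccont; apply: holM => //; apply: holM => //; exact: hol_cis.
Qed.

(** In [goursat] on the full turn, the edges at the angles [0] and [2 * pi] coincide and cancel,
    leaving the two circles. *)
Lemma circ_homotopy a0 a1 (r0 r1 : C) f :
  (forall s t : R, 0 <= s <= 1 -> 0 <= t <= 2 * pi ->
     hol f (a0 + s%:C * (a1 - a0) + (r0 + s%:C * (r1 - r0)) * cis t%:C)) ->
  circ a0 r0 f = circ a1 r1 f.
Proof.
move=> H; have := goursat ler01 pi2_ge0 H; rewrite /annbd.
rewrite [X in _ - X + _](_ : _ = cint (fun s => f (annmap a0 (a1 - a0) r0 (r1 - r0) s 0%:C) *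
   annmap_s (a1 - a0) (r1 - r0) 0%:C) 0 1); last first.
  by apply: cint_congr => s _; rewrite /annmap /annmap_s cis_2pi.
rewrite subrK => /eqP; rewrite subr_eq0 => /eqP /esym E.
rewrite /circ; transitivity (cint (fun t => f (annmap a0 (a1 - a0) r0 (r1 - r0) 0%:C t) *
   annmap_t r0 (r1 - r0) 0%:C t) 0 (2 * pi)).
  by apply: cint_congr => t _; rewrite /annmap /annmap_t !mul0r !addr0.
rewrite E; apply: cint_congr => t _; rewrite /annmap /annmap_t !mul1r.
by rewrite ![_ + (_ - _)]addrC !subrK.
Qed.

Lemma circ_le a (r : R) f M : 0 <= r -> (forall t : R, 0 <= t <= 2 * pi -> ccont f (a + r%:C * cis t%:C)) ->
  (forall w, cabs (w - a) = r -> cabs (f w) <= M) -> cabs (circ a r%:C f) <= 2 * (M * r) * (2 * pi).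
Proof.
move=> r0 hc hM; rewrite -[X in _ * X]subr0; apply: cint_le; first exact: pi2_ge0.
  exact: circ_icont.
move=> t _; rewrite (cabsM (f _)) (cabsM r%:C) (cabsM ii) cabs_i cabs_cis cabs_pos // !mulr1.
by rewrite ler_wpM2r // hM // addrC addKr cabsM cabs_cis cabs_pos // mulr1.
Qed.

Lemma circ_congr a (r : R) f g : 0 <= r -> (forall w, cabs (w - a) = r -> f w = g w) ->
  circ a r%:C f = circ a r%:C g.
Proof.
move=> r0 H; apply: cint_congr => t _; rewrite H //.
by rewrite addrC addKr cabsM cabs_cis cabs_pos // mulr1.
Qed.

Lemma circD a r f g : (forall t : R, ccont f (a + r%:C * cis t%:C)) ->
  (forall t : R, ccont g (a + r%:C * cis t%:C)) ->
  circ a r%:C (fun w => f w + g w) = circ a r%:C f + circ a r%:C g.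
Proof.
move=> hf hg; rewrite /circ -cintD; [|exact: circ_icont|exact: circ_icont].
by apply: cint_congr => t _; rewrite mulrDl.
Qed.

Lemma circB a r f g : (forall t : R, ccont f (a + r%:C * cis t%:C)) ->
  (forall t : R, ccont g (a + r%:C * cis t%:C)) ->
  circ a r%:C (fun w => f w - g w) = circ a r%:C f - circ a r%:C g.
Proof.
move=> hf hg; rewrite /circ -cintB; [|exact: circ_icont|exact: circ_icont].
by apply: cint_congr => t _; rewrite mulrBl.
Qed.

Lemma circZ a r f (k : C) : (forall t : R, ccont f (a + r%:C * cis t%:C)) ->
  circ a r%:C (fun w => k * f w) = k * circ a r%:C f.
Proof.
move=> hf; rewrite /circ -cintZ; last exact: circ_icont.
by apply: cint_congr => t _; rewrite -mulrA.
Qed.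

Lemma eps_zero (x k : R) : 0 <= x -> (forall e, 0 < e -> x <= e * k) -> x = 0.
Proof.
move=> x0 H; apply/eqP; rewrite eq_le x0 andbT leNgt; apply/negP => xp.
have k0 : 0 < k.
  by have := H 1 ltr01; rewrite mul1r; exact: lt_le_trans.
have /H : 0 < x / (2 * k) by rewrite divr_gt0 // mulr_gt0.
have -> : x / (2 * k) * k = x / 2 by field; rewrite gt_eqF.
lra.
Qed.

Lemma dist_circ a r (t : R) : 0 <= r -> cabs (a + r%:C * cis t%:C - a) = r.
Proof. by move=> r0; rewrite addrC addKr cabsM cabs_cis cabs_pos // mulr1. Qed.

Lemma cauchy_formula f a r z : (forall w, cabs (w - a) <= r -> hol f w) ->
  cabs (z - a) < r -> circ a r%:C (fun w => f w / (w - z)) = (2 * pi)%:C * ii * f z.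
Proof.
move=> hf zr; have r0 : 0 < r := le_lt_trans (cabs_ge0 _) zr.
set m := cabs (z - a) in zr.
have hfz : hol f z by apply: hf; exact: ltW.
apply/eqP; rewrite -subr_eq0 -cabs_eq0; apply/eqP.
apply: (@eps_zero _ (4 * (2 * pi))); first exact: cabs_ge0.
move=> e e0; have [d d0 hd] := hol_ccont hfz e0.
have rm : 0 < r - m by rewrite subr_gt0.
have [k k0 hk] := min2_gt0 d0 rm.
set x := k / 2; have x0 : 0 < x by rewrite divr_gt0.
have [xd xr] : x < d /\ x < r - m by apply: hk; rewrite /x; lra.
(* The circle of radius [x] about [z] grows linearly to the given one. At time [s] the distance to
   [z] is at least [x + s * (r - x) - s * m], positive because [x < r - m]. *)
rewrite -(@circ_homotopy z _ x%:C).
  have -> : circ z x%:C (fun w => f w / (w - z)) =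
      cint (fun t => f (z + x%:C * cis t) * ii) 0 (2 * pi).
    apply: cint_congr => t _; rewrite [z + _ - z]addrAC subrr add0r.
    have c0 := cis_neq0 t; have xC : x%:C != 0 :> C by rewrite (inj_eq (@complexI R)) gt_eqF.
    by field; rewrite ?xC ?c0.
  have -> : (2 * pi)%:C * ii * f z = cint (fun t => f z * ii) 0 (2 * pi).
    rewrite (@cint_FTC _ _ (fun t => f z * ii * t)).
    - by rewrite mulr0 subr0; ring.
    - exact: pi2_ge0.
    - move=> t _; have := cderivM (cderiv_cst (f z * ii) t%:C) (cderiv_id t%:C).
      by rewrite mul0r add0r mulr1.
    - by move=> t _; exact: ccont_cst.
  have hx t : cabs (x%:C * cis t%:C : C) < d by rewrite cabsM cabs_cis mulr1 cabs_pos // ltW.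
  have hfx (t : R) : hol f (z + x%:C * cis t%:C).
    apply: hf; rewrite addrAC; apply: le_trans (cabsD _ _) _.
    by rewrite cabsM cabs_cis mulr1 cabs_pos; [lra|exact: ltW].
  rewrite -cintB; first last.
  - by move=> t _; exact: ccont_cst.
  - move=> t _; apply: ccontM; last exact: ccont_cst.
    apply: (@ccont_comp _ (fun t => z + x%:C * cis t)); last exact: hol_ccont.
    by apply: hol_ccont; apply: holD => //; apply: holM => //; exact: hol_cis.
  apply: le_trans (_ : _ <= 2 * e * (2 * pi - 0)) _; last first.
    have : 0 <= e * (2 * pi) by rewrite mulr_ge0 ?pi2_ge0 // ltW.
    lra.
  apply: cint_le; first exact: pi2_ge0.
    move=> t _; apply: ccontD; last exact: ccont_cst.
    apply: ccontM; last exact: ccont_cst.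
    apply: (@ccont_comp _ (fun t => z + x%:C * cis t)); last exact: hol_ccont.
    by apply: hol_ccont; apply: holD => //; apply: holM => //; exact: hol_cis.
  move=> t _; rewrite -mulrBl cabsM cabs_i mulr1 ltW // hd //.
  by rewrite addrC addKr.
move=> s t /andP[s0 s1] _.
set w := _ + _.
have E1 : w - a = (1 - s)%:C * (z - a) + (x + s * (r - x))%:C * cis t%:C.
  by rewrite /w !(rmorphB, rmorphD, rmorphM) /=; ring.
have E2 : w - z = (x + s * (r - x))%:C * cis t%:C - s%:C * (z - a).
  by rewrite /w !(rmorphB, rmorphD, rmorphM) /=; ring.
have rho0 : 0 <= x + s * (r - x).
  have : 0 <= s * (r - x) by apply: mulr_ge0 => //; have := cabs_ge0 (z - a); rewrite -/m; lra.
  lra.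
have s1' : 0 <= 1 - s by lra.
have hfw : hol f w.
  apply: hf; rewrite E1; apply: le_trans (cabsD _ _) _.
  rewrite !cabsM cabs_cis mulr1 !cabs_pos // -/m.
  have : (1 - s) * (m + x) <= (1 - s) * r by apply: ler_wpM2l => //; lra.
  lra.
apply: hol_div => //; last exact: holB.
rewrite -cabs_gt0 E2; apply: lt_le_trans (ler_cabs_dist _ _).
rewrite !cabsM cabs_cis mulr1 !cabs_pos // -/m.
have : s * m <= s * (r - x) by apply: ler_wpM2l => //; lra.
have [s0'|s0'] := ltP 0 s; last by lra.
lra.
Qed.

End Cauchy.

(** * Taylor expansion and the identity theorem *)

Section Taylor.
Variable R : realType.
Local Notation C := R[i].
Local Notation ii := (imag_unit R).
Implicit Types (f g : C -> C) (a c z w h : C) (r M : R).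

Lemma circ_bounded f c r : 0 <= r -> (forall w, cabs (w - c) = r -> ccont f w) ->
  exists2 M, 0 <= M & forall w, cabs (w - c) = r -> cabs (f w) <= M.
Proof.
move=> r0 hf; pose u (t : R) := cabs (f (c + r%:C * cis t%:C)).
have ci (t : R) : ccont (fun t => f (c + r%:C * cis t)) t%:C.
  apply: (@ccont_comp _ (fun t => c + r%:C * cis t)); last by apply: hf; rewrite dist_circ.
  by apply: hol_ccont; apply: holD => //; apply: holM => //; exact: hol_cis.
have cu : continuous u.
  move=> t; apply/cvgrPdist_lt => e e0; have [d d0 hd] := ci t _ e0.
  apply/nbhs_ballP; exists d => // s /= hs0; have hs : `|t - s| < d := hs0.
  rewrite distrC /u.
  have := hd s%:C; rewrite -rmorphB cabs_real (distrC s) => /(_ hs).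
  apply: le_lt_trans; rewrite ler_norml; apply/andP; split; last exact: ler_cabs_dist.
  by rewrite lerNl opprB cabs_sub; exact: ler_cabs_dist.
have [t0 t0i ht0] := EVT_max (@pi2_ge0 R) (continuous_subspaceT cu).
exists (u t0); first exact: cabs_ge0.
move=> w hw; have [w0|w0] := eqVneq r 0.
  have wc : w = c by apply/eqP; rewrite -subr_eq0 -cabs_eq0 hw w0.
  have := ht0 0; rewrite in_itv /= lexx pi2_ge0 => /(_ isT).
  by rewrite /u w0 mul0r addr0 wc mul0r addr0.
have r1 : 0 < r by rewrite lt_neqAle eq_sym w0.
pose q := (w - c) / r%:C.
have rC : r%:C != 0 :> C by rewrite (inj_eq (@complexI R)).
have wq : w = c + r%:C * q by rewrite /q; field.
have q1 : cabs q = 1 by rewrite /q cabsM cabsV hw cabs_pos // divff.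
(* The maximum was taken over the angle, so each point of the circle needs one: [acos] of its real
   part on the upper half, the reflected angle on the lower half. *)
have [t ht qt] : exists2 t : R, 0 <= t <= 2 * pi & q = cis t%:C.
  have := cabs_sqr q; rewrite q1 expr1n; case: (q) => x y /= /esym xy.
  have x1 : -1 <= x <= 1.
    rewrite -ler_norml -(@ler_pXn2r _ 2) ?nnegrE // real_normK ?num_real // expr1n.
    by rewrite -xy lerDl sqr_ge0.
  have sx : y ^+ 2 = 1 - x ^+ 2 by rewrite -xy; ring.
  have [y0|y0] := leP 0 y.
    exists (acos x); first by rewrite acos_ge0 // (le_trans (acos_lepi x1)) // mulr_natl mulr2n lerDl pi_ge0.
    by rewrite cisE acosK // sin_acos // -sx sqrtr_sqr ger0_norm.
  exists (2 * pi - acos x).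
    have := acos_ge0 x1; have := acos_lepi x1; have := pi_ge0 R; lra.
  have -> : 2 * pi = pi *+ 2 :> R by rewrite mulr_natl.
  rewrite cisE cosB sinB cos2pi sin2pi.
  rewrite acosK // sin_acos // -sx sqrtr_sqr ltr0_norm //; congr (_ +i* _); ring.
by rewrite wq qt; apply: ht0; rewrite in_itv.
Qed.

Definition tcoef f c r (k : nat) : C :=
  ((2 * pi)%:C * ii)^-1 * circ c r%:C (fun w => f w / (w - c) ^+ k.+1).

Lemma twopii_neq0 : (2 * pi)%:C * ii != 0.
Proof. by rewrite mulf_neq0 ?ii_neq0 // (inj_eq (@complexI R)) gt_eqF // pi2_gt0. Qed.

(** The remainder is a Cauchy integral, obtained by iterating
    [1/(w-c-h) = 1/(w-c) + h/((w-c)(w-c-h))]. The constant 4 is the 2 of [circ_le] times the 2 from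
    [|w - c - h| >= r / 2]. *)
Lemma taylor f c r M n : 0 < r -> (forall w, cabs (w - c) <= r -> hol f w) ->
  (forall w, cabs (w - c) = r -> cabs (f w) <= M) ->
  forall h, cabs h <= r / 2 ->
  cabs (f (c + h) - \sum_(k < n) tcoef f c r k * h ^+ k) <= 4 * M / r ^+ n * cabs h ^+ n.
Proof.
move=> r0 hf hM h hr; have r0' := ltW r0.
have hcr : cabs (c + h - c) < r by rewrite addrAC subrr add0r; lra.
have M0 : 0 <= M.
  by apply: le_trans (hM (c + r%:C * cis 0%:C) (dist_circ _ _ r0')); exact: cabs_ge0.
have nz w : cabs (w - c) = r -> (w - c != 0) /\ (w - (c + h) != 0).
  move=> hw; split; first by rewrite -cabs_gt0 hw.
  rewrite -cabs_gt0; have -> : w - (c + h) = (w - c) - h by ring.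
  by apply: lt_le_trans (ler_cabs_dist _ _); rewrite hw; lra.
have holk k w : cabs (w - c) = r -> hol (fun w => f w / (w - c) ^+ k) w.
  move=> hw; have [n1 n2] := nz _ hw; apply: hol_div.
  - by rewrite expf_neq0.
  - by apply: hf; rewrite hw.
  - by apply: holX; exact: holB.
have hd (t : R) : cabs (c + r%:C * cis t%:C - c) = r by exact: dist_circ.
pose rem m w := f w / ((w - c) ^+ m * (w - (c + h))).
have holrem m w : cabs (w - c) = r -> hol (rem m) w.
  move=> hw; have [n1 n2] := nz _ hw; apply: hol_div.
  - by rewrite mulf_neq0 // expf_neq0.
  - by apply: hf; rewrite hw.
  - by apply: holM; [apply: holX|]; exact: holB.
have E m : f (c + h) - \sum_(k < m) tcoef f c r k * h ^+ k =
    ((2 * pi)%:C * ii)^-1 * (h ^+ m * circ c r%:C (rem m)).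
  elim: m => [|m IH].
    rewrite big_ord0 subr0 expr0 mul1r.
    have -> : circ c r%:C (rem 0%N) = circ c r%:C (fun w => f w / (w - (c + h))).
      by apply: circ_congr => // w _; rewrite /rem expr0 mul1r.
    by rewrite cauchy_formula // mulKf // twopii_neq0.
  rewrite big_ord_recr /= opprD addrA IH /tcoef -mulrA -mulrBr; congr (_ * _).
  rewrite [_ * h ^+ m]mulrC -mulrBr exprSr -mulrA; congr (_ * _).
  rewrite -circZ; last by move=> t; apply: hol_ccont; exact: holrem.
  rewrite -circB; first last.
  - by move=> t; apply: hol_ccont; exact: holk.
  - by move=> t; apply: hol_ccont; exact: holrem.
  apply: circ_congr => // w hw; have [n1 n2] := nz _ hw; rewrite /rem exprSr.
  have n3 : (w - c) ^+ m != 0 by rewrite expf_neq0.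
  by field; rewrite n1 n2 n3.
rewrite E !cabsM cabsV cabsM cabs_i mulr1 cabs_pos ?pi2_ge0 // cabsX mulrCA mulrC.
apply: ler_wpM2r; first by rewrite exprn_ge0 // cabs_ge0.
rewrite ler_pdivrMl ?pi2_gt0 //.
have -> : 2 * pi * (4 * M / r ^+ n) = 2 * (M / (r ^+ n * (r / 2)) * r) * (2 * pi).
  by field; rewrite ?expf_neq0 // gt_eqF.
apply: circ_le => //; first by move=> t _; apply: hol_ccont; exact: holrem.
move=> w hw; rewrite /rem cabsM cabsV cabsM cabsX hw.
have q : r / 2 <= cabs (w - (c + h)).
  have -> : w - (c + h) = (w - c) - h by ring.
  by apply: le_trans (ler_cabs_dist _ _); rewrite hw; lra.
apply: ler_pM => //; [exact: cabs_ge0| |exact: hM|].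
  by rewrite invr_ge0 mulr_ge0 ?exprn_ge0 // cabs_ge0.
rewrite lef_pV2 ?posrE ?mulr_gt0 ?exprn_gt0 // ?(lt_le_trans _ q) //; try lra.
by rewrite ler_pM2l ?exprn_gt0.
Qed.

Lemma hol_closed_disc f z : hol_near f z ->
  exists r M, [/\ 0 < r, 0 <= M, forall w, cabs (w - z) <= r -> hol f w &
    forall w, cabs (w - z) = r -> cabs (f w) <= M].
Proof.
move=> [d d0 hd]; have r0 : 0 < d / 2 by rewrite divr_gt0.
have H w : cabs (w - z) <= d / 2 -> hol f w by move=> hw; apply: hd; lra.
have [|M M0 hM] := @circ_bounded f z (d / 2) (ltW r0).
  by move=> w hw; apply: hol_ccont; apply: H; rewrite hw.
by exists (d / 2), M.
Qed.

Definition zero_near f z := exists2 d : R, 0 < d & forall w, cabs (w - z) < d -> f w = 0.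

Lemma expn_lt (x e : R) : 0 <= x -> x <= 2^-1 -> 0 < e -> exists n : nat, x ^+ n < e.
Proof.
move=> x0 x1 e0; exists (Num.Def.archi_bound e^-1).
have := upper_nthrootP (leqnn (Num.Def.archi_bound e^-1)).
set n := Num.Def.archi_bound _ => hn.
apply: (@le_lt_trans _ _ (2^-1 ^+ n)); first by rewrite ler_pXn2r ?nnegrE.
by rewrite exprVn -[e]invrK ltf_pV2 ?posrE ?exprn_gt0 ?invr_gt0.
Qed.

(** If all Taylor coefficients vanish, the remainder bound tends to 0. Otherwise the first nonzero
    coefficient dominates the remainder, once [|h|] is below its modulus divided by [Q + 1]. *)
Lemma zero_dichotomy f z : hol_near f z -> zero_near f z \/
  exists2 d : R, 0 < d & forall w, cabs (w - z) < d -> w != z -> f w != 0.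
Proof.
move=> /hol_closed_disc[r [M [r0 M0 hf hM]]].
have T n := taylor n r0 hf hM.
have [H|/existsNP[k /eqP hk]] := pselect (forall k, tcoef f z r k = 0).
  left; exists (r / 2); first by rewrite divr_gt0.
  move=> w hw; apply/eqP; rewrite -cabs_eq0; apply/eqP.
  apply: (@eps_zero _ _ (4 * M)); first exact: cabs_ge0.
  move=> e e0; set h := w - z in hw.
  have x0 : 0 <= cabs h / r by rewrite divr_ge0 ?cabs_ge0 // ltW.
  have [|n hn] := expn_lt x0 _ e0; first by rewrite ler_pdivrMr // mulrC; exact: ltW.
  have := T n h (ltW hw); rewrite big1; last by move=> i _; rewrite H mul0r.
  rewrite subr0 addrC subrK => /le_trans; apply.
  rewrite -mulrA [_^-1 * _]mulrC -expr_div_n mulrC ler_wpM2r //; first lra.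
  exact: ltW.
right.
have [k0 k0n kmin] := @ex_minnP (fun k => tcoef f z r k != 0) (ex_intro _ k hk).
have A0 : 0 < cabs (tcoef f z r k0) by rewrite cabs_gt0.
set Q := 4 * M / r ^+ k0.+1.
have Q0 : 0 <= Q by rewrite /Q divr_ge0 ?exprn_ge0 ?mulr_ge0 // ltW.
have r2 : 0 < r / 2 by rewrite divr_gt0.
have AQ : 0 < cabs (tcoef f z r k0) / (Q + 1) by rewrite divr_gt0 //; lra.
have [d d0 hd] := min2_gt0 r2 AQ.
exists d => // w hw wz; set h := w - z in hw; have [k1 k2] := hd _ hw.
have h0 : 0 < cabs h by rewrite cabs_gt0 subr_eq0.
have := T k0.+1 h (ltW k1); rewrite big_ord_recr /= big1; last first.
  move=> i _; have -> : tcoef f z r i = 0; last by rewrite mul0r.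
  apply/eqP; apply/negP => /negP /kmin; rewrite leqNgt => /negP; apply; exact: ltn_ord.
have zh : z + h = w by rewrite /h addrC subrK.
rewrite add0r zh -/Q => H; apply/eqP => f0; move: H.
rewrite f0 sub0r cabsN cabsM cabsX exprS mulrA ler_pM2r ?exprn_gt0 // leNgt => /negP; apply.
move: k2; rewrite ltr_pdivlMr; last lra.
rewrite mulrDr mulr1 mulrC; lra.
Qed.

(** Connectedness of a segment in transport form: near each [t], the property passes between any two
    points. This replaces separate proofs that a set is open and closed. *)
Lemma interval_induction (P : R -> Prop) (a b : R) : a <= b -> P a ->
  (forall t, a <= t <= b -> exists2 d : R, 0 < d & forall s s', a <= s <= b -> a <= s' <= b ->
     `|s - t| < d -> `|s' - t| < d -> P s -> P s') ->
  P b.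
Proof.
move=> ab Pa H.
pose S := [set t | a <= t <= b /\ P t].
have Sa : S a by rewrite /S /= lexx.
have uS : has_ubound S by exists b => t [/andP[]].
set t0 := sup S.
have t0ab : a <= t0 <= b.
  apply/andP; split; first exact: ub_le_sup.
  by apply: ge_sup; [exists a|move=> t [/andP[]]].
have [d d0 hd] := H _ t0ab.
have [s [sab Ps] st] : exists2 s, S s & t0 - d < s.
  apply: sup_gt; first by exists a.
  by rewrite ltrBlDr ltrDl.
have st0 : s <= t0 by apply: ub_le_sup.
have K s' : a <= s' <= b -> `|s' - t0| < d -> P s'.
  move=> hs' hs't; apply: hd Ps => //; rewrite ltr_norml; lra.
have [tb|tb] := leP b (t0 + d / 2).
  apply: K; first by rewrite ab lexx.
  rewrite ltr_norml; lra.
have /andP[at0 _] := t0ab.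
have : S (t0 + d / 2).
  split; first lra.
  apply: K; first lra.
  by rewrite addrAC subrr add0r gtr0_norm ?divr_gt0 //; lra.
move=> /(ub_le_sup uS); rewrite -/t0; lra.
Qed.

(** Near each point of the segment [f] either vanishes identically or has at most that point as a
    zero; in the second case it vanishes near no neighboring point, so the transport there is
    vacuous. *)
Lemma identity_segment f p q :
  (forall t : R, 0 <= t <= 1 -> hol_near f (p + t%:C * (q - p))) ->
  zero_near f p -> zero_near f q.
Proof.
move=> H zp; pose P (t : R) := zero_near f (p + t%:C * (q - p)).
suff : P 1 by rewrite /P mul1r addrC subrK.
apply: (@interval_induction P 0 1) => //; first by rewrite /P mul0r addr0.
move=> t ht; set z := p + t%:C * (q - p).
have hz := H _ ht.
set m := cabs (q - p) + 1; have m0 : 0 < m by rewrite /m; have := cabs_ge0 (q - p); lra.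
have dist (s : R) (x : R) : 0 < x -> `|s - t| < x / m -> cabs (p + s%:C * (q - p) - z) < x.
  move=> x0; rewrite ltr_pdivlMr // => hs.
  have -> : p + s%:C * (q - p) - z = (s - t)%:C * (q - p) by rewrite /z rmorphB /=; ring.
  rewrite cabsM cabs_real; apply: le_lt_trans hs; apply: ler_wpM2l => //.
  by rewrite /m; lra.
have shrink w (x : R) : cabs (w - z) < x -> (forall v, cabs (v - z) < x -> f v = 0) -> zero_near f w.
  move=> hw hx; exists (x - cabs (w - z)); first by rewrite subr_gt0.
  move=> v hv; apply: hx; have -> : v - z = (v - w) + (w - z) by ring.
  by apply: le_lt_trans (cabsD _ _) _; lra.
have [[d d0 hd]|[d d0 hd]] := zero_dichotomy hz.
  exists (d / m); first by rewrite divr_gt0.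
  move=> s s' _ _ _ hs' _; apply: shrink hd; exact: dist.
exists (d / m); first by rewrite divr_gt0.
move=> s s' _ _ /(dist _ _ d0) hs _ [e e0 he]; exfalso.
set w := p + s%:C * (q - p) in hs he.
have dw : 0 < d - cabs (w - z) by rewrite subr_gt0.
have [x x0 hx] := min2_gt0 e0 dw.
have hx2 : 0 < x / 2 by rewrite divr_gt0.
have [|y1 y2] := hx (x / 2); first lra.
have nz v : v != z -> cabs (v - w) < e -> cabs (v - w) < d - cabs (w - z) -> False.
  move=> vz v1 v2; have := he _ v1; apply/eqP; apply: hd => //.
  have -> : v - z = (v - w) + (w - z) by ring.
  by apply: le_lt_trans (cabsD _ _) _; lra.
have [wz|wz] := eqVneq w z.
  apply: (nz (w + (x / 2)%:C)); rewrite ?[w + _ - w]addrAC ?subrr ?add0r ?cabs_pos ?(ltW hx2) //.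
  rewrite wz -subr_eq0 addrAC subrr add0r (inj_eq (@complexI R)) gt_eqF //.
by apply: (nz w) => //; rewrite subrr cabs0 //.
Qed.

End Taylor.

(** * Removable singularities, local openness and the residue theorem *)

Section Residues.
Variable R : realType.
Local Notation C := R[i].
Local Notation ii := (imag_unit R).
Implicit Types (f g A B : C -> C) (a c z w h l : C) (r M : R).

Lemma cderiv_uniq f z l m : cderiv f z l -> cderiv f z m -> l = m.
Proof.
move=> /cderivP hl /cderivP hm; apply/eqP; rewrite -subr_eq0 -cabs_eq0; apply/eqP.
apply: (@eps_zero _ _ 2); first exact: cabs_ge0.
move=> e e0; have [d1 d10 h1] := hl _ e0; have [d2 d20 h2] := hm _ e0.
have [d d0 hd] := min2_gt0 d10 d20; have d2' : 0 < d / 2 by rewrite divr_gt0.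
have [|k1 k2] := hd (d / 2); first lra.
set h : C := (d / 2)%:C; have hh : cabs h = d / 2 by rewrite cabs_pos // ltW.
have zh : z + h - z = h by ring.
have := h1 (z + h); have := h2 (z + h); rewrite zh hh => /(_ k2) a2 /(_ k1) a1.
rewrite -(ler_pM2r d2') -{1}hh -cabsM.
have -> : (l - m) * h = (f (z + h) - f z - m * h) - (f (z + h) - f z - l * h) by ring.
apply: le_trans (cabsB _ _) _; lra.
Qed.

Lemma taylor_order2 f c r M : 0 < r -> (forall w, cabs (w - c) <= r -> hol f w) ->
  (forall w, cabs (w - c) = r -> cabs (f w) <= M) -> forall h, cabs h <= r / 2 ->
  cabs (f (c + h) - f c - tcoef f c r 1 * h) <= 4 * M / r ^+ 2 * cabs h ^+ 2.
Proof.
move=> r0 hf hM h hr.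
have e0 : tcoef f c r 0 = f c.
  have := taylor 1 r0 hf hM (h := 0); rewrite cabs0 => /(_ _).
  rewrite big_ord_recr big_ord0 /= addr0 add0r expr0 mulr1 expr1 mulr0 => H.
  have {}H : cabs (f c - tcoef f c r 0) <= 0 by apply: H; rewrite divr_ge0 // ltW.
  apply/eqP; rewrite eq_sym -subr_eq0 -cabs_eq0 eq_le H; exact: cabs_ge0.
have := taylor 2 r0 hf hM hr.
by rewrite big_ord_recr big_ord_recr big_ord0 /= add0r e0 expr0 mulr1 expr1 opprD addrA.
Qed.

Lemma order2_cderiv f c l (r K : R) : 0 < r -> 0 <= K ->
  (forall h, cabs h <= r -> cabs (f (c + h) - f c - l * h) <= K * cabs h ^+ 2) ->
  cderiv f c l.
Proof.
move=> r0 K0 H; apply/cderivP => e e0.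
have eK : 0 < e / (K + 1) by rewrite divr_gt0 //; lra.
have [d d0 hd] := min2_gt0 r0 eK; exists d => // w /hd[k1 k2].
have := H (w - c) (ltW k1); rewrite [c + (_ - c)]addrC subrK => /le_trans; apply.
rewrite expr2 mulrA ler_wpM2r ?cabs_ge0 //.
have : K * cabs (w - c) <= K * (e / (K + 1)) by rewrite ler_wpM2l // ltW.
move=> /le_trans; apply; rewrite mulrA ler_pdivrMr; lra.
Qed.

Lemma cauchy_const_ge0 M r n : 0 <= M -> 0 < r -> 0 <= 4 * M / r ^+ n.
Proof. by move=> M0 /ltW r0; apply: divr_ge0; [exact: mulr_ge0|exact: exprn_ge0]. Qed.

(** The removable singularity theorem for a simple factor. At [c] the derivative of the quotient is
    the second Taylor coefficient of [f], by the third-order Taylor bound divided by [h]. *)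
Lemma div_root f c l : f c = 0 -> cderiv f c l ->
  exists g, [/\ forall w, f w = (w - c) * g w, g c = l &
    forall z, hol_near f z -> hol_near g z].
Proof.
move=> fc fl; exists (fun w => if w == c then l else f w / (w - c)); split.
- move=> w; case: eqP => [->|/eqP wc]; first by rewrite fc subrr mul0r.
  by rewrite mulrC divfK // subr_eq0.
- by rewrite eqxx.
move=> z hz; have K w : w != c -> hol f w -> hol (fun w => if w == c then l else f w / (w - c)) w.
  move=> wc hw; apply: (@near_hol _ (fun w => f w / (w - c)) _ _ (cabs (w - c))).
  - by rewrite cabs_gt0 subr_eq0.
  - move=> v; case: eqP => // ->; by rewrite cabs_sub ltxx.
  - by apply: hol_div; [rewrite subr_eq0| |exact: holB].
have Kc : hol_near f c -> hol (fun w => if w == c then l else f w / (w - c)) c.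
  move=> /hol_closed_disc[r [M [r0 M0 hf hM]]].
  have l1 : l = tcoef f c r 1.
    apply: (cderiv_uniq fl); apply: (@order2_cderiv _ _ _ (r / 2) (4 * M / r ^+ 2)).
    - by rewrite divr_gt0.
    - exact: cauchy_const_ge0.
    - exact: taylor_order2.
  have e0 : tcoef f c r 0 = 0.
    have := taylor 1 r0 hf hM (h := 0); rewrite cabs0 => /(_ _).
    rewrite big_ord_recr big_ord0 /= addr0 add0r expr0 mulr1 expr1 mulr0 fc sub0r cabsN => H.
    have {}H : cabs (tcoef f c r 0) <= 0 by apply: H; rewrite divr_ge0 // ltW.
    apply/eqP; rewrite -cabs_eq0 eq_le H; exact: cabs_ge0.
  exists (tcoef f c r 2); apply: (@order2_cderiv _ _ _ (r / 2) (4 * M / r ^+ 3)).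
  - by rewrite divr_gt0.
  - exact: cauchy_const_ge0.
  move=> h hr; rewrite eqxx; have [->|h0] := eqVneq h 0.
    by rewrite addr0 eqxx subrr mulr0 subrr cabs0 expr0n mulr0.
  have -> : (c + h == c) = false by apply/negbTE; rewrite -subr_eq0 addrAC subrr add0r.
  have -> : c + h - c = h by ring.
  have := taylor 3 r0 hf hM hr.
  rewrite big_ord_recr big_ord_recr big_ord_recr big_ord0 /= add0r e0 mul0r add0r expr1 -l1.
  have -> : f (c + h) / h - l - tcoef f c r 2 * h =
     (f (c + h) - (l * h + tcoef f c r 2 * h ^+ 2)) / h by field.
  by move=> Hh; rewrite cabsM cabsV ler_pdivrMr ?cabs_gt0 // -[leRHS]mulrA -exprSr.
have [zc|zc] := eqVneq z c; last first.
  have [d d0 hd] := hz; have zc0 : 0 < cabs (z - c) by rewrite cabs_gt0 subr_eq0.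
  have [x x0 hx] := min2_gt0 d0 zc0; exists x => // w /hx[k1 k2]; apply: K; last exact: hd.
  by apply/eqP => wc; move: k2; rewrite wc cabs_sub ltxx.
have [d d0 hd] := hz; exists d => // w hw.
have [->|wc] := eqVneq w c; last by apply: K => //; exact: hd.
by apply: Kc; rewrite -zc.
Qed.

(** If [w] were missed, [1 / (g - w)] would be holomorphic on the disc and its value at the center
    would be controlled by its values on the circle, although [g z] is closer to [w] than the circle
    allows. *)
Lemma local_open g z l : hol_near g z -> cderiv g z l -> l != 0 ->
  forall r, 0 < r -> exists2 d : R, 0 < d &
    forall w, cabs (w - g z) < d -> exists2 t, cabs (t - z) < r & g t = w.
Proof.
move=> [d1 d10 h1] /cderivP hl l0 r r0; have L0 : 0 < cabs l by rewrite cabs_gt0.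
have [|d2 d20 h2] := hl (cabs l / 2); first by rewrite divr_gt0.
have [d3 d30 h3] := min2_gt0 d10 d20; have [d4 d40 h4] := min2_gt0 d30 r0.
set x := d4 / 2; have x0 : 0 < x by rewrite divr_gt0.
have xd : x < d4 by rewrite /x; lra.
have far w : cabs (w - z) <= x -> cabs l / 2 * cabs (w - z) <= cabs (g w - g z).
  move=> hw; have [/h3[k1 k2] k3] := h4 _ (le_lt_trans hw xd).
  have := h2 _ k2; have := ler_cabs_dist (l * (w - z)) (g w - g z).
  rewrite (cabs_sub (l * (w - z))) cabsM; lra.
(* On the circle [|g - g z|] is at least [4 * dl], so [|g - w|] is at least [3 * dl]. The Cauchy
   estimate with its factor 2 gives [1 / |g z - w| <= 2 / (3 * dl)], against [|w - g z| < dl]. *)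
set dl := cabs l * x / 8; have dl0 : 0 < dl by rewrite /dl divr_gt0 // mulr_gt0.
exists dl => // w hw; apply/not_exists2P => N.
have nz t : cabs (t - z) <= x -> g t - w != 0.
  move=> ht; apply/eqP => /eqP; rewrite subr_eq0 => /eqP E.
  have [[]|] := N t => //; have [_ k3] := h4 _ (le_lt_trans ht xd).
  by [].
pose k t := (g t - w)^-1.
have hk t : cabs (t - z) <= x -> hol k t.
  move=> ht; have [/h3[k1 _] _] := h4 _ (le_lt_trans ht xd).
  by apply: holV; [exact: nz|apply: holB => //; exact: h1].
have zz : cabs (z - z) < x by rewrite subrr cabs0.
have := cauchy_formula hk zz.
have x0' := ltW x0.
have bd : cabs (circ z x%:C (fun w => k w / (w - z))) <= 2 * (((3 * dl)^-1 / x) * x) * (2 * pi).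
  apply: circ_le => //.
    move=> t _; apply: hol_ccont; apply: hol_div.
    - by rewrite -cabs_gt0 dist_circ.
    - by apply: hk; rewrite dist_circ.
    - exact: holB.
  move=> t ht; rewrite cabsM cabsV ht ler_wpM2r ?invr_ge0 // /k cabsV.
  rewrite lef_pV2 ?posrE ?cabs_gt0 ?nz ?ht ?mulr_gt0 //.
  have -> : g t - w = (g t - g z) - (w - g z) by ring.
  apply: le_trans (ler_cabs_dist _ _); have := far t; rewrite ht => /(_ (lexx _)).
  by rewrite /dl in hw *; lra.
move=> E; move: bd; rewrite E !cabsM cabs_i mulr1 cabs_pos ?pi2_ge0 // divfK ?gt_eqF //.
rewrite mulrC ler_pM2r ?pi2_gt0 // /k cabsV.
have gz0 : 0 < cabs (g z - w) by rewrite cabs_gt0; apply: nz; rewrite subrr cabs0.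
have : (dl)^-1 < (cabs (g z - w))^-1 by rewrite ltf_pV2 ?posrE // cabs_sub.
have : 0 < dl^-1 by rewrite invr_gt0.
have -> : (3 * dl)^-1 = dl^-1 / 3 by field; rewrite gt_eqF.
lra.
Qed.

Lemma circ_pole_in p : cabs p < 1 -> circ 0 1%:C (fun w => (w - p)^-1) = (2 * pi)%:C * ii.
Proof.
move=> p1; have := @cauchy_formula R (fun=> 1) 0 1 p (fun _ _ => hol_cst _ _).
rewrite subr0 mulr1 => /(_ p1) <-; apply: circ_congr => // w _; by rewrite mul1r.
Qed.

Lemma circ_pole_out p r : 0 <= r -> r < cabs p -> circ 0 r%:C (fun w => (w - p)^-1) = 0.
Proof.
move=> r0 rp; rewrite -(@circ_homotopy R 0 0 0%:C r%:C).
  rewrite /circ (@cint_congr _ _ (fun t => 0 * 1)); last first.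
    by move=> t _; rewrite (_ : 0%:C = 0 :> C) // (mul0r (ii * _)) mulr0 mul0r.
  by rewrite cintZ ?mul0r // => t _; exact: ccont_cst.
move=> s t /andP[s0 s1] _; apply: holV; last exact: holB.
rewrite subrr mulr0 !add0r subr0 -cabs_gt0 cabs_sub; apply: lt_le_trans (ler_cabs_dist _ _).
rewrite !cabsM cabs_cis mulr1 !cabs_pos // subr_gt0; apply: le_lt_trans rp.
by rewrite ler_piMl.
Qed.

(** Induction on the poles. With [B = (w - p) * B1] and [c] the residue at [p], the function
    [A - c * B1] vanishes at [p], so [A / B = c / (w - p) + N1 / B1] and one zero of the denominator
    is gone. *)
Lemma residue_annulus r (s : seq C) A B (d : C -> C) : 0 < r -> r < 1 -> uniq s ->
  (forall w, r <= cabs w <= 1 -> hol_near A w) ->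
  (forall w, r <= cabs w <= 1 -> hol_near B w) ->
  (forall p, p \in s -> [/\ r < cabs p, cabs p < 1, B p = 0, cderiv B p (d p) & d p != 0]) ->
  (forall w, r <= cabs w <= 1 -> B w = 0 -> w \in s) ->
  circ 0 1%:C (fun w => A w / B w) - circ 0 r%:C (fun w => A w / B w) =
  (2 * pi)%:C * ii * \sum_(p <- s) A p / d p.
Proof.
move=> r0 r1; have r0' := ltW r0.
elim: s A B d => [|p s IH] A B d us hA hB hs hz.
  rewrite big_nil mulr0 (@circ_homotopy R 0 0 r%:C 1%:C) ?subrr //.
  move=> x t /andP[x0 x1] _; rewrite mulr0 !add0r.
  set w := _ * _.
  have xr : 0 <= x * (1 - r) by rewrite mulr_ge0 // subr_ge0 ltW.
  have cw : cabs w = r + x * (1 - r).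
    rewrite /w cabsM cabs_cis mulr1.
    have -> : r%:C + x%:C * (1 - r%:C) = (r + x * (1 - r))%:C.
      by rewrite rmorphD rmorphM rmorphB.
    by rewrite cabs_pos // addr_ge0.
  have hw : r <= cabs w <= 1.
    rewrite cw; have : x * (1 - r) <= 1 * (1 - r) by rewrite ler_wpM2r // subr_ge0 ltW.
    lra.
  apply: hol_div; [|exact/hol_near_hol/hA|exact/hol_near_hol/hB].
  by apply/eqP => /(hz _ hw).
move: us => /= /andP[ps us].
have [pr p1 Bp dB dp] := hs p (mem_head _ _).
have hp : r <= cabs p <= 1 by rewrite !ltW.
have [B1 [EB B1p hB1]] := div_root Bp dB.
set c := A p / d p; pose N w := A w - c * B1 w.
have Np : N p = 0 by rewrite /N B1p /c divfK // subrr.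
have hN w : r <= cabs w <= 1 -> hol_near N w.
  move=> hw; apply: holnB; first exact: hA.
  by apply: holnM; [exact: holn_all|apply: hB1; exact: hB].
have [lN hlN] := hol_near_hol (hN _ hp).
have [N1 [EN _ hN1]] := div_root Np hlN.
have B1z w : r <= cabs w <= 1 -> B1 w = 0 -> w \in s.
  move=> hw Bw; have : w \in p :: s by apply: hz => //; rewrite EB Bw mulr0.
  rewrite inE => /predU1P[wp|//]; move: dp; by rewrite -B1p -wp Bw eqxx.
(* The derivative of [B / (w - p)] at another zero [q] of [B]. *)
pose d1 q := d q / (q - p).
have hs1 q : q \in s -> [/\ r < cabs q, cabs q < 1, B1 q = 0, cderiv B1 q (d1 q) & d1 q != 0].
  move=> qs; have qps : q \in p :: s by rewrite inE qs orbT.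
  have [qr q1 Bq dBq dq] := hs _ qps.
  have qp : q - p != 0 by rewrite subr_eq0; apply: contraNneq ps => <-.
  split=> //; last by rewrite /d1 mulf_neq0 ?invr_eq0.
    by move/eqP: Bq; rewrite EB mulf_eq0 (negbTE qp) => /eqP.
  have h : cderiv (fun w => B w / (w - p)) q (d q / (q - p) + B q * (- ((q - p) ^- 2) * 1)).
    apply: cderivM => //; apply: (@cderiv_comp _ (fun w => w - p)); last exact: cderivV.
    by have := cderivD (cderiv_id q) (cderiv_cst (- p) q); rewrite addr0.
  rewrite Bq mul0r addr0 in h; apply: (near_cderiv (d := cabs (q - p)) _ _ h).
    by rewrite cabs_gt0.
  move=> w hw; rewrite EB mulrAC mulfV ?mul1r // subr_eq0.
  by apply: contraTneq hw => ->; rewrite cabs_sub ltxx.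
have := IH N1 B1 d1 us _ _ hs1 B1z.
move=> /(_ (fun w hw => hN1 _ (hN _ hw))) /(_ (fun w hw => hB1 _ (hB _ hw))) IH1.
have Bnz w : cabs w = r \/ cabs w = 1 -> w - p != 0 /\ B1 w != 0.
  move=> hw; have hw' : r <= cabs w <= 1 by case: hw => ->; rewrite ?lexx ?(ltW r1).
  split; first by rewrite subr_eq0; apply/eqP => wp; move: pr p1; rewrite -wp; case: hw => ->; rewrite ltxx.
  apply/eqP => /(B1z _ hw') /hs1[]; by case: hw => ->; rewrite ltxx.
have dec w : cabs w = r \/ cabs w = 1 -> A w / B w = c * (w - p)^-1 + N1 w / B1 w.
  move=> hw; have [n1 n2] := Bnz _ hw.
  have -> : N1 w = (A w - c * B1 w) / (w - p) by rewrite -/(N w) EN mulrAC divff ?mul1r.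
  by rewrite EB; field; rewrite n1 n2.
have on (x : R) (t : R) : 0 <= x -> cabs (0 + x%:C * cis t%:C : C) = x.
  by move=> x0; rewrite add0r cabsM cabs_cis mulr1 cabs_pos.
have eqc (x : R) : x = r \/ x = 1 -> circ 0 x%:C (fun w => A w / B w) =
    c * circ 0 x%:C (fun w => (w - p)^-1) + circ 0 x%:C (fun w => N1 w / B1 w).
  move=> hx; have x0 : 0 <= x by case: hx => ->.
  have hx' (t : R) : cabs (0 + x%:C * cis t%:C : C) = r \/ cabs (0 + x%:C * cis t%:C : C) = 1.
    by rewrite on.
  have hc (t : R) : ccont (fun w => (w - p)^-1) (0 + x%:C * cis t%:C).
    by have [n1 _] := Bnz _ (hx' t); apply: hol_ccont; apply: holV => //; exact: holB.
  rewrite -circZ // -circD; first last.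
  - move=> t; have [_ n2] := Bnz _ (hx' t); apply: hol_ccont.
    have hw' : r <= cabs (0 + x%:C * cis t%:C : C) <= 1.
      by case: (hx' t) => ->; rewrite ?lexx ?(ltW r1).
    by apply: hol_div => //; apply: hol_near_hol; [exact/hN1/hN|exact/hB1/hB].
  - by move=> t; apply: ccontM => //; exact: ccont_cst.
  by apply: circ_congr => // w; rewrite subr0 => hw; apply: dec; rewrite hw.
rewrite (eqc 1 (or_intror erefl)) (eqc r (or_introl erefl)) circ_pole_in // circ_pole_out // mulr0 add0r.
rewrite -addrA IH1 big_cons [RHS]mulrDr -/c; congr (_ + _); first exact: mulrC.
congr (_ * _).
apply: eq_big_seq => q qs; have qps : q \in p :: s by rewrite inE qs orbT.
have [qr q1 Bq _ dq] := hs _ qps; have [_ _ B1q _ _] := hs1 _ qs.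
have qp : q - p != 0 by rewrite subr_eq0; apply: contraNneq ps => <-.
have : (q - p) * N1 q = A q by rewrite -EN /N B1q mulr0 subr0.
move=> <-; rewrite /d1; by field; rewrite dq qp.
Qed.

End Residues.

(** * Holomorphic dependence on parameters *)

Section ParametricIntegrals.
Variable R : realType.
Local Notation C := R[i].
Implicit Types (f g a b : C -> C) (z w h s : C) (r M K : R).

(** Completeness without sequences: for the real and imaginary parts, the limit is the supremum of
    the lower bounds [u h - K * cabs h]. *)
Lemma cauchy_limit (q : C -> C) (P : C -> Prop) K : (exists h, P h) ->
  (forall h h', P h -> P h' -> cabs (q h - q h') <= K * (cabs h + cabs h')) ->
  exists l, forall h, P h -> cabs (q h - l) <= 2 * K * cabs h.
Proof.
move=> [h0 Ph0] H.
have aux (u : C -> R) : (forall h h', P h -> P h' -> `|u h - u h'| <= K * (cabs h + cabs h')) ->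
    exists l, forall h, P h -> `|u h - l| <= K * cabs h.
  move=> Hu; pose S := [set u h - K * cabs h | h in [set h | P h]].
  have ubS h : P h -> forall x, S x -> x <= u h + K * cabs h.
    move=> Ph _ [h' Ph' <-]; have := Hu _ _ Ph' Ph; rewrite ler_norml mulrDr; lra.
  exists (sup S) => h Ph; rewrite ler_norml.
  have h1 : u h - K * cabs h <= sup S.
    by apply: ub_le_sup; [exists (u h0 + K * cabs h0); exact: ubS|exists h].
  have h2 : sup S <= u h + K * cabs h.
    by apply: ge_sup; [exists (u h0 - K * cabs h0); exists h0|exact: ubS].
  lra.
have [|l1 hl1] := aux (fun h => complex.Re (q h)).
  by move=> h h' Ph Ph'; apply: le_trans (H _ _ Ph Ph'); rewrite -cReN -cReD Re_le_cabs.
have [|l2 hl2] := aux (fun h => complex.Im (q h)).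
  by move=> h h' Ph Ph'; apply: le_trans (H _ _ Ph Ph'); rewrite -cImN -cImD Im_le_cabs.
exists (l1 +i* l2) => h Ph; apply: le_trans (cabs_le_ReIm _) _.
rewrite !ReImE /=; have := hl1 _ Ph; have := hl2 _ Ph; lra.
Qed.

Lemma diff_quotient_le f z r M h : 0 < r -> (forall w, cabs (w - z) <= r -> hol f w) ->
  (forall w, cabs (w - z) = r -> cabs (f w) <= M) -> cabs h <= r / 2 -> h != 0 ->
  cabs ((f (z + h) - f z) / h - tcoef f z r 1) <= 4 * M / r ^+ 2 * cabs h.
Proof.
move=> r0 hf hM hr h0; have := taylor_order2 r0 hf hM hr.
have -> : (f (z + h) - f z) / h - tcoef f z r 1 = (f (z + h) - f z - tcoef f z r 1 * h) / h.
  by field.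
by move=> Hh; rewrite cabsM cabsV ler_pdivrMr ?cabs_gt0 // -[leRHS]mulrA -expr2.
Qed.

(** By the Cauchy estimates, the difference quotients lie within [K * cabs h] of their limit
    uniformly in [t], so their integrals form a Cauchy family. The derivative of the integrand
    itself is never integrated. *)
Lemma param_integral d (T : measurableType d) (mu : {measure set T -> \bar R})
    (D : set T) (G : C -> T -> C) z r M :
  measurable D -> (mu D < +oo)%E -> 0 < r -> 0 <= M ->
  (forall t w, D t -> cabs (w - z) <= r -> hol (G^~ t) w) ->
  (forall t w, D t -> cabs (w - z) <= r -> cabs (G w t) <= M) ->
  (forall w, cabs (w - z) <= r -> cintble mu D (G w)) ->
  hol (fun w => Cintegral mu D (G w)) z.
Proof.
move=> mD muD r0 M0 hG hM iG.
set K := 4 * M / r ^+ 2; have K0 : 0 <= K by exact: cauchy_const_ge0.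
set m := fine (mu D); have m0 : 0 <= m by exact: fine_ge0.
pose P h := cabs h <= r / 2 /\ h != 0.
pose I w := Cintegral mu D (G w).
have zr h : P h -> cabs (z + h - z) <= r by move=> [hr _]; rewrite addrAC subrr add0r; lra.
have z0 : cabs (z - z) <= r by rewrite subrr cabs0 ltW.
pose q h t := h^-1 * (G (z + h) t - G z t).
have iq h : P h -> cintble mu D (q h).
  move=> Ph; apply: cintbleZ => //; apply: cintbleD => //; first exact/iG/zr.
  by apply: cintbleN => //; exact: iG.
have qd h t : P h -> D t -> cabs (q h t - tcoef (G^~ t) z r 1) <= K * cabs h.
  move=> [hr h0] Dt; rewrite /q mulrC; apply: diff_quotient_le => //.
  - by move=> w; exact: hG.
  - by move=> w hw; apply: hM => //; rewrite hw.
have IQ h : P h -> (I (z + h) - I z) / h = Cintegral mu D (q h).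
  move=> Ph; rewrite /q CintegralZ //; last first.
    by apply: cintbleD => //; [exact/iG/zr|apply: cintbleN => //; exact: iG].
  by rewrite CintegralB //; [rewrite mulrC|exact/iG/zr|exact: iG].
have [|h h' Ph Ph'|l hl] := @cauchy_limit (fun h => (I (z + h) - I z) / h) P (2 * K * m).
- exists (r / 2)%:C; split; first by rewrite cabs_pos // ltW // divr_gt0.
  by rewrite (inj_eq (@complexI R)) gt_eqF // divr_gt0.
- rewrite !IQ // -CintegralB //; try exact: iq.
  have -> : 2 * K * m * (cabs h + cabs h') = 2 * (K * (cabs h + cabs h')) * m by ring.
  apply: Cintegral_le => //; first by apply: cintbleD => //; [exact: iq|apply: cintbleN => //; exact: iq].
  move=> t Dt; have -> : q h t - q h' t =
    (q h t - tcoef (G^~ t) z r 1) - (q h' t - tcoef (G^~ t) z r 1) by ring.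
  by apply: le_trans (cabsB _ _) _; rewrite mulrDr lerD // qd.
exists l; apply: (@order2_cderiv _ _ _ _ (r / 2) (2 * (2 * K * m))).
- by rewrite divr_gt0.
- by do 3 apply: mulr_ge0 => //.
move=> h hr; have [->|h0] := eqVneq h 0.
  by rewrite addr0 subrr mulr0 subrr cabs0 expr0n mulr0.
have := hl h (conj hr h0); rewrite -/(I _).
have -> : (I (z + h) - I z) / h - l = (I (z + h) - I z - l * h) / h by field.
by move=> Hh; rewrite expr2 [leRHS]mulrA -ler_pdivrMr ?cabs_gt0 // -cabsV -cabsM.
Qed.

Definition jcont (F : C -> C -> C) s1 s2 := forall e : R, 0 < e -> exists2 d : R, 0 < d &
  forall w1 w2, cabs (w1 - s1) < d -> cabs (w2 - s2) < d -> cabs (F w1 w2 - F s1 s2) < e.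

(** The increment is split into a step in the first variable and one in the second. The second is a
    composition; the first needs the slope [p], completed at [x = s1] by the partial derivative
    [c1], to be jointly continuous at the point. *)
Lemma osgood (F : C -> C -> C) a b z : (forall s1 s2, jcont F s1 s2) ->
  (forall s1 s2, hol (F^~ s2) s1) -> (forall s1 s2, hol (F s1) s2) ->
  hol a z -> hol b z -> hol (fun w => F (a w) (b w)) z.
Proof.
move=> cF h1 h2 ha hb; set s1 := a z; set s2 := b z.
have [d d0 hd] := cF s1 s2 _ ltr01.
set r := d / 2; have r0 : 0 < r by rewrite divr_gt0.
have rd : r < d by rewrite /r; lra.
set M := cabs (F s1 s2) + 1.
have M0 : 0 <= M by rewrite addr_ge0 ?cabs_ge0.
have hM y : cabs (y - s2) < d -> forall x, cabs (x - s1) = r -> cabs (F x y) <= M.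
  move=> hy x hx; have := hd x y; rewrite hx => /(_ rd hy).
  have := cabsD (F x y - F s1 s2) (F s1 s2); rewrite subrK /M; lra.
set K := 4 * M / r ^+ 2; have K0 : 0 <= K by exact: cauchy_const_ge0.
pose c1 y := tcoef (F^~ y) s1 r 1.
have dq y h : cabs (y - s2) < d -> cabs h <= r / 2 -> h != 0 ->
    cabs ((F (s1 + h) y - F s1 y) / h - c1 y) <= K * cabs h.
  by move=> hy hr h0; apply: (@diff_quotient_le (F^~ y)) => //; exact: hM.
pose p x y := if x == s1 then c1 y else (F x y - F s1 y) / (x - s1).
have pd x y : cabs (y - s2) < d -> cabs (x - s1) <= r / 2 -> cabs (p x y - c1 y) <= K * cabs (x - s1).
  move=> hy hx; rewrite /p; case: eqP => [->|/eqP xs]; first by rewrite !subrr cabs0 mulr0.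
  have := @dq y (x - s1) hy hx; rewrite [s1 + _]addrC subrK subr_eq0; exact.
have pc (e : R) : 0 < e -> exists2 d' : R, 0 < d' & forall x y, cabs (x - s1) < d' -> cabs (y - s2) < d' ->
    cabs (p x y - c1 s2) < e.
  move=> e0; have ek : 0 < e / (4 * (K + 1)) by rewrite divr_gt0 // mulr_gt0 //; lra.
  have r2 : 0 < r / 2 by rewrite divr_gt0.
  have [x0 x00 hx0] := min2_gt0 ek r2.
  set eta := x0 / 2; have eta0 : 0 < eta by rewrite divr_gt0.
  have [e1 e2] : eta < e / (4 * (K + 1)) /\ eta < r / 2 by apply: hx0; rewrite /eta; lra.
  have Ke : K * eta < e / 4.
    have : eta * (K + 1) < e / 4 by move: e1; rewrite invfM mulrA ltr_pdivlMr //; lra.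
    lra.
  (* At the fixed abscissa [x1] the slope is continuous in [y]. The comparison runs from [p x y] to
     [c1 y], [p x1 y], [p x1 s2] and [c1 s2]; the outer steps are uniform by the Cauchy estimate. *)
  set x1 := s1 + eta%:C.
  have x1s : x1 - s1 = eta%:C by rewrite /x1 addrAC subrr add0r.
  have hcont : ccont (fun y => (F x1 y - F s1 y) / (x1 - s1)) s2.
    by apply: hol_ccont; apply: holM => //; apply: holB.
  have [d1 d10 hd1] := hcont _ (divr_gt0 e0 (ltr0Sn R 3)).
  have [d2 d20 hd2] := min2_gt0 d10 d0.
  have [d3 d30 hd3] := min2_gt0 d20 eta0.
  exists d3 => // x y /hd3[_ hx] /hd3[/hd2[y1 y2] _].
  have x1n : (x1 == s1) = false.
    by rewrite -subr_eq0 x1s (inj_eq (@complexI R)) gt_eqF.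
  have q1 : cabs (p x y - c1 y) <= K * eta.
    apply: le_trans (pd _ _ _ _) _ => //; first by lra.
    by apply: ler_wpM2l => //; exact: ltW.
  have q2 y' : cabs (y' - s2) < d -> cabs (p x1 y' - c1 y') <= K * eta.
    move=> hy'; have := pd x1 y' hy'; rewrite x1s cabs_pos ?(ltW eta0) //; apply; exact: ltW.
  have := hd1 _ y1; have := q2 y y2; have := q2 s2; rewrite subrr cabs0 => /(_ d0).
  rewrite /p x1n -/(p x y) => a1 a2 a3.
  set u1 := (F x1 s2 - F s1 s2) / _ in a1 a3; set u2 := (F x1 y - F s1 y) / _ in a2 a3.
  have -> : p x y - c1 s2 = (p x y - c1 y) - (u2 - c1 y) + (u2 - u1) + (u1 - c1 s2) by ring.
  have t1 := cabsD ((p x y - c1 y) - (u2 - c1 y) + (u2 - u1)) (u1 - c1 s2).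
  have t2 := cabsD ((p x y - c1 y) - (u2 - c1 y)) (u2 - u1).
  have t3 := cabsB (p x y - c1 y) (u2 - c1 y).
  lra.
have hol2 : hol (fun w => F s1 (b w)) z by apply: (hol_comp hb); exact: h2.
have hol1 : hol (fun w => F (a w) (b w) - F s1 (b w)) z.
  have [la [qa [cqa _ hqa]]] := ha.
  exists (p s1 s2 * qa z); exists (fun w => p (a w) (b w) * qa w); split=> //.
    apply: ccontM => // e /pc[d' d'0 hd'].
    have [d1 d10 hd1] := hol_ccont ha d'0; have [d2 d20 hd2] := hol_ccont hb d'0.
    have [d3 d30 hd3] := min2_gt0 d10 d20; exists d3 => // w /hd3[/hd1 k1 /hd2 k2].
    have -> : p (a z) (b z) = c1 s2 by rewrite /p -/s1 eqxx.
    exact: hd'.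
  move=> w; rewrite -/s1 -/s2 !subrr subr0 -mulrA -hqa -/s1 /p.
  case: eqP => [->|/eqP xs]; first by rewrite !subrr mulr0.
  by rewrite divfK // subr_eq0.
apply: (@near_hol _ (fun w => (F (a w) (b w) - F s1 (b w)) + F s1 (b w)) _ _ 1) => //.
  by move=> w _; rewrite subrK.
exact: holD.
Qed.

End ParametricIntegrals.

(** * Parity of the multiplicity of beta/2 *)

Section MatrixExp.
Variables (R : realType) (n : nat).
Local Notation M := 'M[R]_n.+1.
Implicit Types (X Y A L : M).

(** The entrywise sum norm is submultiplicative and invariant under transposition, and it dominates
    each entry. *)
Definition nrm X : R := \sum_i \sum_j `|X i j|.

Lemma nrm_ge0 X : 0 <= nrm X.
Proof. by apply: sumr_ge0 => i _; apply: sumr_ge0. Qed.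

Lemma le_nrm X i j : `|X i j| <= nrm X.
Proof.
rewrite /nrm (bigD1 i) //= (bigD1 j) //= -addrA lerDl addr_ge0 //; apply: sumr_ge0 => //.
by move=> k _; apply: sumr_ge0.
Qed.

Lemma nrmD X Y : nrm (X + Y) <= nrm X + nrm Y.
Proof.
rewrite /nrm -big_split /=; apply: ler_sum => i _; rewrite -big_split /=.
by apply: ler_sum => j _; rewrite mxE ler_normD.
Qed.

Lemma nrmZ a X : nrm (a *: X) = `|a| * nrm X.
Proof.
rewrite /nrm mulr_sumr; apply: eq_bigr => i _; rewrite mulr_sumr.
by apply: eq_bigr => j _; rewrite mxE normrM.
Qed.

Lemma nrmN X : nrm (- X) = nrm X.
Proof. by rewrite -scaleN1r nrmZ normrN normr1 mul1r. Qed.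

Lemma nrmB X Y : nrm (X - Y) <= nrm X + nrm Y.
Proof. by rewrite -(nrmN Y) nrmD. Qed.

Lemma nrm0 : nrm 0 = 0.
Proof. by rewrite -(scale0r 0) nrmZ normr0 mul0r. Qed.

Lemma nrm_sum (I : Type) (s : seq I) (F : I -> M) :
  nrm (\sum_(i <- s) F i) <= \sum_(i <- s) nrm (F i).
Proof.
elim: s => [|i s IH]; first by rewrite !big_nil nrm0.
by rewrite !big_cons; apply: le_trans (nrmD _ _) _; apply: lerD.
Qed.

Lemma nrm_eq0 X : nrm X = 0 -> X = 0.
Proof.
move=> X0; apply/matrixP => i j; rewrite mxE; apply/eqP.
by rewrite -normr_eq0 eq_le normr_ge0 andbT -X0 le_nrm.
Qed.

Lemma nrm_tr X : nrm X^T = nrm X.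
Proof.
by rewrite /nrm exchange_big; apply: eq_bigr => i _; apply: eq_bigr => j _; rewrite mxE.
Qed.

Lemma nrmM X Y : nrm (X * Y) <= nrm X * nrm Y.
Proof.
rewrite /nrm mulr_suml; apply: ler_sum => i _.
apply: (@le_trans _ _ (\sum_j \sum_k `|X i k| * `|Y k j|)).
  apply: ler_sum => j _; rewrite mxE; apply: le_trans (ler_norm_sum _ _ _) _.
  by apply: ler_sum => k _; rewrite normrM.
rewrite exchange_big mulr_suml /=; apply: ler_sum => k _.
rewrite -mulr_sumr ler_wpM2l //.
by rewrite [leRHS](bigD1 k) //= lerDl; apply: sumr_ge0 => *; apply: sumr_ge0.
Qed.

Lemma entry_exp_le X k i j : `|(X ^+ k) i j| <= nrm X ^+ k.
Proof.
case: k => [|k].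
  by rewrite !expr0 mxE; case: (i == j); rewrite ?normr1 ?normr0 ?ler01.
apply: le_trans (le_nrm _ i j) _; elim: k => [|k IH]; first by rewrite !expr1.
rewrite exprS [leRHS]exprS; apply: le_trans (nrmM _ _) _.
by apply: ler_wpM2l => //; exact: nrm_ge0.
Qed.

Lemma nrm_exp_le X k : nrm (X ^+ k.+1) <= nrm X ^+ k.+1.
Proof.
elim: k => [|k IH]; first by rewrite !expr1.
rewrite exprS [leRHS]exprS; apply: le_trans (nrmM _ _) _.
by apply: ler_wpM2l => //; exact: nrm_ge0.
Qed.

Definition nrm_lim (u : nat -> M) L := forall e : R, 0 < e ->
  exists N, forall k, (N <= k)%N -> nrm (u k - L) < e.

Lemma nrm_lim_uniq u L L' : nrm_lim u L -> nrm_lim u L' -> L = L'.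
Proof.
move=> h h'; apply/eqP; rewrite -subr_eq0; apply/eqP/nrm_eq0.
apply: (@eps_zero _ _ 2); first exact: nrm_ge0.
move=> e e0; have [N hN] := h _ e0; have [N' hN'] := h' _ e0.
have := hN (maxn N N') (leq_maxl _ _); have := hN' (maxn N N') (leq_maxr _ _).
set k := maxn N N' => a1 a2; have -> : L - L' = (u k - L') - (u k - L) by apply/matrixP => i j; rewrite !mxE; ring.
apply: le_trans (nrmB _ _) _; lra.
Qed.

Definition expm_sum X k := \sum_(0 <= l < k) (l`!%:R)^-1 *: X ^+ l.

(** Entrywise, the series is dominated by that of [expR (nrm X)]. This is the passage from the limit
    in the matrix topology, which defines [expm], to estimates in [nrm]. *)
Lemma expm_lim X : nrm_lim (expm_sum X) (expm X).
Proof.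
pose u (i j : 'I_n.+1) l := (l`!%:R)^-1 * (X ^+ l) i j.
have cu i j : cvgn (series (u i j)).
  apply: normed_cvg; apply: (@series_le_cvg _ _ (exp_coeff (nrm X))).
  - by move=> k /=.
  - by move=> k; apply: exp_coeff_ge0; exact: nrm_ge0.
  - move=> k; rewrite /u /= normrM ger0_norm ?invr_ge0 // mulrC /exp_coeff /=.
    by rewrite ler_wpM2r ?invr_ge0 // entry_exp_le.
  - exact: is_cvg_series_exp_coeff.
pose L : M := \matrix_(i, j) limn (series (u i j)).
have E k i j : expm_sum X k i j = series (u i j) k.
  by rewrite /expm_sum /series /= summxE; apply: eq_bigr => l _; rewrite mxE.
have conv : series (fun k => (k`!%:R)^-1 *: X ^+ k) @ \oo --> L.
  apply/cvgrPdist_lt => e e0.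
  have H : \forall k \near \oo, forall ij : 'I_n.+1 * 'I_n.+1, `|L ij.1 ij.2 - series (u ij.1 ij.2) k| < e.
    apply: filter_forall => -[i j] /=; rewrite mxE.
    by have /cvgrPdist_lt := cu i j; apply.
  apply: filterS H => k Hk; rewrite /Num.norm /= mx_normrE.
  by apply: bigmax_lt => // -[i j] _ /=; have := Hk (i, j); rewrite /= -E !mxE.
have -> : expm X = L by apply/cvg_lim.
move=> e e0.
have e2 : 0 < e / (n.+1 * n.+1).+1%:R by rewrite divr_gt0.
have H : \forall k \near \oo, forall ij : 'I_n.+1 * 'I_n.+1, `|L ij.1 ij.2 - series (u ij.1 ij.2) k| < e / (n.+1 * n.+1).+1%:R.
  apply: filter_forall => -[i j] /=; rewrite mxE.
  by have /cvgrPdist_lt := cu i j; apply.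
have [N _ HN] := H; exists N => k /HN /= Hk.
apply: (@le_lt_trans _ _ (\sum_(i < n.+1) \sum_(j < n.+1) (e / (n.+1 * n.+1).+1%:R))).
  apply: ler_sum => i _; apply: ler_sum => j _; have := Hk (i, j) => /ltW /=.
  by rewrite -E !mxE distrC.
rewrite !sumr_const !card_ord -mulrnA -[_ *+ _]mulr_natr mulrAC ltr_pdivrMr //.
by rewrite ltr_pM2l // ltr_nat.
Qed.

Lemma expm_tr X : expm X^T = (expm X)^T.
Proof.
apply: (nrm_lim_uniq (expm_lim X^T)) => e e0; have [N HN] := expm_lim X e0.
exists N => k /HN hk; suff -> : expm_sum X^T k = (expm_sum X k)^T by rewrite -raddfB nrm_tr.
rewrite /expm_sum [RHS]raddf_sum /=; apply: eq_bigr => l _; rewrite [RHS]linearZ /=; congr (_ *: _).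
elim: l => [|l IH]; first by rewrite !expr0 trmx1.
by rewrite exprS [in RHS]exprSr trmx_mul IH.
Qed.

Lemma expm_conj A B X : A * B = 1 -> B * A = 1 -> expm (A * X * B) = A * expm X * B.
Proof.
move=> AB BA; apply: (nrm_lim_uniq (expm_lim _)) => e e0.
have K0 : 0 < nrm A * nrm B + 1 by rewrite ltr_wpDl // mulr_ge0 // nrm_ge0.
have [|N HN] := @expm_lim X (e / (nrm A * nrm B + 1)); first by rewrite divr_gt0.
exists N => k /HN hk.
have pw l : (A * X * B) ^+ l = A * X ^+ l * B.
  elim: l => [|l IH]; first by rewrite !expr0 mulr1.
  by rewrite exprS IH exprS !mulrA -(mulrA _ B) BA mulr1.
have -> : expm_sum (A * X * B) k - A * expm X * B = A * (expm_sum X k - expm X) * B.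
  rewrite mulrBr mulrBl; congr (_ - _); rewrite /expm_sum mulr_sumr mulr_suml.
  by apply: eq_bigr => l _; rewrite pw -scalerAr -scalerAl.
apply: le_lt_trans (nrmM _ _) _; apply: le_lt_trans (ler_wpM2r (nrm_ge0 _) (nrmM _ _)) _.
move: hk; rewrite ltr_pdivlMr // => hk; apply: le_lt_trans hk.
have := nrm_ge0 (expm_sum X k - expm X); lra.
Qed.

Lemma expm_order2 X (t : R) : `|t| <= 1 ->
  nrm (expm (t *: X) - 1 - t *: X) <= expR (nrm X) * t ^+ 2.
Proof.
move=> t1; apply/ler_addgt0Pr => e e0; have [N HN] := expm_lim (t *: X) e0.
have {HN} := HN N.+2 (leq_trans (leqnSn _) (leqnSn _)).
rewrite /expm_sum big_nat_recl // big_nat_recl // => HN.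
set S := \sum_(0 <= l < N) _ in HN.
move: HN; rewrite fact0 factS fact0 !invr1 expr0 expr1 !scale1r => HN.
have -> : expm (t *: X) - 1 - t *: X = S - (1 + (t *: X + S) - expm (t *: X)).
  by apply/matrixP => i j; rewrite !mxE; ring.
apply: le_trans (nrmB _ _) _; apply: lerD; last exact: ltW.
apply: (@le_trans _ _ (\sum_(0 <= l < N) (exp_coeff (nrm X) l.+2 * t ^+ 2))).
  rewrite /S; elim: (index_iota 0 N) => [|l s IH]; first by rewrite !big_nil nrm0.
  rewrite !big_cons; apply: le_trans (nrmD _ _) _; apply: lerD => //.
  rewrite nrmZ ger0_norm ?invr_ge0 // exprZn nrmZ normrX.
  have -> : exp_coeff (nrm X) l.+2 * t ^+ 2 = (l.+2`!%:R)^-1 * (t ^+ 2 * nrm X ^+ l.+2).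
    by rewrite /exp_coeff /=; ring.
  apply: ler_wpM2l; first by rewrite invr_ge0.
  have -> : t ^+ 2 = `|t| ^+ 2 by rewrite real_normK ?num_real.
  apply: ler_pM; [exact: exprn_ge0|exact: nrm_ge0| |exact: nrm_exp_le].
  by rewrite -addn2 exprD -[leRHS]mul1r ler_wpM2r ?exprn_ge0 // exprn_ile1.
rewrite -mulr_suml ler_wpM2r ?sqr_ge0 //.
apply: (@le_trans _ _ (series (exp_coeff (nrm X)) N.+2)).
  rewrite /series /= big_nat_recl // big_nat_recl // addrA lerDr addr_ge0 // exp_coeff_ge0 //; exact: nrm_ge0.
apply: nondecreasing_cvgn_le; last exact: is_cvg_series_exp_coeff.
apply/nondecreasing_seqP => k; rewrite /series /= big_nat_recr //= lerDl.
by rewrite exp_coeff_ge0 // nrm_ge0.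
Qed.

(** Membership in [V] becomes the vanishing of a bounded linear map, that is, a condition stable
    under limits. *)
Lemma vspace_bound (V : {vspace M}) : exists2 K : R, 0 <= K &
  exists P : {linear M -> M}, (forall X, (X \in V) <-> P X = 0) /\ forall X, nrm (P X) <= K * nrm X.
Proof.
pose P : 'End(M) := (\1 - projv V)%VF.
have PE X : P X = X - projv V X by rewrite /P add_lfunE opp_lfunE id_lfunE.
exists (\sum_i \sum_j nrm (P (delta_mx i j))).
  by apply: sumr_ge0 => i _; apply: sumr_ge0 => j _; exact: nrm_ge0.
exists P; split=> X.
  rewrite /= PE; split=> [XV|/eqP].
    by rewrite projv_id // subrr.
  by rewrite subr_eq0 => /eqP ->; exact: memv_proj.
rewrite {1}(matrix_sum_delta X) raddf_sum /=.
apply: (@le_trans _ _ (\sum_i \sum_j `|X i j| * nrm (P (delta_mx i j)))).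
  apply: le_trans (nrm_sum _ _) _; apply: ler_sum => i _; rewrite linear_sum.
  apply: le_trans (nrm_sum _ _) _; apply: ler_sum => j _.
  by rewrite linearZ /= nrmZ.
rewrite mulr_suml; apply: ler_sum => i _; rewrite mulr_suml; apply: ler_sum => j _.
by rewrite mulrC ler_wpM2l ?nrm_ge0 // le_nrm.
Qed.

End MatrixExp.

Ltac mxadd := apply/matrixP => ? ?; rewrite !mxE; ring.

Section RankOneParity.
Variables (R : realType) (S : rank_one_space R).
Local Notation M := 'M[R]_((sdim S).+1).
Local Notation H := (cartan S).
Local Notation bt := (beta_cartan S).
Implicit Types X Y Z A : M.

Lemma lie_conj A X : grp S A -> X \in lie S -> A * X * A^-1 \in lie S.
Proof.
move=> gA /lieP hX; have [uA gAV] := grpV gA.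
apply/lieP => t; have -> : t *: (A * X * A^-1) = A * (t *: X) * A^-1.
  by rewrite -scalerAr -scalerAl.
by rewrite expm_conj ?mulrV ?mulVr //; apply: grpM => //; exact: grpM.
Qed.

Lemma lie_tr X : X \in lie S -> X^T \in lie S.
Proof.
move=> /lieP hX; apply/lieP => t.
have -> : t *: X^T = (t *: X)^T by rewrite linearZ.
by rewrite expm_tr; exact: grp_trmx.
Qed.

(** The record describes [lie] only through one-parameter subgroups. The bracket is the derivative
    at 0 of [Ad (expm (t X)) Y], a curve in [lie], and a subspace contains the derivatives of its
    curves. *)
Lemma lie_bracket X Y : X \in lie S -> Y \in lie S -> bracket X Y \in lie S.
Proof.
move=> hX hY; have [K K0 [P [hP PK]]] := vspace_bound (lie S).
apply/hP/nrm_eq0.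
set x := nrm X; set y := nrm Y; set E0 := expR x.
have [x0 y0 E00] : [/\ 0 <= x, 0 <= y & 0 <= E0] by rewrite !nrm_ge0 expR_ge0.
set c := x + E0.
have c0 : 0 <= c by rewrite addr_ge0.
pose Q := K * (4 * c * y * x + 4 * E0 * y).
apply: (@eps_zero _ _ (Q + 1)); first exact: nrm_ge0.
move=> e e0.
(* The last bound gives [t * c <= 1 / 2], which lets the estimate of [Z - Y] absorb its own
   right-hand side. *)
set t := Num.min (Num.min 1 e) (1 / (2 * (c + 1))).
have t0 : 0 < t by rewrite !lt_min ltr01 e0 divr_gt0 //; lra.
have te : t <= e by rewrite /t !ge_min lexx !orbT.
have t1 : t <= 1 by rewrite /t !ge_min lexx.
have tc : t * c <= 1 / 2.
  have : t <= 1 / (2 * (c + 1)) by rewrite /t !ge_min lexx !orbT.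
  rewrite ler_pdivlMr; last by lra.
  lra.
set A := expm (t *: X).
have gA : grp S A by move/lieP: hX; exact.
have [uA _] := grpV gA.
set Z := A * Y * A^-1; have ZV : Z \in lie S by exact: lie_conj.
set E := A - 1 - t *: X.
have hE : nrm E <= E0 * t ^+ 2 by apply: expm_order2; rewrite ger0_norm // ltW.
have AE : A = 1 + t *: X + E by rewrite /E; mxadd.
have ZA : Z * A = A * Y by rewrite /Z -mulrA mulVr // mulr1.
clearbody Z E.
have hA : nrm (A - 1) <= t * c.
  have -> : A - 1 = t *: X + E by rewrite AE; mxadd.
  apply: le_trans (nrmD _ _) _; rewrite nrmZ gtr0_norm // /c mulrDr -/x lerD2l.
  apply: le_trans hE _; rewrite mulrC ler_wpM2r // expr2 -[leRHS]mulr1 ler_wpM2l //; exact: ltW.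
have DZ : Z - Y = (A - 1) * Y - Z * (A - 1).
  by rewrite mulrBl mulrBr ZA mul1r mulr1; mxadd.
have hZ : nrm (Z - Y) <= 4 * (t * c) * y.
  have h1 : nrm Z <= y + nrm (Z - Y) by have := nrmD Y (Z - Y); rewrite [Y + _]addrC subrK.
  have h2 : nrm (Z - Y) <= t * c * y + nrm Z * (t * c).
    rewrite {1}DZ; apply: le_trans (nrmB _ _) _; apply: lerD; apply: le_trans (nrmM _ _) _.
      by rewrite ler_wpM2r.
    by rewrite ler_wpM2l // nrm_ge0.
  have h3 : nrm Z * (t * c) <= (y + nrm (Z - Y)) * (t * c).
    by rewrite ler_wpM2r // mulr_ge0 // ltW.
  have h4 : nrm (Z - Y) * (t * c) <= nrm (Z - Y) * (1 / 2) by rewrite ler_wpM2l // nrm_ge0.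
  lra.
(* Obtained from [Z * A = A * Y] with [A = 1 + t *: X + E]. The map [P] kills [Z - Y], and all that
   remains is of order [t ^+ 2]. *)
have key : t *: bracket X Y = (Z - Y) + t *: ((Z - Y) * X) - (E * Y - Z * E).
  have h : Z + t *: (Z * X) + Z * E = Y + t *: (X * Y) + E * Y.
    by have := ZA; rewrite AE !mulrDr !mulrDl mulr1 mul1r -scalerAr -scalerAl.
  have e' : t *: (X * Y) = Z + t *: (Z * X) + Z * E - Y - E * Y by rewrite h; mxadd.
  by rewrite /bracket scalerBr e' [(Z - Y) * X]mulrBl scalerBr; mxadd.
have PK2 : nrm (P (t *: bracket X Y)) <= t * (t * Q).
  have PZ : P (Z - Y) = 0 by rewrite linearB /= ((hP Z).1 ZV) ((hP Y).1 hY) subrr.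
  rewrite key -addrA linearD PZ add0r; apply: le_trans (PK _) _.
  rewrite /Q mulrA mulrA [t * t * K]mulrC -!mulrA ler_wpM2l //.
  apply: le_trans (nrmB _ _) _; rewrite nrmZ gtr0_norm //.
  have k1 : nrm ((Z - Y) * X) <= 4 * (t * c) * y * x.
    by apply: le_trans (nrmM _ _) _; rewrite ler_wpM2r.
  have k2 : nrm (E * Y - Z * E) <= 4 * E0 * t ^+ 2 * y.
    apply: le_trans (nrmB _ _) _.
    have a1 := nrmM E Y; have a2 := nrmM Z E; rewrite -/y in a1.
    have a3 : nrm E * y <= E0 * t ^+ 2 * y by rewrite ler_wpM2r.
    have b1 : nrm Z <= 3 * y.
      have := nrmD Y (Z - Y); rewrite [Y + _]addrC subrK -/y => b1.
      have : (t * c) * y <= (1 / 2) * y by rewrite ler_wpM2r.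
      lra.
    have a4 : nrm Z * nrm E <= 3 * y * (E0 * t ^+ 2) by apply: ler_pM; rewrite ?nrm_ge0.
    have y2 : E0 * t ^+ 2 * y + 3 * y * (E0 * t ^+ 2) = 4 * E0 * t ^+ 2 * y by ring.
    apply: le_trans (lerD (le_trans a1 a3) (le_trans a2 a4)) _.
    by rewrite y2.
  apply: le_trans (lerD (ler_wpM2l (ltW t0) k1) k2) _.
  by rewrite le_eqVlt; apply/orP; left; apply/eqP; ring.
move: PK2; rewrite linearZ nrmZ gtr0_norm // ler_pM2l // => PK2.
have Q0 : 0 <= Q by rewrite /Q mulr_ge0 // addr_ge0 // !mulr_ge0.
apply: le_trans PK2 _; apply: (@le_trans _ _ (e * Q)); first by rewrite ler_wpM2r.
by rewrite ler_wpM2l ?(ltW e0) // lerDl.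
Qed.

Definition frob X Y : R := \tr (X^T * Y).

Lemma frob_gt0 X : X != 0 -> 0 < frob X X.
Proof.
move=> X0; rewrite lt_neqAle eq_sym.
have E : frob X X = \sum_i \sum_j (X j i) ^+ 2.
  by rewrite /frob /mxtrace; apply: eq_bigr => i _; rewrite mxE; apply: eq_bigr => j _; rewrite mxE expr2.
have ge : 0 <= frob X X by rewrite E; apply: sumr_ge0 => i _; apply: sumr_ge0 => j _; exact: sqr_ge0.
rewrite ge andbT; apply: contraNneq X0 => f0; apply/eqP/matrixP => i j; rewrite mxE.
have /psumr_eq0P : \sum_i \sum_j (X j i) ^+ 2 = 0 by rewrite -E.
move=> /(_ (fun i _ => sumr_ge0 _ (fun j _ => sqr_ge0 (X j i)))) /(_ j isT) /psumr_eq0P.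
by move=> /(_ (fun k _ => sqr_ge0 _)) /(_ i isT) /eqP; rewrite sqrf_eq0 => /eqP.
Qed.

Lemma jacobi X Y Z : bracket X (bracket Y Z) = bracket (bracket X Y) Z + bracket Y (bracket X Z).
Proof.
rewrite /bracket !mulrBr !mulrBl !mulrA; mxadd.
Qed.

Lemma bracketZr (c : R) X Y : bracket X (c *: Y) = c *: bracket X Y.
Proof. by rewrite /bracket scalerBr -scalerAr -scalerAl. Qed.

Lemma bracketZl (c : R) X Y : bracket (c *: X) Y = c *: bracket X Y.
Proof. by rewrite /bracket scalerBr -scalerAr -scalerAl. Qed.

Lemma bracket_tr X Y : (bracket X Y)^T = bracket Y^T X^T.
Proof. by rewrite /bracket raddfB /= !trmx_mul. Qed.

Lemma frob_bracket X Y Z : frob (bracket X Y) Z = frob Y (bracket X^T Z).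
Proof.
rewrite /frob bracket_tr /bracket mulrBl mulrBr !raddfB /=; congr (_ - _).
  by rewrite mulrA.
by rewrite -mulrA [LHS]mxtrace_mulC -mulmxA.
Qed.

(** [root_space] applies [linfun] to a bare function, so its kernel is meaningful only once a linear
    structure has been packed on that function. *)
Lemma root_spaceP c X : reflect (X \in lie S /\ bracket H X = c *: X) (X \in root_space (lie S) H c).
Proof.
have lin : linear (fun X : M => bracket H X - c *: X).
  move=> a U V; rewrite /bracket mulrDr mulrDl -scalerAr -scalerAl !scalerBr scalerDr scalerA mulrC -scalerA.
  by mxadd.
pose f := GRing.isLinear.Build R M M _ (fun X : M => bracket H X - c *: X) lin.
pose F : {linear M -> M} := HB.pack (fun X : M => bracket H X - c *: X) f.
rewrite /root_space memv_cap memv_ker -[linfun _]/(linfun F) lfunE /= subr_eq0.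
by apply: (iffP andP) => -[h /eqP].
Qed.

Lemma noncompactP X : reflect (X \in lie S /\ X^T = X) (X \in noncompact_part (lie S)).
Proof.
have lin : linear (fun X : M => X^T - X).
  by move=> a U V; rewrite linearP /= scalerBr; mxadd.
pose f := GRing.isLinear.Build R M M _ (fun X : M => X^T - X) lin.
pose F : {linear M -> M} := HB.pack (fun X : M => X^T - X) f.
rewrite /noncompact_part memv_cap memv_ker -[linfun _]/(linfun F) lfunE /= subr_eq0.
by apply: (iffP andP) => -[h /eqP].
Qed.

Lemma mult_beta_gt0 : (0 < mult_beta S)%N.
Proof. by rewrite lt0n dimv_eq0; exact: beta_root. Qed.

(* A nonzero [Z] in the root space of [beta] gives a nondegenerate alternating
   form [(Y, Y') |-> tr (Z^T [Y', Y])] on the root space of [beta / 2]. *)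
Lemma mult_half_even : ~~ odd (mult_half S).
Proof.
have /noncompactP[Hl HT] := cartan_p S.
set V := root_space (lie S) H (bt / 2).
set Z := vpick (root_space (lie S) H bt).
have Z0 : Z != 0 by rewrite vpick0; exact: beta_root.
have /root_spaceP[Zl HZ] : Z \in root_space (lie S) H bt by exact: memv_pick.
have HtT c U : bracket H U = c *: U -> bracket H U^T = (- c) *: U^T.
  move=> hU; have := congr1 trmx hU; rewrite bracket_tr HT linearZ /= scaleNr => <-.
  by rewrite /bracket opprB.
have br_der c e U W : bracket H U = c *: U -> bracket H W = e *: W ->
    bracket H (bracket U W) = (c + e) *: bracket U W.
  by move=> hU hW; rewrite jacobi hU hW bracketZl bracketZr scalerDl.
(* [W] is symmetric and commutes with the Cartan vector, hence a multiple [c *: H] by rank one;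
   pairing it with [H] in the trace form shows [c > 0]. *)
set W := bracket Z Z^T.
have Wl : W \in lie S by apply: lie_bracket => //; exact: lie_tr.
have WT : W^T = W by rewrite /W bracket_tr trmxK.
have HW : bracket H W = 0 by rewrite (br_der _ _ _ _ HZ (HtT _ _ HZ)) subrr scale0r.
have [c Wc] : exists c, W = c *: H.
  by apply: rank_one => //; apply/noncompactP.
have c0 : 0 < c.
  have h1 : frob W H = bt * frob Z^T Z^T.
    rewrite /W frob_bracket; have -> : bracket Z^T H = bt *: Z^T.
      by have := HtT _ _ HZ; rewrite /bracket scaleNr => /(congr1 -%R); rewrite opprB opprK.
    by rewrite /frob -scalerAr linearZ.
  have h2 : frob W H = c * frob H H by rewrite Wc /frob linearZ /= -scalerAl linearZ.
  have p1 := frob_gt0 (cartan_neq0 S).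
  have p2 : 0 < bt * frob Z^T Z^T.
    apply: mulr_gt0; first exact: beta_gt0.
    by apply: frob_gt0; rewrite -[0]trmx0 (inj_eq trmx_inj).
  by rewrite -(pmulr_lgt0 _ p1) -h2 h1.
(* Here [v = Y^T] has weight [- bt / 2]. If [[Z, v] = 0], the Jacobi identity gives [[Z, [Z^T, v]] =
   c [H, v]], so the squared norm of [[Z^T, v]] is [- c * (bt / 2)] times that of [v], which is
   negative unless [v = 0]. *)
have J_inj Y : Y \in V -> bracket Z Y^T = 0 -> Y = 0.
  move=> /root_spaceP[Yl HY] ZY; apply/eqP; apply: contraT => Y0.
  set v := Y^T in ZY *; have Hv := HtT _ _ HY; rewrite -/v in Hv.
  have v0 : v != 0 by rewrite -[0]trmx0 (inj_eq trmx_inj).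
  have k : frob (bracket Z^T v) (bracket Z^T v) = c * - (bt / 2) * frob v v.
    rewrite frob_bracket trmxK jacobi -/W ZY Wc bracketZl Hv.
    have -> : bracket Z^T 0 = 0 by rewrite /bracket mulr0 mul0r subrr.
    by rewrite addr0 scalerA /frob -scalerAr linearZ.
  have p1 := frob_gt0 v0; have p2 := beta_gt0 S.
  have p3 : c * - (bt / 2) * frob v v < 0.
    rewrite mulrN mulNr oppr_lt0 mulr_gt0 // mulr_gt0 // divr_gt0 //.
  have [e|/frob_gt0] := eqVneq (bracket Z^T v) 0; last by rewrite k => /lt_trans /(_ p3); rewrite ltxx.
  by move: p3; rewrite -k e /frob mulr0 linear0 ltxx.
pose b i := (vbasis V)`_i.
have bV (i : 'I_(\dim V)) : b i \in V by apply: vbasis_mem; rewrite mem_nth // size_tuple.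
pose Om : 'M[R]_(\dim V) := \matrix_(i, j) frob (bracket Z (b i)^T) (b j).
have alt Y Y' : frob (bracket Z Y^T) Y' = - frob (bracket Z Y'^T) Y.
  have E U U' : frob (bracket Z U^T) U' = \tr (Z^T * (U' * U)) - \tr (Z^T * (U * U')).
    rewrite /frob bracket_tr trmxK /bracket mulrBl raddfB /=; congr (_ - _).
      by rewrite -mulrA [LHS]mxtrace_mulC -mulmxA.
    by rewrite mulrA.
  by rewrite !E opprB.
have OmT : Om^T = - Om by apply/matrixP => i j; rewrite !mxE alt.
(* A kernel vector gives a nonzero [Y] in [V] such that [[Z, Y^T]] lies in [V] and is orthogonal to
   [V], hence vanishes, against [J_inj]. *)
have det0 : \det Om != 0.
  apply/det0P => -[u u0 uOm].
  pose Y := \sum_(i < \dim V) u 0 i *: b i.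
  have YV : Y \in V by apply: memv_suml => i _; exact: memvZ.
  have JYV : bracket Z Y^T \in V.
    have /root_spaceP[Yl HY] := YV; apply/root_spaceP; split.
      by apply: lie_bracket => //; exact: lie_tr.
    rewrite (br_der _ _ _ _ HZ (HtT _ _ HY)); congr (_ *: _).
    by rewrite {1}[bt](_ : _ = bt / 2 + bt / 2) ?addrK //; field.
  have ort (j : 'I_(\dim V)) : frob (bracket Z Y^T) (b j) = 0.
    have := congr1 (fun q : 'rV_(\dim V) => q 0 j) uOm; rewrite mxE [RHS]mxE => <-.
    have -> : frob (bracket Z Y^T) (b j) = - \sum_(i < \dim V) u 0 i * frob (bracket Z (b j)^T) (b i).
      rewrite alt /Y /frob; congr (- _); rewrite mulr_sumr raddf_sum /=; apply: eq_bigr => i _.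
      by rewrite -scalerAr linearZ.
    by rewrite -sumrN; apply: eq_bigr => i _; rewrite mxE -mulrN -alt.
  have JY0 : bracket Z Y^T = 0.
    apply/eqP; apply: contraT => /frob_gt0.
    rewrite {2}(coord_vbasis JYV) /frob mulr_sumr raddf_sum /= big1 ?ltxx // => i _.
    by rewrite -scalerAr linearZ /= -/(frob _ _) ort mulr0.
  have Y0 := J_inj _ YV JY0.
  have /freeP fr := basis_free (vbasisP V).
  by case/eqP: u0; apply/rowP => i; rewrite mxE; exact: (fr (fun i => u 0 i) Y0).
(* An antisymmetric matrix of odd size is singular. *)
apply/negP => od; have : \det Om = - \det Om.
  rewrite -{1}det_tr OmT -scaleN1r detZ -signr_odd.
  by rewrite (_ : odd _ = true) // expr1 mulN1r.
move=> /eqP; rewrite -subr_eq0 opprK -mulr2n mulrn_eq0 /= => /eqP d0.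
by rewrite d0 eqxx in det0.
Qed.

End RankOneParity.

(** * Holomorphy in the spectral parameter *)

Section MatrixTopology.
Variables (R : realType) (n : nat).
Local Notation M := 'M[R]_n.+1.
Implicit Types (X Y A : M).

Lemma mnbhsP X (P : set M) : nbhs X P <->
  exists2 d : R, 0 < d & forall Y, nrm (Y - X) < d -> P Y.
Proof.
split.
- move=> /nbhs_ballP[e /= e0 H]; exists e => // Y hY; apply: H.
  split => // i j; rewrite /ball /= distrC; apply: le_lt_trans hY.
  by have := le_nrm (Y - X) i j; rewrite !mxE.
- move=> [d d0 H]; apply/nbhs_ballP; exists (d / (n.+1 * n.+1).+1%:R) => /=.
    by rewrite divr_gt0.
  move=> Y [_ hY]; apply: H.
  apply: (@le_lt_trans _ _ (\sum_(i < n.+1) \sum_(j < n.+1) (d / (n.+1 * n.+1).+1%:R))).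
    apply: ler_sum => i _; apply: ler_sum => j _; have := hY i j.
    by rewrite /ball /= !mxE distrC; exact: ltW.
  rewrite !sumr_const !card_ord -mulrnA -[_ *+ _]mulr_natr mulrAC ltr_pdivrMr //.
  by rewrite ltr_pM2l // ltr_nat.
Qed.

Lemma nrm_inv A A' : A \is a GRing.unit -> A' \is a GRing.unit ->
  nrm (A' - A) * nrm A^-1 <= 1 / 2 ->
  nrm (A'^-1 - A^-1) <= 2 * (nrm A^-1) ^+ 2 * nrm (A' - A).
Proof.
move=> uA uA' h; set x := nrm (A'^-1 - A^-1); set a := nrm A^-1 in h *.
have E : A'^-1 - A^-1 = - (A'^-1 * (A' - A) * A^-1).
  by rewrite mulrBr mulrBl mulVr // mul1r mulrK // opprB.
have h1 : x <= nrm A'^-1 * nrm (A' - A) * a.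
  rewrite /x E nrmN; apply: le_trans (nrmM _ _) _; rewrite ler_wpM2r ?nrm_ge0 //.
  exact: nrmM.
have h2 : nrm A'^-1 <= x + a by have := nrmD (A'^-1 - A^-1) A^-1; rewrite subrK.
have h3 : nrm A'^-1 * (nrm (A' - A) * a) <= (x + a) * (nrm (A' - A) * a).
  by rewrite ler_wpM2r // mulr_ge0 ?nrm_ge0.
have h4 : x * (nrm (A' - A) * a) <= x * (1 / 2) by rewrite ler_wpM2l // nrm_ge0.
rewrite expr2; lra.
Qed.

End MatrixTopology.

(** * Convolution with spherical functions: continuity, holomorphy and parity *)

Section HaarIntegral.
Variables (R : realType) (X1 X2 : rank_one_space R).
Local Notation C := R[i].
Local Notation T := ('M[R]_((sdim X1).+1) * 'M[R]_((sdim X2).+1))%type.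
Variable mu : {measure set (borelT X1 X2) -> \bar R}.
Variable phi : C -> C -> T -> C.
Hypothesis mu_haar : haar_measure mu.
Hypothesis hphi : spherical_family phi.
Variables (f : T -> C) (y : T).
Hypothesis hf : Cc_infty f.
Hypothesis hy : prodG y.
Local Notation G := (@prodG R X1 X2).

Definition tdist (g' g : T) : R := nrm (g'.1 - g.1) + nrm (g'.2 - g.2).

Lemma tnbhsP (g : T) (P : set T) : nbhs g P <->
  exists2 d : R, 0 < d & forall g', tdist g' g < d -> P g'.
Proof.
split.
- move=> [[P1 P2] /= [/mnbhsP[d1 d10 h1] /mnbhsP[d2 d20 h2]] HP].
  have [d d0 hd] := min2_gt0 d10 d20; exists d => // g' /hd[]; rewrite /tdist => k1 k2.
  have p1 := nrm_ge0 (g'.1 - g.1); have p2 := nrm_ge0 (g'.2 - g.2).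
  by apply: HP; split=> /=; [apply: h1|apply: h2]; lra.
- move=> [d d0 H]; have d2 : 0 < d / 2 by rewrite divr_gt0.
  exists ([set Y | nrm (Y - g.1) < d / 2], [set Y | nrm (Y - g.2) < d / 2]) => /=.
    by split; apply/mnbhsP; exists (d / 2).
  by move=> g' [/= k1 k2]; apply: H; rewrite /tdist; lra.
Qed.

Definition tcont (u : T -> C) (g : T) := forall e : R, 0 < e -> exists2 d : R, 0 < d &
  forall g', G g' -> tdist g' g < d -> cabs (u g' - u g) < e.

Lemma f_tcont g : G g -> tcont f g.
Proof.
have [[sf _] _] := hf; have [cf _] := sf [::] (fun X => fun h => match notF h with end).
move=> Gg e e0; move/subspace_continuousP : cf => /(_ g Gg) cf.
have : nbhs (f g : C^o) [set w | cabs (w - f g) < e] by apply/cnbhsP; exists e.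
by move=> /cf /tnbhsP[d d0 hd]; exists d => // g' Gg' /hd /(_ Gg').
Qed.

Lemma phi_tcont s1 s2 g : G g -> forall e : R, 0 < e -> exists2 d : R, 0 < d &
  forall s1' s2' g', cabs (s1' - s1) < d -> cabs (s2' - s2) < d -> G g' -> tdist g' g < d ->
  cabs (phi s1' s2' g' - phi s1 s2 g) < e.
Proof.
have [_ _ cphi _ _] := hphi => Gg e e0.
move/subspace_continuousP : cphi => /(_ (s1, s2, g) Gg) cphi.
have /cphi : nbhs (phi s1 s2 g : C^o) [set w | cabs (w - phi s1 s2 g) < e].
  by apply/cnbhsP; exists e.
move=> [[P1 P2] /= [[[Q1 Q2] /= [/cnbhsP[d1 d10 h1] /cnbhsP[d2 d20 h2]] HQ] /tnbhsP[d3 d30 h3]] HP].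
have [d4 d40 h4] := min2_gt0 d10 d20; have [d d0 hd] := min2_gt0 d40 d30.
exists d => // s1' s2' g' /hd[/h4[k1 _] _] /hd[/h4[_ k2] _] Gg' /hd[_ k3].
apply: (HP (s1', s2', g')) => //; split => /=; last exact: h3.
by apply: HQ; split; [exact: h1|exact: h2].
Qed.

Lemma prodG_unit g : G g -> g.1 \is a GRing.unit /\ g.2 \is a GRing.unit.
Proof. by move=> [/grpV[u1 _] /grpV[u2 _]]. Qed.

Lemma prodG_inv g : G g -> g^-1 = (g.1^-1, g.2^-1).
Proof.
move=> /prodG_unit[u1 u2]; have ug : g \is a GRing.unit by rewrite unfold_in /= u1 u2.
apply: (mulrI ug); rewrite mulrV //; case: (g) u1 u2 => a b /= u1 u2.
by congr (_, _); rewrite mulrV.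
Qed.

Lemma prodG_invM g : G g -> G (g^-1 * y).
Proof.
move=> Gg; rewrite prodG_inv //; case: Gg => /grpV[_ g1] /grpV[_ g2].
by split; apply: grpM => //; case: hy.
Qed.

Lemma inv_tcont g : G g -> forall e : R, 0 < e -> exists2 d : R, 0 < d &
  forall g', G g' -> tdist g' g < d -> tdist (g'^-1 * y) (g^-1 * y) < e.
Proof.
move=> Gg e e0; have [u1 u2] := prodG_unit Gg.
set a := nrm g.1^-1 + nrm g.2^-1 + nrm y.1 + nrm y.2 + 1.
have [p1 p2] : 0 <= nrm g.1^-1 /\ 0 <= nrm g.2^-1 by split; exact: nrm_ge0.
have [p3 p4] : 0 <= nrm y.1 /\ 0 <= nrm y.2 by split; exact: nrm_ge0.
have a1 : 1 <= a by rewrite /a; lra.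
have a0 : 0 < a by lra.
have d10 : 0 < 1 / (2 * a) by rewrite divr_gt0 // mulr_gt0.
have d20 : 0 < e / (2 * a ^+ 2 * a) by rewrite divr_gt0 // !mulr_gt0 // exprn_gt0.
have [d d0 hd] := min2_gt0 d10 d20; exists d => // g' Gg' /hd[k1 k2].
have [u1' u2'] := prodG_unit Gg'.
have aux m (A A' Y : 'M[R]_m.+1) : A \is a GRing.unit -> A' \is a GRing.unit ->
    nrm A^-1 <= a -> nrm Y <= a -> nrm (A' - A) < 1 / (2 * a) ->
    nrm (A'^-1 * Y - A^-1 * Y) <= 2 * a ^+ 2 * a * nrm (A' - A).
  move=> uA uA' hA hY hd'; rewrite -mulrBl; apply: le_trans (nrmM _ _) _.
  have q := nrm_ge0 (A' - A).
  have h : nrm (A' - A) * nrm A^-1 <= 1 / 2.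
    have : nrm (A' - A) * nrm A^-1 <= 1 / (2 * a) * a.
      by apply: ler_pM => //; [exact: nrm_ge0|exact: ltW].
    by have -> : 1 / (2 * a) * a = 1 / 2 by field; rewrite gt_eqF.
  have h2 := nrm_inv uA uA' h.
  have h3 : 2 * nrm A^-1 ^+ 2 * nrm (A' - A) <= 2 * a ^+ 2 * nrm (A' - A).
    by rewrite ler_wpM2r // ler_wpM2l // ler_pXn2r ?nnegrE ?nrm_ge0 // ltW.
  have -> : 2 * a ^+ 2 * a * nrm (A' - A) = 2 * a ^+ 2 * nrm (A' - A) * a by ring.
  by apply: ler_pM; rewrite ?nrm_ge0 //; exact: le_trans h2 h3.
rewrite !prodG_inv // /tdist /=; rewrite /tdist in k1 k2.
have q1 := nrm_ge0 (g'.1 - g.1); have q2 := nrm_ge0 (g'.2 - g.2).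
have b1 := aux _ _ _ y.1 u1 u1'; have b2 := aux _ _ _ y.2 u2 u2'.
have {}b1 : nrm (g'.1^-1 * y.1 - g.1^-1 * y.1) <= 2 * a ^+ 2 * a * nrm (g'.1 - g.1).
  by apply: b1; rewrite ?/a; lra.
have {}b2 : nrm (g'.2^-1 * y.2 - g.2^-1 * y.2) <= 2 * a ^+ 2 * a * nrm (g'.2 - g.2).
  by apply: b2; rewrite ?/a; lra.
apply: le_lt_trans (lerD b1 b2) _; rewrite -mulrDr mulrC.
by rewrite -ltr_pdivlMr // !mulr_gt0 // exprn_gt0.
Qed.

Definition kern (s1 s2 : C) (g : T) : C := f g * phi s1 s2 (g^-1 * y).

Lemma kern_tcont s1 s2 g : G g -> forall e : R, 0 < e -> exists2 d : R, 0 < d &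
  forall s1' s2' g', cabs (s1' - s1) < d -> cabs (s2' - s2) < d -> G g' -> tdist g' g < d ->
  cabs (kern s1' s2' g' - kern s1 s2 g) < e.
Proof.
move=> Gg e e0; set p := phi s1 s2 (g^-1 * y).
set M := cabs (f g) + cabs p + 1.
have [q1 q2] : 0 <= cabs (f g) /\ 0 <= cabs p by rewrite !cabs_ge0.
have M0 : 0 < M by rewrite /M; lra.
have e1 : 0 < Num.min 1 (e / (2 * M)) by rewrite lt_min ltr01 divr_gt0 // mulr_gt0.
have [d1 d10 h1] := f_tcont Gg e1.
have [d2 d20 h2] := phi_tcont s1 s2 (prodG_invM Gg) e1.
have [d3 d30 h3] := inv_tcont Gg d20.
have [d4 d40 h4] := min2_gt0 d10 d20; have [d d0 hd] := min2_gt0 d40 d30.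
exists d => // s1' s2' g' /hd[/h4[_ k1] _] /hd[/h4[_ k2] _] Gg' /hd[/h4[k3 _] k4].
have := h1 _ Gg' k3; have := h2 _ _ _ k1 k2 (prodG_invM Gg') (h3 _ Gg' k4).
rewrite !lt_min -/p => /andP[a1 a2] /andP[a3 a4]; rewrite /kern -/p.
set p' := phi _ _ _ in a1 a2 *.
have -> : f g' * p' - f g * p = f g' * (p' - p) + (f g' - f g) * p by ring.
apply: le_lt_trans (cabsD _ _) _; rewrite !cabsM.
have b1 : cabs (f g') <= M by have := cabsD (f g' - f g) (f g); rewrite subrK /M; lra.
have b2 : cabs p <= M by rewrite /M; lra.
have c1 : cabs (f g') * cabs (p' - p) <= M * cabs (p' - p) by rewrite ler_wpM2r // cabs_ge0.
have c2 : cabs (f g' - f g) * cabs p <= cabs (f g' - f g) * M by rewrite ler_wpM2l // cabs_ge0.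
move: a2 a4; rewrite invfM mulrA !ltr_pdivlMr // => a2 a4.
lra.
Qed.

(** Compactness as the existence of a uniform radius; it yields both uniform continuity in the
    parameters and boundedness of the kernel. *)
Lemma ccover (B : set T) (P : R -> T -> Prop) : compact B -> B `<=` G ->
  (forall d d' g, d' <= d -> P d g -> P d' g) ->
  (forall g, B g -> exists2 d : R, 0 < d & forall g', G g' -> tdist g' g < d -> P d g') ->
  exists2 d : R, 0 < d & forall g, B g -> P d g.
Proof.
move=> /compact_near_coveringP cB BG mono H.
have /cB : forall g, B g -> \forall g' \near g & d \near (0 : R)^'+, B g' -> P d g'.
  move=> g Bg; have [d d0 hd] := H _ Bg.
  exists ([set g' | tdist g' g < d], [set e | e < d]) => /=; last first.
    move=> [g' e] [/= k1 k2] Bg'; apply: (mono d e); first exact: ltW.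
    by apply: hd => //; exact: BG.
  split; first by apply/tnbhsP; exists d.
  exact: nbhs_right_lt.
move=> K; have : \forall d \near (0 : R)^'+, 0 < d /\ (B `<=` (fun g => B g -> P d g)).
  near=> d; split; first by near: d; exact: nbhs_right_gt.
  by near: d; exact: K.
by move=> /filter_ex[d [d0 hd]]; exists d => // g Bg; exact: hd.
Unshelve. all: by end_near. Qed.

Section Support.
Variable B : set T.
Hypotheses (cB : compact B) (BG : B `<=` G) (fB : forall g, G g -> ~ B g -> f g = 0).

Lemma kern_unif s1 s2 (e : R) : 0 < e -> exists2 d : R, 0 < d & forall g, B g ->
  forall s1' s2', cabs (s1' - s1) < d -> cabs (s2' - s2) < d ->
  cabs (kern s1' s2' g - kern s1 s2 g) < e.
Proof.
move=> e0; apply: (@ccover B (fun d g => forall s1' s2', cabs (s1' - s1) < d -> cabs (s2' - s2) < d ->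
  cabs (kern s1' s2' g - kern s1 s2 g) < e)) => //.
  by move=> d d' g dd H s1' s2' k1 k2; apply: H; exact: lt_le_trans dd.
move=> g /BG Gg; have [|d d0 hd] := kern_tcont s1 s2 Gg (_ : 0 < e / 2); first by rewrite divr_gt0.
exists d => // g' Gg' k s1' s2' k1 k2.
have := hd _ _ _ k1 k2 Gg' k; have := hd s1 s2 g'; rewrite !subrr cabs0 => /(_ d0 d0 Gg' k) a1 a2.
have -> : kern s1' s2' g' - kern s1 s2 g' = (kern s1' s2' g' - kern s1 s2 g) - (kern s1 s2 g' - kern s1 s2 g).
  by ring.
apply: le_lt_trans (cabsB _ _) _; lra.
Qed.

Lemma kern_bounded s1 s2 : exists2 M : R, 0 <= M & forall g, B g -> cabs (kern s1 s2 g) <= M.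
Proof.
(* The reciprocal of the radius plays the role of the bound, which makes boundedness an antitone
   property. *)
have [||d d0 hd] := @ccover B (fun d g => cabs (kern s1 s2 g) <= d^-1 \/ d <= 0) cB BG.
- move=> d d' g dd; have [d0|d0] := leP d' 0; first by right.
  move=> [k|k]; last by move: (lt_le_trans d0 dd); rewrite ltNge k.
  left; apply: le_trans k _; rewrite lef_pV2 ?posrE //; exact: lt_le_trans dd.
- move=> g /BG Gg; have [d d0 hd] := kern_tcont s1 s2 Gg ltr01.
  set m := cabs (kern s1 s2 g) + 1.
  have m0 : 0 < m by rewrite /m; have := cabs_ge0 (kern s1 s2 g); lra.
  have mV : 0 < m^-1 by rewrite invr_gt0.
  exists (Num.min d m^-1); first by rewrite lt_min d0.
  move=> g' Gg'; rewrite lt_min => /andP[k _]; left.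
  have := hd s1 s2 g'; rewrite !subrr cabs0 => /(_ d0 d0 Gg' k) a.
  apply: (@le_trans _ _ m).
    have := cabsD (kern s1 s2 g' - kern s1 s2 g) (kern s1 s2 g); rewrite subrK /m; lra.
  by rewrite -[leLHS]invrK lef_pV2 ?posrE ?lt_min ?d0 // ge_min lexx orbT.
exists d^-1; first by rewrite invr_ge0 ltW.
by move=> g /hd[//|]; rewrite leNgt d0.
Qed.

Lemma tcont_measurable (u : T -> R) :
  (forall g, B g -> forall e : R, 0 < e -> exists2 d : R, 0 < d &
    forall g', G g' -> tdist g' g < d -> `|u g' - u g| < e) ->
  measurable_fun (B : set (borelT X1 X2)) (u : borelT X1 X2 -> R).
Proof.
move=> H.
have mB : measurable (B : set (borelT X1 X2)).
  rewrite -[B]setCK; apply: measurableC; apply: sub_sigma_algebra.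
  by apply: closed_openC; apply: compact_closed => //; exact: norm_hausdorff.
move=> _; apply: (measurability _ (measurable_realfun.RGenOpens.measurableE R)) => //.
move=> _ [_ [a [b ->] <-]].
set U := `]a, b[%classic.
have oU : open U by exact: interval_open.
(* [u] is controlled on [G] only, so its preimage of an open set need not be open; adding the
   complement of [B] makes each point of the left side interior. *)
have -> : B `&` u @^-1` U = B `&` (~` B `|` u @^-1` U)°.
  apply/seteqP; split=> g [Bg]; last first.
    by move=> /interior_subset [].
  move=> ug; split=> //; apply/tnbhsP.
  have /nbhs_ballP[e /= e0 he] : nbhs (u g) U by exact: open_nbhs_nbhs.
  have [d d0 hd] := H _ Bg _ e0; exists d => // g' k.
  have [Bg'|] := pselect (B g'); last by left.
  right; apply: he; rewrite /ball /= distrC; apply: hd => //; exact: BG.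
apply: measurableI => //; apply: sub_sigma_algebra; exact: open_interior.
Qed.

Lemma kern_integral s1 s2 : convolution mu f (phi s1 s2) y =
  Cintegral mu (B : set (borelT X1 X2)) (kern s1 s2).
Proof.
by apply: Cintegral_supp => // g Gg Bg; rewrite fB // mul0r.
Qed.

Lemma supp_measurable : measurable (B : set (borelT X1 X2)).
Proof.
rewrite -[B]setCK; apply: measurableC; apply: sub_sigma_algebra.
by apply: closed_openC; apply: compact_closed => //; exact: norm_hausdorff.
Qed.

Lemma supp_finite : (mu B < +oo)%E.
Proof. by have [_ _ H _] := mu_haar; exact: H. Qed.

Lemma kern_cintble s1 s2 : cintble mu (B : set (borelT X1 X2)) (kern s1 s2).
Proof.
have [M M0 hM] := kern_bounded s1 s2.
have aux (u : T -> R) : (forall g, `|u g| <= cabs (kern s1 s2 g)) ->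
    (forall g g', `|u g' - u g| <= cabs (kern s1 s2 g' - kern s1 s2 g)) ->
    mu.-integrable (B : set (borelT X1 X2)) (EFin \o (u : borelT X1 X2 -> R)).
  move=> h1 h2; apply: measurable_bounded_integrable.
  - exact: supp_measurable.
  - exact: supp_finite.
  - apply: tcont_measurable => g /BG Gg e e0; have [d d0 hd] := kern_tcont s1 s2 Gg e0.
    exists d => // g' Gg' k; apply: le_lt_trans (h2 _ _) _.
    by apply: hd; rewrite ?subrr ?cabs0.
  - exists M; split; first exact: num_real.
    move=> x Mx g Bg; apply: le_trans (h1 _) _; apply: le_trans (hM _ Bg) _; exact: ltW.
split; apply: aux.
- by move=> g; exact: Re_le_cabs.
- by move=> g g'; rewrite -cReN -cReD; exact: Re_le_cabs.
- by move=> g; exact: Im_le_cabs.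
- by move=> g g'; rewrite -cImN -cImD; exact: Im_le_cabs.
Qed.

Definition Psi (s1 s2 : C) : C := convolution mu f (phi s1 s2) y.

Lemma Psi_jcont s1 s2 : jcont Psi s1 s2.
Proof.
move=> e e0; set m := fine (mu B); have m0 : 0 <= m by exact: fine_ge0.
have e1 : 0 < e / (2 * (m + 1)) by rewrite divr_gt0 // mulr_gt0 //; lra.
have [d d0 hd] := kern_unif s1 s2 e1; exists d => // w1 w2 k1 k2.
rewrite /Psi !kern_integral -CintegralB; [|exact: supp_measurable|exact: kern_cintble|exact: kern_cintble].
apply: (@le_lt_trans _ _ (2 * (e / (2 * (m + 1))) * m)).
  apply: Cintegral_le.
  - exact: supp_measurable.
  - exact: supp_finite.
  - apply: cintbleD; [exact: supp_measurable|exact: kern_cintble|].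
    by apply: cintbleN; [exact: supp_measurable|exact: kern_cintble].
  - by move=> g Bg; apply: ltW; exact: hd.
have -> : 2 * (e / (2 * (m + 1))) * m = e * m / (m + 1) by field; lra.
by rewrite ltr_pdivrMr; [nra|lra].
Qed.

Lemma Psi_hol1 s1 s2 : hol (Psi^~ s2) s1.
Proof.
have [d d0 hd] := kern_unif s1 s2 ltr01; have [M M0 hM] := kern_bounded s1 s2.
have [_ _ _ h1 _] := hphi.
apply: (@near_hol _ (fun w => Cintegral mu (B : set (borelT X1 X2)) (kern w s2)) _ _ 1) => //.
  by move=> w _; rewrite /Psi kern_integral.
have d2 : 0 < d / 2 by rewrite divr_gt0.
apply: (@param_integral R _ (borelT X1 X2) mu B (fun w => kern w s2) s1 (d / 2) (M + 1)).
- exact: supp_measurable.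
- exact: supp_finite.
- by [].
- by rewrite addr_ge0.
- move=> g w /BG Gg _; apply: holM => //.
  by apply/derivable_hol; apply: h1 => //; exact: prodG_invM.
- move=> g w Bg hw; have := hd _ Bg w s2; rewrite subrr cabs0 => /(_ _ d0) k.
  have {}k := k (le_lt_trans hw _); have {}k : cabs (kern w s2 g - kern s1 s2 g) < 1 by apply: k; lra.
  have := hM _ Bg; have := cabsD (kern w s2 g - kern s1 s2 g) (kern s1 s2 g); rewrite subrK; lra.
- by move=> w _; exact: kern_cintble.
Qed.

Lemma Psi_hol2 s1 s2 : hol (Psi s1) s2.
Proof.
have [d d0 hd] := kern_unif s1 s2 ltr01; have [M M0 hM] := kern_bounded s1 s2.
have [_ _ _ _ h2] := hphi.
apply: (@near_hol _ (fun w => Cintegral mu (B : set (borelT X1 X2)) (kern s1 w)) _ _ 1) => //.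
  by move=> w _; rewrite /Psi kern_integral.
have d2 : 0 < d / 2 by rewrite divr_gt0.
apply: (@param_integral R _ (borelT X1 X2) mu B (fun w => kern s1 w) s2 (d / 2) (M + 1)).
- exact: supp_measurable.
- exact: supp_finite.
- by [].
- by rewrite addr_ge0.
- move=> g w /BG Gg _; apply: holM => //.
  by apply/derivable_hol; apply: h2 => //; exact: prodG_invM.
- move=> g w Bg hw; have := hd _ Bg s1 w; rewrite subrr cabs0 => /(_ d0) k.
  have {}k := k (le_lt_trans hw _); have {}k : cabs (kern s1 w g - kern s1 s2 g) < 1 by apply: k; lra.
  have := hM _ Bg; have := cabsD (kern s1 w g - kern s1 s2 g) (kern s1 s2 g); rewrite subrK; lra.
- by move=> w _; exact: kern_cintble.
Qed.

End Support.

Lemma compact_support : exists B : set T, [/\ compact B, B `<=` G & forall g, G g -> ~ B g -> f g = 0].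
Proof. by case: hf. Qed.

(** The eigenvalue equations contain only the squares of the parameters, and their normalized
    invariant solution is unique on [G]. *)
Lemma Psi_even s1 s2 : Psi (- s1) (- s2) = Psi s1 s2.
Proof.
have [h1 h2 _ _ _] := hphi.
have [B [cB BG fB]] := compact_support.
rewrite /Psi !(kern_integral BG fB); apply: Cintegral_congr => g /BG Gg.
rewrite /kern (h2 s1 s2 (phi (- s1) (- s2))) //; last exact: prodG_invM.
by have [a b c d e] := h1 (- s1) (- s2); split=> // g' Gg'; rewrite ?d ?e // sqrrN.
Qed.

Lemma Psi_comp (a b : C -> C) z : hol a z -> hol b z -> hol (fun w => Psi (a w) (b w)) z.
Proof.
have [B [cB BG fB]] := compact_support.
apply: osgood; first exact: (Psi_jcont cB BG fB).
  exact: (Psi_hol1 cB BG fB).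
exact: (Psi_hol2 cB BG fB).
Qed.

End HaarIntegral.

(** * The Plancherel density *)

Section ComplexSine.
Variable R : realType.
Local Notation C := R[i].
Local Notation ii := (imag_unit R).
Implicit Types (x y z w p : C).

Lemma ii2 : ii * ii = -1.
Proof. by rewrite /imag_unit; apply: complex_ext; rewrite !ReImE /=; ring. Qed.

Lemma sin_nat_pi (n : nat) : sin (n%:R * pi : R) = 0.
Proof.
elim: n => [|n IH]; first by rewrite mul0r sin0.
by rewrite -natr1 mulrDl mul1r sinD IH sinpi mul0r mulr0 addr0.
Qed.

Lemma sin_int_pi (j : int) : sin (j%:~R * pi : R) = 0.
Proof.
case: j => n; first exact: sin_nat_pi.
by rewrite NegzE mulrNz mulNr sinN sin_nat_pi oppr0.
Qed.

Lemma sin_eq0_int (t : R) : sin t = 0 -> exists j : int, t = j%:~R * pi.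
Proof.
move=> t0; have pi0 := pi_gt0 R.
set j := Num.floor (t / pi); exists j.
have /andP[h1 h2] := floor_itv (t / pi); rewrite -/j in h1 h2.
set t' := t - j%:~R * pi.
have s0 : sin t' = 0 by rewrite /t' sinB t0 sin_int_pi mul0r mulr0 subrr.
have t1 : 0 <= t' by rewrite subr_ge0 -ler_pdivlMr.
have t2 : t' < pi.
  rewrite ltrBlDr -{1}[pi]mul1r -mulrDl -ltr_pdivrMr //.
  by apply: lt_le_trans h2 _; rewrite intrD addrC.
have [t3|t3] := ltP 0 t'; first by have := @sin_gt0_pi _ t'; rewrite t3 t2 s0 ltxx => /(_ isT).
by apply/eqP; rewrite -subr_eq0 -/t' eq_le t3 t1.
Qed.

(* [2i sin (pi (x - c))] and, up to the factor [pi], its derivative. *)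
Definition csin (c x : C) : C := Cexp (ii * (pi%:C * (x - c))) - Cexp (- ii * (pi%:C * (x - c))).
Definition ccos (c x : C) : C := ii * (Cexp (ii * (pi%:C * (x - c))) + Cexp (- ii * (pi%:C * (x - c)))).

Lemma hol_affine (k c x : C) : hol (fun x => k * (pi%:C * (x - c))) x.
Proof. by apply: holM => //; apply: holM => //; exact: holB. Qed.

Lemma hol_csin c x : hol (csin c) x.
Proof. by apply: holB; apply: hol_Cexp; exact: hol_affine. Qed.

Lemma hol_ccos c x : hol (ccos c) x.
Proof. by apply: holM => //; apply: holD; apply: hol_Cexp; exact: hol_affine. Qed.

Lemma cderiv_csin c x : cderiv (csin c) x (pi%:C * ccos c x).
Proof.
have aux k : cderiv (fun x => Cexp (k * (pi%:C * (x - c)))) x (Cexp (k * (pi%:C * (x - c))) * (k * pi%:C)).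
  apply: (@cderiv_comp _ (fun x => k * (pi%:C * (x - c)))); last exact: cderiv_Cexp.
  have h := cderivM (cderiv_cst k x) (cderivM (cderiv_cst pi%:C x)
    (cderivD (cderiv_id x) (cderiv_cst (- c) x))).
  rewrite !mul0r !add0r addr0 mulr1 in h; exact: h.
have aux2 : cderiv (fun x => -1 * Cexp (- ii * (pi%:C * (x - c)))) x
   (0 * Cexp (- ii * (pi%:C * (x - c))) + -1 * (Cexp (- ii * (pi%:C * (x - c))) * (- ii * pi%:C))).
  by apply: cderivM; [exact: cderiv_cst|exact: aux].
have := cderivD (aux ii) aux2.
set l := (_ + _); have -> : l = pi%:C * ccos c x by rewrite /l /ccos; ring.
by apply: (@near_cderiv _ _ _ _ _ 1) => // w _; rewrite /csin mulN1r.
Qed.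

(** Equal moduli of the two exponentials force the argument to be real, where the zeros are those of
    the real sine. *)
Lemma csin_eq0 c x : csin c x = 0 -> exists j : int, x = c + j%:~R.
Proof.
move=> /eqP; rewrite subr_eq0 => /eqP E; set z := pi%:C * (x - c) in E.
have pi0 := pi_gt0 R.
have m0 : complex.Im z = 0.
  have := congr1 (@cabs R) E; rewrite !cabs_Cexp => /expR_inj.
  rewrite !ReImE /= !mul0r !mul1r oppr0 mul0r !sub0r mulN1r; lra.
have zr : z = (complex.Re z)%:C by apply: complex_ext.
have : sin (complex.Re z) = 0.
  move: E; rewrite zr mulNr -!cisdef -mulrN -cisdef -rmorphN !cisE cosN sinN => -[].
  by rewrite /=; lra.
move=> /sin_eq0_int[j hj]; exists j.
have piC : pi%:C != 0 :> C by rewrite (inj_eq (@complexI R)) gt_eqF.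
apply: (mulfI piC); rewrite mulrDr -[X in X + _](addrK 0).
have -> : pi%:C * x = z + pi%:C * c by rewrite /z; ring.
rewrite zr hj rmorphM /= rmorph_int; ring.
Qed.

Lemma csin_ccos c x : csin c x = 0 -> ccos c x != 0.
Proof.
move=> /eqP; rewrite subr_eq0 => /eqP E.
rewrite /ccos -E -mulr2n mulf_neq0 ?ii_neq0 // mulrn_eq0 /=; exact: Cexp_neq0.
Qed.

Lemma csin_int c (j : int) : csin c (c + j%:~R) = 0.
Proof.
rewrite /csin; have -> : c + j%:~R - c = (j%:~R : R)%:C by rewrite addrAC subrr add0r rmorph_int.
rewrite -rmorphM mulNr -mulrN -rmorphN -!cisdef !cisE cosN sinN /= [pi * _]mulrC sin_int_pi oppr0.
by rewrite subrr.
Qed.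

Lemma Ccot_csin c x : Ccot (pi%:C * (x - c)) = ccos c x / csin c x.
Proof. by []. Qed.

(** Simple zeros are divided out one at a time; simplicity is what keeps the last factor nonzero at
    each of them. *)
Lemma div_roots (s : seq C) (F : C -> C) : uniq s -> (forall x, hol F x) ->
  (forall p, p \in s -> F p = 0 /\ exists2 l, cderiv F p l & l != 0) ->
  exists G : C -> C, [/\ forall x, hol G x, forall x, F x = \prod_(p <- s) (x - p) * G x &
    forall p, p \in s -> G p != 0].
Proof.
elim: s F => [|p s IH] F /=.
  by move=> _ hF _; exists F; split=> // x; rewrite big_nil mul1r.
move=> /andP[ps us] hF hs; have [Fp [l hl l0]] := hs p (mem_head _ _).
have [F1 [E1 F1p h1]] := div_root Fp hl.
have hF1 x : hol F1 x by apply: hol_near_hol; apply: h1; exact: holn_all.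
have nz q : q \in s -> q - p != 0.
  by move=> qs; rewrite subr_eq0; apply: contraNneq ps => <-.
have [q qs|G [hG EG Gs]] := IH F1 us hF1.
  have qps : q \in p :: s by rewrite inE qs orbT.
  have [Fq [m hm m0]] := hs q qps; have qp := nz _ qs.
  have F1q : F1 q = 0 by move/eqP: Fq; rewrite E1 mulf_eq0 (negbTE qp) => /eqP.
  split=> //; have [k hk] := hF1 q; exists k => //.
  have h : cderiv (fun w => (w - p) * F1 w) q ((1 + 0) * F1 q + (q - p) * k).
    by apply: cderivM => //; apply: cderivD; [exact: cderiv_id|exact: cderiv_cst].
  rewrite F1q mulr0 add0r in h.
  have e : m = (q - p) * k.
    by apply: (cderiv_uniq hm); apply: (near_cderiv (d := 1) _ _ h) => // w _; rewrite E1.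
  by apply: contraNneq m0 => k0; rewrite e k0 mulr0.
exists G; split=> //.
  by move=> x; rewrite E1 EG big_cons mulrA.
move=> q; rewrite inE => /predU1P[->|/Gs//].
by apply: contraTneq l0 => G0; rewrite -F1p EG G0 mulr0 eqxx.
Qed.

End ComplexSine.

Section Plancherel.
Variables (R : realType) (X : rank_one_space R).
Local Notation C := R[i].
Local Notation ii := (imag_unit R).
Local Notation rho := (rhob X).
Implicit Types (x y z w p : C).

(** This is [2 * rhob], a natural number because [mult_half] is even. *)
Definition trho : nat := (mult_beta X + (mult_half X)./2)%N.

Lemma half_double : (mult_half X = ((mult_half X)./2).*2)%N.
Proof. by rewrite -[LHS]odd_double_half (negbTE (mult_half_even X)). Qed.

Lemma rhobE : rho = trho%:R / 2.
Proof.
by rewrite /rhob /trho {1}half_double -muln2 natrD natrM; congr (_ / _); field.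
Qed.

Lemma trho_gt0 : (0 < trho)%N.
Proof. by rewrite /trho addn_gt0 mult_beta_gt0. Qed.

Lemma rho_ge : 1 / 2 <= rho.
Proof. by rewrite rhobE ler_pM2r ?invr_gt0 // ler1n trho_gt0. Qed.

(** The monic polynomial with [N] roots of spacing 1 placed symmetrically about 0. Both products of
    [Ppol] have this shape, which gives their parity. *)
Definition symprod (N : nat) x : C := \prod_(0 <= k < N) (x - ((N%:R - 1) / 2 : R)%:C + k%:R).

Lemma symprodN N x : symprod N (- x) = (-1) ^+ N * symprod N x.
Proof.
rewrite /symprod big_nat_rev /= add0n.
transitivity (\prod_(0 <= k < N) (-1 * (x - ((N%:R - 1) / 2 : R)%:C + k%:R))); last first.
  by rewrite big_split /= big_const_nat subn0 iter_mulr_1.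
apply: eq_big_nat => k /andP[_ kN].
rewrite natrB // -natr1 !(rmorphM, rmorphB, rmorph1, rmorph_nat, fmorphV) /=; by field.
Qed.

Lemma PpolE x : Ppol X x = symprod trho.-1 x * symprod (mult_half X)./2 x.
Proof.
rewrite /Ppol /symprod -/trho; congr (_ * _).
  apply: eq_bigr => k _; congr (_ - _ + _); congr (_%:C).
  by rewrite rhobE -{1}(prednK trho_gt0) -natr1; field.
apply: eq_bigr => k _; congr (_ - _ + _); congr (_%:C).
by rewrite {1}half_double -muln2 natrM; field.
Qed.

Lemma PpolN x : Ppol X (- x) = (-1) ^+ (mult_beta X).-1 * Ppol X x.
Proof.
rewrite !PpolE !symprodN mulrACA -exprD; congr (_ * _).
(* The number [mult_half ./2] of factors of the second product also enters [2 * rhob], so it counts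
   twice and drops out of the sign. *)
have -> : (trho.-1 + (mult_half X)./2 = (mult_beta X).-1 + ((mult_half X)./2).*2)%N.
  by rewrite /trho -addnn; have := mult_beta_gt0 X; lia.
by rewrite exprD -mul2n exprM sqrrN expr1n expr1n mulr1.
Qed.

Lemma hol_Ppol f z : hol f z -> hol (fun w => Ppol X (f w)) z.
Proof.
move=> hf; apply: holM; apply: hol_prod => k;
  by apply: holD => //; apply: holB.
Qed.

(** The roots of the first product, which are the poles of the cotangent strictly between [- rho]
    and [rho]; [singpt] describes the other poles. *)
Definition proots : seq C := [seq (rho - 1)%:C - k%:R | k <- index_iota 0 trho.-1].

Lemma proots_prod x : \prod_(p <- proots) (x - p) = symprod trho.-1 x.
Proof.
rewrite big_map /symprod; apply: eq_bigr => k _; rewrite opprB addrCA addrC; congr (_ - _ + _); congr (_%:C).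
by rewrite rhobE -{1}(prednK trho_gt0) -natr1; field.
Qed.

Lemma proots_uniq : uniq proots.
Proof.
rewrite map_inj_uniq ?iota_uniq // => k l /addrI /oppr_inj /eqP.
by rewrite eqr_nat => /eqP.
Qed.

Lemma nat_complex (n : nat) : n%:R = (n%:R : R)%:C.
Proof. by rewrite rmorph_nat. Qed.

Definition singpt p := exists l : nat, p = (rho + l%:R)%:C \/ p = - (rho + l%:R)%:C.

Lemma singpt_proots p : singpt p -> p \notin proots.
Proof.
move=> [l hp]; apply/mapP => -[k]; rewrite mem_index_iota /= => kn pk.
have tr := prednK trho_gt0.
case: hp => e; move/(congr1 (@complex.Re R)): pk; rewrite e nat_complex !ReImE /=.
  have : 0 <= l%:R :> R by []. have : 0 <= k%:R :> R by []. lra.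
have h1 : k%:R + 1 <= (trho.-1)%:R :> R by rewrite natr1 ler_nat.
have h2 : trho%:R = (trho.-1)%:R + 1 :> R by rewrite natr1 tr.
have : 0 <= l%:R :> R by [].
rewrite rhobE h2; lra.
Qed.

(** [Dt] is the sine divided by the first product of [Ppol]: polynomial times cotangent becomes the
    second product times [ccos] over [Dt], with only the genuine poles left as zeros of the
    denominator. *)
Lemma plancherel_denominator : exists Dt : C -> C,
  [/\ forall x, hol Dt x,
      forall x, csin rho%:C x = symprod trho.-1 x * Dt x &
      forall x, Dt x = 0 -> singpt x].
Proof.
have r2 : rho + rho = trho%:R by rewrite rhobE; field.
have hp p : p \in proots -> csin rho%:C p = 0.
  move=> /mapP[k _ ->].
  have -> : (rho - 1)%:C - k%:R = rho%:C + (- (k%:Z) - 1)%:~R.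
    by rewrite rmorphB rmorph1 intrB intrN -pmulrn mulr1z; ring.
  exact: csin_int.
have [p hps|G [hG EG Gp]] := div_roots proots_uniq (hol_csin rho%:C).
  split; first exact: hp.
  exists (pi%:C * ccos rho%:C p); first exact: cderiv_csin.
  rewrite mulf_neq0 //; last by apply: csin_ccos; exact: hp.
  by rewrite (inj_eq (@complexI R)) gt_eqF // pi_gt0.
exists G; split=> // [x|x G0]; first by rewrite EG proots_prod.
have [j xj] : exists j : int, x = rho%:C + j%:~R by apply: csin_eq0; rewrite EG G0 mulr0.
have xn : x \notin proots by apply: contraTN isT => /Gp; rewrite G0 eqxx.
case: j xj => n xj; first by exists n; left; rewrite xj rmorphD /= -pmulrn nat_complex.
have [nt|nt] := ltnP n trho.-1.
  move: xn; rewrite xj => /mapP[]; exists n; first by rewrite mem_index_iota.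
  by rewrite NegzE intrN -pmulrn -natr1 rmorphB rmorph1; ring.
(* [Negz n] stands for [- (n + 1)], and [rho - (n + 1) = - (rho + l)] for [l = n + 1 - 2 * rho]. *)
exists (n - trho.-1)%N; right; rewrite xj -rmorphN.
have -> : rho%:C + (Negz n)%:~R = (rho - n.+1%:R)%:C :> C.
  by rewrite NegzE intrN -pmulrn rmorphB /= nat_complex.
congr (_%:C); rewrite natrB // -natr1.
have -> : (trho.-1)%:R = rho + rho - 1 by rewrite r2 -[in RHS](prednK trho_gt0) -natr1; ring.
by ring.
Qed.

Lemma plancherel_derivative (Dt : C -> C) p : (forall x, hol Dt x) ->
  (forall x, csin rho%:C x = symprod trho.-1 x * Dt x) -> singpt p ->
  [/\ symprod trho.-1 p != 0, Dt p = 0 &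
    cderiv Dt p (pi%:C * ccos rho%:C p / symprod trho.-1 p)].
Proof.
move=> hD ED sp; have pn := singpt_proots sp.
have S0 : symprod trho.-1 p != 0.
  rewrite -proots_prod prodf_seq_neq0; apply/allP => q qs; apply/implyP => _.
  by rewrite subr_eq0; apply: contraNneq pn => ->.
have sin0 : csin rho%:C p = 0.
  have [l [e|e]] := sp.
    by rewrite e rmorphD /= -nat_complex; exact: (csin_int _ (Posz l)).
  have -> : p = rho%:C + (- ((trho + l)%:Z))%:~R.
    rewrite e intrN -pmulrn natrD !nat_complex -rmorphD -!rmorphN -rmorphD /=; congr (_%:C).
    by rewrite rhobE; field.
  exact: csin_int.
have D0 : Dt p = 0 by move/eqP: sin0; rewrite ED mulf_eq0 (negbTE S0) => /eqP.
split=> //; have [l hl] := hD p.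
have [k hk] : hol (symprod trho.-1) p.
  by apply: hol_prod => j; apply: holD => //; exact: holB.
have h := cderivM hk hl; rewrite D0 mulr0 add0r in h.
have e : pi%:C * ccos rho%:C p = symprod trho.-1 p * l.
  apply: cderiv_uniq (cderiv_csin _ _) _.
  by apply: (near_cderiv (d := 1) _ _ h) => // w _; rewrite ED.
by rewrite e mulrAC divff // mul1r.
Qed.

End Plancherel.

(** * The Joukowski map *)

Section SquareRoot.
Variable R : realType.
Local Notation C := R[i].
Local Notation ii := (imag_unit R).
Local Notation Re := complex.Re.
Local Notation Im := complex.Im.
Implicit Types (x y z w u : C).

Lemma sqrtc_Re_ge0 x : 0 <= Re (sqrtc x).
Proof. by case: x => a b /=; exact: sqrtr_ge0. Qed.

Lemma sqrtc_Im_ge0 x : 0 <= Im x -> 0 <= Im (sqrtc x).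
Proof.
case: x => a b /= b0; rewrite mulr_ge0 ?sqrtr_ge0 //.
by case: eqP => // _; rewrite sgr_ge0.
Qed.

Lemma sqrtc_Im_le0 x : Im x < 0 -> Im (sqrtc x) <= 0.
Proof.
case: x => a b /= b0; rewrite mulr_le0_ge0 ?sqrtr_ge0 //.
by rewrite lt_eqF // sgr_le0 ltW.
Qed.

(** The branch cut of the principal square root. *)
Definition npos x := Im x = 0 /\ Re x <= 0.

Lemma sqrtc_Re_gt0 x : ~ npos x -> 0 < Re (sqrtc x).
Proof.
move=> nx; rewrite lt_neqAle sqrtc_Re_ge0 andbT eq_sym; apply/eqP => r0; apply: nx.
have := sqr_sqrtc x; rewrite expr2; case: (sqrtc x) r0 => a b /= -> <-.
by rewrite /npos !ReImE /= !mul0r mulr0 addr0 sub0r oppr_le0 -expr2 sqr_ge0.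
Qed.

Lemma sqrtcB x y : (sqrtc x - sqrtc y) * (sqrtc x + sqrtc y) = x - y.
Proof. by rewrite -subr_sqr !sqr_sqrtc. Qed.

(** By [sqrtcB] the slope is the inverse of [sqrtc y + s], whose real part is at least
    [Re s > 0]. *)
Lemma hol_sqrtc x : ~ npos x -> hol (@sqrtc R) x.
Proof.
move=> nx; have r0 := sqrtc_Re_gt0 nx; set s := sqrtc x in r0.
have dist y : cabs (sqrtc y - s) * Re s <= cabs (y - x).
  rewrite -sqrtcB cabsM -/s ler_wpM2l ?cabs_ge0 //.
  apply: le_trans (Re_le_cabs _); rewrite cReD ger0_norm ?addr_ge0 ?sqrtc_Re_ge0 //.
  by rewrite lerDr sqrtc_Re_ge0.
have cs : ccont (@sqrtc R) x.
  move=> e e0; exists (e * Re s); first by rewrite mulr_gt0.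
  by move=> y hy; rewrite -(ltr_pM2r r0); apply: le_lt_trans hy; exact: dist.
have s0 : s + s != 0.
  by apply: contraTneq r0 => /(congr1 (@complex.Re R)); rewrite cReD /= => h; rewrite -leNgt; lra.
exists ((s + s)^-1); exists (fun y => (sqrtc y + s)^-1); split=> //.
  apply: (ccontV (f := fun y => sqrtc y + s)) => //.
  by apply: ccontD => //; exact: ccont_cst.
move=> y; rewrite -[y - x]sqrtcB -/s mulrCA mulVf ?mulr1 //.
apply/eqP => /(congr1 (@complex.Re R)); rewrite cReD /=; have := sqrtc_Re_ge0 y; lra.
Qed.

(** Both roots lie in the closed first quadrant, where [|a - b| <= |a + b|]. The resulting Hoelder
    bound gives continuity up to the cut from above. *)
Lemma sqrtc_quadrant x y : 0 <= Im x -> 0 <= Im y ->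
  cabs (sqrtc x - sqrtc y) ^+ 2 <= cabs (x - y).
Proof.
move=> hx hy; rewrite -sqrtcB cabsM expr2 ler_wpM2l ?cabs_ge0 //.
rewrite -(@ler_pXn2r _ 2) ?nnegrE ?cabs_ge0 // !cabs_sqr !ReImE.
have := sqrtc_Re_ge0 x; have := sqrtc_Re_ge0 y.
have := sqrtc_Im_ge0 hx; have := sqrtc_Im_ge0 hy.
move: (sqrtc x) (sqrtc y) => [a b] [c d] /= h1 h2 h3 h4.
have : 0 <= a * c by exact: mulr_ge0.
have : 0 <= b * d by exact: mulr_ge0.
nra.
Qed.

(* The branch of [sqrt (u^2 - 1)] on the complement of [-1, 1]. *)
Definition zs u : C := sqrtc (u + 1) * sqrtc (u - 1).

Definition slit u := Im u = 0 /\ -1 <= Re u <= 1.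

Lemma zs_sqr u : zs u ^+ 2 = u ^+ 2 - 1.
Proof. by rewrite /zs exprMn !sqr_sqrtc; ring. Qed.

(** The inner product of the real plane. Its sign for a root [w] of [u^2 - 1] decides which of
    [|u - w|] and [|u + w|] is smaller, and so characterizes the branch. *)
Definition rdot u w : R := Re u * Re w + Im u * Im w.

(** With [a] and [b] the roots of [u + 1] and [u - 1], [u] is [(a^2 + b^2) / 2] and [zs u] is
    [a * b], so the product is a nonnegative multiple of [rdot a b]; [a] and [b] lie in the same
    closed quadrant because [u + 1] and [u - 1] have the same imaginary part. *)
Lemma rdot_zs u : 0 <= rdot u (zs u) /\ (~ slit u -> 0 < rdot u (zs u)).
Proof.
set a := sqrtc (u + 1); set b := sqrtc (u - 1).
have E : rdot u (zs u) = (cabs a ^+ 2 + cabs b ^+ 2) / 2 * rdot a b.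
  have h1 : u + 1 = a * a by rewrite -expr2 sqr_sqrtc.
  have h2 : u - 1 = b * b by rewrite -expr2 sqr_sqrtc.
  have hu : u = (a * a + b * b) / 2 by rewrite -h1 -h2; field.
  have r1 : Re u = (Re (a * a) + Re (b * b)) / 2.
    have : Re (u + u) = Re (a * a + b * b) by rewrite {1 2}hu; congr Re; field.
    rewrite !cReD; lra.
  have r2 : Im u = (Im (a * a) + Im (b * b)) / 2.
    have : Im (u + u) = Im (a * a + b * b) by rewrite {1 2}hu; congr Im; field.
    rewrite !cImD; lra.
  by rewrite /rdot r1 r2 !cabs_sqr /zs -/a -/b !ReImE; field.
have pos : 0 <= cabs a ^+ 2 + cabs b ^+ 2 by rewrite addr_ge0 // sqr_ge0.
have Imu : Im (u + 1) = Im u /\ Im (u - 1) = Im u by rewrite !ReImE /= oppr0 !addr0.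
have Reu : Re (u + 1) = Re u + 1 /\ Re (u - 1) = Re u - 1 by rewrite !ReImE.
have p1 : 0 <= Im a * Im b.
  have [h|h] := leP 0 (Im u).
    by apply: mulr_ge0; apply: sqrtc_Im_ge0; rewrite ?Imu.1 ?Imu.2.
  by rewrite -mulrNN; apply: mulr_ge0; rewrite oppr_ge0; apply: sqrtc_Im_le0; rewrite ?Imu.1 ?Imu.2.
have p2 : 0 <= Re a * Re b by apply: mulr_ge0; exact: sqrtc_Re_ge0.
split; first by rewrite E mulr_ge0 ?divr_ge0 // /rdot addr_ge0.
move=> ns; have pos' : 0 < cabs a ^+ 2 + cabs b ^+ 2.
  have [a0|a0] := eqVneq a 0; last by rewrite ltr_pwDl ?sqr_ge0 // exprn_gt0 // cabs_gt0.
  have [b0|b0] := eqVneq b 0; last by rewrite ltr_wpDl ?sqr_ge0 // exprn_gt0 // cabs_gt0.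
  exfalso; move: (sqr_sqrtc (u + 1)) (sqr_sqrtc (u - 1)); rewrite -/a -/b a0 b0 expr0n /= => e1 e2.
  move: (congr1 (@complex.Re R) e1) (congr1 (@complex.Re R) e2); rewrite !ReImE /=; lra.
rewrite E mulr_gt0 ?divr_gt0 // /rdot.
have [n1|n1] := pselect (npos (u + 1)); last first.
  have [n2|n2] := pselect (npos (u - 1)); last first.
    by rewrite ltr_pwDl // mulr_gt0 // sqrtc_Re_gt0.
  by exfalso; apply: ns; move: n2 n1; rewrite /npos /slit Imu.1 Imu.2 Reu.1 Reu.2 => -[i0 h] h';
    split=> //; apply/andP; split; rewrite leNgt; apply/negP => h2; [apply: h'; split=> //|]; lra.
have im (v : C) : Im v = 0 -> Re v < 0 -> 0 < Im (sqrtc v).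
  move=> i0 r0; rewrite lt_neqAle sqrtc_Im_ge0 ?i0 // andbT eq_sym; apply/eqP => s0.
  have := sqr_sqrtc v; rewrite expr2 => /(congr1 (@complex.Re R)); rewrite !ReImE s0 mulr0 subr0.
  have := sqr_ge0 (Re (sqrtc v)); rewrite expr2; lra.
have [i0 h] := n1; rewrite Imu.1 Reu.1 in i0 h.
have h' : Re u < -1.
  rewrite ltNge; apply/negP => h'; apply: ns; split=> //; lra.
rewrite ltr_wpDl // mulr_gt0 // /a /b; apply: im; rewrite ?Imu.1 ?Imu.2 ?Reu.1 ?Reu.2 //; lra.
Qed.

Lemma rdotN u w : rdot u (- w) = - rdot u w.
Proof. by rewrite /rdot !ReImE; ring. Qed.

Lemma zs_uniq u w : ~ slit u -> w ^+ 2 = u ^+ 2 - 1 -> 0 < rdot u w -> w = zs u.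
Proof.
move=> ns; rewrite -zs_sqr => /eqP; rewrite eqf_sqr => /orP[/eqP //|/eqP ->].
by rewrite rdotN => h; exfalso; have := (rdot_zs u).2 ns; lra.
Qed.

Lemma zs_opp u : ~ slit u -> zs (- u) = - zs u.
Proof.
move=> ns; have ns' : ~ slit (- u).
  by rewrite /slit !ReImE => -[h1 h2]; apply: ns; split; lra.
apply/esym; apply: zs_uniq => //; first by rewrite sqrrN zs_sqr sqrrN.
have := (rdot_zs u).2 ns; rewrite /rdot !ReImE; lra.
Qed.

Lemma zs_neq0 u : ~ slit u -> zs u != 0.
Proof.
move=> /((rdot_zs u).2); apply: contraTneq => ->; by rewrite /rdot /= !mulr0 addr0 ltxx.
Qed.

Lemma slit_open u : ~ slit u -> exists2 d : R, 0 < d & forall v, cabs (v - u) < d -> ~ slit v.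
Proof.
move=> ns; have [i0|i0] := eqVneq (Im u) 0; last first.
  exists `|Im u|; first by rewrite normr_gt0.
  move=> v hv [v0 _]; have := Im_le_cabs (v - u); rewrite !ReImE v0 sub0r normrN => h.
  by have := le_lt_trans h hv; rewrite ltxx.
have [r1|r1] := ltP 1 `|Re u|; last first.
  by exfalso; apply: ns; split=> //; rewrite -ler_norml.
exists (`|Re u| - 1); first by rewrite subr_gt0.
move=> v hv [_]; rewrite -ler_norml => h; have := Re_le_cabs (v - u); rewrite !ReImE => h2.
have := lerB_dist (Re u) (Re v); rewrite distrC; lra.
Qed.

(** Left of [-1] both factors jump; there the oddness of [zs] transfers the holomorphy from the
    right of 1. *)
Lemma hol_zs u : ~ slit u -> hol zs u.
Proof.
have aux v : ~ npos (v - 1) -> hol zs v.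
  move=> n2; apply: holM; (apply: (@hol_comp _ _ (@sqrtc R)); first exact: holD); apply: hol_sqrtc => //.
  by move=> [h1 h2]; apply: n2; move: h1 h2; rewrite /npos !ReImE /=; lra.
move=> ns; have [n2|n2] := pselect (npos (u - 1)); last exact: aux.
have [d d0 hd] := slit_open ns.
apply: (@near_hol _ (fun v => - zs (- v)) _ _ d) => //.
  by move=> v /hd nv; rewrite zs_opp // opprK.
apply: holN; apply: (@hol_comp _ (fun v => - v)); first exact: holN.
apply: aux => -[h1 h2]; apply: ns; move: n2 h1 h2; rewrite /npos /slit !ReImE /=; lra.
Qed.

Lemma holn_zs u : ~ slit u -> hol_near zs u.
Proof. by move=> /slit_open[d d0 hd]; exists d => // v /hd; exact: hol_zs. Qed.

Lemma zs_cont_upper u (e : R) : 0 <= Im u -> 0 < e -> exists2 d : R, 0 < d &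
  forall v, 0 <= Im v -> cabs (v - u) < d -> cabs (zs v - zs u) < e.
Proof.
move=> hu e0; set a := sqrtc (u + 1); set b := sqrtc (u - 1).
set M := cabs a + cabs b + 1.
have M0 : 1 <= M by rewrite /M; have := cabs_ge0 a; have := cabs_ge0 b; lra.
set x := Num.min 1 (e / (2 * M)).
have x0 : 0 < x by rewrite lt_min ltr01 divr_gt0 //; lra.
exists (x ^+ 2); first by rewrite exprn_gt0.
move=> v hv hd.
have aux (k : R) : cabs (sqrtc (v + k%:C) - sqrtc (u + k%:C)) < x.
  rewrite -(@ltr_pXn2r _ 2) ?nnegrE ?cabs_ge0 ?(ltW x0) //.
  apply: le_lt_trans (sqrtc_quadrant _ _) _; rewrite ?ReImE /= ?addr0 //.
  by have -> : v + k%:C - (u + k%:C) = v - u by ring.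
have h1 : cabs (sqrtc (v + 1) - a) < x by exact: (aux 1).
have h2 : cabs (sqrtc (v - 1) - b) < x by have := aux (-1); rewrite rmorphN rmorph1.
have [y1 y2] : x <= 1 /\ x <= e / (2 * M) by rewrite /x !ge_min !lexx orbT.
rewrite /zs -/a -/b; set a' := sqrtc (v + 1) in h1 *; set b' := sqrtc (v - 1) in h2 *.
have -> : a' * b' - a * b = (a' - a) * b' + a * (b' - b) by ring.
apply: le_lt_trans (cabsD _ _) _; rewrite !cabsM.
have k1 : cabs b' <= M by have := cabsD (b' - b) b; rewrite subrK /M; have := cabs_ge0 a; lra.
have k2 : cabs a <= M by rewrite /M; have := cabs_ge0 b; lra.
have c1 : cabs (a' - a) * cabs b' <= cabs (a' - a) * M by rewrite ler_wpM2l // cabs_ge0.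
have c2 : cabs a * cabs (b' - b) <= M * cabs (b' - b) by rewrite ler_wpM2r // cabs_ge0.
move: y2; rewrite ler_pdivlMr; last by lra.
have : cabs (a' - a) * M < x * M by rewrite ltr_pM2r //; lra.
have : cabs (b' - b) * M < x * M by rewrite ltr_pM2r //; lra.
lra.
Qed.

(* Half the sum of the distances to the foci of the ellipses [c(|w| = r)]. *)
Definition kap u : R := (cabs (u - 1) + cabs (u + 1)) / 2.

(** [c(w) - 1] and [c(w) + 1] are [(w - 1)^2] and [(w + 1)^2] over [2 w], so the sum of their moduli
    reduces to the parallelogram law. *)
Lemma kap_cfun w : w != 0 -> kap (cfun w) = cR (cabs w).
Proof.
move=> w0; rewrite /kap /cR /cfun.
have c0 : 0 < cabs w by rewrite cabs_gt0.
have -> : (w + w^-1) / 2 - 1 = (w - 1) ^+ 2 / (2 * w) by field.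
have -> : (w + w^-1) / 2 + 1 = (w + 1) ^+ 2 / (2 * w) by field.
have c2 : cabs (2 : C) = 2 by have := cabs_pos (ler0n R 2); rewrite rmorph_nat.
rewrite !(cabsM, cabsV) c2 -!expr2.
have h : cabs (w - 1) ^+ 2 + cabs (w + 1) ^+ 2 = 2 * (cabs w ^+ 2 + 1).
  by rewrite !cabs_sqr !ReImE /=; ring.
rewrite -mulrDl h; field; by rewrite gt_eqF.
Qed.

Lemma jouk_root u : (u - zs u) * (u + zs u) = 1.
Proof. by rewrite -subr_sqr zs_sqr; ring. Qed.

Lemma jouk_root_neq0 u : u - zs u != 0.
Proof.
have := jouk_root u; apply: contra_eq_neq => ->; by rewrite mul0r eq_sym oner_neq0.
Qed.

Lemma jouk_inv u : (u - zs u)^-1 = u + zs u.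
Proof.
apply: (mulfI (jouk_root_neq0 u)); by rewrite jouk_root mulfV ?jouk_root_neq0.
Qed.

Lemma cfun_root u : cfun (u - zs u) = u.
Proof. by rewrite /cfun jouk_inv; field. Qed.

Lemma cabs_root_le1 u : cabs (u - zs u) <= 1.
Proof.
have := congr1 (@cabs R) (jouk_root u); rewrite cabsM cabs1 => E.
have h : cabs (u - zs u) <= cabs (u + zs u).
  rewrite -(@ler_pXn2r _ 2) ?nnegrE ?cabs_ge0 // !cabs_sqr.
  move: (zs u) ((rdot_zs u).1) => v; rewrite /rdot !(cReD,cImD,cReN,cImN); lra.
rewrite leNgt; apply/negP => h1; move: E; apply/eqP; rewrite gt_eqF //.
by apply: mulr_egt1 => //; exact: lt_le_trans h1 h.
Qed.

Lemma cabs_root_lt1 u : ~ slit u -> cabs (u - zs u) < 1.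
Proof.
move=> ns; have := congr1 (@cabs R) (jouk_root u); rewrite cabsM cabs1 => E.
have h : cabs (u - zs u) < cabs (u + zs u).
  rewrite -(@ltr_pXn2r _ 2) ?nnegrE ?cabs_ge0 // !cabs_sqr.
  move: (zs u) ((rdot_zs u).2 ns) => v; rewrite /rdot !(cReD,cImD,cReN,cImN); lra.
rewrite lt_neqAle cabs_root_le1 andbT; apply/eqP => e1.
by move: h E; rewrite e1 mul1r => h E; rewrite E ltxx in h.
Qed.

Lemma cfun_inj u w : w != 0 -> cabs w <= 1 -> cfun w = u -> ~ slit u -> w = u - zs u.
Proof.
move=> w0 w1 E ns.
have : (w - (u - zs u)) * (w - (u + zs u)) = 0.
  have -> : (w - (u - zs u)) * (w - (u + zs u)) = w ^+ 2 - 2 * u * w + (u ^+ 2 - zs u ^+ 2) by ring.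
  by rewrite zs_sqr -E /cfun; field.
move=> /eqP; rewrite mulf_eq0 => /orP[|]; rewrite subr_eq0 => /eqP // e.
exfalso; have := congr1 (@cabs R) (jouk_root u); rewrite cabsM cabs1 -e => h.
have := cabs_root_lt1 ns; have h0 : 0 < cabs w by rewrite cabs_gt0.
have := cabs_ge0 (u - zs u) => h2 h3.
have : cabs (u - zs u) * cabs w <= cabs (u - zs u) * 1 by rewrite ler_wpM2l.
rewrite h; lra.
Qed.

Lemma kap_root u : kap u = cR (cabs (u - zs u)).
Proof. by rewrite -{1}(cfun_root u) kap_cfun // jouk_root_neq0. Qed.

(** Links the focal description of the ellipses, used in all comparisons, with the Cartesian
    equation in [disc_data]. *)
Lemma kap_ellipse u r : 0 < r -> r < 1 -> kap u = cR r -> ellipse (cR r) (sR r) u.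
Proof.
move=> r0 r1; rewrite kap_root; set w := u - zs u => e.
have w0 : w != 0 := jouk_root_neq0 u.
have cw0 : 0 < cabs w by rewrite cabs_gt0.
have wr : cabs w = r.
  have : (cabs w - r) * (cabs w * r - 1) = 0.
    have := e; rewrite /cR; clearbody w; move=> /(congr1 (fun x : R => 2 * x * (cabs w * r))) h.
    have h1 : 2 * ((cabs w + (cabs w)^-1) / 2) * (cabs w * r) = (cabs w ^+ 2 + 1) * r.
      by field; rewrite gt_eqF.
    have h2 : 2 * ((r + r^-1) / 2) * (cabs w * r) = (r ^+ 2 + 1) * cabs w.
      by field; rewrite gt_eqF.
    by move: h; rewrite h1 h2; nra.
  move=> /eqP; rewrite mulf_eq0 => /orP[|]; rewrite subr_eq0 => /eqP // h.
  exfalso; have := cabs_root_le1 u; rewrite -/w => h3.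
  have : cabs w * r <= 1 * r by rewrite ler_wpM2r // ltW.
  rewrite h; lra.
have Eu : u = (w + w^-1) / 2 by rewrite -[LHS](cfun_root u).
clearbody w.
have wV : w^-1 = (Re w / r ^+ 2) +i* (- Im w / r ^+ 2).
  apply: (mulfI w0); rewrite mulfV //; have := cabs_sqr w; rewrite wr.
  case: (w) => a b /= h; apply: complex_ext; rewrite !ReImE /= ?h.
    by rewrite !mulrA -mulrBl mulrN opprK -!expr2 divff // -h expf_neq0 // gt_eqF.
  by ring.
have r0' : r != 0 by rewrite gt_eqF.
have Re2 : Re u = (Re w + Re w / r ^+ 2) / 2.
  have : Re (u + u) = Re (w + w^-1) by rewrite {1 2}Eu; congr Re; field.
  rewrite !cReD wV /=; lra.
have Im2 : Im u = (Im w - Im w / r ^+ 2) / 2.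
  have : Im (u + u) = Im (w + w^-1) by rewrite {1 2}Eu; congr Im; field.
  rewrite !cImD wV /= mulNr; lra.
have c0 : cR r != 0.
  rewrite /cR gt_eqF // divr_gt0 // addr_gt0 // invr_gt0 //.
have s0 : sR r != 0.
  have ri : 1 < r^-1 by rewrite invf_gt1.
  by rewrite /sR lt_eqF //; lra.
change ((Re u / cR r) ^+ 2 + (Im u / sR r) ^+ 2 = 1); rewrite Re2 Im2.
have -> : (Re w + Re w / r ^+ 2) / 2 / cR r = Re w / r.
  have -> : (Re w + Re w / r ^+ 2) / 2 = Re w / r * cR r by rewrite /cR; field.
  by rewrite mulfK.
have -> : (Im w - Im w / r ^+ 2) / 2 / sR r = Im w / r.
  have -> : (Im w - Im w / r ^+ 2) / 2 = Im w / r * sR r by rewrite /sR; field.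
  by rewrite mulfK.
by rewrite !expr_div_n -mulrDl -cabs_sqr wr divff // expf_neq0.
Qed.

Lemma cR_decr (r s : R) : 0 < r -> r < s -> s <= 1 -> cR s < cR r.
Proof.
move=> r0 rs s1; have s0 : 0 < s by exact: lt_trans rs.
rewrite /cR ltr_pM2r ?invr_gt0 // -subr_gt0.
have -> : r + r^-1 - (s + s^-1) = (s - r) * (1 - r * s) / (r * s).
  by field; rewrite !gt_eqF.
have h : r * s < 1 * s by rewrite ltr_pM2r //; lra.
apply: divr_gt0; last exact: mulr_gt0.
by apply: mulr_gt0; rewrite subr_gt0 //; lra.
Qed.

Lemma cR_lt (r s : R) : 0 < r -> r <= 1 -> 0 < s -> s <= 1 -> (cR s < cR r) = (r < s).
Proof.
move=> r0 r1 s0 s1; have [rs|rs] := ltP r s; first by rewrite cR_decr.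
apply/negbTE; rewrite -leNgt; move: rs; rewrite le_eqVlt => /predU1P[->//|rs].
by apply: ltW; exact: cR_decr.
Qed.

Lemma kap_slit u : slit u -> kap u = 1.
Proof.
move=> [i0 /andP[h1 h2]]; have eu : u = (Re u)%:C by exact: complex_ext.
rewrite /kap eu -[1]/((1 : R)%:C) -rmorphB -rmorphD !cabs_real ler0_norm ?ger0_norm; lra.
Qed.

Lemma kap_cont u (e : R) : 0 < e -> forall v, cabs (v - u) < e -> `|kap v - kap u| < e.
Proof.
move=> e0 v hv; have aux k : `|cabs (v + k) - cabs (u + k)| <= cabs (v - u).
  have -> : v - u = (v + k) - (u + k) by ring.
  rewrite ler_norml ler_cabs_dist andbT lerNl opprB cabs_sub; exact: ler_cabs_dist.
rewrite /kap -mulrBl normrM (gtr0_norm (_ : 0 < 2^-1)) ?invr_gt0 //.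
have := aux (-1); have := aux 1 => h1 h2.
have -> : cabs (v - 1) + cabs (v + 1) - (cabs (u - 1) + cabs (u + 1)) =
  (cabs (v - 1) - cabs (u - 1)) + (cabs (v + 1) - cabs (u + 1)) by ring.
have := ler_normD (cabs (v - 1) - cabs (u - 1)) (cabs (v + 1) - cabs (u + 1)); lra.
Qed.

End SquareRoot.

Transparent cint Cintegral.

(** * The contour shift *)

Section AlmostEverywhere.
Variable R : realType.
Local Notation C := R[i].
Local Notation ii := (imag_unit R).
Local Notation leb := (@lebesgue_measure R).

Lemma measurable_fun_countable (D N : set R) (u v : R -> R) : measurable D -> countable N ->
  measurable_fun D v -> (forall t, D t -> ~ N t -> u t = v t) -> measurable_fun D u.
Proof.
move=> mD cN mv uv.
have mset (A : set R) : countable A -> measurable A.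
  by apply: countable_measurable => t; exact: measurable_set1.
have mN := mset _ cN.
have E : D = (D `\` N) `|` (D `&` N).
  by apply/seteqP; split=> t; [have [|] := pselect (N t); [right|left] | case=> -[]].
rewrite E; apply/measurable_funU.
- exact: measurableD.
- exact: measurableI.
split.
  apply: (eq_measurable_fun v); last by apply: measurable_funS mv => // t [].
  by move=> t; rewrite inE => -[Dt Nt]; rewrite uv.
move=> _ Y _; apply: mset; apply: sub_countable cN; apply: subset_card_le.
by move=> t [[]].
Qed.

Lemma Cintegral_countable (D N : set R) (f g : R -> C) : measurable D -> countable N ->
  cintble leb D g -> (forall t, D t -> ~ N t -> f t = g t) ->
  Cintegral leb D f = Cintegral leb D g.
Proof.
move=> mD cN [ig1 ig2] fg.
have aux (h : C -> R) : leb.-integrable D (EFin \o (fun t => h (g t))) ->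
    Rintegral leb D (fun t => h (f t)) = Rintegral leb D (fun t => h (g t)).
  move=> ih; rewrite /Rintegral; congr fine.
  have mh : measurable_fun D (fun t => h (g t)) by apply/measurable_realfun.measurable_EFinP; exact: measurable_int ih.
  apply: ae_eq_integral => //; first last.
  - exists N; split.
    + by apply: countable_measurable => // t; exact: measurable_set1.
    + exact: countable_lebesgue_measure0.
    + move=> t /= /not_implyP[Dt /eqP h1]; apply: contrapT => Nt; apply: (elimN eqP h1).
      by rewrite /= fg.
  - exact: measurable_int ih.
  - apply/measurable_realfun.measurable_EFinP; apply: (@measurable_fun_countable D N _ _ mD cN mh) => t Dt Nt.
    by rewrite fg.
by rewrite /Cintegral (aux _ ig1) (aux _ ig2).
Qed.

(** Multiples of [pi] rather than [2 * pi] are enough, because only the countability of the fibers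
    is wanted. *)
Lemma cis_eq (s t : R) : cis s%:C = cis t%:C :> C -> exists j : int, s = t + j%:~R * pi.
Proof.
rewrite !cisE => -[c1 s1].
have /sin_eq0_int[j hj] : sin (s - t) = 0 by rewrite sinB c1 s1; ring.
by exists j; lra.
Qed.

Lemma countable_cis (w : C) : countable [set t : R | cis t%:C = w].
Proof.
have [[s hs]|ns] := pselect (exists s : R, cis s%:C = w); last first.
  have -> : [set t : R | cis t%:C = w] = set0; last exact: countable0.
  by rewrite -subset0 => t /= ht; apply: ns; exists t.
apply: (@sub_countable _ _ _ (range (fun j : int => s + j%:~R * pi))).
  apply: subset_card_le => t /= ht.
  have [j hj] := cis_eq (etrans ht (esym hs)); by exists j.
by apply: (sub_countable (card_image_le _ _)); exact: countableP.
Qed.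

(** Serves to replace the integrand of [Fcirc] by its holomorphic extension at the finitely many
    points where the cotangent has a default value. *)
Lemma circ_finite_congr (r : R) (s : seq C) (f g : C -> C) : r != 0 ->
  (forall t : R, ccont g (r%:C * cis t%:C)) ->
  (forall w, cabs w = `|r| -> w \notin s -> f w = g w) ->
  circ 0 r%:C f = circ 0 r%:C g.
Proof.
move=> r0 cg fg; rewrite /circ /cint.
apply: (@Cintegral_countable _ (\bigcup_(i in [set k : nat | (k < size s)%N])
   [set t : R | cis t%:C = nth 0 s i / r%:C])).
- exact: measurable_itv.
- by apply: bigcup_countable => [|i _]; [exact: finite_set_countable | exact: countable_cis].
- apply: (@icont_cintble _ (fun t => g (0 + r%:C * cis t) * (r%:C * (ii * cis t)))).
  by apply: circ_icont => t _; rewrite add0r.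
move=> t _ Nt; congr (_ * _); apply: fg; rewrite add0r.
  by rewrite cabsM cabs_real cabs_cis mulr1.
apply/negP => ts; apply: Nt; exists (index (r%:C * cis t%:C) s); first by rewrite /= index_mem.
rewrite /= nth_index //; field; by rewrite -cabs_gt0 cabs_real normr_gt0.
Qed.

End AlmostEverywhere.

Opaque cint Cintegral.

Section JointContinuity.
Variable R : realType.
Local Notation C := R[i].
Implicit Types (F G : C -> C -> C) (g : C -> C) (s t : C).

Lemma jcont_fst g s t : ccont g s -> jcont (fun a _ => g a) s t.
Proof. by move=> cg e e0; have [d d0 hd] := cg e e0; exists d => // a b /hd. Qed.

Lemma jcont_snd g s t : ccont g t -> jcont (fun _ b => g b) s t.
Proof. by move=> cg e e0; have [d d0 hd] := cg e e0; exists d => // a b _ /hd. Qed.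

Lemma jcont_comp g F s t : jcont F s t -> ccont g (F s t) -> jcont (fun a b => g (F a b)) s t.
Proof.
move=> cF cg e /cg[d1 /cF[d d0 hd] h1]; exists d => // a b ha hb; apply: h1; exact: hd.
Qed.

Lemma jcont_comp2 G F1 F2 s t : jcont F1 s t -> jcont F2 s t -> jcont G (F1 s t) (F2 s t) ->
  jcont (fun a b => G (F1 a b) (F2 a b)) s t.
Proof.
move=> c1 c2 cG e /cG[d d0 h]; have [e1 e10 h1] := c1 _ d0; have [e2 e20 h2] := c2 _ d0.
have [d' d'0 hd] := min2_gt0 e10 e20; exists d' => // a b /hd[a1 a2] /hd[b1 b2].
by apply: h; [exact: h1 | exact: h2].
Qed.

Lemma jcontM F G s t : jcont F s t -> jcont G s t -> jcont (fun a b => F a b * G a b) s t.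
Proof.
move=> cF cG e e0; set M := 1 + cabs (F s t) + cabs (G s t).
have a0 := cabs_ge0 (F s t); have b0 := cabs_ge0 (G s t).
have M0 : 0 < M by rewrite /M; lra.
have [k k0 hk] := min2_gt0 ltr01 (divr_gt0 e0 M0).
have [l l0 hl] : exists2 l, 0 < l & l < 1 /\ l < e / M.
  by exists (k / 2); [lra | apply: hk; lra].
clear hk.
have [e1 e10 h1] := cF _ l0; have [e2 e20 h2] := cG _ l0.
have [d d0 hd] := min2_gt0 e10 e20; exists d => // a b /hd[a1 a2] /hd[b1 b2].
have := h1 _ _ a1 b1; have := h2 _ _ a2 b2.
move: (F a b) (G a b) (F s t) (G s t) @M a0 b0 M0 hl => f' g' f g M a0 b0 M0 [l1 l2] hg hf.
rewrite ltr_pdivlMr // in l2.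
have -> : f' * g' - f * g = (f' - f) * (g' - g) + f * (g' - g) + (f' - f) * g by ring.
apply: (le_lt_trans (cabsD _ _)).
have := cabsD ((f' - f) * (g' - g)) (f * (g' - g)); rewrite !cabsM.
have p0 := cabs_ge0 (f' - f); have q0 := cabs_ge0 (g' - g).
move: (cabs (f' - f)) (cabs (g' - g)) (cabs f) (cabs g)
  (cabs ((f' - f) * (g' - g) + f * (g' - g))) @M M0 l2 p0 q0 a0 b0 hf hg =>
  p q a1' b1' x M M0 l2 p0 q0 a0 b0 hf hg hx.
have h3 : p * q <= l * 1 by apply: ler_pM => //; lra.
have h4 : a1' * q <= a1' * l by rewrite ler_wpM2l //; lra.
have h5 : p * b1' <= l * b1' by rewrite ler_wpM2r //; lra.
rewrite /M in l2; lra.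
Qed.

Lemma jcont_bounded F s t : jcont F s t -> exists d M : R, [/\ 0 < d, 0 <= M &
  forall a b, cabs (a - s) < d -> cabs (b - t) < d -> cabs (F a b) <= M].
Proof.
move=> /(_ _ ltr01)[d d0 hd]; exists d, (cabs (F s t) + 1); split => //.
  by have := cabs_ge0 (F s t); lra.
move=> a b ha hb; have := hd _ _ ha hb; have := cabsD (F a b - F s t) (F s t).
rewrite subrK; lra.
Qed.

Lemma jcont_fix1 F s t : jcont F s t -> ccont (F s) t.
Proof.
move=> cF e /cF[d d0 hd]; exists d => // b hb; apply: hd => //; by rewrite subrr cabs0.
Qed.

Lemma jcont_subst F (k : C -> C) s t : jcont F s (k t) -> ccont k t ->
  jcont (fun a b => F a (k b)) s t.
Proof.
move=> cF ck e /cF[d1 d10 h1]; have [d2 d20 h2] := ck _ d10.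
have [d d0 hd] := min2_gt0 d10 d20; exists d => // a b /hd[a1 _] /hd[_ /h2]; exact: h1.
Qed.

(** A tube lemma: the bounds near finitely many heights are accumulated by [interval_induction],
    with a shrinking radius and a growing constant. *)
Lemma jcont_strip_bounded F s (a b : R) : a <= b ->
  (forall t : R, a <= t <= b -> jcont F s t%:C) ->
  exists d M : R, [/\ 0 < d, 0 <= M & forall z (t : R), cabs (z - s) < d -> a <= t <= b ->
    cabs (F z t%:C) <= M].
Proof.
move=> ab cF; pose P (c : R) := exists d M : R, [/\ 0 < d, 0 <= M &
  forall z (t : R), cabs (z - s) < d -> a <= t <= c -> cabs (F z t%:C) <= M].
apply: (@interval_induction _ P a b) => //.
  have [|d [M [d0 M0 h]]] := jcont_bounded (cF a _); first by rewrite lexx.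
  exists d, M; split => // z t hz /andP[t1 t2]; apply: h => //.
  by have -> : t = a by [apply/eqP; rewrite eq_le t1 t2]; rewrite subrr cabs0.
move=> t tab; have [d [M [d0 M0 h]]] := jcont_bounded (cF t tab); exists d => // c c' _ _ hc hc'.
move=> [d' [M' [d'0 M'0 h']]]; have [k k0 hk] := min2_gt0 d0 d'0.
exists (k / 2), (M + M'); split; [lra | lra | move=> z u hz /andP[u1 u2]].
have [|z1 z2] := hk (cabs (z - s)); first lra.
have [uc|uc] := leP u c; first by have := h' z u z2; rewrite u1 uc => /(_ isT); lra.
have : cabs (F z u%:C) <= M; last lra.
apply: h => //; rewrite -rmorphB cabs_real; move: hc hc'; rewrite !ltr_norml => /andP[] ? ? /andP[] ? ?.
by apply/andP; split; lra.
Qed.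

End JointContinuity.

Section Integrand.
Variables (R : realType) (X1 X2 : rank_one_space R).
Local Notation C := R[i].
Local Notation ii := (imag_unit R).
Local Notation Re := complex.Re.
Local Notation Im := complex.Im.
Local Notation T := ('M[R]_((sdim X1).+1) * 'M[R]_((sdim X2).+1))%type.
Variables (mu : {measure set (borelT X1 X2) -> \bar R}) (phi : C -> C -> T -> C).
Hypotheses (mu_haar : haar_measure mu) (hphi : spherical_family phi).
Variables (f : T -> C) (y : T).
Hypotheses (hf : Cc_infty f) (hy : prodG y).
Local Notation P := (Psi mu phi f y).
Local Notation b1 := ((blen X1)%:C).
Local Notation b2 := ((blen X2)%:C).
Local Notation rho := (rhob X1).
Local Notation L := (Lval X1).
Hypothesis b1_gt0 : 0 < blen X1.
Variable Dt : C -> C.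
Hypotheses (hol_Dt : forall x, hol Dt x)
  (csin_Dt : forall x, csin rho%:C x = symprod (trho X1).-1 x * Dt x)
  (Dt_zero : forall x, Dt x = 0 -> singpt X1 x).
Implicit Types (z w u : C).

Definition argx z w : C := ii * (z * cfun w) / b1.

(** The integrand after the first product of [Ppol X1] has been cancelled against the sine in the
    cotangent. *)
Definition numer z w : C := psi mu phi f y z w *
  (- z ^+ 2 * cfun w * (Defs.sfun w / w) * symprod (mult_half X1)./2 (argx z w) *
   ccos rho%:C (argx z w) * ppol X2 (z * cfun (- ii * w))).

Definition denom z w : C := Dt (argx z w).

Lemma integrandE z w : symprod (trho X1).-1 (argx z w) != 0 ->
  psi mu phi f y z w * phiz X1 X2 z w = numer z w / denom z w.
Proof.
move=> n0; rewrite /phiz /numer /denom {1}/ppol -/(argx z w) PpolE.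
rewrite /qcot -/(argx z w) Ccot_csin csin_Dt.
move: (psi _ _ _ _ _ _) (ppol X2 _) (ccos _ _) (symprod (mult_half X1)./2 _) => p q c s.
(* At a genuine pole both sides are 0, by the convention on division. *)
have [->|D0] := eqVneq (Dt (argx z w)) 0; first by rewrite !(mulr0, invr0, mul0r).
by move: (Defs.sfun w / w) => k; field; apply/andP.
Qed.

Lemma cderiv_cfun w : w != 0 -> cderiv (@cfun R) w (Defs.sfun w / w).
Proof.
move=> w0; have := cderivM (cderivD (cderiv_id w) (cderivV w0)) (cderiv_cst (2^-1) w).
by congr cderiv; rewrite /Defs.sfun /id; field.
Qed.

Lemma hol_cfun w : w != 0 -> hol (@cfun R) w.
Proof. by move=> w0; exists (Defs.sfun w / w); exact: cderiv_cfun. Qed.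

Lemma hol_sfun w : w != 0 -> hol (@Defs.sfun R) w.
Proof.
move=> w0; rewrite /Defs.sfun; apply: holM => //; apply: holB => //; exact: holV.
Qed.

Lemma iiN_neq0 w : w != 0 -> - ii * w != 0.
Proof. by move=> w0; rewrite mulf_neq0 // oppr_eq0 ii_neq0. Qed.

Lemma hol_cfun_rot w : w != 0 -> hol (fun w => cfun (- ii * w)) w.
Proof.
move=> w0; apply: (@hol_comp _ (fun w => - ii * w)); first exact: holM.
by apply: hol_cfun; exact: iiN_neq0.
Qed.

Lemma hol_symprod (g : C -> C) N z : hol g z -> hol (fun w => symprod N (g w)) z.
Proof.
by move=> hg; apply: hol_prod => k; apply: holD => //; apply: holB.
Qed.

Lemma hol_ccos_comp (g : C -> C) c z : hol g z -> hol (fun w => ccos c (g w)) z.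
Proof. by move=> hg; apply: hol_comp => //; exact: hol_ccos. Qed.

Lemma hol_ppol2 (g : C -> C) z : hol g z -> hol (fun w => ppol X2 (g w)) z.
Proof. by move=> hg; apply: hol_Ppol; apply: holM => //; apply: holM. Qed.

Lemma hol_numer_w z w : w != 0 -> hol (numer z) w.
Proof.
move=> w0; have hc := hol_cfun w0; have hs := hol_sfun w0; have hr := hol_cfun_rot w0.
have hx : hol (argx z) w by apply: holM => //; apply: holM => //; exact: holM.
apply: holM.
  by apply: (Psi_comp mu_haar hphi hf hy); apply: holM.
apply: holM; last by apply: hol_ppol2; exact: holM.
apply: holM; last exact: hol_ccos_comp.
apply: holM; last exact: hol_symprod.
by apply: holM; [exact: holM | apply: holM => //; exact: holV].
Qed.

Lemma hol_denom_w z w : w != 0 -> hol (denom z) w.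
Proof.
move=> w0; apply: (@hol_comp _ (argx z)) => //.
by apply: holM => //; apply: holM => //; apply: holM => //; exact: hol_cfun.
Qed.

Lemma hol_numer_z z w : hol (numer^~ w) z.
Proof.
have hx : hol (argx^~ w) z by apply: holM => //; apply: holM => //; exact: holM.
apply: holM.
  by apply: (Psi_comp mu_haar hphi hf hy); apply: holM => //; apply: holM => //; exact: holM.
apply: holM; last by apply: hol_ppol2; exact: holM.
apply: holM; last exact: hol_ccos_comp.
apply: holM; last exact: hol_symprod.
apply: holM => //; apply: holM => //; apply: holN; exact: holX.
Qed.

Lemma hol_denom_z z w : hol (denom^~ w) z.
Proof.
apply: (@hol_comp _ (argx^~ w)) => //.
by apply: holM => //; apply: holM => //; exact: holM.
Qed.

Lemma jcont_argx z w : w != 0 -> jcont argx z w.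
Proof.
move=> w0; apply: jcontM; last by apply: jcont_fst; exact: ccont_cst.
apply: jcontM; first by apply: jcont_fst; exact: ccont_cst.
apply: jcontM; first by apply: jcont_fst; exact: ccont_id.
by apply: jcont_snd; apply: hol_ccont; exact: hol_cfun.
Qed.

Lemma jcont_numer z w : w != 0 -> jcont numer z w.
Proof.
move=> w0; have hx := jcont_argx z w0.
have jz (g : C -> C) : hol g z -> jcont (fun a _ => g a) z w.
  by move=> /hol_ccont; exact: jcont_fst.
have jw (g : C -> C) : hol g w -> jcont (fun _ b => g b) z w.
  by move=> /hol_ccont; exact: jcont_snd.
have hc := jw _ (hol_cfun w0); have hr := jw _ (hol_cfun_rot w0).
apply: jcontM.
  have [B [cB BG fB]] := compact_support hf.
  apply: (@jcont_comp2 _ P).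
  - by apply: jcontM => //; apply: jz; apply: holM => //; exact: holM.
  - by apply: jcontM => //; apply: jz; apply: holM => //; exact: holM.
  - exact: (Psi_jcont mu_haar hphi hf hy cB BG fB).
apply: jcontM; last first.
  apply: (@jcont_comp _ (ppol X2)); last by apply: hol_ccont; exact: hol_ppol2.
  by apply: jcontM => //; exact: (jz id).
apply: jcontM; last by apply: jcont_comp hx _; apply: hol_ccont; exact: hol_ccos.
apply: jcontM; last by apply: jcont_comp hx _; apply: hol_ccont; exact: (@hol_symprod id).
apply: jcontM; last by apply: jw; apply: holM; [exact: hol_sfun | exact: holV].
apply: jcontM => //; apply: jz; apply: holN; exact: holX.
Qed.

Lemma jcont_denom z w : w != 0 -> jcont denom z w.
Proof. by move=> w0; apply: jcont_comp (jcont_argx z w0) _; exact: hol_ccont. Qed.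

Lemma cfun_roots u w : w != 0 -> cfun w = u -> w = u - zs u \/ w = u + zs u.
Proof.
move=> w0 E; have : (w - (u - zs u)) * (w - (u + zs u)) = 0.
  have -> : (w - (u - zs u)) * (w - (u + zs u)) = w ^+ 2 - 2 * u * w + (u ^+ 2 - zs u ^+ 2) by ring.
  by rewrite zs_sqr -E /cfun; field.
by move=> /eqP; rewrite mulf_eq0 !subr_eq0 => /orP[] /eqP; [left|right].
Qed.

Lemma b1_neq0 : b1 != 0.
Proof. by rewrite -cabs_gt0 cabs_real gtr0_norm. Qed.

Lemma argx_cfun z w p : z != 0 -> argx z w = p -> cfun w = p * b1 / (ii * z).
Proof.
move=> z0 <-; rewrite /argx; field.
by rewrite b1_neq0 z0 ii_neq0.
Qed.

Lemma Fcirc_quot z (r : R) : z != 0 -> 0 < r -> (forall t : R, denom z (r%:C * cis t%:C) != 0) ->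
  Fcirc mu phi f y r z = circ 0 r%:C (fun w => numer z w / denom z w).
Proof.
move=> z0 r0 hd; rewrite /Fcirc circle_integralE.
have w0 (t : R) : r%:C * cis t%:C != 0 :> C by rewrite -cabs_gt0 cabsM cabs_cis mulr1 cabs_pos // ltW.
pose q p := p * b1 / (ii * z) : C.
(* [argx z w = p] means [cfun w = q p]; the exceptional points are the two preimages of each
   [q p]. *)
pose s := [seq q p - zs (q p) | p <- proots X1] ++ [seq q p + zs (q p) | p <- proots X1].
apply: (@circ_finite_congr _ _ s) => [|t|w wr ws]; first by rewrite gt_eqF.
  by apply: hol_ccont; apply: holM; [exact: hol_numer_w | apply: holV => //; exact: hol_denom_w].
have wn0 : w != 0 by rewrite -cabs_gt0 wr normr_gt0 gt_eqF.
apply: integrandE; rewrite -proots_prod; apply: contra ws.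
rewrite prodf_seq_eq0 => /hasP[p ps /=]; rewrite subr_eq0 => /eqP /(argx_cfun z0).
rewrite -/(q p) => /(cfun_roots wn0) h; rewrite mem_cat.
by apply/orP; case: h => ->; [left|right]; apply/mapP; exists p.
Qed.

End Integrand.

Section ContourShift.
Variables (R : realType) (X1 X2 : rank_one_space R).
Local Notation C := R[i].
Local Notation ii := (imag_unit R).
Local Notation Re := complex.Re.
Local Notation Im := complex.Im.
Local Notation T := ('M[R]_((sdim X1).+1) * 'M[R]_((sdim X2).+1))%type.
Variables (mu : {measure set (borelT X1 X2) -> \bar R}) (phi : C -> C -> T -> C).
Hypotheses (mu_haar : haar_measure mu) (hphi : spherical_family phi).
Variables (f : T -> C) (y : T).
Hypotheses (hf : Cc_infty f) (hy : prodG y).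
Local Notation P := (Psi mu phi f y).
Local Notation b1 := ((blen X1)%:C).
Local Notation b2 := ((blen X2)%:C).
Local Notation rho := (rhob X1).
Local Notation L := (Lval X1).
Hypothesis b1_gt0 : 0 < blen X1.
Hypotheses (m1_odd : odd (mult_beta X1)) (m2_even : ~~ odd (mult_beta X2)).
Implicit Types (z w u : C).

Lemma real_complexM (r s : R) : (r * s)%:C = r%:C * s%:C :> C.
Proof. exact: rmorphM. Qed.

Lemma real_complexV (r : R) : (r^-1)%:C = (r%:C)^-1 :> C.
Proof. exact: fmorphV. Qed.

Lemma LvalE (l : nat) : L l = blen X1 * (rho + l%:R).
Proof. by rewrite /Lval ltNge le0z_nat. Qed.

Lemma Lval_gt0 (l : nat) : 0 < L l.
Proof.
rewrite LvalE mulr_gt0 //; have := rho_ge X1; have := ler0n R l; lra.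
Qed.

Lemma Lval_inj (l k : nat) : L l = L k -> l = k.
Proof.
rewrite !LvalE => /(mulfI (lt0r_neq0 b1_gt0)) /addrI /eqP; by rewrite eqr_nat => /eqP.
Qed.

Definition upt (l : int) z : C := ii * (L l)%:C / z.

Lemma ii_V : ii^-1 = - ii :> C.
Proof. by apply: (mulfI (ii_neq0 R)); rewrite mulfV ?ii_neq0 // mulrN ii2 opprK. Qed.

Lemma argx_upt (l : nat) z w : z != 0 -> cfun w = upt l z -> argx X1 z w = - (rho + l%:R)%:C.
Proof.
move=> z0 E; rewrite /argx E /upt LvalE !real_complexM.
have := b1_neq0 b1_gt0; move: (b1) (_ + _)%:C => b x b0.
have -> : ii * (z * (ii * (b * x) / z)) / b = (ii * ii) * x by field; rewrite b0.
by rewrite ii2 mulN1r.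
Qed.

Lemma argxN z w : argx X1 z (- w) = - argx X1 z w.
Proof. by rewrite /argx /cfun invrN; ring. Qed.

Lemma cfunN w : cfun (- w) = - cfun w.
Proof. by rewrite /cfun invrN; ring. Qed.

Lemma kapN u : kap (- u) = kap u.
Proof.
have h1 : - u - 1 = - (u + 1) by ring.
have h2 : - u + 1 = - (u - 1) by ring.
by rewrite /kap h1 h2 !cabsN addrC.
Qed.

Lemma singpt_cfun z w : z != 0 -> singpt X1 (argx X1 z w) ->
  exists l : nat, cfun w = upt l z \/ cfun w = - upt l z.
Proof.
move=> z0 [l h]; exists l.
have aux p : argx X1 z w = p -> cfun w = - p * b1 * ii / z.
  move=> /(argx_cfun b1_gt0 z0) ->; rewrite invfM ii_V; ring.
by case: h => /aux ->; [right|left]; rewrite /upt LvalE real_complexM; ring.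
Qed.

Lemma ppol1E (l : nat) : ppol X1 (ii * (L l)%:C) = Ppol X1 (- (rho + l%:R)%:C).
Proof.
rewrite /ppol LvalE real_complexM; congr Ppol; rewrite mulrA ii2; field; exact: b1_neq0.
Qed.

Lemma Ppol1N x : Ppol X1 (- x) = Ppol X1 x.
Proof.
rewrite PpolN -signr_odd; have := m1_odd; case: (mult_beta X1) => // k /= hk.
by rewrite (negbTE hk) mul1r.
Qed.

Lemma ppol2N x : ppol X2 (- x) = - ppol X2 x.
Proof.
rewrite /ppol mulrN mulNr PpolN -signr_odd; have := m2_even; have := mult_beta_gt0 X2.
by case: (mult_beta X2) => // k _ /=; rewrite negbK => ->; rewrite expr1 mulN1r.
Qed.

Lemma psiN z w : psi mu phi f y z (- w) = psi mu phi f y z w.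
Proof.
have E1 (a : C) : a * cfun (- w) = - (a * cfun w) by rewrite cfunN mulrN.
have E2 (a : C) : a * cfun (- ii * - w) = - (a * cfun (- ii * w)) by rewrite mulrN cfunN mulrN.
rewrite /psi E1 E2; exact: (Psi_even mu hphi hf hy).
Qed.

Variable Dt : C -> C.
Hypotheses (hol_Dt : forall x, hol Dt x)
  (csin_Dt : forall x, csin rho%:C x = symprod (trho X1).-1 x * Dt x)
  (Dt_zero : forall x, Dt x = 0 -> singpt X1 x).
Local Notation denom := (denom X1 Dt).
Local Notation numer := (numer mu phi f y).

(** The chain rule at a pole: the derivative of [Dt] at a zero times that of [argx z]. *)
Definition ddenom z w : C := pi%:C * ccos rho%:C (argx X1 z w) / symprod (trho X1).-1 (argx X1 z w) *
  (ii * (z * (Defs.sfun w / w)) / b1).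

Lemma cderiv_denom z w : w != 0 -> singpt X1 (argx X1 z w) -> cderiv (denom z) w (ddenom z w).
Proof.
move=> w0 /(plancherel_derivative hol_Dt csin_Dt)[_ _ hD].
apply: (@cderiv_comp _ (argx X1 z)) hD.
have := cderivM (cderivM (cderiv_cst ii w) (cderivM (cderiv_cst z w) (cderiv_cfun w0))) (cderiv_cst b1^-1 w).
by congr cderiv; ring.
Qed.

Lemma ddenom_neq0 z w : z != 0 -> w != 0 -> Defs.sfun w != 0 -> singpt X1 (argx X1 z w) ->
  ddenom z w != 0.
Proof.
move=> z0 w0 s0 /(plancherel_derivative hol_Dt csin_Dt)[p0 D0 _].
have c0 : ccos rho%:C (argx X1 z w) != 0 by apply: csin_ccos; rewrite csin_Dt D0 mulr0.
have pi0 : (pi%:C : C) != 0 by rewrite -cabs_gt0 cabs_real normr_gt0 gt_eqF ?pi_gt0.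
rewrite /ddenom mulf_neq0 //.
  by apply: mulf_neq0; [exact: mulf_neq0 | exact: invr_neq0].
apply: mulf_neq0; last by apply: invr_neq0; exact: b1_neq0.
apply: mulf_neq0; first exact: ii_neq0.
by apply: mulf_neq0 => //; apply: mulf_neq0 => //; exact: invr_neq0.
Qed.

(** The factor [s(w) / w] of [phiz] is the derivative of [cfun], so it cancels against the one in
    [ddenom]; the cofactor of the sine recombines with the second product into [Ppol X1]. *)
Lemma residueE z w : z != 0 -> w != 0 -> Defs.sfun w != 0 -> singpt X1 (argx X1 z w) ->
  numer z w / ddenom z w = ii * (z * cfun w) * b1 / pi%:C * Ppol X1 (argx X1 z w) *
    ppol X2 (z * cfun (- ii * w)) * psi mu phi f y z w.
Proof.
move=> z0 w0 s0 /(plancherel_derivative hol_Dt csin_Dt)[p0 D0 _].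
have c0 : ccos rho%:C (argx X1 z w) != 0 by apply: csin_ccos; rewrite csin_Dt D0 mulr0.
have pi0 : (pi%:C : C) != 0 by rewrite -cabs_gt0 cabs_real normr_gt0 gt_eqF ?pi_gt0.
have bn := b1_neq0 b1_gt0; rewrite /numer /ddenom PpolE.
move: (ppol X2 _) (psi _ _ _ _ _ _) (symprod (mult_half X1)./2 _) => q p s.
move: (symprod _ _) p0 (ccos _ _) c0 (pi%:C : C) pi0 (b1) bn (cfun w) (Defs.sfun w) s0.
move=> S S0 c c0 pp pp0 b b0 cw sw sw0.
transitivity (- ii^-1 * (z * cw) * b / pp * (S * s) * q * p); last by rewrite ii_V opprK.
by field; rewrite pp0 c0 z0 sw0 w0 b0 S0 ii_neq0.
Qed.

Lemma sfun_root u : Defs.sfun (u - zs u) = - zs u.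
Proof. by rewrite /Defs.sfun jouk_inv; field. Qed.

Lemma cfun_rot w : cfun (- ii * w) = - ii * Defs.sfun w.
Proof. by rewrite /cfun /Defs.sfun invfM invrN ii_V opprK; ring. Qed.

(** Under [w |-> - w] the factors [cfun] and [ppol X2] are odd, while [Ppol X1] and [psi] are even,
    so the two residues agree. The parities of both multiplicities enter here. *)
Lemma residue_root (l : nat) z (w := upt l z - zs (upt l z)) : z != 0 -> ~ slit (upt l z) ->
  2 * pi%:C * ii * (numer z w / ddenom z w) = Gfun mu phi f y l z (zeta_plus X1 l z) /\
  2 * pi%:C * ii * (numer z (- w) / ddenom z (- w)) = Gfun mu phi f y l z (zeta_plus X1 l z).
Proof.
move=> z0 ns; have w0 : w != 0 := jouk_root_neq0 _.
have hc : cfun w = upt l z := cfun_root _.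
have hs : Defs.sfun w = - zs (upt l z) := sfun_root _.
have s0 : Defs.sfun w != 0 by rewrite hs oppr_eq0 zs_neq0.
have ha := argx_upt z0 hc.
have zu : z * upt l z = ii * (L l)%:C by rewrite /upt; field.
have sg : singpt X1 (argx X1 z w) by exists l; right.
have sgN : singpt X1 (argx X1 z (- w)) by exists l; left; rewrite argxN ha opprK.
have sN : Defs.sfun (- w) = - Defs.sfun w by rewrite /Defs.sfun invrN; ring.
have q2 : ppol X2 (- ii * z * zs (upt l z)) = - ppol X2 (z * cfun (- ii * w)).
  rewrite -ppol2N cfun_rot hs; congr ppol; ring.
rewrite !residueE ?sN ?oppr_eq0 // argxN Ppol1N psiN cfunN hc.
rewrite /Gfun -[ii * _ / z - _]/w q2 ppol1E -ha !cfun_rot sN.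
have -> : z * (- ii * - Defs.sfun w) = - (z * (- ii * Defs.sfun w)) by ring.
rewrite ppol2N mulrN zu real_complexM real_complexV.
have E : ii * (ii * (L l)%:C) = - (L l)%:C by rewrite mulrA ii2 mulN1r.
have EN : ii * (z * - upt l z) = (L l)%:C by rewrite !mulrN zu E opprK.
by rewrite E EN; split; ring.
Qed.

(** Since [kap] of a pole value is [cR] of the modulus of its root and [cR] decreases on [(0, 1]],
    the hypotheses on [kap] say which poles lie in the annulus. The factor 2 counts the pairs [w],
    [- w]. *)
Lemma contour_shift z (r : R) (n : nat) : z != 0 -> 0 < r -> r < 1 ->
  (forall l : nat, (l <= n)%N -> kap (upt l z) < cR r) ->
  (forall l : nat, (n < l)%N -> cR r < kap (upt l z)) ->
  (forall l : nat, (l <= n)%N -> ~ slit (upt l z)) ->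
  Fcirc mu phi f y 1 z = Fcirc mu phi f y r z +
    2 * \sum_(l < n.+1) Gfun mu phi f y l z (zeta_plus X1 l z).
Proof.
move=> z0 r0 r1 klt kgt ns; pose w (l : nat) := upt l z - zs (upt l z).
have cw l : cfun (w l) = upt l z := cfun_root _.
have w0 l : w l != 0 := jouk_root_neq0 _.
have cR1 : cR 1 = 1 :> R by rewrite /cR invr1; field.
have cabs_w l : (l <= n)%N -> r < cabs (w l) /\ cabs (w l) < 1.
  move=> ln; split; last exact: cabs_root_lt1 (ns _ ln).
  rewrite -(@cR_lt _ r) ?cabs_gt0 ?w0 ?cabs_root_le1 ?(ltW r1) //.
  rewrite -kap_root; exact: klt.
have u_inj (l k : nat) : upt l z = upt k z -> l = k.
  rewrite /upt => /(mulIf (invr_neq0 z0)) /(mulfI (ii_neq0 R)) [] ?; exact: Lval_inj.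
have u_opp (l k : nat) : upt l z <> - upt k z.
  rewrite /upt -mulNr => /(mulIf (invr_neq0 z0)); rewrite -mulrN => /(mulfI (ii_neq0 R)) [] h _.
  have := Lval_gt0 l; have := Lval_gt0 k; lra.
have den_root v : r <= cabs v <= 1 -> denom z v = 0 ->
    exists2 l, (l <= n)%N & v = w l \/ v = - w l.
  move=> /andP[v1 v2] /Dt_zero /(singpt_cfun z0)[l hl].
  have cv : 0 < cabs v by exact: lt_le_trans v1.
  have v0 : v != 0 by rewrite -cabs_gt0.
  have kv : kap (upt l z) = cR (cabs v) by case: hl => h; rewrite -(kap_cfun v0) h ?kapN.
  have ln : (l <= n)%N.
    rewrite leqNgt; apply/negP => /kgt; rewrite kv cR_lt // ?(ltW r1) // => h.
    by have := lt_le_trans h v1; rewrite ltxx.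
  exists l => //; case: hl => h; [left|right].
    exact: cfun_inj v0 v2 h (ns _ ln).
  apply: oppr_inj; rewrite opprK; apply: cfun_inj (ns _ ln) => //; first by rewrite oppr_eq0.
    by rewrite cabsN.
  by rewrite cfunN h opprK.
have den_circ (v : C) : cabs v = r \/ cabs v = 1 -> denom z v != 0.
  move=> cv; apply/eqP => /den_root[|l /cabs_w[h1 h2] h].
    by case: cv => ->; rewrite lexx ?ltW.
  have cvw : cabs v = cabs (w l) by case: h => ->; rewrite ?cabsN.
  by rewrite -cvw in h1 h2; case: cv => e; [move: h1|move: h2]; rewrite e ltxx.
rewrite !(@Fcirc_quot _ _ _ _ _ mu_haar hphi _ _ hf hy b1_gt0 Dt) //; first last.
- by move=> t; apply: den_circ; right; rewrite cabsM cabs_cis mulr1 cabs1.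
- by move=> t; apply: den_circ; left; rewrite cabsM cabs_cis mulr1 cabs_pos // ltW.
pose s := [seq w l | l <- index_iota 0 n.+1] ++ [seq - w l | l <- index_iota 0 n.+1].
apply/eqP; rewrite [X in _ == X]addrC -subr_eq; apply/eqP.
have in_s v : v \in s -> exists2 l, (l <= n)%N & v = w l \/ v = - w l.
  rewrite mem_cat => /orP[] /mapP[l]; rewrite mem_index_iota => /andP[_ ln] ->; exists l => //.
    by left.
  by right.
have hol_near_of (g : C -> C) v : (forall v, v != 0 -> hol g v) -> r <= cabs v <= 1 -> hol_near g v.
  move=> hg /andP[v1 _]; have v0 : 0 < cabs v by exact: lt_le_trans v1.
  exists (cabs v) => // u hu; apply: hg; apply: contraTneq hu => ->.
  by rewrite sub0r cabsN ltxx.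
rewrite (@residue_annulus _ r s _ _ (ddenom z)) //; first last.
- move=> v hv /(den_root _ hv)[l ln h]; rewrite mem_cat; apply/orP.
  by case: h => ->; [left|right]; apply/mapP; exists l; rewrite ?mem_index_iota.
- move=> v /in_s[l ln h]; have [h1 h2] := cabs_w _ ln.
  have cv : cabs v = cabs (w l) by case: h => ->; rewrite ?cabsN.
  have v0 : v != 0 by case: h => ->; rewrite ?oppr_eq0.
  have sw : Defs.sfun (w l) != 0 by rewrite sfun_root oppr_eq0 zs_neq0 //; exact: ns.
  have sv : Defs.sfun v != 0.
    case: h => -> //; have -> : Defs.sfun (- w l) = - Defs.sfun (w l).
      by rewrite /Defs.sfun invrN; ring.
    by rewrite oppr_eq0.
  have sg : singpt X1 (argx X1 z v).
    have := argx_upt z0 (cw l); case: h => -> e; exists l; [right|left] => //.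
    by rewrite argxN e opprK.
  split; rewrite ?cv //.
  + by have [] := plancherel_derivative hol_Dt csin_Dt sg.
  + exact: cderiv_denom.
  + exact: ddenom_neq0.
- by move=> v; apply: hol_near_of => v'; exact: hol_denom_w.
- by move=> v; apply: hol_near_of => v'; exact: (hol_numer_w mu_haar hphi hf hy).
- rewrite cat_uniq !map_inj_in_uniq ?iota_uniq //; first last.
  + by move=> l k _ _ /(congr1 (@cfun R)); rewrite !cw => /u_inj.
  + by move=> l k _ _ /oppr_inj /(congr1 (@cfun R)); rewrite !cw => /u_inj.
  rewrite andTb andbT; apply/hasPn => v /mapP[l _ ->]; apply/negP => /mapP[k _].
  by move=> /(congr1 (@cfun R)); rewrite cfunN !cw => /esym; exact: u_opp.
rewrite [in LHS]/s big_cat 2!big_map 2!big_mkord /= -big_split mulr_sumr [RHS]mulr_sumr.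
apply: eq_bigr => l _; have [e1 e2] := residue_root z0 (ns l (ltn_ord l)).
rewrite mulrDr real_complexM; have -> : (2 : R)%:C = 2 :> C by rewrite rmorph_nat.
rewrite -/(w l) in e1 e2; rewrite /w in e1 e2 *; rewrite e1 e2; ring.
Qed.

End ContourShift.

(** * The discs W_v, the cuts and the confocal ellipses *)

Section Geometry.
Variables (R : realType) (X1 : rank_one_space R).
Local Notation C := R[i].
Local Notation ii := (imag_unit R).
Local Notation Re := complex.Re.
Local Notation Im := complex.Im.
Local Notation rho := (rhob X1).
Local Notation L := (Lval X1).
Hypothesis b1_gt0 : 0 < blen X1.
Variables (rr dd : R -> R).
Hypothesis discs : disc_data X1 rr dd.
Local Notation W := (Wdisc dd).
Implicit Types (z w u : C).

(** The slit plane on which [F] is holomorphic, without 0, since the pole values [upt] are quotients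
    by [z]. *)
Definition offaxis z := z != 0 /\ (Re z <> 0 \/ `|Im z| < L 0).

Lemma offaxis_near z : offaxis z -> exists2 d : R, 0 < d & forall w, cabs (w - z) < d -> offaxis w.
Proof.
move=> [z0 h]; have c0 : 0 < cabs z by rewrite cabs_gt0.
have [e e0 he] : exists2 e : R, 0 < e & forall w, cabs (w - z) < e -> Re w <> 0 \/ `|Im w| < L 0.
  case: h => h.
    exists `|Re z|; first by rewrite normr_gt0; exact/eqP.
    move=> w hw; left=> rw; have := Re_le_cabs (w - z).
    by rewrite cReD cReN rw sub0r normrN leNgt hw.
  exists (L 0 - `|Im z|); first by rewrite subr_gt0.
  move=> w hw; right; have := Im_le_cabs (w - z); rewrite cImD cImN.
  have := ler_normD (Im w - Im z) (Im z); rewrite subrK; lra.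
have [d d0 hd] := min2_gt0 c0 e0; exists d => // w /hd[h1 h2]; split; last exact: he.
by apply: contraTneq h1 => ->; rewrite sub0r cabsN ltxx.
Qed.

Lemma Lval_le (k l : nat) : (k <= l)%N -> L k <= L l.
Proof. by move=> kl; rewrite !LvalE ler_pM2l // lerD2l ler_nat. Qed.

Lemma slit_upt (l : nat) z : z != 0 -> slit (upt X1 l z) -> Re z = 0 /\ L l <= `|Im z|.
Proof.
move=> z0 [i0 /andP[h1 h2]]; set u := upt X1 l z in i0 h1 h2.
have zu : z * u = ii * (L l)%:C by rewrite /u /upt; field.
have eu : u = (Re u)%:C by exact: complex_ext.
clearbody u; have hR := congr1 (@complex.Re R) zu; have hI := congr1 (@complex.Im R) zu.
rewrite eu !ReImE /= !(mulr0, mul0r, subr0, addr0, mul1r) in hR hI.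
have L0 := Lval_gt0 b1_gt0 l.
have e1 : Im z * Re u = L l by lra.
have u0 : Re u != 0 by apply: contraTneq L0 => e; rewrite -e1 e mulr0 ltxx.
split; first by apply: (mulIf u0); rewrite mul0r; lra.
have : `|Im z| * `|Re u| = L l by rewrite -normrM e1 gtr0_norm.
have : `|Im z| * `|Re u| <= `|Im z| * 1 by rewrite ler_wpM2l // ler_norml h1 h2.
lra.
Qed.

Lemma offaxis_slit (l : nat) z : offaxis z -> ~ slit (upt X1 l z).
Proof. by move=> [z0 h] /(slit_upt z0)[h1 h2]; case: h => //; rewrite ltNge (le_trans (Lval_le (leq0n l))). Qed.

Lemma offcut_offaxis z : Im z < 0 -> ~ neg_imag_cut X1 z -> offaxis z.
Proof.
move=> i0 nc; split; first by apply: contraTneq i0 => ->; rewrite ltxx.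
have [r0|] := eqVneq (Re z) 0; last by left; exact/eqP.
right; rewrite ltr0_norm // ltNge; apply/negP => h; apply: nc; split => //; lra.
Qed.

Lemma WdiscE v z : W v z <-> cabs (z - ibelow v) < dd v.
Proof. by rewrite /Wdisc /= cabsE ltcR. Qed.

Lemma LvalS (n : nat) : L (n%:Z + 1) = L n.+1.
Proof. by rewrite -PoszD addn1. Qed.

Lemma Lval_N1 : L (-1) = 0.
Proof. by []. Qed.

Lemma Lval_unbounded v : exists n : nat, v < L n.
Proof.
pose n := Num.Def.archi_bound `|v / blen X1|; exists n; rewrite LvalE mulrC -ltr_pdivrMr //.
have h : v / blen X1 < n%:R.
  by apply: le_lt_trans (ler_norm _) _; exact: (archi_boundP (normr_ge0 _)).
have := rho_ge X1; lra.
Qed.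

Lemma level v : 0 < v -> exists2 m : int, -1 <= m & L m <= v < L (m + 1).
Proof.
move=> v0; have [n hn] := Lval_unbounded v.
elim: n hn => [|n IH] hn; first by exists (-1) => //; rewrite Lval_N1 ltW.
have [/IH//|h] := ltP v (L n); exists n%:Z => //; by rewrite LvalS h.
Qed.

Lemma dd_gt0 v : 0 < v -> 0 < dd v.
Proof. by move=> v0; have [m m1 hm] := level v0; have [] := discs v0 m1 hm. Qed.

Lemma int_ge0_nat (m : int) : 0 <= m -> exists n : nat, m = n.
Proof. by case: m => // n _; exists n. Qed.

Lemma Wdisc_axis v z : 0 < v -> W v z -> Re z = 0 -> Im z <= 0.
Proof.
move=> v0 hz r0; have [m m1 hm] := level v0; have [_ [h1 h2]] := discs v0 m1 hm.
have [m0|] := ltP m 0.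
  have e : m = -1 by lia.
  by have /andP[? _] := h1 e z hz r0; lra.
move=> m0; have [_ _ _ _ [a1 a2]] := h2 m0.
have [n en] := int_ge0_nat m0; subst m.
(* Uses [rho >= 1 / 2]: even a disc centered at [-i L n] does not meet the positive imaginary
   axis. *)
have hb : 0 <= L n - blen X1 / 2.
  rewrite LvalE; have -> : blen X1 * (rho + n%:R) - blen X1 / 2 = blen X1 * (rho + n%:R - 1 / 2) by ring.
  by rewrite mulr_ge0 ?(ltW b1_gt0) //; have := rho_ge X1; have := ler0n R n; lra.
case/andP: hm => /[dup] hm; rewrite le_eqVlt => /predU1P[e|lt] _.
  by have /andP[? _] := a2 (esym e) z hz r0; lra.
by have /andP[? _] := a1 lt z hz r0; have := Lval_gt0 b1_gt0 n; lra.
Qed.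

Lemma ibelow_sub v (a b : R) : (a +i* b) - ibelow v = a +i* (b + v).
Proof. by apply: complex_ext; rewrite /ibelow !ReImE /=; ring. Qed.

(** The data constrain only the trace of the disc on the axis. As the center lies on the axis, a
    disc reaching the real line would contain a point [i e] with [e > 0]. *)
Lemma Wdisc_lower v z : 0 < v -> W v z -> Im z < 0.
Proof.
move=> v0 hz; rewrite ltNge; apply/negP => i0.
have h1 : cabs (0 +i* (Im z + v)) < dd v.
  apply: le_lt_trans (_ : cabs (z - ibelow v) < _); last exact/WdiscE.
  have -> : z - ibelow v = (Re z) +i* (Im z + v) by rewrite -ibelow_sub; case: (z).
  by rewrite -(@ler_pXn2r _ 2) ?nnegrE ?cabs_ge0 // !cabs_sqr /= expr0n /= add0r lerDr sqr_ge0.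
have c1 : cabs (0 +i* (Im z + v)) = Im z + v.
  have -> : 0 +i* (Im z + v) = ii * (Im z + v)%:C by apply: complex_ext; rewrite !ReImE /=; ring.
  by rewrite cabsM cabs_i mul1r cabs_pos //; lra.
(* A positive height with [e + v < dd v]. *)
rewrite c1 in h1; pose e := (dd v - (Im z + v)) / 2.
have : W v (0 +i* e).
  apply/WdiscE; rewrite ibelow_sub.
  have -> : 0 +i* (e + v) = ii * (e + v)%:C by apply: complex_ext; rewrite !ReImE /=; ring.
  by rewrite cabsM cabs_i mul1r cabs_pos /e; lra.
by move=> /(Wdisc_axis v0) /= /(_ erefl); rewrite /e; lra.
Qed.

Lemma Wdisc_segment v z (t : R) : W v z -> 0 <= t <= 1 -> W v (ibelow v + t%:C * (z - ibelow v)).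
Proof.
move=> /WdiscE hz /andP[t0 t1]; apply/WdiscE; rewrite [_ + _ * _ - _]addrAC subrr add0r.
rewrite cabsM cabs_pos //; apply: le_lt_trans hz.
by rewrite -[leRHS]mul1r ler_wpM2r // cabs_ge0.
Qed.

(** [kap - c] is continuous and has no zero along the segment, so its sign is transported from [z0]
    to [z]. *)
Lemma kap_side (l : nat) z0 z (c : R) :
  (forall t : R, 0 <= t <= 1 -> z0 + t%:C * (z - z0) != 0 /\ kap (upt X1 l (z0 + t%:C * (z - z0))) <> c) ->
  (kap (upt X1 l z0) < c -> kap (upt X1 l z) < c) /\ (c < kap (upt X1 l z0) -> c < kap (upt X1 l z)).
Proof.
move=> h; pose g (t : R) := kap (upt X1 l (z0 + t%:C * (z - z0))).
have g0 : g 0 = kap (upt X1 l z0) by rewrite /g mul0r addr0.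
have g1 : g 1 = kap (upt X1 l z) by rewrite /g mul1r addrC subrK.
have loc (t : R) : 0 <= t <= 1 -> exists2 d : R, 0 < d & forall s : R, `|s - t| < d -> `|g s - g t| < `|g t - c|.
  move=> t01; have [n0 nc] := h t t01.
  have e0 : 0 < `|g t - c| by rewrite normr_gt0 subr_eq0; exact/eqP.
  have cu : ccont (fun s => upt X1 l (z0 + s * (z - z0))) t%:C.
    apply: hol_ccont; apply: holM => //; apply: holV => //; apply: holD => //; exact: holM.
  have [d d0 hd] := cu _ e0; exists d => // s hs; apply: kap_cont => //.
  by apply: hd; rewrite -rmorphB cabs_real.
have nz (s t : R) : `|g s - g t| < `|g t - c| -> (g s < c) = (g t < c).
  rewrite ltr_norml => /andP[]; have [k|k|k] := ltrgtP (g t) c.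
  - by move=> ? ?; apply/idP; lra.
  - by move=> ? ?; apply/negbTE; rewrite -leNgt; lra.
  - by move=> ? ?; exfalso; lra.
have P : (g 0 < c) = (g 1 < c).
  apply: (@interval_induction _ (fun t => (g 0 < c) = (g t < c)) 0 1) => //.
  move=> t t01; have [d d0 hd] := loc t t01; exists d => // s s' _ _ /hd/nz e1 /hd/nz e2.
  by rewrite e1 e2.
rewrite -g0 -g1; split; first by rewrite P.
have n1 : g 1 <> c by have [] := h 1; rewrite ?ler01 ?lexx.
move=> c0; have : ~~ (g 1 < c) by rewrite -P -leNgt ltW.
by rewrite -leNgt le_eqVlt => /predU1P[e|//]; exfalso; exact: n1.
Qed.

Lemma upt_center (l : nat) v : 0 < v -> upt X1 l (ibelow v) = - (L l / v)%:C.
Proof.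
move=> v0; have v0' : (v%:C : C) != 0 by rewrite -cabs_gt0 cabs_real gtr0_norm.
by rewrite /upt /ibelow real_complexM real_complexV; field; rewrite v0' ii_neq0.
Qed.

Lemma kap_pos (x : R) : 1 <= x -> kap (x%:C : C) = x.
Proof.
by move=> x1; rewrite /kap -[1]/((1 : R)%:C) -rmorphB -rmorphD !cabs_real !ger0_norm; lra.
Qed.

Lemma level_nat (n : nat) : L n <= L n < L (n%:Z + 1).
Proof. by rewrite lexx LvalS !LvalE ltr_pM2l // ltrD2l ltr_nat /=. Qed.

(** At the center [upt l] is [- L l / L n]: it lies on the slit for [l <= n], where [kap] is 1, and
    for [l > n] its [kap] is at least [(rho + n + 1) / (rho + n)], beyond the bound on [cR]. The
    separation persists on the disc because [kap = cR] would put a point of [sing1] on a forbidden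
    ellipse. *)
Lemma disc_kap (n : nat) z : W (L n) z ->
  (forall l : nat, (l <= n)%N -> kap (upt X1 l z) < cR (rr (L n))) /\
  (forall l : nat, (n < l)%N -> cR (rr (L n)) < kap (upt X1 l z)).
Proof.
move=> hz; have v0 := Lval_gt0 b1_gt0 n; have [_ [_ /(_ isT)]] := discs v0 (isT : -1 <= n%:Z) (level_nat n).
set r := rr (L n); move=> [/andP[r0 r1] _ hc hsing _].
have cR1 : 1 < cR r by have := cR_decr r0 r1 (lexx _); rewrite {1}/cR invr1; lra.
have seg (l : nat) (t : R) : 0 <= t <= 1 -> let zt := ibelow (L n) + t%:C * (z - ibelow (L n)) in
    zt != 0 /\ kap (upt X1 l zt) <> cR r.
  move=> t01 zt; have Wt := Wdisc_segment hz t01; rewrite -/zt in Wt.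
  have zt0 : zt != 0 by apply: contraTneq (Wdisc_lower v0 Wt) => ->; rewrite ltxx.
  split=> // k; have /kap_ellipse h := k; have E := h r0 r1.
  have : set0 (ii * (L l)%:C : C); last by [].
  rewrite -hsing; split; first by exists l; left.
  exists zt => //; exists (upt X1 l zt) => //.
  by rewrite /upt; field.
split=> l hl; have [lo hi] := kap_side (seg l).
  apply: lo; rewrite upt_center // kapN kap_slit //; split => //=.
  have := Lval_le hl; have := Lval_gt0 b1_gt0 l => a1 a2.
  have : L l / L n <= 1 by rewrite ler_pdivrMr // mul1r.
  have : 0 < L l / L n by rewrite divr_gt0.
  by move=> *; apply/andP; split; lra.
apply: hi; rewrite upt_center // kapN.
have hr : 0 < rho + n%:R by have := rho_ge X1; have := ler0n R n; lra.
have a1 : (rho + n%:R + 1) / (rho + n%:R) <= L l / L n.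
  rewrite !LvalE -[X in X / _ <= _]mul1r -{2}(mulfV (lt0r_neq0 b1_gt0)).
  have -> : blen X1 * (rho + l%:R) / (blen X1 * (rho + n%:R)) = (rho + l%:R) / (rho + n%:R).
    by field; rewrite !gt_eqF.
  rewrite mulfV ?gt_eqF // mul1r ler_pM2r ?invr_gt0 //.
  have : n.+1%:R <= l%:R :> R by rewrite ler_nat.
  rewrite -natr1; lra.
have a2 : (rho + n%:~R + 1 / 2) / (rho + n%:~R) < (rho + n%:R + 1) / (rho + n%:R).
  by rewrite ltr_pM2r ?invr_gt0 //; have -> : (n%:Z)%:~R = n%:R :> R by []; lra.
rewrite kap_pos; first by apply: lt_le_trans a1; apply: lt_trans a2.
by have := lt_le_trans (lt_trans hc a2) a1; lra.
Qed.

End Geometry.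

Section Continuation.
Variables (R : realType) (X1 X2 : rank_one_space R).
Local Notation C := R[i].
Local Notation ii := (imag_unit R).
Local Notation Re := complex.Re.
Local Notation Im := complex.Im.
Local Notation T := ('M[R]_((sdim X1).+1) * 'M[R]_((sdim X2).+1))%type.
Variables (mu : {measure set (borelT X1 X2) -> \bar R}) (phi : C -> C -> T -> C).
Hypotheses (mu_haar : haar_measure mu) (hphi : spherical_family phi).
Variables (f : T -> C) (y : T).
Hypotheses (hf : Cc_infty f) (hy : prodG y).
Local Notation rho := (rhob X1).
Local Notation L := (Lval X1).
Hypothesis b1_gt0 : 0 < blen X1.
Hypotheses (m1_odd : odd (mult_beta X1)) (m2_even : ~~ odd (mult_beta X2)).
Variables (rr dd : R -> R).
Hypothesis discs : disc_data X1 rr dd.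
Variable Fm : (T -> C) -> T -> int -> C -> C.
Hypothesis HFm : Fm_family mu phi rr dd Fm.
Local Notation W := (Wdisc dd).
Local Notation Wm := (Wm X1 dd).
Local Notation F := (Ffun mu phi f y).
Local Notation G := (Gfun mu phi f y).
Local Notation zeta := (zeta_plus X1).
Implicit Types (z w u : C).

Lemma cfun_circle_slit w : cabs w = 1 -> slit (cfun w).
Proof.
move=> w1; have w0 : w != 0 by rewrite -cabs_gt0 w1.
apply: contrapT => /[dup] /cabs_root_lt1 h _.
have J := congr1 (@cabs R) (jouk_root (cfun w)); rewrite cabsM cabs1 in J.
have [e|e] := cfun_roots w0 erefl; rewrite -e w1 ?mulr1 ?mul1r in J h.
  by rewrite ltxx in h.
by rewrite J ltxx in h.
Qed.

Transparent cint.

(** [cfun] maps the unit circle into [[-1, 1]], which contains no pole value off the axis; after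
    passing to [numer / denom], one differentiates under the integral with a bound uniform in the
    angle. *)
Lemma Ffun_hol z : offaxis X1 z -> hol_near F z.
Proof.
move=> oz; have [Dt [hD sD zD]] := plancherel_denominator X1.
have [d d0 hd] := offaxis_near oz.
suff H w : offaxis X1 w -> hol F w by exists d => // w /hd; exact: H.
clear z oz d d0 hd => /[dup] ow /offaxis_near[d d0 hd].
have den0 v (t : R) : offaxis X1 v -> denom X1 Dt v (1%:C * cis t%:C) != 0.
  move=> ov; apply/eqP => /zD /(singpt_cfun b1_gt0 ov.1)[l hl].
  have := offaxis_slit b1_gt0 (l := l) ov; apply.
  have := @cfun_circle_slit (1%:C * cis t%:C); rewrite cabsM cabs_cis mulr1 cabs1 => /(_ erefl).
  case: hl => -> // -[]; rewrite cReN cImN => i0 /andP[h1 h2]; split; first by lra.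
  by apply/andP; split; lra.
pose h v t := numer mu phi f y v (0 + 1%:C * cis t) / denom X1 Dt v (0 + 1%:C * cis t) * (1%:C * (ii * cis t)).
have Fh v : offaxis X1 v -> F v = Cintegral (@lebesgue_measure R) `[0, 2 * pi] (fun t => h v t%:C).
  move=> ov; rewrite /Ffun (Fcirc_quot mu_haar hphi hf hy b1_gt0 hD sD ov.1 ltr01) //.
  by move=> t; exact: den0.
have cis0 (t : R) : 0 + 1%:C * cis t%:C != 0 :> C by rewrite add0r -cabs_gt0 cabsM cabs_cis mulr1 cabs1.
have ccis (t : R) : ccont (fun t => 0 + 1%:C * cis t) t%:C.
  apply: hol_ccont; apply: holD => //; apply: holM => //; exact: hol_cis.
have jh v (t : R) : offaxis X1 v -> jcont h v t%:C.
  move=> ov; apply: jcontM; last first.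
    by apply: jcont_snd; apply: hol_ccont; apply: holM => //; apply: holM => //; exact: hol_cis.
  apply: jcontM.
    exact: (@jcont_subst _ (numer mu phi f y) (fun t => 0 + 1%:C * cis t) _ _
      (jcont_numer mu_haar hphi hf hy v (cis0 t)) (ccis t)).
  apply: (@jcont_comp _ (@GRing.inv C) (fun v t => denom X1 Dt v (0 + 1%:C * cis t))).
    exact: (@jcont_subst _ (denom X1 Dt) (fun t => 0 + 1%:C * cis t) _ _
      (jcont_denom X1 hD v (cis0 t)) (ccis t)).
  by apply: hol_ccont; apply: holV => //; rewrite add0r; exact: den0.
have [|d1 [M [d10 M0 hM]]] := @jcont_strip_bounded _ h w 0 (2 * pi) (pi2_ge0 R).
  by move=> t _; exact: jh.
have [k k0 hk] := min2_gt0 d0 d10.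
have k2 v : cabs (v - w) <= k / 2 -> offaxis X1 v /\ cabs (v - w) < d1.
  by move=> hv; have [|/hd] := hk (cabs (v - w)); first lra.
apply: (near_hol d0 (fun v hv => Fh v (hd v hv))).
apply: (@param_integral _ _ _ _ _ _ _ (k / 2) M) => //.
- exact: (eq_ind_r (fun x => (x < +oo)%E) (ltry _) (leb_itv (pi2_ge0 R))).
- lra.
- move=> t v _ /k2[ov _]; apply: holM => //; apply: holM; first exact: (hol_numer_z mu_haar hphi hf hy).
  by apply: holV; [rewrite add0r; exact: den0 | exact: hol_denom_z].
- by move=> t v /=; rewrite in_itv /= => ht /k2[_ hv]; exact: hM.
- move=> v /k2[ov _].
  apply: (@icont_cintble _ (h v)) => t _; exact: jcont_fix1 (jh _ _ ov).
Qed.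

Opaque cint.

(** At [v = L n] the bound on [cR (rr v)] separates the poles of index [n] from those of index
    [n + 1]. The holomorphy of [Fm] carries the identity to the rest of [Wm n]. *)
Lemma shift_disc (n : nat) z : W (L n) z -> ~ neg_imag_cut X1 z ->
  F z = Fm f y n z + 2 * \sum_(l < n.+1) G l z (zeta l z).
Proof.
move=> hz nc; have [Dt [hD sD zD]] := plancherel_denominator X1.
have v0 := Lval_gt0 b1_gt0 n; have lz := Wdisc_lower b1_gt0 discs v0 hz.
have oz := offcut_offaxis lz nc; have [k1 k2] := disc_kap b1_gt0 discs hz.
have [_ [_ /(_ isT)]] := discs v0 (isT : -1 <= n%:Z) (level_nat b1_gt0 n).
move=> [/andP[r0 r1] _ _ _ _].
have [_ HF] := HFm hf hy; have [_ HFn] := HF n isT; rewrite (HFn _ _ (level_nat b1_gt0 n) hz).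
apply: (contour_shift mu_haar hphi hf hy b1_gt0 m1_odd m2_even hD sD zD oz.1 r0 r1 k1 k2).
by move=> l _; exact: offaxis_slit.
Qed.

Lemma hol_Gfun (l : int) (a g : C -> C) t : hol a t -> hol g t -> a t != 0 ->
  ii * (L l)%:C / a t - g t != 0 -> hol (fun s => G l (a s) (g s)) t.
Proof.
move=> ha hg a0 w0; rewrite /Gfun; apply: holM => //; apply: holM.
  apply: holM => //; apply: hol_ppol2; apply: holM => //; exact: holM.
have hw : hol (fun s => ii * (L l)%:C / a s - g s) t.
  by apply: holB => //; apply: holM => //; exact: holV.
apply: (Psi_comp mu_haar hphi hf hy); apply: holM.
- by apply: holM => //; exact: holM.
- exact: (hol_comp hw (hol_cfun w0)).
- by apply: holM => //; exact: holM.
- exact: (hol_comp hw (hol_cfun_rot w0)).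
Qed.

Lemma holn_upt (l : int) z : z != 0 -> hol_near (upt X1 l) z.
Proof.
move=> z0; apply: holnM; first by apply: holn_all.
by apply: holnV => //; exact: holn_all.
Qed.

Lemma holn_zeta (l : int) z : z != 0 -> ~ slit (upt X1 l z) -> hol_near (zeta l) z.
Proof.
by move=> z0 ns; apply: (@holn_comp _ (upt X1 l) (@zs R) z (holn_upt l z0)); exact: holn_zs.
Qed.

Lemma nonzero_near z : z != 0 -> exists2 d : R, 0 < d & forall w, cabs (w - z) < d -> w != 0.
Proof.
move=> z0; exists (cabs z); first by rewrite cabs_gt0.
by move=> w hw; apply: contraTneq hw => ->; rewrite sub0r cabsN ltxx.
Qed.

Lemma holn_Gzeta (l : int) z : z != 0 -> ~ slit (upt X1 l z) ->
  hol_near (fun z => G l z (zeta l z)) z.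
Proof.
move=> z0 ns; have [d1 d10 h1] := holn_zeta z0 ns; have [d2 d20 h2] := nonzero_near z0.
have [d d0 hd] := min2_gt0 d10 d20; exists d => // w /hd[/h1 k1 /h2 k2].
apply: (@hol_Gfun l id) => //; exact: jouk_root_neq0.
Qed.

Lemma Wdisc_open v z : W v z -> exists2 d : R, 0 < d & forall w, cabs (w - z) < d -> W v w.
Proof.
move=> /WdiscE hz; exists (dd v - cabs (z - ibelow v)); first lra.
move=> w hw; apply/WdiscE; have := cabsD (w - z) (z - ibelow v); rewrite subrKA; lra.
Qed.

Lemma Wm_open m z : Wm m z -> exists2 d : R, 0 < d & forall w, cabs (w - z) < d -> Wm m w.
Proof.
move=> [v hv /Wdisc_open[d d0 hd]]; exists d => // w /hd ?; by exists v.
Qed.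

Lemma Wm_lower m z : Wm m z -> Im z < 0.
Proof. by move=> [v [v0 _]]; exact: (Wdisc_lower b1_gt0 discs). Qed.

Lemma lower_neq0 z : Im z < 0 -> z != 0.
Proof. by apply: contraTneq => ->; rewrite ltxx. Qed.

Lemma holn_Fm (n : nat) z : Wm n z -> hol_near (Fm f y n) z.
Proof.
move=> /Wm_open[d d0 hd]; exists d => // w /hd hw; apply/derivable_hol.
by have [_ HF] := HFm hf hy; have [h _] := HF n isT; exact: h.
Qed.

Lemma Fm_N1 z : Wm (-1) z -> Fm f y (-1) z = F z.
Proof. by have [h _] := HFm hf hy; exact: h. Qed.

Lemma ibelow_shift v v' : `|v' - v| < dd v -> exists2 d : R, 0 < d &
  forall x : R, `|x| < d -> W v (ibelow v' + x%:C).
Proof.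
move=> h; exists (dd v - `|v' - v|); first lra.
move=> x hx; apply/WdiscE.
have -> : ibelow v' + x%:C - ibelow v = x%:C - ii * (v' - v)%:C by rewrite /ibelow rmorphB; ring.
have := cabsB x%:C (ii * (v' - v)%:C); rewrite cabsM cabs_i mul1r !cabs_real; lra.
Qed.

End Continuation.

(** * Propagation along the imaginary axis and the single-valued part *)

Section Spreading.
Variables (R : realType) (X1 X2 : rank_one_space R).
Local Notation C := R[i].
Local Notation ii := (imag_unit R).
Local Notation Re := complex.Re.
Local Notation Im := complex.Im.
Local Notation T := ('M[R]_((sdim X1).+1) * 'M[R]_((sdim X2).+1))%type.
Variables (mu : {measure set (borelT X1 X2) -> \bar R}) (phi : C -> C -> T -> C).
Hypotheses (mu_haar : haar_measure mu) (hphi : spherical_family phi).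
Variables (f : T -> C) (y : T).
Hypotheses (hf : Cc_infty f) (hy : prodG y).
Local Notation rho := (rhob X1).
Local Notation L := (Lval X1).
Hypothesis b1_gt0 : 0 < blen X1.
Variables (rr dd : R -> R).
Hypothesis discs : disc_data X1 rr dd.
Variable Fm : (T -> C) -> T -> int -> C -> C.
Hypothesis HFm : Fm_family mu phi rr dd Fm.
Local Notation W := (Wdisc dd).
Local Notation Wm := (Wm X1 dd).
Local Notation F := (Ffun mu phi f y).
Local Notation G := (Gfun mu phi f y).
Local Notation zeta := (zeta_plus X1).
Implicit Types (z w u : C).

Lemma Wdisc_convex v p q (t : R) : W v p -> W v q -> 0 <= t <= 1 -> W v (p + t%:C * (q - p)).
Proof.
move=> /WdiscE hp /WdiscE hq /andP[t0 t1]; apply/WdiscE.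
have -> : p + t%:C * (q - p) - ibelow v = (1 - t)%:C * (p - ibelow v) + t%:C * (q - ibelow v).
  by rewrite rmorphB rmorph1; ring.
apply: (le_lt_trans (cabsD _ _)); rewrite !cabsM !cabs_pos ?subr_ge0 //.
move: (cabs _) (cabs _) hp hq => a b ha hb.
have [->|tn0] := eqVneq t 0; first lra.
have tp : 0 < t by rewrite lt_neqAle eq_sym tn0.
have : t * a < t * dd v by rewrite ltr_pM2l.
have : (1 - t) * b <= (1 - t) * dd v by rewrite ler_wpM2l ?subr_ge0 // ltW.
lra.
Qed.

Lemma half_overlap (D : C -> C) (s a b : R) p :
  (forall z, W b z -> 0 < s * Re z -> hol_near D z) -> W a p -> W b p -> 0 < s * Re p ->
  (forall z, W a z -> 0 < s * Re z -> D z = 0) -> forall z, W b z -> 0 < s * Re z -> D z = 0.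
Proof.
move=> hD ap bp rp Da z bz rz.
have zp : zero_near D p.
  have [d1 d10 h1] := Wdisc_open ap; have [|d2 d20 h2] := (_ : exists2 d : R, 0 < d &
    forall w, cabs (w - p) < d -> 0 < s * Re w).
    exists (s * Re p / (1 + `|s|)); first by rewrite divr_gt0 //; have := normr_ge0 s; lra.
    move=> w; rewrite ltr_pdivlMr; last by have := normr_ge0 s; lra.
    move=> hw; have hR := Re_le_cabs (w - p).
    have : `|s * Re (w - p)| <= cabs (w - p) * (1 + `|s|).
      rewrite normrM mulrC; apply: ler_pM => //; have := normr_ge0 s; lra.
    rewrite ler_norml cReD cReN => /andP[]; lra.
  have [d d0 hd] := min2_gt0 d10 d20; exists d => // w /hd[/h1 k1 /h2]; exact: Da.
have [d d0] : zero_near D z.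
  apply: identity_segment zp => t t01; apply: hD; first exact: Wdisc_convex.
  rewrite !ReImE /= mul0r subr0; case/andP: t01 => t0 t1.
  have -> : s * (Re p + t * (Re z - Re p)) = (1 - t) * (s * Re p) + t * (s * Re z) by ring.
  have [->|tn0] := eqVneq t 0; first by rewrite subr0 mul1r mul0r addr0.
  have tp : 0 < t by rewrite lt_neqAle eq_sym tn0.
  have : 0 < t * (s * Re z) by rewrite mulr_gt0.
  have : 0 <= (1 - t) * (s * Re p) by rewrite mulr_ge0 ?subr_ge0 // ltW.
  lra.
by apply; rewrite subrr cabs0.
Qed.

(** The identity theorem from disc to disc down the axis. The sign [s] selects the right or left
    half discs, as the functions in question jump across the axis. *)
Lemma half_spread (D : C -> C) (s v0 v1 : R) : s * s = 1 -> 0 < v0 -> v0 <= v1 ->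
  (forall v z, v0 <= v <= v1 -> W v z -> 0 < s * Re z -> hol_near D z) ->
  (forall z, W v0 z -> 0 < s * Re z -> D z = 0) -> forall z, W v1 z -> 0 < s * Re z -> D z = 0.
Proof.
move=> ss v00 v01 hD; pose P v := forall z, W v z -> 0 < s * Re z -> D z = 0.
move=> P0; apply: (@interval_induction _ P _ _ v01 P0) => v hv.
have dpos (u : R) : v0 <= u <= v1 -> 0 < dd u.
  by move=> /andP[h _]; apply: (dd_gt0 b1_gt0 discs); exact: lt_le_trans h.
exists (dd v); first exact: dpos.
have meet (u : R) : v0 <= u <= v1 -> `|u - v| < dd v ->
    exists p, [/\ W v p, W u p & 0 < s * Re p].
  move=> hu huv; have [d1 d10 h1] := ibelow_shift huv.
  have [|d2 d20 h2] := @ibelow_shift R dd u u; first by rewrite subrr normr0 dpos.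
  have [d d0 hd] := min2_gt0 d10 d20.
  have s1 : `|s| = 1.
    by apply: (pexpIrn (n := 2)); rewrite ?nnegrE // expr1n -normrX expr2 ss normr1.
  have sd : `|s * (d / 2)| = d / 2 by rewrite normrM s1 mul1r gtr0_norm //; lra.
  have [|k1 k2] := hd (d / 2); first lra.
  (* The center of the second disc, pushed off the axis to the chosen side by less than the room
     left in both discs. *)
  exists (ibelow u + (s * (d / 2))%:C); split.
  - by apply: h1; rewrite sd.
  - by apply: h2; rewrite sd.
  by rewrite /ibelow !ReImE /= !(mul0r, mul1r, mulr0, subr0, oppr0, add0r) mulrA ss mul1r; lra.
move=> u u' hu hu' huv hu'v Pu.
have [p [vp up rp]] := meet u hu huv; have [p' [vp' up' rp']] := meet u' hu' hu'v.
have Pv : P v.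
  by apply: (half_overlap _ up vp rp Pu) => z; exact: hD.
by apply: (half_overlap _ vp' up' rp' Pv) => z; exact: hD.
Qed.

Lemma Re_offaxis (s : R) z : 0 < s * Re z -> offaxis X1 z.
Proof.
move=> h; have r0 : Re z <> 0 by move=> e; rewrite e mulr0 ltxx in h.
by split; [apply/eqP => e; rewrite e in r0; exact: r0 | left].
Qed.

Lemma Wdisc_Wm (n : nat) v z : L n <= v -> v < L n.+1 -> W v z -> Wm n z.
Proof.
move=> h1 h2 hz; exists v => //; split; first exact: lt_le_trans (Lval_gt0 b1_gt0 n) h1.
by rewrite h1 LvalS.
Qed.

(** On the axis a disc of level [m] ends above [-i L (m + 1)]: by assumption if [v > L m] or
    [m = -1], and because half a step is added if [v = L m]. So [zeta_plus l] is holomorphic on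
    it. *)
Lemma Wm_slit (m : int) (l : nat) z : -1 <= m -> m < l%:Z -> Wm m z -> ~ slit (upt X1 l z).
Proof.
move=> m1 ml [v [v0 hv] hz]; have lz := Wdisc_lower b1_gt0 discs v0 hz.
move=> /(slit_upt b1_gt0 (lower_neq0 lz))[r0]; rewrite ltr0_norm // => hL.
have [_ [a1 a2]] := discs v0 m1 hv.
have [m0|m0] := ltP m 0.
  have /andP[_] := a1 (ltac:(lia)) z hz r0.
  have := Lval_le b1_gt0 (leq0n l); lra.
have [n en] := int_ge0_nat m0; subst m.
have nl : (n.+1 <= l)%N by lia.
have := Lval_le b1_gt0 nl; have [_ _ _ _ [b1 b2]] := a2 m0.
case/andP: hv => /[dup] hv; rewrite le_eqVlt => /predU1P[e|lt] _.
  have eS : L n.+1 = L n + blen X1 by rewrite !LvalE -natr1; ring.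
  by have /andP[_] := b2 (esym e) z hz r0; have := b1_gt0; lra.
by have /andP[_] := b1 lt z hz r0; rewrite LvalS; lra.
Qed.

Lemma Wm_N1_offaxis z : Wm (-1) z -> offaxis X1 z.
Proof.
move=> [v [v0 hv] hz]; have lz := Wdisc_lower b1_gt0 discs v0 hz.
split; first exact: lower_neq0.
have [r0|] := eqVneq (Re z) 0; last by left; exact/eqP.
right; rewrite ltr0_norm //; have [_ [a1 _]] := discs v0 (lexx _) hv.
by have /andP[] := a1 erefl z hz r0.
Qed.

Hypotheses (m1_odd : odd (mult_beta X1)) (m2_even : ~~ odd (mult_beta X2)).

Lemma continuation_Wm (n : nat) z : Wm n z -> offaxis X1 z ->
  F z = Fm f y n z + 2 * \sum_(l < n.+1) G l z (zeta l z).
Proof.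
move=> [v [v0 /andP[h1]]]; rewrite LvalS => h2 hz oz.
pose D w := F w - (Fm f y n w + 2 * \sum_(l < n.+1) G l w (zeta l w)).
suff : D z = 0 by move/eqP; rewrite subr_eq0 => /eqP.
have hD w (u : R) : L n <= u <= v -> W u w -> offaxis X1 w -> hol_near D w.
  move=> /andP[a1 a2] hw ow; apply: holnB.
    exact: (Ffun_hol mu_haar hphi hf hy b1_gt0).
  apply: holnD.
    apply: (holn_Fm hf hy HFm); apply: Wdisc_Wm hw => //; exact: le_lt_trans a2 h2.
  apply: holnM; first exact: holn_all.
  apply: holn_sum => l _; apply: (holn_Gzeta mu_haar hphi hf hy) ow.1 _.
  exact: offaxis_slit.
have half (s : R) : s * s = 1 -> 0 < s * Re z -> D z = 0.
  move=> ss rz; apply: (half_spread ss (Lval_gt0 b1_gt0 n) h1) rz => //.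
    by move=> u w hu hw rw; apply: hD hu hw _; exact: Re_offaxis rw.
  move=> w hw rw; rewrite /D -(shift_disc mu_haar hphi hf hy b1_gt0 m1_odd m2_even discs HFm hw) ?subrr //.
  by move=> [r0 _]; rewrite r0 mulr0 ltxx in rw.
have [r|r|r] := ltrgtP 0 (Re z).
- by apply: (half 1); rewrite mul1r.
- by apply: (half (-1)); rewrite ?mulrNN ?mulN1r ?mul1r //; lra.
(* On the axis the point lies above [-i L 0]. A disc with [v > L n] does not meet that part of the
   axis, and for [v = L n] the contour shift applies directly. *)
have lz := Wdisc_lower b1_gt0 discs v0 hz.
have [_ [|hi]] := oz; first by rewrite -r.
rewrite ltr0_norm // in hi.
move: h1; rewrite le_eqVlt => /predU1P[e|lt]; last first.
  have hv : L n <= v < L (n%:Z + 1) by rewrite ltW // LvalS.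
  have [_ [_ /(_ isT)[_ _ _ _ [/(_ lt z hz (esym r))]]]] := discs v0 (isT : -1 <= n%:Z) hv.
  move=> /andP[h3 _] _; exfalso; have := Lval_le b1_gt0 (leq0n n); lra.
rewrite /D -(shift_disc mu_haar hphi hf hy b1_gt0 m1_odd m2_even discs HFm) ?subrr ?e //.
by case=> _; rewrite leNgt => /negP; apply; lra.
Qed.

Variable N : nat.

(* Off the cut this is F z - 2 \sum_(l <= N) G_l(z, zeta_l^+), whatever m; on the
   cut, the remaining zeta_l^+ are holomorphic on Wm m. *)
Definition Kbranch (m : int) z : C :=
  Fm f y m z - 2 * \sum_(l < N.+1 | m < l%:Z) G l z (zeta l z).

Lemma holn_Kbranch (m : int) z : -1 <= m -> Wm m z -> hol_near (Kbranch m) z.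
Proof.
move=> m1 hz; have z0 := lower_neq0 (Wm_lower b1_gt0 discs hz).
apply: holnB; last first.
  apply: holnM; first exact: holn_all.
  apply: holn_sum => l ml; apply: (holn_Gzeta mu_haar hphi hf hy) z0 _.
  exact: Wm_slit m1 ml hz.
have [m0|m0] := ltP m 0; last first.
  by have [n en] := int_ge0_nat m0; subst m; exact: (holn_Fm hf hy HFm).
have em : m = -1 by lia.
subst m; have [d d0 hd] := Wm_open hz.
apply: (near_holn d0 (fun w hw => Fm_N1 hf hy HFm (hd w hw))).
by apply: (Ffun_hol mu_haar hphi hf hy b1_gt0); exact: Wm_N1_offaxis.
Qed.

Lemma Kbranch_offaxis (m : int) z : -1 <= m <= N%:Z -> Wm m z -> offaxis X1 z ->
  Kbranch m z = F z - 2 * \sum_(l < N.+1) G l z (zeta l z).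
Proof.
move=> /andP[m1 mN] hz oz; rewrite /Kbranch.
have [m0|m0] := ltP m 0.
  have em : m = -1 by lia.
  by subst m; rewrite (Fm_N1 hf hy HFm).
have [n en] := int_ge0_nat m0; subst m.
rewrite (continuation_Wm hz oz) (big_ord_widen N.+1 (fun l => G l z (zeta l z))); last by lia.
rewrite [X in _ = _ - 2 * X](bigID (fun l : 'I_N.+1 => (l < n.+1)%N)) /=.
have E : \sum_(l < N.+1 | n%:Z < l%:Z) G l z (zeta l z) =
  \sum_(l < N.+1 | ~~ (l < n.+1)%N) G l z (zeta l z) by apply: eq_bigl => l; lia.
rewrite E; ring.
Qed.

Lemma ccont_zero (D : C -> C) z : ccont D z ->
  (forall d : R, 0 < d -> exists2 w, cabs (w - z) < d & D w = 0) -> D z = 0.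
Proof.
move=> cD h; apply/eqP; rewrite -cabs_eq0; apply/eqP/le_anti; rewrite cabs_ge0 andbT leNgt.
apply/negP => /cD[d d0 hd]; have [w /hd hw Dw] := h _ d0.
by move: hw; rewrite Dw sub0r cabsN ltxx.
Qed.

Lemma offaxis_dense z (d : R) : 0 < d -> exists2 w, cabs (w - z) < d & Re w <> 0.
Proof.
move=> d0; have aux (e : R) : cabs (z + e%:C - z) = `|e| by rewrite addrC addKr cabs_real.
have [r0|] := eqVneq (Re z) 0; last first.
  by exists z; rewrite ?subrr ?cabs0 //; exact/eqP.
exists (z + (d / 2)%:C); first by rewrite aux gtr0_norm; lra.
by rewrite cReD r0 /=; lra.
Qed.

(** Off the axis both sides have the same expression without [m]; such points are dense and both
    sides are continuous. *)
Lemma Kbranch_eq (m m' : int) z : -1 <= m <= N%:Z -> -1 <= m' <= N%:Z -> Wm m z -> Wm m' z ->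
  Kbranch m z = Kbranch m' z.
Proof.
move=> hm hm' hz hz'; apply/eqP; rewrite -subr_eq0; apply/eqP.
apply: (@ccont_zero (fun z => Kbranch m z - Kbranch m' z)).
  apply: hol_ccont; apply: hol_near_hol; apply: holnB; apply: holn_Kbranch => //.
    by case/andP: hm.
  by case/andP: hm'.
move=> d d0; have [d1 d10 h1] := Wm_open hz; have [d2 d20 h2] := Wm_open hz'.
have [d3 d30 h3] := min2_gt0 d10 d20; have [d4 d40 h4] := min2_gt0 d0 d30.
have [|w hw rw] := @offaxis_dense z (d4 / 2); first lra.
have [|k1 /h3[k2 k3]] := h4 (cabs (w - z)); first lra.
have ow : offaxis X1 w by split; [apply/eqP => e; rewrite e in rw; exact: rw | left].
by exists w => //; rewrite !Kbranch_offaxis ?subrr //; [exact: h2 | exact: h1].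
Qed.

(** The level is chosen arbitrarily among those whose region contains [z]; [Kbranch_eq] makes the
    choice harmless. *)
Definition Kfun z : C := Kbranch (xget 0 [set m | -1 <= m <= N%:Z /\ Wm m z]) z.

Lemma KfunE (m : int) z : -1 <= m <= N%:Z -> Wm m z -> Kfun z = Kbranch m z.
Proof.
move=> hm hz; rewrite /Kfun; case: xgetP => [m' -> [hm' hz']|/(_ m) []//].
exact: Kbranch_eq.
Qed.

Lemma holn_Kfun z : Wall X1 N dd z -> hol_near Kfun z.
Proof.
move=> [m hm hz]; have [d d0 hd] := Wm_open hz.
apply: (near_holn d0 (fun w hw => KfunE hm (hd w hw))).
by apply: holn_Kbranch hz; case/andP: hm.
Qed.

Lemma Kfun_offaxis z : Wall X1 N dd z -> offaxis X1 z ->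
  Kfun z = F z - 2 * \sum_(l < N.+1) G l z (zeta l z).
Proof. by move=> [m hm hz] oz; rewrite (KfunE hm hz) Kbranch_offaxis. Qed.

End Spreading.

(** The analogue of [interval_induction] for a connected set. *)
Lemma connected_spread (T : topologicalType) (B : set T) (P : T -> Prop) (x q : T) :
  connected B -> B x -> B q -> P x ->
  (forall p, B p -> exists2 V : set T, open V /\ V p &
     forall a b, B a -> V a -> B b -> V b -> P a -> P b) -> P q.
Proof.
move=> cB Bx Bq Px loc.
pose O : set T := \bigcup_(V in [set V : set T | open V /\ forall b, B b -> V b -> P b]) V.
pose O' : set T := \bigcup_(V in [set V : set T | open V /\ forall b, B b -> V b -> ~ P b]) V.
have oO : open O by apply: bigcup_open => V [].
have oO' : open O' by apply: bigcup_open => V [].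
suff : B `&` P = B by move=> E; have [] : (B `&` P) q by rewrite E.
apply: cB; first by exists x.
- exists O => //; apply/seteqP; split=> p [Bp hp]; split=> //.
    have [V [oV Vp] hV] := loc p Bp; exists V => //; split => // b Bb Vb; exact: hV hp.
  by have [V [_ hV] Vp] := hp; exact: hV.
- exists (~` O'); first exact: open_closedC.
  apply/seteqP; split=> p [Bp hp]; split=> //.
    by move=> [V [_ hV] Vp]; exact: hV hp.
  apply: contrapT => nP; apply: hp; have [V [oV Vp] hV] := loc p Bp.
  by exists V => //; split => // b Bb Vb Pb; apply: nP; exact: hV Pb.
Qed.

(** * The Riemann surface *)

Section SurfaceTopology.
Variables (R : realType) (N : nat).
Local Notation C := R[i].
Local Notation pt := (surface_point R N).

Lemma surf_nbhsP (p : pt) (V : set pt) : nbhs p V <-> exists2 d : R, 0 < d &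
  forall q : pt, cabs ((q.1 : C) - p.1) < d ->
    (forall l, cabs ((q.2 0 l : C) - p.2 0 l) < d) -> V q.
Proof.
split.
- move=> /nbhs_ballP[e /= e0 H].
  have ee : e = (complex.Re e)%:C by move: e0; rewrite ltcE => /andP[/eqP h _]; exact: complex_ext.
  rewrite ee ltcR in e0; exists (complex.Re e) => // q h1 h2; apply: H; split.
    by rewrite /ball /= ee distrC cabsE ltcR.
  split; first by rewrite ee ltcR.
  by move=> i j; rewrite (ord1 i) /ball /= ee distrC cabsE ltcR.
- move=> [d d0 H]; apply/nbhs_ballP; exists (d%:C) => /=; first by rewrite ltcR.
  move=> q [h1 [_ h2]]; apply: H.
    by move: h1; rewrite /ball /= distrC cabsE ltcR.
  by move=> l; move: (h2 0 l); rewrite /ball /= distrC cabsE ltcR.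
Qed.

Lemma surf_open_near (p : pt) (d : R) : 0 < d -> exists2 V : set pt, open V /\ V p &
  forall q, V q -> cabs ((q.1 : C) - p.1) < d /\ forall l, cabs ((q.2 0 l : C) - p.2 0 l) < d.
Proof.
move=> d0; pose A : set pt := [set q : pt | cabs ((q.1 : C) - p.1) < d /\
  forall l, cabs ((q.2 0 l : C) - p.2 0 l) < d].
have nA : nbhs p A by apply/surf_nbhsP; exists d.
exists (interior A); first by split; [exact: open_interior | exact: nA].
by move=> q /interior_subset.
Qed.

Lemma open_surf_near (p : pt) (V : set pt) : open V -> V p -> exists2 d : R, 0 < d &
  forall q : pt, cabs ((q.1 : C) - p.1) < d ->
    (forall l, cabs ((q.2 0 l : C) - p.2 0 l) < d) -> V q.
Proof. by move=> oV Vp; apply/surf_nbhsP; exact: open_nbhs_nbhs. Qed.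

End SurfaceTopology.

(** If [blen] were 0, all [L] would vanish and [Wm' (-1)] would be empty, with no component above it
    instead of the prescribed [2 ^ 2] for [N = 1]. *)
Lemma small_discs_blen (R : realType) (X1 : rank_one_space R) (dd : R -> R) :
  small_discs X1 1 dd -> 0 < blen X1.
Proof.
move=> [/(_ (-1) isT)[h _] _]; rewrite lt_neqAle sqrtr_ge0 andbT eq_sym; apply/eqP => b0.
have W0 : Wm' X1 dd (-1) = set0.
  rewrite -subset0 => z [v /= /andP[]]; rewrite /Lval /= b0 mul0r => v1 v2.
  by have := lt_trans v1 v2; rewrite ltxx.
have C0 : components (piN_inv X1 (Wm' X1 dd (-1)) : set (surface_point R 1)) = set0.
  by rewrite -subset0 => U [p [_ hp] _]; move: hp; rewrite W0.
by move: h; rewrite C0 card_eq_sym card_eq0 => /eqP E; have : `I_4 0%N by []; rewrite E.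
Qed.

Section Sheets.
Variables (R : realType) (X1 X2 : rank_one_space R).
Local Notation C := R[i].
Local Notation ii := (imag_unit R).
Local Notation Re := complex.Re.
Local Notation Im := complex.Im.
Local Notation T := ('M[R]_((sdim X1).+1) * 'M[R]_((sdim X2).+1))%type.
Variables (mu : {measure set (borelT X1 X2) -> \bar R}) (phi : C -> C -> T -> C).
Hypotheses (mu_haar : haar_measure mu) (hphi : spherical_family phi).
Variables (f : T -> C) (y : T).
Hypotheses (hf : Cc_infty f) (hy : prodG y).
Local Notation L := (Lval X1).
Hypothesis b1_gt0 : 0 < blen X1.
Hypotheses (m1_odd : odd (mult_beta X1)) (m2_even : ~~ odd (mult_beta X2)).
Variables (rr dd : R -> R).
Hypothesis discs : disc_data X1 rr dd.
Variable Fm : (T -> C) -> T -> int -> C -> C.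
Hypothesis HFm : Fm_family mu phi rr dd Fm.
Local Notation W := (Wdisc dd).
Local Notation Wm := (Wm X1 dd).
Local Notation F := (Ffun mu phi f y).
Local Notation G := (Gfun mu phi f y).
Local Notation zeta := (zeta_plus X1).
Variable N : nat.
Local Notation pt := (surface_point R N).

Lemma MN_zeta (p : pt) (l : 'I_N.+1) : MN X1 p ->
  (p.2 0 l : C) = zeta l p.1 \/ (p.2 0 l : C) = - zeta l p.1.
Proof.
move=> [_ /(_ l)[_ _ h]]; have : (p.2 0 l : C) ^+ 2 = zs (upt X1 l p.1) ^+ 2 by rewrite h zs_sqr.
by move=> /eqP; rewrite eqf_sqr => /orP[] /eqP; [left|right].
Qed.

(** The sign cannot jump where [zeta l] is continuous and nonzero: with [c] its modulus, a change of
    sign would move the coordinate by at least [3 c / 2], while nearby coordinates differ by less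
    than [c / 2]. *)
Lemma sheet_sign (A : set C) (l : 'I_N.+1) (e : bool) (x p : pt) :
  (forall z, A z -> z != 0 /\ ~ slit (upt X1 l z)) ->
  connected_component (piN_inv X1 A) x p -> (x.2 0 l : C) = (-1) ^+ e * zeta l x.1 ->
  (p.2 0 l : C) = (-1) ^+ e * zeta l p.1.
Proof.
move=> hA [B [Bx BA cB] Bp]; move: x p Bx Bp => x q Bx Bq hx.
apply: (@connected_spread _ B (fun p : pt => (p.2 0 l : C) = (-1) ^+ e * zeta l p.1) x q) => //.
move=> p /BA[_ Ap]; have [z0 ns] := hA _ Ap.
set c := cabs (zeta l p.1); have c0 : 0 < c by rewrite cabs_gt0; exact: zs_neq0.
have c4 : 0 < c / 4 by lra.
have [d1 d10 h1] := hol_ccont (hol_near_hol (holn_zeta z0 ns)) c4.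
have [d d0 hd] := min2_gt0 d10 c4; have d2 : 0 < d / 2 by lra.
have [V [oV Vp] hV] := surf_open_near p d2.
  exists V => // a b Ba Va Bb Vb ha.
  have [a1 a2] := hV _ Va; have [b1 b2] := hV _ Vb.
  have [Mb _] := BA _ Bb; have [//|hb] : (b.2 0 l : C) = (-1) ^+ e * zeta l b.1 \/
    (b.2 0 l : C) = - ((-1) ^+ e * zeta l b.1).
    by case: (MN_zeta l Mb) => ->; case: (e); rewrite ?expr1 ?expr0 ?mulN1r ?mul1r ?opprK; auto.
  exfalso; have za : cabs (zeta l a.1 - zeta l p.1) < c / 4 by apply: h1; apply: (hd _ _).1; lra.
  have zb : cabs (zeta l b.1 - zeta l p.1) < c / 4 by apply: h1; apply: (hd _ _).1; lra.
  have [|_ la] := hd (cabs ((a.2 0 l : C) - p.2 0 l)); first by have := a2 l; lra.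
  have [|_ lb] := hd (cabs ((b.2 0 l : C) - p.2 0 l)); first by have := b2 l; lra.
  have s1 : cabs ((-1) ^+ e : C) = 1 by rewrite cabsX cabsN cabs1 expr1n.
  have := cabsD ((a.2 0 l : C) - p.2 0 l) (- ((b.2 0 l : C) - p.2 0 l)).
  have -> : (a.2 0 l : C) - p.2 0 l - ((b.2 0 l : C) - p.2 0 l) =
    (-1) ^+ e * (2 * zeta l p.1 - ((zeta l p.1 - zeta l a.1) + (zeta l p.1 - zeta l b.1))).
    by rewrite ha hb; ring.
  rewrite cabsM s1 mul1r cabsN.
  have := ler_cabs_dist (2 * zeta l p.1) ((zeta l p.1 - zeta l a.1) + (zeta l p.1 - zeta l b.1)).
  have := cabsD (zeta l p.1 - zeta l a.1) (zeta l p.1 - zeta l b.1).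
  have c2 : cabs (2 : C) = 2 by have := cabs_pos (ler0n R 2); rewrite rmorph_nat.
  rewrite cabsM c2 -/c ![cabs (zeta l p.1 - _)]cabs_sub; lra.
Qed.

Local Notation K := (Kfun mu phi f y dd Fm N).

Definition Ftilde (p : pt) : C := K p.1 + 2 * \sum_(l < N.+1) G l p.1 (p.2 0 l).

Lemma Ftilde_plus z : Wall X1 N dd z -> offaxis X1 z -> Ftilde (sigma X1 (all_plus N) z) = F z.
Proof.
move=> hz oz; rewrite /Ftilde /= (Kfun_offaxis mu_haar hphi hf hy b1_gt0 discs HFm m1_odd m2_even hz oz).
rewrite (eq_bigr (fun l : 'I_N.+1 => G l z (zeta l z))); first by ring.
by move=> l _; rewrite mxE ffunE expr0 mul1r.
Qed.

(** For [l > m] the coordinate is [eps_l] times [zeta_plus l]. The term subtracted in [Kbranch]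
    cancels that of the sum if the sign is [+], and is the value at [- zeta] if the sign is [-]. *)
Lemma Ftilde_sheet (m : int) (eps : {ffun 'I_N.+1 -> bool}) (p : pt) : -1 <= m <= N%:Z ->
  (Uvee X1 dd m eps `|` Ueps X1 dd m eps) p ->
  Ftilde p = Fm f y m p.1
    + 2 * (\sum_(l < N.+1 | l%:Z <= m) G l p.1 (p.2 0 l))
    + 2 * (\sum_(l < N.+1 | (m < l%:Z) && eps l) (G l p.1 (p.2 0 l) - G l p.1 (- p.2 0 l))).
Proof.
move=> hm Up.
have m1 : -1 <= m by case/andP: hm.
(* Both kinds of sets are components above a part of [Wm m] through a point of the section
   [sigma eps], so they can be treated together. *)
have [A [v [AW Ap hc]]] : exists A v, [/\ A `<=` Wm m, A p.1 &
    connected_component (piN_inv X1 A) (sigma X1 eps (ibelow v)) p].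
  case: Up => [[m0 hc]|[v /= /andP[hv1 hv2] hc]].
    exists (W (L m)), (L m); split => //; last by have [B [_ BA _] /BA[]] := hc.
    have [n en] := int_ge0_nat m0; subst m.
    move=> z hz; apply: Wdisc_Wm hz => //; by have := level_nat b1_gt0 n; rewrite LvalS => /andP[].
  exists (Wm' X1 dd m), v; split => //; last by have [B [_ BA _] /BA[]] := hc.
  move=> z [u /= /andP[u1 u2] hz]; exists u => //; split; last by rewrite ltW.
  apply: le_lt_trans u1; have [m0|m0] := ltP m 0; first by rewrite /Lval m0.
  by have [n en] := int_ge0_nat m0; subst m; exact: ltW (Lval_gt0 b1_gt0 n).
have sgn (l : 'I_N.+1) : m < l%:Z -> (p.2 0 l : C) = (-1) ^+ eps l * zeta l p.1.
  move=> ml; apply: sheet_sign hc _; last by rewrite mxE.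
  move=> z /AW hz; split; first exact: lower_neq0 (Wm_lower b1_gt0 discs hz).
  exact: (Wm_slit b1_gt0 discs m1 ml hz).
rewrite /Ftilde (KfunE mu_haar hphi hf hy b1_gt0 discs HFm m1_odd m2_even hm (AW _ Ap)) /Kbranch.
rewrite [X in _ + 2 * X = _](bigID (fun l : 'I_N.+1 => l%:Z <= m)) /=.
have -> : \sum_(l < N.+1 | (m < l%:Z) && eps l) (G l p.1 (p.2 0 l) - G l p.1 (- p.2 0 l)) =
    \sum_(l < N.+1 | ~~ (l%:Z <= m)) G l p.1 (p.2 0 l) - \sum_(l < N.+1 | m < l%:Z) G l p.1 (zeta l p.1).
  have -> : \sum_(l < N.+1 | ~~ (l%:Z <= m)) G l p.1 (p.2 0 l) = \sum_(l < N.+1 | m < l%:Z) G l p.1 (p.2 0 l).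
    by apply: eq_bigl => l; rewrite ltNge.
  rewrite -sumrB big_mkcondr; apply: eq_bigr => l ml; rewrite sgn //.
  by case: (eps l); rewrite ?expr1 ?mulN1r ?opprK ?expr0 ?mul1r ?subrr.
ring.
Qed.

End Sheets.

Section Charts.
Variables (R : realType) (X1 : rank_one_space R) (N : nat).
Local Notation C := R[i].
Local Notation ii := (imag_unit R).
Local Notation Re := complex.Re.
Local Notation Im := complex.Im.
Local Notation L := (Lval X1).
Local Notation pt := (surface_point R N).
Hypothesis b1_gt0 : 0 < blen X1.
Implicit Types (z w u s t : C).

Definition chart (zc : C -> C) (zt : 'I_N.+1 -> C -> C) (s : C) : pt := (zc s, \row_l zt l s).

Definition cball (t : C) (d : R) : set C^o := [set s | cabs ((s : C) - t) < d].

Lemma cball_open t d : open (cball t d).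
Proof.
rewrite openE => s hs; apply/cnbhsP; exists (d - cabs (s - t)); first by move: hs; rewrite /cball /=; lra.
move=> w hw; rewrite /cball /=; have := cabsD (w - s) (s - t); rewrite subrKA; lra.
Qed.

(** [crd] names the coordinate used as local parameter: [None] for [z], [Some l] for [zeta_l]. The
    parameter is recovered from the point, hence injectivity and a derivative equal to 1. *)
Lemma chart_parametrization (t0 : C) (d : R) (zc : C -> C) (zt : 'I_N.+1 -> C -> C)
    (crd : option 'I_N.+1) (kap := fun q : pt => if crd is Some l then (q.2 0 l : C) else q.1) :
  (forall s, cball t0 d s -> hol zc s /\ forall l, hol (zt l) s) ->
  (forall s, cball t0 d s -> MN X1 (chart zc zt s)) ->
  (forall s, kap (chart zc zt s) = s) ->
  (forall q, MN X1 q -> cball t0 d (kap q) -> q.1 = zc (kap q)) ->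
  (forall l s, cball t0 d s -> zt l s != 0 \/ crd = Some l) ->
  parametrization X1 (cball t0 d) (chart zc zt).
Proof.
move=> hH hM hk hz hnz.
have row l : (fun s : C => (chart zc zt s).2 0 l : C) = zt l by apply/funext => s; rewrite mxE.
split.
- exact: cball_open.
- move=> t /hH[h1 h2]; split; first exact/derivable_hol.
  by move=> l; rewrite row; exact/derivable_hol.
- move=> t ht; case E: crd hk => [l|] hk; [right; exists l|left].
    rewrite row; have -> : zt l = id by apply/funext => s; have := hk s; rewrite /kap E /= mxE.
    by rewrite derive_id; exact/eqP/oner_neq0.
  have -> : (fun s => (chart zc zt s).1) = id by apply/funext => s; have := hk s; rewrite /kap E.
  by rewrite derive_id; exact/eqP/oner_neq0.
- by move=> s t _ _ e; rewrite -(hk s) -(hk t) e.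
(* The largest set meeting [MN] inside the image; it remains to see that the image lies in its
   interior. *)
pose A : set pt := [set q : pt | MN X1 q -> exists2 t, cball t0 d t & chart zc zt t = q].
exists (interior A); first exact: open_interior.
apply/seteqP; split=> q; last first.
  by move=> [Mq /interior_subset /(_ Mq)[t ht e]]; exists t.
move=> [t ht <-]; clear q; split; first exact: hM.
have [_ hl] := hH _ ht.
(* Within half the modulus of each nonzero coordinate only one of the two square roots is possible,
   so a nearby point of [MN] is determined by its parameter. *)
have [k k0 hk'] : exists2 k : R, 0 < k & forall l, zt l t != 0 -> forall s, cabs (s - t) < k ->
    cabs (zt l s - zt l t) < cabs (zt l t) / 2 /\ k < cabs (zt l t) / 2.
  suff [k k0 h] : exists2 k : R, 0 < k & forall l, l \in enum 'I_N.+1 -> zt l t != 0 -> forall s, cabs (s - t) < k ->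
    cabs (zt l s - zt l t) < cabs (zt l t) / 2 /\ k < cabs (zt l t) / 2.
    by exists k => // l; apply: h; rewrite mem_enum.
  elim: (enum _) => [|l r [k k0 IH]]; first by exists 1.
  have [l0|l0] := eqVneq (zt l t) 0.
    exists k => // l'; rewrite inE => /predU1P[->|/IH//]; by rewrite l0 eqxx.
  have c2 : 0 < cabs (zt l t) / 2 by rewrite divr_gt0 // cabs_gt0.
  have [e e0 he] := hol_ccont (hl l) c2.
  have [k1 k10 hk1] := min2_gt0 k0 e0; have [k2 k20 hk2] := min2_gt0 k10 c2.
  exists (k2 / 2); first lra.
  have [|a1 a2] := hk2 (k2 / 2); first lra.
  have [a3 a4] := hk1 _ a1.
  move=> l' l'r z0 s hs; move: l'r; rewrite inE => /predU1P[e'|l'r].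
    rewrite e'; split=> //; apply: he; lra.
  by have [|] := IH l' l'r z0 s; [lra | split => //; lra].
have dt : 0 < d - cabs (t - t0) by move: ht; rewrite /cball /=; lra.
have [j j0 hj] := min2_gt0 dt k0.
apply/surf_nbhsP; exists j => // q h1 h2 Mq.
have hq : cabs (kap q - t) < j
  by rewrite -[X in _ - X](hk t) /kap; case: (crd) => [l|]; [exact: h2 | exact: h1].
have Dq : cball t0 d (kap q).
  have [] := hj _ hq; rewrite /cball /=; have := cabsD (kap q - t) (t - t0); rewrite subrKA; lra.
exists (kap q) => //.
have E1 := hz _ Mq Dq.
apply: injective_projections; first by rewrite /= E1.
apply/rowP => l; rewrite [LHS]mxE.
have [e|ncrd] := eqVneq crd (Some l).
  by have := hk (kap q); rewrite /kap e /= mxE.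
have znz s : cball t0 d s -> zt l s != 0.
  by move=> hs; case: (hnz l s hs) => // e; rewrite e eqxx in ncrd.
have sq : zt l (kap q) ^+ 2 = (q.2 0 l : C) ^+ 2.
  have [_ /(_ l)[_ _ a]] := Mq; have [_ /(_ l)[_ _ b]] := hM _ Dq.
  by rewrite a E1 -b mxE.
move/eqP: sq; rewrite eqf_sqr => /orP[/eqP//|/eqP e]; exfalso.
have [_ hqk] := hj _ hq; have [n1 n2] := hk' l (znz _ ht) _ hqk.
have := h2 l; rewrite /= mxE => n3.
have [_ n4] := hj _ n3.
have := cabsD (zt l (kap q) - zt l t) ((q.2 0 l : C) - zt l t).
have -> : zt l (kap q) - zt l t + ((q.2 0 l : C) - zt l t) = - (2 * zt l t) by rewrite e; ring.
have c2 : cabs (2 : C) = 2 by have := cabs_pos (ler0n R 2); rewrite rmorph_nat.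
rewrite cabsN cabsM c2; have := n4; have := n1; have := n2; lra.
Qed.

Lemma sqrtc1 : sqrtc 1 = 1 :> C.
Proof.
have h := sqr_sqrtc (1 : C); have /eqP := h; rewrite sqrf_eq1 => /orP[/eqP//|/eqP e].
by exfalso; have := sqrtc_Re_ge0 (1 : C); rewrite e /=; lra.
Qed.

Lemma npos_near (w : C) : cabs (w - 1) < 1 -> ~ npos w.
Proof.
move=> h [_ r0]; have := Re_le_cabs (w - 1); rewrite cReD cReN /= ler_norml => /andP[]; lra.
Qed.

Lemma sqrtc_neq0 (w : C) : w != 0 -> sqrtc w != 0.
Proof. by apply: contra_neq => e; rewrite -(sqr_sqrtc w) e expr0n. Qed.

Lemma Im_ii (r : R) : Im (ii * r%:C) = r.
Proof. by rewrite !ReImE /=; ring. Qed.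

Lemma sqr_neq_i (w u : C) : w ^+ 2 = u ^+ 2 - 1 -> u != 0 -> w <> ii /\ w <> - ii.
Proof.
move=> hw u0; have u2 : u ^+ 2 != 0 by rewrite expf_neq0.
have i2 : ii ^+ 2 = -1 :> C by rewrite expr2 ii2.
have aux : w ^+ 2 <> -1 by move=> h; move/eqP: u2; apply; rewrite -(subrK 1 (u ^+ 2)) -hw h addNr.
by split=> e; apply: aux; rewrite e ?sqrrN.
Qed.

Lemma upt_neq0 (l : nat) z : z != 0 -> ii * (L l)%:C / z != 0.
Proof.
by move=> z0; rewrite !mulf_neq0 ?invr_neq0 ?ii_neq0 // -cabs_gt0 cabs_real gtr0_norm ?Lval_gt0.
Qed.

Lemma cball_sub t (d d' : R) s : d' <= d -> cball t d' s -> cball t d s.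
Proof. by move=> dd hs; exact: lt_le_trans hs dd. Qed.

(** Away from the branch points [z] is the parameter. Over [-i L l0] the parameter is [s = zeta_l0],
    and solving [s^2 = (i L / z)^2 - 1] gives [z = - i L / sqrt (1 + s^2)]. The values [L l] are
    distinct, so no second coordinate vanishes. Charts are given on all smaller discs because
    [agree_local] shrinks them. *)
Lemma MN_exists_chart (p : pt) (r : R) : MN X1 p -> 0 < r -> exists t0 d zc zt,
  [/\ 0 < d, forall d' : R, d' <= d -> parametrization X1 (cball t0 d') (chart zc zt),
      chart zc zt t0 = p,
      forall s, cball t0 d s -> [/\ hol zc s, forall l, hol (zt l) s, MN X1 (chart zc zt s) &
         cabs (zc s - p.1) < r] &
      forall s, cball t0 d s -> s != t0 -> forall l, zt l s != 0].
Proof.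
move=> Mp r0; have [i0 hp] := Mp.
have pz0 : (p.1 : C) != 0 by exact: lower_neq0.
(* A nonzero coordinate is continued as its value at [p] times the principal root of a quotient
   equal to 1 at [p], hence away from the cut of [sqrtc]. *)
have lift (t0 : C) (zc : C -> C) (S : pred 'I_N.+1) : zc t0 = p.1 -> hol_near zc t0 ->
    (forall l, S l -> (p.2 0 l : C) != 0) -> exists2 d : R, 0 < d & forall s, cabs (s - t0) < d ->
    [/\ hol zc s, zc s != 0, Im (zc s) < 0, cabs (zc s - p.1) < r & forall l, S l ->
      let zt := fun s => (p.2 0 l : C) * sqrtc (((ii * (L l)%:C / zc s) ^+ 2 - 1) / (p.2 0 l : C) ^+ 2) in
      [/\ hol zt s, zt s ^+ 2 = (ii * (L l)%:C / zc s) ^+ 2 - 1 & zt s != 0]].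
  move=> zt0 [d1 d10 h1] hS.
  have [d2 d20 h2] := hol_ccont (h1 t0 (ltac:(by rewrite subrr cabs0))) r0.
  have [d3 d30 h3] := hol_ccont (h1 t0 (ltac:(by rewrite subrr cabs0))) (ltac:(by rewrite oppr_gt0) : 0 < - Im p.1).
  pose q (l : 'I_N.+1) s := ((ii * (L l)%:C / zc s) ^+ 2 - 1) / (p.2 0 l : C) ^+ 2.
  have hq l s : hol zc s -> zc s != 0 -> hol (q l) s.
    move=> hz z0; apply: holM => //; apply: holB => //; apply: holX; apply: holM => //; exact: holV.
  have q1 l : S l -> q l t0 = 1.
    by move=> Sl; rewrite /q zt0; have [_ _ <-] := hp l; rewrite divff // expf_neq0 // hS.
  have [d4 d40 h4] : exists2 d : R, 0 < d & forall l, S l -> forall s, cabs (s - t0) < d -> cabs (q l s - 1) < 1.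
    suff [d d0 h] : exists2 d : R, 0 < d & forall l, l \in enum 'I_N.+1 -> S l -> forall s, cabs (s - t0) < d -> cabs (q l s - 1) < 1.
      by exists d => // l; apply: h; rewrite mem_enum.
    elim: (enum _) => [|l e [d d0 IH]]; first by exists 1.
    have [Sl|Sl] := boolP (S l); last first.
      by exists d => // l'; rewrite inE => /predU1P[->|/IH//]; rewrite (negbTE Sl).
    have := hol_ccont (hq l t0 (h1 t0 (ltac:(by rewrite subrr cabs0))) (ltac:(by rewrite zt0))) ltr01.
    move=> [e1 e10 he1]; have [k k0 hk] := min2_gt0 d0 e10; exists k => // l'.
    rewrite inE => /predU1P[->|l'e] Sl' s /hk[k1 k2]; last exact: IH.
    by rewrite -(q1 l Sl); exact: he1.
  have [k1 k10 hk1] := min2_gt0 d10 d20; have [k2 k20 hk2] := min2_gt0 d30 d40.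
  have [d d0 hd] := min2_gt0 k10 k20; exists d => // s /hd[/hk1[/h1 a1 /h2 a2] /hk2[/h3 a3 a4]].
  rewrite zt0 in a2 a3.
  have a5 : Im (zc s) < 0.
    have := Im_le_cabs (zc s - p.1); rewrite cImD cImN ler_norml => /andP[]; lra.
  have a6 : zc s != 0 by exact: lower_neq0.
  split => // l Sl; have nq := npos_near (h4 l Sl s a4); split.
  - apply: holM => //; apply: (@hol_comp _ (q l)); [exact: hq | exact: hol_sqrtc].
  - by rewrite exprMn sqr_sqrtc mulrCA divff ?mulr1 // expf_neq0 // hS.
  - rewrite mulf_neq0 ?hS // sqrtc_neq0 //; apply/eqP => e; apply: nq; rewrite /q e; split => //=.
have [[l0 hl0]|nb] := pselect (exists l0, (p.2 0 l0 : C) = 0); last first.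
  have nb' l : (p.2 0 l : C) != 0 by apply/eqP => e; apply: nb; exists l.
  pose zt (l : 'I_N.+1) s := (p.2 0 l : C) * sqrtc (((ii * (L l)%:C / s) ^+ 2 - 1) / (p.2 0 l : C) ^+ 2).
  have [d d0 hd] := lift p.1 id xpredT erefl (holn_all p.1 (fun w => hol_id w)) (fun l _ => nb' l).
  have HM s : cball p.1 d s -> MN X1 (chart id zt s).
    move=> /hd[_ s0 si _ hl]; split => // l; have [_ e _] := hl l isT.
    by have [] := sqr_neq_i e (upt_neq0 l s0); rewrite /= mxE; split.
  exists p.1, d, id, zt; split => //.
  - move=> d' dd; apply: (@chart_parametrization p.1 d' id zt None) => //.
    + by move=> s /(cball_sub dd) /hd[h _ _ _ hl]; split => // l; have [] := hl l isT.
    + by move=> s /(cball_sub dd) /HM.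
    + by move=> l s /(cball_sub dd) /hd[_ _ _ _ hl]; left; have [] := hl l isT.
  - apply: injective_projections => //=; apply/rowP => l; rewrite mxE /zt.
    have [_ _ <-] := hp l; by rewrite divff ?expf_neq0 // sqrtc1 mulr1.
  - move=> s hs; have [h1 h2 h3 h4 hl] := hd s hs; split => //; last exact: HM.
    by move=> l; have [] := hl l isT.
  - by move=> s /hd[_ _ _ _ hl] _ l; have [] := hl l isT.
have z0E : (p.1 : C) = - (ii * (L l0)%:C).
  have [_ _ e] := hp l0; move: e; rewrite hl0 expr0n /= => /esym /eqP; rewrite subr_eq0 sqrf_eq1.
  have zz : ii * (L l0)%:C / p.1 * p.1 = ii * (L l0)%:C by rewrite divfK.
  case/orP => /eqP e; rewrite e in zz; last by rewrite -zz mulN1r opprK.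
  have := congr1 (@complex.Im R) zz; rewrite mul1r Im_ii => h.
  by have := Lval_gt0 b1_gt0 l0; rewrite -h; move: i0 => /= ? ?; exfalso; lra.
pose zc s := - (ii * (L l0)%:C) / sqrtc (1 + s ^+ 2).
have zc0 : zc 0 = p.1 by rewrite /zc expr0n addr0 sqrtc1 divr1 z0E.
have hzc : hol_near zc 0.
  exists 1 => // s; rewrite subr0 => hs; apply: holM => //; apply: holV; last first.
    apply: (@hol_comp _ (fun s => 1 + s ^+ 2)); first by apply: holD => //; exact: holX.
    apply: hol_sqrtc; apply: npos_near; rewrite addrC addKr cabsX.
    by rewrite expr_lt1 // cabs_ge0.
  apply: sqrtc_neq0; apply/eqP => e.
  have : cabs (s ^+ 2) = 1 by have -> : s ^+ 2 = -1; [apply/eqP; rewrite -subr_eq0 opprK addrC e | rewrite cabsN cabs1].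
  by rewrite cabsX => h; have := expr_lt1 (isT : (0 < 2)%N) (cabs_ge0 s); rewrite hs h ltxx.
pose S : pred 'I_N.+1 := fun l => l != l0.
have hS l : S l -> (p.2 0 l : C) != 0.
  move=> ll0; apply/eqP => e; have [_ _ el] := hp l; move: el; rewrite e expr0n /= z0E => /esym /eqP.
  have Ln0 : ((L l0)%:C : C) != 0 by rewrite -cabs_gt0 cabs_real gtr0_norm ?Lval_gt0.
  have -> : ii * (L l)%:C / - (ii * (L l0)%:C) = - (L l / L l0)%:C.
    by rewrite real_complexM real_complexV; field; rewrite Ln0 ii_neq0.
  rewrite sqrrN subr_eq0 sqrf_eq1.
  have Lp : 0 < L l / L l0 by rewrite divr_gt0 ?Lval_gt0.
  case/orP => /eqP /(congr1 (@complex.Re R)) /= h; last by lra.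
  have : L l = L l0 by have := divfK (lt0r_neq0 (Lval_gt0 b1_gt0 l0)) (L l); rewrite h mul1r.
  by move=> /(Lval_inj b1_gt0) /ord_inj e'; rewrite /S e' eqxx in ll0.
pose zt (l : 'I_N.+1) s := if l == l0 then s else
  (p.2 0 l : C) * sqrtc (((ii * (L l)%:C / zc s) ^+ 2 - 1) / (p.2 0 l : C) ^+ 2).
have [d1 d10 hd1] := lift 0 zc S zc0 hzc hS.
have [d d0 hd'] := min2_gt0 d10 (ltr01 : 0 < 1 :> R).
have hd s : cball 0 d s -> [/\ hol zc s, zc s != 0, Im (zc s) < 0, cabs (zc s - p.1) < r & forall l,
    [/\ hol (zt l) s, zt l s ^+ 2 = (ii * (L l)%:C / zc s) ^+ 2 - 1 & l != l0 -> zt l s != 0]].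
  move=> hs; have [a1 a2] := hd' _ hs; have [h1 h2 h3 h4 hl] := hd1 s a1; split => // l.
  rewrite /zt; case: eqVneq => [e|nl]; last by have [] := hl l nl.
  split => //; rewrite e /zc.
  have Ln0 : ((L l0)%:C : C) != 0 by rewrite -cabs_gt0 cabs_real gtr0_norm ?Lval_gt0.
  have sn0 : sqrtc (1 + s ^+ 2) != 0.
    by apply: contraNneq h2 => e0; rewrite /zc e0 invr0 mulr0.
  have -> : ii * (L l0)%:C / (- (ii * (L l0)%:C) / sqrtc (1 + s ^+ 2)) = - sqrtc (1 + s ^+ 2).
    by field; rewrite ii_neq0 Ln0 sn0.
  by rewrite sqrrN sqr_sqrtc; ring.
have HM s : cball 0 d s -> MN X1 (chart zc zt s).
  move=> /hd[_ s0 si _ hl]; split => // l; have [_ e _] := hl l.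
  by have [] := sqr_neq_i e (upt_neq0 l s0); rewrite /= mxE; split.
exists 0, d, zc, zt; split => //.
- move=> d' dd; apply: (@chart_parametrization 0 d' zc zt (Some l0)) => //.
  + by move=> s /(cball_sub dd) /hd[h _ _ _ hl]; split => // l; have [] := hl l.
  + by move=> s /(cball_sub dd) /HM.
  + by move=> s; rewrite /= mxE /zt eqxx.
  + move=> q Mq /(cball_sub dd) /hd[_ s0 si _ hl] /=; have [_ e _] := hl l0; move: e; rewrite {1}/zt eqxx.
    have [qi /(_ l0)[_ _ ->]] := Mq; move=> /eqP; rewrite (inj_eq (addIr _)) eqf_sqr.
    have q0 : (q.1 : C) != 0 by exact: lower_neq0.
    have Ln0 : ii * (L l0)%:C != 0 by rewrite mulf_neq0 ?ii_neq0 // -cabs_gt0 cabs_real gtr0_norm ?Lval_gt0.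
    move=> /orP[/eqP /(mulfI Ln0) /invr_inj //|/eqP]; rewrite -mulrN -invrN => /(mulfI Ln0) /invr_inj e.
    exfalso; move: qi si; rewrite e cImN /=; lra.
  + move=> l s /(cball_sub dd) /hd[_ _ _ _ hl]; have [->|nl] := eqVneq l l0; [by right|left].
    by have [_ _] := hl l; apply.
- apply: injective_projections => //=; apply/rowP => l; rewrite mxE /zt.
  case: eqVneq => [->//|nl]; rewrite zc0; have [_ _ <-] := hp l.
  by rewrite divff ?expf_neq0 ?hS // sqrtc1 mulr1.
- move=> s hs; have [h1 h2 h3 h4 hl] := hd s hs; split => //; last exact: HM.
  by move=> l; have [] := hl l.
- move=> s /hd[_ _ _ _ hl] s0 l; have [->|nl] := eqVneq l l0; first by rewrite /zt eqxx.
  by have [_ _] := hl l; apply.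
Qed.

End Charts.

(** * The lifted resolvent *)

Section Lifts.
Variables (R : realType) (X1 X2 : rank_one_space R).
Local Notation C := R[i].
Local Notation ii := (imag_unit R).
Local Notation Re := complex.Re.
Local Notation Im := complex.Im.
Local Notation T := ('M[R]_((sdim X1).+1) * 'M[R]_((sdim X2).+1))%type.
Variables (mu : {measure set (borelT X1 X2) -> \bar R}) (phi : C -> C -> T -> C).
Hypotheses (mu_haar : haar_measure mu) (hphi : spherical_family phi).
Variables (f : T -> C) (y : T).
Hypotheses (hf : Cc_infty f) (hy : prodG y).
Local Notation L := (Lval X1).
Hypothesis b1_gt0 : 0 < blen X1.
Hypotheses (m1_odd : odd (mult_beta X1)) (m2_even : ~~ odd (mult_beta X2)).
Variables (rr dd : R -> R).
Hypothesis discs : disc_data X1 rr dd.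
Variable Fm : (T -> C) -> T -> int -> C -> C.
Hypothesis HFm : Fm_family mu phi rr dd Fm.
Local Notation F := (Ffun mu phi f y).
Local Notation G := (Gfun mu phi f y).
Variable N : nat.
Local Notation pt := (surface_point R N).
Local Notation Wall := (Wall X1 N dd).
Local Notation Ft := (Ftilde mu phi f y dd Fm (N := N)).

Lemma holomorphic_on_charts (U : set C) (h : pt -> C) :
  (forall z, U z -> exists2 r : R, 0 < r & forall w, cabs (w - z) < r -> U w) ->
  (forall zc zt s, hol zc s -> (forall l, hol (zt l) s) -> MN X1 (chart zc zt s) -> U (zc s) ->
     hol (fun s => h (chart zc zt s)) s) ->
  holomorphic_on_surf X1 (piN_inv X1 U) h.
Proof.
move=> oU hh p [Mp Up]; have [r r0 hr] := oU _ Up.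
have [t0 [d [zc [zt [d0 hpar e hc _]]]]] := MN_exists_chart b1_gt0 Mp r0.
exists (cball t0 d), (chart zc zt), t0; split => //; first exact: hpar.
  by rewrite /cball /= subrr cabs0.
move=> s /hc[h1 h2 h3 h4]; apply/derivable_hol; apply: hh => //; exact: hr.
Qed.

Lemma Wall_open z : Wall z -> exists2 r : R, 0 < r & forall w, cabs (w - z) < r -> Wall w.
Proof. by move=> [m hm /Wm_open[d d0 hd]]; exists d => // w /hd ?; exists m. Qed.

Lemma Wall_lower z : Wall z -> Im z < 0.
Proof. by move=> [m _ /(Wm_lower b1_gt0 discs)]. Qed.

Lemma hol_Ftilde_chart zc zt s : hol zc s -> (forall l, hol (zt l) s) -> MN X1 (chart zc zt s) ->
  Wall (zc s) -> hol (fun s => Ft (chart zc zt s)) s.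
Proof.
move=> hz hzt [_ Ms] Wz; rewrite /Ftilde; apply: holD.
  apply: (hol_comp hz); apply: hol_near_hol.
  exact: (holn_Kfun mu_haar hphi hf hy b1_gt0 discs HFm m1_odd m2_even).
apply: holM => //; apply: hol_sum => l _.
have -> : (fun s => G l (chart zc zt s).1 ((chart zc zt s).2 0 l)) = (fun s => G l (zc s) (zt l s)).
  by apply/funext => t; rewrite /= mxE.
apply: (hol_Gfun mu_haar hphi hf hy (a := zc) (g := zt l)) => //; first exact: lower_neq0 (Wall_lower Wz).
have [_ _] := Ms l; rewrite /= mxE; set u := ii * _ / _ => e.
apply/eqP => /eqP; rewrite subr_eq0 => /eqP e'.
have : (1 : C) = u ^+ 2 - (u ^+ 2 - 1) by ring.
by rewrite -e e' subrr => /eqP; rewrite oner_eq0.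
Qed.

Variables (kappa : C) (Rs H : (T -> C) -> T -> C -> C).
Hypothesis Rs_resolvent : resolvent_family mu kappa Rs.
Variables (x0 y0 : R).
Hypotheses (x0_gt0 : 0 < x0) (y0_gt0 : 0 < y0).
Hypothesis HH : H_family mu phi x0 y0 Rs H.

(** A region joining the strip, where the relation between [Rs], [H] and [F] is given, to the lower
    half plane off the cut; all three functions are holomorphic on it. *)
Definition upper_dom (z : C) := offaxis X1 z /\ (Im z < 0 \/ x0 < Re z /\ Im z < y0).

Lemma ReIm_near z (a b : R) : exists2 d : R, 0 < d & forall w, cabs (w - z) < d ->
  (a < Re z -> a < Re w) /\ (Im z < b -> Im w < b).
Proof.
have [k k0 hk] : exists2 k : R, 0 < k & (a < Re z -> k <= Re z - a) /\ (Im z < b -> k <= b - Im z).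
  pose k1 := if a < Re z then Re z - a else 1; pose k2 := if Im z < b then b - Im z else 1.
  have k10 : 0 < k1 by rewrite /k1; case: ifP => // ?; lra.
  have k20 : 0 < k2 by rewrite /k2; case: ifP => // ?; lra.
  have [d d0 hd] := min2_gt0 k10 k20; have [|h1 h2] := hd (d / 2); first lra.
  exists (d / 2); first lra.
  by move: h1 h2; rewrite /k1 /k2; case: ifP => ?; case: ifP => ? h1 h2; split=> // ?; lra.
exists k => // w hw; have := Re_le_cabs (w - z); have := Im_le_cabs (w - z).
rewrite cReD cReN cImD cImN !ler_norml => /andP[i1 i2] /andP[r1 r2].
by split=> h; [have := hk.1 h | have := hk.2 h]; lra.
Qed.

Lemma upper_dom_near z : upper_dom z -> exists2 d : R, 0 < d & forall w, cabs (w - z) < d -> upper_dom w.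
Proof.
move=> [oz hz]; have [d1 d10 h1] := offaxis_near oz.
have [d2 d20 h2] := ReIm_near z x0 0; have [d3 d30 h3] := ReIm_near z x0 y0.
have [k k0 hk] := min2_gt0 d10 d20; have [d d0 hd] := min2_gt0 k0 d30.
exists d => // w /hd[/hk[/h1 a1 /h2[a2 a3]] /h3[a4 a5]]; split => //.
by case: hz => [|[]] *; [left; exact: a3 | right; split; [exact: a4 | exact: a5]].
Qed.

Lemma Rs_defect_hol z : upper_dom z ->
  hol_near (fun z => Rs f y z - (H f y z + pi%:C * ii * F z)) z.
Proof.
move=> /[dup] [[oz _]] /upper_dom_near[d d0 hd]; have [d2 d20 h2] := Ffun_hol mu_haar hphi hf hy b1_gt0 oz.
have [k k0 hk] := min2_gt0 d0 d20.
exists k => // w /hk[/hd[[w0 ow] hw] /h2 Fw]; apply: holB.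
  apply/derivable_hol; have [_ /(_ _ hf)[hR _]] := Rs_resolvent; apply: hR => // -[[i0 r0]|[r0 i0]].
    by have hx := x0_gt0; case: hw => [|[]] *; lra.
  by case: ow => // ?; have := Lval_gt0 b1_gt0 0; have := ler_norm (- Im w); rewrite normrN => *; lra.
apply: holD; last by apply: holM => //; exact: Fw.
apply/derivable_hol; have [hH _] := HH hf hy; apply: hH; case: hw => [h|[h1 h2']]; [by right|].
by have [i0|i0] := ltP (Im w) 0; [right|left; split => //; apply/andP].
Qed.

Lemma Rs_continuation z : Im z < 0 -> ~ neg_imag_cut X1 z ->
  Rs f y z = H f y z + pi%:C * ii * F z.
Proof.
have hx := x0_gt0; have hy0 := y0_gt0.
move=> iz nc; have oz := offcut_offaxis iz nc; have L0 := Lval_gt0 b1_gt0 0.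
(* The path goes from [q0] in the strip down to [q1], across to [c = -i L 0 / 2], which lies in the
   gap of the axis above the cut, and straight to [z]: the cut lower half plane is star-shaped about
   [c]. *)
pose q0 : C := (x0 + 1) +i* (y0 / 2); pose q1 : C := (x0 + 1) +i* (- (L 0 / 2)).
pose c : C := 0 +i* (- (L 0 / 2)).
have seg (p q : C) (t : R) : Re (p + t%:C * (q - p)) = (1 - t) * Re p + t * Re q /\
    Im (p + t%:C * (q - p)) = (1 - t) * Im p + t * Im q.
  by rewrite !ReImE /=; split; ring.
have off_of (w : C) : Re w <> 0 -> offaxis X1 w.
  by move=> h; split; [apply/eqP => e; rewrite e in h; exact: h | left].
suff [d d0 hd] : zero_near (fun z => Rs f y z - (H f y z + pi%:C * ii * F z)) z.
  by have := hd z; rewrite subrr cabs0 => /(_ d0) /eqP; rewrite subr_eq0 => /eqP.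
apply: (@identity_segment _ _ c).
  move=> t /andP[t0 t1]; apply: Rs_defect_hol; have [eR eI] := seg c z t.
  have ineg : Im (c + t%:C * (z - c)) < 0.
    rewrite eI /=; have [->|tn0] := eqVneq t 0; first lra.
    have tp : 0 < t by rewrite lt_neqAle eq_sym tn0.
    have : t * Im z < 0 by rewrite pmulr_rlt0.
    have : 0 <= (1 - t) * (L 0 / 2) by rewrite mulr_ge0 ?subr_ge0 //; lra.
    lra.
  split; last by left.
  have [rz|rz] := eqVneq (t * Re z) 0; last first.
    by apply: off_of; rewrite eR /= mulr0 add0r; exact/eqP.
  split; first exact: lower_neq0.
  move: ineg; rewrite eI => ineg; right; rewrite ltr0_norm //= ; move: rz => /eqP; rewrite mulf_eq0.
  case/orP => /eqP e; first by rewrite e; lra.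
  have [_ [//|hz]] := oz; rewrite ltr0_norm // in hz.
  have : t * (- Im z) <= t * L 0 by rewrite ler_wpM2l // ltW.
  have : (1 - t) * (L 0 / 2) <= (1 - t) * L 0 by rewrite ler_wpM2l ?subr_ge0 //; lra.
  have [->|tn0] := eqVneq t 0; first lra.
  have tp : 0 < t by rewrite lt_neqAle eq_sym tn0.
  have : t * (- Im z) < t * L 0 by rewrite ltr_pM2l.
  lra.
apply: (@identity_segment _ _ q1).
  move=> t /andP[t0 t1]; apply: Rs_defect_hol; have [eR eI] := seg q1 c t.
  have eI' : Im (q1 + t%:C * (c - q1)) = - (L 0 / 2) by rewrite eI /=; ring.
  split; last by left; rewrite eI'; lra.
  have i0 : Im (q1 + t%:C * (c - q1)) < 0 by rewrite eI'; lra.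
  split; first exact: lower_neq0.
  by right; rewrite ltr0_norm // eI'; lra.
apply: (@identity_segment _ _ q0).
  move=> t /andP[t0 t1]; apply: Rs_defect_hol; have [eR eI] := seg q0 q1 t.
  have eR' : Re (q0 + t%:C * (q1 - q0)) = x0 + 1 by rewrite eR /=; ring.
  split; first by apply: off_of; rewrite eR'; lra.
  right; rewrite eR' eI /=; split; first lra.
  have : 0 <= t * (L 0 / 2) by rewrite mulr_ge0 //; lra.
  have : (1 - t) * (y0 / 2) <= 1 * (y0 / 2) by rewrite ler_wpM2r //; lra.
  lra.
have [d1 d10 h1] := ReIm_near q0 x0 y0; have d2 : 0 < y0 / 2 by lra.
have [d d0 hd] := min2_gt0 d10 d2; exists d => // w /hd[/h1[a1 a2] a3].
have : x0 < Re w by apply: a1 => /=; lra.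
have : Im w < y0 by apply: a2 => /=; lra.
have := Im_le_cabs (w - q0); rewrite cImD cImN /= ler_norml => /andP[b1 b2] c1 c2.
have [_ hQ] := HH hf hy; rewrite hQ ?subrr //; split => //; apply/andP; split => //; lra.
Qed.

End Lifts.

(** * Absence of resonances *)

Section PuncturedDisc.
Variable R : realType.
Local Notation C := R[i].
Local Notation ii := (imag_unit R).
Local Notation Re := complex.Re.
Local Notation Im := complex.Im.
Implicit Types (z w p q k : C).

Lemma derive_cderiv (f : C -> C) z l : cderiv f z l -> 'D_1 (f : C^o -> C^o) z = l.
Proof.
move=> /cderivP H; apply: cvg_lim => //; apply/cvgrPdist_le => e.
case: e => a b; rewrite ltcE /= => /andP[/eqP -> a0]; apply/cnbhsP.
have [d d0 hd] := H _ a0; exists d => // h; rewrite subr0 => hh h0.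
rewrite /GRing.scale /= mulr1 cabsE lecR (cabs_sub l).
have := hd (h + z); rewrite addrK => /(_ hh).
rewrite -ler_pdivrMr ?cabs_gt0 // -cabsV -cabsM => H1.
apply: le_trans H1; rewrite [X in cabs X <= _](_ : _ = (f (h + z) - f z - l * h) / h) //.
by field.
Qed.

Lemma segment_neq0 p q (t : R) : p != 0 -> Im (q / p) <> 0 \/ 0 < Re (q / p) -> 0 <= t <= 1 ->
  p + t%:C * (q - p) != 0.
Proof.
move=> p0 h /andP[t0 t1]; have -> : p + t%:C * (q - p) = p * (1 + t%:C * (q / p - 1)) by field.
rewrite mulf_neq0 //; move: (q / p) h => k h; apply/eqP => e.
have eR := congr1 (@complex.Re R) e; have eI := congr1 (@complex.Im R) e.
rewrite !ReImE /= in eR eI.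
have [tz|tn0] := eqVneq t 0; first by rewrite tz in eR; lra.
have tp : 0 < t by rewrite lt_neqAle eq_sym tn0.
case: h => h.
  apply: h; apply: (mulfI tn0); rewrite mulr0; lra.
have := mulr_gt0 tp h; lra.
Qed.

Lemma punctured_segment (g : C -> C) c (d : R) p q :
  (forall t, 0 < cabs (t - c) < d -> hol_near g t) ->
  0 < cabs p < d -> 0 < cabs q < d -> Im (q / p) <> 0 \/ 0 < Re (q / p) ->
  zero_near g (c + p) -> zero_near g (c + q).
Proof.
move=> hg /andP[p0 pd] /andP[q0 qd] h; apply: identity_segment => t /andP[t0 t1]; apply: hg.
have -> : c + p + t%:C * (c + q - (c + p)) - c = p + t%:C * (q - p) by ring.
rewrite cabs_gt0 segment_neq0 ?t0 ?t1 // -?cabs_gt0 //=.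
have -> : p + t%:C * (q - p) = (1 - t)%:C * p + t%:C * q by rewrite rmorphB rmorph1; ring.
apply: (le_lt_trans (cabsD _ _)); rewrite !cabsM !cabs_pos ?subr_ge0 //.
have [->|tn0] := eqVneq t 0; first by rewrite subr0 mul1r mul0r addr0.
have tp : 0 < t by rewrite lt_neqAle eq_sym tn0.
have : t * cabs q < t * d by rewrite ltr_pM2l.
have : (1 - t) * cabs p <= (1 - t) * d by rewrite ler_wpM2l ?subr_ge0 // ltW.
lra.
Qed.

(** A segment meets the center only if its ends are opposite; in that case the detour through
    [ii * p] splits it into two admissible segments. *)
Lemma punctured_identity (g : C -> C) c (d : R) t1 t2 :
  (forall t, 0 < cabs (t - c) < d -> hol_near g t) ->
  0 < cabs (t1 - c) < d -> 0 < cabs (t2 - c) < d -> zero_near g t1 -> zero_near g t2.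
Proof.
move=> hg h1 h2; have e1 : t1 = c + (t1 - c) by rewrite addrC subrK.
have e2 : t2 = c + (t2 - c) by rewrite addrC subrK.
rewrite e1 e2; move: (t1 - c) (t2 - c) h1 h2 => p q hp hq.
have p0 : p != 0 by case/andP: hp; rewrite cabs_gt0.
have q0 : q != 0 by case/andP: hq; rewrite cabs_gt0.
have [h|h] := pselect (Im (q / p) <> 0 \/ 0 < Re (q / p)); first exact: punctured_segment hg hp hq h.
have hip : 0 < cabs (ii * p) < d by rewrite cabsM cabs_i mul1r.
have i0 : Im (q / p) = 0 by apply: contrapT => k; apply: h; left.
have rlt : Re (q / p) < 0.
  have r0 : Re (q / p) <= 0 by rewrite leNgt; apply/negP => k; apply: h; right.
  rewrite lt_neqAle r0 andbT; apply/eqP => r00.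
  have : q / p == 0 by apply/eqP; exact: complex_ext.
  by rewrite mulf_eq0 invr_eq0 (negbTE p0) (negbTE q0).
move=> zp; apply: (punctured_segment hg hip hq); last first.
  apply: (punctured_segment hg hp hip _ zp); left.
  by rewrite mulfK //= ; apply/eqP/oner_neq0.
left; have -> : q / (ii * p) = - ii * (q / p) by rewrite invfM ii_V; ring.
by move: (q / p) i0 rlt => k k1 k2; rewrite !ReImE /= k1; lra.
Qed.

Lemma fin_min (I : finType) (P : I -> R -> Prop) : (forall i d d', d' <= d -> P i d -> P i d') ->
  (forall i, exists2 d : R, 0 < d & P i d) -> exists2 d : R, 0 < d & forall i, P i d.
Proof.
move=> mono h; suff [d d0 hd] : exists2 d : R, 0 < d & forall i, i \in enum I -> P i d.
  by exists d => // i; apply: hd; rewrite mem_enum.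
elim: (enum I) => [|i r [d d0 IH]]; first by exists 1.
have [e e0 he] := h i; have [k k0 hk] := min2_gt0 d0 e0.
have [|k1 k2] := hk (k / 2); first lra.
exists (k / 2); first lra.
by move=> j; rewrite inE => /predU1P[->|jr]; [exact: mono (ltW k2) he | exact: mono (ltW k1) (IH j jr)].
Qed.

End PuncturedDisc.

Section Transfer.
Variables (R : realType) (X1 : rank_one_space R) (N : nat).
Local Notation C := R[i].
Local Notation ii := (imag_unit R).
Local Notation Re := complex.Re.
Local Notation Im := complex.Im.
Local Notation L := (Lval X1).
Local Notation pt := (surface_point R N).
Hypothesis b1_gt0 : 0 < blen X1.

Definition unramified (q : pt) := forall l, (q.2 0 l : C) != 0.

Lemma chart_enters (zc : C -> C) (zt : 'I_N.+1 -> C -> C) t (V : set pt) :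
  ccont zc t -> (forall l, ccont (zt l) t) -> open V -> V (chart zc zt t) ->
  exists2 d : R, 0 < d & forall s, cabs (s - t) < d -> V (chart zc zt s).
Proof.
move=> cz cl oV Vt; have [r r0 hr] := open_surf_near oV Vt.
have [d1 d10 h1] := cz _ r0.
have [|l|d2 d20 h2] := @fin_min R _ (fun l d => forall s, cabs (s - t) < d -> cabs (zt l s - zt l t) < r).
- by move=> l d d' dd h s hs; apply: h; exact: lt_le_trans hs dd.
- by have [d d0 hd] := cl l _ r0; exists d.
have [d d0 hd] := min2_gt0 d10 d20; exists d => // s /hd[/h1 k1 k2]; apply: hr => // l.
by rewrite /= !mxE; exact: h2.
Qed.

(* At an unramified point the first coordinate of any parametrization has a
   nonzero derivative, hence is locally open, and it determines the point. *)
Lemma parametrization_transfer (D : set C^o) (gam : C^o -> pt) t' (h : pt -> C)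
    (zc : C -> C) (zt : 'I_N.+1 -> C -> C) s0 (d0 : R) :
  parametrization X1 D gam -> D t' -> holomorphic_on D (h \o gam) ->
  0 < d0 -> (forall s, cabs (s - s0) < d0 -> [/\ hol zc s, forall l, hol (zt l) s & MN X1 (chart zc zt s)]) ->
  chart zc zt s0 = gam t' -> unramified (gam t') ->
  hol (fun s => h (chart zc zt s)) s0.
Proof.
move=> [oD dD rD iD [V oV VD]] Dt' hh d00 hch e0 un.
have [dD1 dD10 hD1] : exists2 d : R, 0 < d & forall t, cabs (t - t') < d -> D t.
  by apply/cnbhsP; exact: open_nbhs_nbhs.
pose om (t : C) : C := (gam t).1; pose nu l (t : C) : C := (gam t).2 0 l.
have hom t : D t -> hol om t by move=> /dD[h1 _]; apply/derivable_hol.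
have hnu l t : D t -> hol (nu l) t by move=> /dD[_ h1]; apply/derivable_hol; exact: h1.
have MD t : D t -> MN X1 (gam t).
  by move=> Dt; have : (gam @` D) (gam t) by [exists t]; rewrite VD => -[].
have s0d : cabs (s0 - s0) < d0 by rewrite subrr cabs0.
have [hzc0 hzt0 Ms0] := hch _ s0d.
have ez : zc s0 = om t' by have := congr1 fst e0.
have el l : zt l s0 = nu l t' by have := congr1 (fun q : pt => q.2 0 l : C) e0; rewrite /= mxE.
have om0 : om t' != 0 by apply: lower_neq0; have [] := MD _ Dt'.
have [lo [Q [cQ Q0 EQ]]] := hom _ Dt'.
(* If the derivative of the first coordinate vanished, the defining equations would give
   [2 * zeta_l * zeta_l' = 0] for all [l], so all derivatives would vanish, against the regularity
   of the parametrization. *)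
have lo0 : lo != 0.
  apply/eqP => lz; have hc : cderiv om t' 0 by rewrite -lz; exists Q.
  have [h1|[l h1]] := rD _ Dt'.
    by apply: h1; exact: (derive_cderiv hc).
  have [ln hl] := hnu l _ Dt'; apply: h1; rewrite (derive_cderiv hl).
  have c1 := cderivM hl hl.
  have c2 : cderiv (fun t => nu l t * nu l t) t' 0.
    have E t : cabs (t - t') < dD1 -> nu l t * nu l t = (ii * (L l)%:C / om t) * (ii * (L l)%:C / om t) + -1.
      by move=> /hD1 /MD[_ /(_ l)[_ _ e]]; rewrite -!expr2.
    apply: (near_cderiv dD10 E).
    have cu := cderivM (cderiv_cst (ii * (L l)%:C) t') (cderiv_comp hc (cderivV om0)).
    have := cderivD (cderivM cu cu) (cderiv_cst (-1) t').
    by congr cderiv; rewrite /= !(mulr0, mul0r, addr0).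
  have /eqP := cderiv_uniq c1 c2; rewrite [nu l t' * _]mulrC -mulrDr mulf_eq0 => /orP[/eqP//|].
  by rewrite -mulr2n mulrn_eq0 /= (negbTE (un l)).
have [lk [q [cq q0 Eq]]] : hol (fun t => h (gam t)) t' by apply/derivable_hol; exact: hh.
have [lz [Z [cZ Z0 EZ]]] := hzc0.
pose l := lk / lo * lz.
(* When [gam t] and the chart at [s] are the same point, [Q t * (t - t') = Z s * (s - s0)], so the
   slope of [h] along the chart is [J t s]. This avoids inverting the parametrization. *)
pose J t s := q t * (Q t)^-1 * Z s.
have jJ : jcont J t' s0.
  apply: jcontM; last exact: jcont_snd.
  apply: jcont_fst; apply: (@ccontM _ q (fun t => (Q t)^-1)) => //; apply: ccontV => //; by rewrite Q0.
have J0 : J t' s0 = l by rewrite /J q0 Q0 Z0.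
(* [local_open] matches the first coordinates by a parameter [t] near [t']; the others then agree up
   to sign, and the sign is fixed by closeness to a nonzero value. *)
have ident r : 0 < r -> exists2 d : R, 0 < d & forall s, cabs (s - s0) < d ->
    exists2 t, cabs (t - t') < r & [/\ D t, om t = zc s & gam t = chart zc zt s].
  move=> r0.
  have [|k|d1 d10 h1] := @fin_min R _ (fun k d => (forall t, cabs (t - t') < d -> cabs (nu k t - nu k t') < cabs (nu k t') / 2) /\
     forall s, cabs (s - s0) < d -> cabs (zt k s - zt k s0) < cabs (nu k t') / 2).
  - by move=> k d d' dd [a1 a2]; split=> t ht; [apply: a1|apply: a2]; exact: lt_le_trans ht dd.
  - have c2 : 0 < cabs (nu k t') / 2 by rewrite divr_gt0 // cabs_gt0; exact: un.
    have [e1 e10 a1] := hol_ccont (hnu k _ Dt') c2; have [e2 e20 a2] := hol_ccont (hzt0 k) c2.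
    have [e e00 he] := min2_gt0 e10 e20; exists e => //; split=> t /he[b1 b2]; [exact: a1|exact: a2].
  have [k1 k10 hk1] := min2_gt0 r0 d10; have [k2 k20 hk2] := min2_gt0 k10 dD10.
  have hn : hol_near om t' by exists dD1 => // t /hD1; exact: hom.
  have hc : cderiv om t' lo by exists Q.
  have [d2 d20 h2] := local_open hn hc lo0 k20.
  have [d3 d30 h3] := hol_ccont hzc0 d20.
  have [k3 k30 hk3] := min2_gt0 d30 d10; have [k4 k40 hk4] := min2_gt0 k30 d00.
  exists k4 => // s /hk4[/hk3[/h3 s1 s2] s3]; rewrite ez in s1.
  have [t /hk2[/hk1[t1 t2] t3] omt] := h2 _ s1; exists t => //.
  have Dt := hD1 _ t3; split => //; have [_ _ Ms] := hch _ s3.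
  apply: injective_projections => //; apply/rowP => j; rewrite [RHS]mxE.
  have [_ /(_ j)[_ _ a]] := MD _ Dt; have [_ /(_ j)[_ _ b]] := Ms.
  have : (nu j t) ^+ 2 = zt j s ^+ 2.
    by move: a b; rewrite /= mxE /nu => -> ->; rewrite -/(om t) omt.
  move/eqP; rewrite eqf_sqr => /orP[/eqP//|/eqP e]; exfalso.
  have [a1 a2] := h1 j; have b1 := a1 _ t2; have b2 := a2 _ s2; rewrite el in b2.
  rewrite e in b1; have := cabsD (- zt j s - nu j t') (zt j s - nu j t').
  have -> : - zt j s - nu j t' + (zt j s - nu j t') = - (2 * nu j t') by ring.
  have c2 : cabs (2 : C) = 2 by have := cabs_pos (ler0n R 2); rewrite rmorph_nat.
  rewrite cabsN cabsM c2; have := cabs_ge0 (nu j t'); lra.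
exists l; exists (fun s => if s == s0 then l else (h (chart zc zt s) - h (chart zc zt s0)) / (s - s0)); split.
- move=> e e00; have [r r0 hr] := jJ _ e00.
  have [rq rq0 hrq] : exists2 d : R, 0 < d & forall t, cabs (t - t') < d -> Q t != 0.
    have [|d' d'0 hd'] := @ccont_neq0 _ Q t' cQ; first by rewrite Q0.
    exists d' => // t /hd' ht; rewrite -cabs_gt0; apply: le_lt_trans ht.
    by rewrite divr_ge0 // cabs_ge0.
  have [r1 r10 hr1] := min2_gt0 r0 rq0.
  have [d d0' hd] := ident r1 r10.
  have [k k0 hk] := min2_gt0 r0 d0'; exists k => // s /hk[s1 s2]; rewrite eqxx.
  case: eqVneq => [_|ss0]; first by rewrite subrr cabs0.
  have [t /hr1[tr /hrq Qt] [Dt omt gt]] := hd s s2; rewrite -J0 -gt e0 Eq.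
  have -> : q t * (t - t') / (s - s0) = J t s; last exact: hr.
  have sn : s - s0 != 0 by rewrite subr_eq0.
  have E : Q t * (t - t') = Z s * (s - s0) by rewrite -EQ -EZ omt ez.
  rewrite /J; apply: (mulIf sn); rewrite divfK // -[RHS]mulrA -E; by field.
- by rewrite eqxx.
- move=> s; case: eqVneq => [->|ss0]; first by rewrite !subrr mulr0.
  by rewrite divfK // subr_eq0.
Qed.

End Transfer.

(** * Sections over the closed half planes *)

Section Sections.
Variables (R : realType) (X1 : rank_one_space R) (N : nat).
Local Notation C := R[i].
Local Notation ii := (imag_unit R).
Local Notation Re := complex.Re.
Local Notation Im := complex.Im.
Local Notation L := (Lval X1).
Local Notation pt := (surface_point R N).
Hypothesis b1_gt0 : 0 < blen X1.
Implicit Types (z w : C) (s : R) (e : 'I_N.+1 -> bool).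

(* For s = 1 (resp. -1) these sections are continuous up to the imaginary axis on
   the right (resp. left) half of the lower half plane, as zs is continuous on
   the closed upper half plane. *)
Definition half_section s e z : pt := (z, \row_l ((-1) ^+ e l * zs (s%:C * upt X1 l z))).

Definition half_plane s z := Im z < 0 /\ 0 <= s * Re z.

Lemma half_section_sqr s z (l : nat) : s * s = 1 -> zs (s%:C * upt X1 l z) ^+ 2 = upt X1 l z ^+ 2 - 1.
Proof. by move=> ss; rewrite zs_sqr exprMn expr2 -rmorphM ss rmorph1 mul1r. Qed.

Lemma half_section_MN s e z : s * s = 1 -> Im z < 0 -> MN X1 (half_section s e z).
Proof.
move=> ss iz; split => // l; have z0 := lower_neq0 iz.
have E : ((half_section s e z).2 0 l : C) ^+ 2 = upt X1 l z ^+ 2 - 1.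
  by rewrite /= mxE exprMn half_section_sqr // sqrr_sign mul1r.
by have [h1 h2] := sqr_neq_i E (upt_neq0 b1_gt0 l z0).
Qed.

Lemma half_section_of s (p : pt) : s * s = 1 -> MN X1 p -> exists e, p = half_section s e p.1.
Proof.
move=> ss [_ hp]; exists (fun l => (p.2 0 l : C) != zs (s%:C * upt X1 l p.1)).
apply: injective_projections => //; apply/rowP => l; rewrite [RHS]mxE.
have [_ _ h] := hp l; have : (p.2 0 l : C) ^+ 2 = zs (s%:C * upt X1 l p.1) ^+ 2.
  by rewrite half_section_sqr.
case: eqVneq => [->|ne]; first by rewrite mul1r.
by move=> /eqP; rewrite eqf_sqr (negbTE ne) /= => /eqP ->; rewrite mulN1r.
Qed.

Lemma Im_upt (l : nat) s z : half_plane s z -> 0 <= Im (s%:C * upt X1 l z).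
Proof.
move=> [iz h]; have z0 := lower_neq0 iz; set u := upt X1 l z.
have c0 : 0 < cabs z ^+ 2 by rewrite exprn_gt0 // cabs_gt0.
have zu : z * u = ii * (L l)%:C by rewrite /u /upt; field.
clearbody u; have eR := congr1 (@complex.Re R) zu; have eI := congr1 (@complex.Im R) zu.
rewrite !ReImE /= in eR eI; rewrite ReImE /= mul0r addr0.
have E : cabs z ^+ 2 * (s * Im u) = L l * (s * Re z).
  rewrite cabs_sqr; transitivity (s * (Re z * (Re z * Im u + Im z * Re u) - Im z * (Re z * Re u - Im z * Im u))).
    by ring.
  by rewrite eI eR; ring.
by rewrite -(pmulr_rge0 _ c0) E mulr_ge0 // ltW // Lval_gt0.
Qed.

Lemma half_section_cont s e z (V : set pt) : half_plane s z -> open V -> V (half_section s e z) ->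
  exists2 d : R, 0 < d & forall w, half_plane s w -> cabs (w - z) < d -> V (half_section s e w).
Proof.
move=> hz oV Vz; have [r r0 hr] := open_surf_near oV Vz; have z0 := lower_neq0 hz.1.
have [|l|d1 d10 h1] := @fin_min R _ (fun (l : 'I_N.+1) d => forall w, half_plane s w -> cabs (w - z) < d ->
    cabs (zs (s%:C * upt X1 l w) - zs (s%:C * upt X1 l z)) < r).
- by move=> l d d' dd h w hw wd; apply: h => //; exact: lt_le_trans wd dd.
- have [k k0 hk] := zs_cont_upper (Im_upt l hz) r0.
  have cu : ccont (fun w => s%:C * upt X1 l w) z.
    apply: hol_ccont; apply: holM => //; apply: hol_near_hol; exact: holn_upt.
  have [d d0 hd] := cu _ k0; exists d => // w hw wd; apply: hk; [exact: Im_upt | exact: hd].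
have [d d0 hd] := min2_gt0 d10 r0; exists d => // w hw /hd[k1 k2]; apply: hr => // l.
rewrite /= !mxE -mulrBr cabsM cabsX cabsN cabs1 expr1n mul1r; exact: h1.
Qed.

(** At the branch point the coordinate of index [l0] is 0, so its sign is immaterial; here the
    sheets meet. *)
Lemma half_section_flip (l0 : 'I_N.+1) e e' : (forall l, l != l0 -> e l = e' l) ->
  half_section 1 e (ibelow (L l0)) = half_section 1 e' (ibelow (L l0)).
Proof.
move=> h; apply: injective_projections => //; apply/rowP => l; rewrite !mxE.
have [->|/h ->//] := eqVneq l l0.
have L0 := Lval_gt0 b1_gt0 l0.
rewrite upt_center // divff ?gt_eqF // rmorph1 mul1r.
have -> : zs (- (1 : R)%:C : C) = 0; last by rewrite !mulr0.
by rewrite /zs rmorph1 addNr sqrtc0 mul0r.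
Qed.

(** The sections for the two sides differ by the oddness of [zs], hence by all signs at once. *)
Lemma half_section_opp e z : offaxis X1 z ->
  half_section (-1) e z = half_section 1 (fun l => ~~ e l) z.
Proof.
move=> oz; apply: injective_projections => //; apply/rowP => l; rewrite !mxE.
rewrite rmorphN rmorph1 mulN1r mul1r zs_opp; last exact: offaxis_slit.
by case: (e l); rewrite /= ?expr1 ?expr0 ?mulN1r ?mul1r ?opprK.
Qed.

End Sections.

Section Resonances.
Variables (R : realType) (X1 : rank_one_space R) (N : nat).
Local Notation C := R[i].
Local Notation ii := (imag_unit R).
Local Notation Re := complex.Re.
Local Notation Im := complex.Im.
Local Notation L := (Lval X1).
Local Notation pt := (surface_point R N).
Hypothesis b1_gt0 : 0 < blen X1.
Variables (rr dd : R -> R).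
Hypothesis discs : disc_data X1 rr dd.
Local Notation W := (Wdisc dd).
Local Notation Wall := (Wall X1 N dd).
Local Notation Mg := (Mgamma X1 dd (N := N)).
Implicit Types (z w : C) (e : 'I_N.+1 -> bool).
Variables (h h0 : pt -> C) (E : set pt).
Hypothesis discE : discrete_in E Mg.
Hypothesis hol_h : holomorphic_on_surf X1 (Mg `\` E) h.
Hypothesis hol_h0 : forall zc zt s, hol zc s -> (forall l, hol (zt l) s) ->
  MN X1 (chart zc zt s) -> Wall (zc s) -> hol (fun s => h0 (chart zc zt s)) s.

(* The ramified points are left out so that the chart at every point considered
   can be compared with any other parametrization. *)
Definition agree (a : pt) := exists2 V : set pt, open V /\ V a &
  forall q, MN X1 q -> V q -> ~ E q -> unramified q -> h q = h0 q.

(** In one chart, shrunk so that only its center can be ramified or belong to [E], the difference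
    [h - h0] is holomorphic on a punctured disc, where the identity theorem applies; at the center
    it vanishes by continuity when it is holomorphic there. *)
Lemma agree_local p : Mg p -> exists2 V : set pt, open V /\ V p &
  forall a b, MN X1 a -> V a -> MN X1 b -> V b -> agree a -> agree b.
Proof.
move=> /[dup] Mp [MNp Wp]; have [r r0 hr] := Wall_open Wp.
have [t0 [d [zc [zt [d0 hpar e0 hc hnz]]]]] := MN_exists_chart b1_gt0 MNp r0.
have [_ /(_ p Mp)[V1 [oV1 V1p] hV1]] := discE.
have t0d : cball t0 d t0 by rewrite /cball /= subrr cabs0.
have Vt0 : V1 (chart zc zt t0) by rewrite e0.
have [cz ct _ _] := hc _ t0d.
have [d1 d10 h1] := chart_enters (hol_ccont cz) (fun l => hol_ccont (ct l)) oV1 Vt0.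
have [d2 d20 h2] : exists2 d2 : R, 0 < d2 & d2 <= d /\ d2 <= d1.
  have [k k0 hk] := min2_gt0 d0 d10; have [|k1 k2] := hk (k / 2); first lra.
  by exists (k / 2); [lra | rewrite !ltW].
have hpar2 := hpar _ h2.1; have [_ _ _ inj [V oV VD]] := hpar2.
have in2 s : cabs (s - t0) < d2 -> [/\ hol zc s, forall l, hol (zt l) s, MN X1 (chart zc zt s), Wall (zc s) & V1 (chart zc zt s)].
  move=> hs; have [|a1 a2 a3 /hr a4] := hc s; first exact: lt_le_trans hs h2.1.
  by split => //; apply: h1; exact: lt_le_trans hs h2.2.
have hM s : cabs (s - t0) < d2 -> Mg (chart zc zt s) by move=> /in2[].
have unr s : cabs (s - t0) < d2 -> s != t0 -> unramified (chart zc zt s).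
  by move=> hs st l; rewrite /= mxE; apply: hnz st l; exact: lt_le_trans hs h2.1.
have nE s : cabs (s - t0) < d2 -> s != t0 -> ~ E (chart zc zt s).
  move=> hs st Es; have [_ _ _ _ Vs] := in2 s hs.
  have := hV1 (chart zc zt s) (conj Es Vs) => /= ep; move/eqP: st; apply.
  by apply: inj => //; rewrite ?ep // /cball /= subrr cabs0.
have holh s : cabs (s - t0) < d2 -> ~ E (chart zc zt s) -> unramified (chart zc zt s) ->
    hol (fun s => h (chart zc zt s)) s.
  move=> hs nEs us; have [D [gam [t' [pg Dt' eg hg]]]] := hol_h (conj (hM s hs) nEs).
  have k0 : 0 < d2 - cabs (s - t0) by lra.
  apply: (parametrization_transfer (zc := zc) (zt := zt) (s0 := s) pg Dt' hg k0); rewrite ?eg //.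
  move=> u hu; have [|a1 a2 a3 _ _] := in2 u; last by [].
  by have := cabsD (u - s) (s - t0); rewrite subrKA; lra.
pose g s := h (chart zc zt s) - h0 (chart zc zt s).
have holg s : cabs (s - t0) < d2 -> ~ E (chart zc zt s) -> unramified (chart zc zt s) -> hol g s.
  move=> hs a1 a2; apply: holB; first exact: holh.
  by have [b1 b2 b3 b4 _] := in2 s hs; exact: hol_h0.
have punct s : 0 < cabs (s - t0) < d2 -> hol_near g s.
  move=> /andP[s1 s2]; have k1 : 0 < d2 - cabs (s - t0) by lra.
  have [k k0 hk] := min2_gt0 s1 k1; exists k => // u /hk[u1 u2].
  have ut : cabs (u - t0) < d2 by have := cabsD (u - s) (s - t0); rewrite subrKA; lra.
  have un : u != t0 by apply: contraTneq u1 => ->; rewrite cabs_sub ltxx.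
  by apply: holg => //; [exact: nE | exact: unr].
have off_pt t (k : R) : 0 < k -> cabs (t - t0) < d2 ->
    exists s, [/\ s != t0, cabs (s - t) < k & cabs (s - t0) < d2].
  move=> k0 ht; have [tt|tt] := eqVneq t t0; last by exists t; split => //; rewrite subrr cabs0.
  have [j j0 hj] := min2_gt0 k0 d20; have [|j1 j2] := hj (j / 2); first lra.
  have cj : cabs (t0 + (j / 2)%:C - t0) = j / 2 by rewrite addrC addKr cabs_pos; lra.
  exists (t0 + (j / 2)%:C); rewrite tt cj; split => //.
  by rewrite -subr_eq0 -cabs_gt0 cj; lra.
exists V.
  split => //; have : (chart zc zt @` cball t0 d2) p by exists t0 => //; rewrite /cball /= subrr cabs0.
  by rewrite VD => -[].
move=> a b Ma Va Mb Vb [Va' [oVa' Va'a] hVa'].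
have [ta hta ea] : (chart zc zt @` cball t0 d2) a by rewrite VD.
have [az at_ _ _ _] := in2 ta hta.
have Vta : Va' (chart zc zt ta) by rewrite ea.
have [k k0 hk] := chart_enters (hol_ccont az) (fun l => hol_ccont (at_ l)) oVa' Vta.
have [t1 [t1n t1k t1d]] := off_pt ta k k0 hta.
have z1 : zero_near g t1.
  have c1 : 0 < cabs (t1 - t0) by rewrite cabs_gt0 subr_eq0.
  have k1 : 0 < k - cabs (t1 - ta) by lra.
  have k2 : 0 < d2 - cabs (t1 - t0) by lra.
  have [j1 j10 hj1] := min2_gt0 c1 k1; have [j j0 hj] := min2_gt0 j10 k2.
  exists j => // s /hj[/hj1[s1 s2] s3].
  have st : s != t0 by apply: contraTneq s1 => ->; rewrite cabs_sub ltxx.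
  have sd : cabs (s - t0) < d2 by have := cabsD (s - t1) (t1 - t0); rewrite subrKA; lra.
  have sk : cabs (s - ta) < k by have := cabsD (s - t1) (t1 - ta); rewrite subrKA; lra.
  have [_ _ a3 _ _] := in2 s sd.
  by rewrite /g (hVa' _ a3 (hk s sk) (nE s sd st) (unr s sd st)) subrr.
have zero s : cabs (s - t0) < d2 -> s != t0 -> g s = 0.
  move=> sd st; have [||k' k'0 hk'] := punctured_identity punct (t1 := t1) (t2 := s) _ _ z1.
  - by rewrite cabs_gt0 subr_eq0 t1n.
  - by rewrite cabs_gt0 subr_eq0 st.
  by apply: hk'; rewrite subrr cabs0.
exists V => // q Mq Vq nEq uq.
have [t ht et] : (chart zc zt @` cball t0 d2) q by rewrite VD.
apply/eqP; rewrite -subr_eq0 -et -/(g t); apply/eqP.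
have [tt|tt] := eqVneq t t0; last exact: zero.
rewrite -et in nEq uq; apply: ccont_zero; first by apply: hol_ccont; exact: holg.
by move=> k' k'0; have [s [s1 s2 s3]] := off_pt t k' k'0 ht; exists s => //; exact: zero.
Qed.

Lemma agree_path (s : R) e z0 z1 : s * s = 1 ->
  (forall t : R, 0 <= t <= 1 -> half_plane s (z0 + t%:C * (z1 - z0)) /\ Wall (z0 + t%:C * (z1 - z0))) ->
  agree (half_section X1 s e z0) -> agree (half_section X1 s e z1).
Proof.
move=> ss hz; pose zt (t : R) := z0 + t%:C * (z1 - z0).
pose P t := agree (half_section X1 s e (zt t)).
have P1 : zt 1 = z1 by rewrite /zt rmorph1 mul1r addrC subrK.
have P0 : zt 0 = z0 by rewrite /zt rmorph0 mul0r addr0.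
rewrite -{1}P0 -{1}P1 => A0.
apply: (@interval_induction _ P 0 1 ler01 A0) => t ht.
have [ph pw] := hz t ht.
have Mz u : 0 <= u <= 1 -> MN X1 (half_section X1 s e (zt u)).
  by move=> /hz[[iu _] _]; exact: half_section_MN.
have [V [oV Vp] hV] := agree_local (conj (Mz t ht) pw).
have [k k0 hk] := half_section_cont b1_gt0 ph oV Vp.
exists (k / (1 + cabs (z1 - z0))); first by rewrite divr_gt0 //; have := cabs_ge0 (z1 - z0); lra.
have near u : 0 <= u <= 1 -> `|u - t| < k / (1 + cabs (z1 - z0)) -> V (half_section X1 s e (zt u)).
  move=> hu; rewrite ltr_pdivlMr; last by have := cabs_ge0 (z1 - z0); lra.
  move=> hut; have [pu _] := hz u hu; apply: hk => //.
  have -> : zt u - (z0 + t%:C * (z1 - z0)) = (u - t)%:C * (z1 - z0) by rewrite /zt rmorphB; ring.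
  rewrite cabsM cabs_real; apply: le_lt_trans hut; rewrite ler_wpM2l //; lra.
by move=> u u' hu hu' hut hu't; apply: hV; [exact: Mz | exact: near | exact: Mz | exact: near].
Qed.

Lemma Wall_below v : 0 < v -> v < L N.+1 -> Wall (ibelow v).
Proof.
move=> v0 vN; have [m m1 hm] := level b1_gt0 v0; exists m.
  rewrite /= m1 /= leNgt; apply/negP => Nm.
  have [n en] : exists n : nat, m = n by apply: int_ge0_nat; lia.
  subst m; have : (N.+1 <= n)%N by lia.
  by move=> /(Lval_le b1_gt0); case/andP: hm => h1 _; lra.
exists v => //; apply/WdiscE; rewrite subrr cabs0; exact: dd_gt0 discs _ v0.
Qed.

Lemma agree_axis (s : R) e (v v' : R) : s * s = 1 -> 0 < v -> v < L N.+1 -> 0 < v' -> v' < L N.+1 ->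
  agree (half_section X1 s e (ibelow v)) -> agree (half_section X1 s e (ibelow v')).
Proof.
move=> ss v0 vN v'0 v'N; apply: agree_path => // t /andP[t0 t1].
have -> : ibelow v + t%:C * (ibelow v' - ibelow v) = ibelow ((1 - t) * v + t * v').
  by rewrite /ibelow rmorphD !rmorphM rmorphB rmorph1; ring.
have [->|tn0] := eqVneq t 0.
  rewrite subr0 mul1r mul0r addr0; split; last exact: Wall_below.
  by rewrite /half_plane /ibelow !ReImE /=; split; lra.
have tp : 0 < t by rewrite lt_neqAle eq_sym tn0.
have a1 : 0 < t * v' by rewrite mulr_gt0.
have a2 : 0 <= (1 - t) * v by rewrite mulr_ge0 ?subr_ge0 // ltW.
have a3 : t * v' < t * L N.+1 by rewrite ltr_pM2l.
have a4 : (1 - t) * v <= (1 - t) * L N.+1 by rewrite ler_wpM2l ?subr_ge0 // ltW.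
have a5 : 0 < (1 - t) * v + t * v' by lra.
split; last by apply: Wall_below => //; lra.
by move: (_ + _) a5 => u u0; rewrite /half_plane /ibelow !ReImE /=; split; lra.
Qed.

Lemma agree_all : agree (half_section X1 1 (fun=> false) (ibelow (L 0 / 2))) ->
  forall p, Mg p -> agree p.
Proof.
move=> A0; have L0 := Lval_gt0 b1_gt0 0; have LN (l : 'I_N.+1) : L l < L N.+1.
  by rewrite !LvalE ltr_pM2l // ltrD2l ltr_nat.
have v0 : 0 < L 0 / 2 by lra.
have vN : L 0 / 2 < L N.+1 by have := LN ord0; rewrite /=; lra.
(* Signs are changed one at a time: go along the axis to [-i L l0], flip the sign of index [l0]
   there, and come back. *)
have A1 e : agree (half_section X1 1 e (ibelow (L 0 / 2))).
  suff H (r : seq 'I_N.+1) : agree (half_section X1 1 (fun l => e l && (l \in r)) (ibelow (L 0 / 2))).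
    have := H (enum 'I_N.+1); congr (agree (half_section _ _ _ _)); apply/funext => l.
    by rewrite mem_enum andbT.
  elim: r => [|l0 r IH].
    by have -> : (fun l => e l && (l \in [::])) = (fun=> false) by apply/funext => l; rewrite andbF.
  apply: (@agree_axis 1 _ (L l0)); rewrite ?mulr1 ?Lval_gt0 //.
  rewrite -(half_section_flip b1_gt0 (e := fun l => e l && (l \in r))).
    by apply: (@agree_axis 1 _ (L 0 / 2)); rewrite ?mulr1 ?Lval_gt0.
  by move=> l ll0; rewrite inE (negbTE ll0).
move=> p [Mp [m hm [v [v0' hv] hz]]].
have iz := Wdisc_lower b1_gt0 discs v0' hz.
have vN' : v < L N.+1.
  case/andP: hv => _ hv; apply: lt_le_trans hv _; case/andP: hm => m1 mN.
  have [m0|m0] := ltP m 0.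
    have em : m = -1 by lia.
    by subst m; have := LN ord0; rewrite /= => ?; apply: ltW.
  have [n en] := int_ge0_nat m0; subst m; rewrite LvalS; apply: Lval_le => //; lia.
(* The side of the axis on which [p] lies, so that the radius of its disc stays in the closed half
   plane where the section is continuous. *)
have [s ss hs] : exists2 s : R, s * s = 1 & 0 <= s * Re p.1.
  have [hre|hre] := leP 0 (Re p.1); first by exists 1; rewrite ?mulr1 // mul1r.
  by exists (-1); rewrite ?mulrNN ?mulr1 // mulN1r oppr_ge0 ltW.
have [e ->] := half_section_of ss Mp.
apply: (@agree_path s e (ibelow v)) => //.
  move=> t ht; have Wt := Wdisc_segment hz ht; split.
    split; first exact: (Wdisc_lower b1_gt0 discs v0' Wt).
    rewrite /ibelow !ReImE /=; case/andP: ht => t0 t1.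
    have -> : s * (- (0 * v - 1 * 0) + (t * (Re p.1 - - (0 * v - 1 * 0)) - 0 * (Im p.1 - - (0 * 0 + 1 * v)))) =
      t * (s * Re p.1) by ring.
    exact: mulr_ge0.
  by exists m => //; exists v.
apply: (@agree_axis s e (L 0 / 2)) => //.
have s1 : s = 1 \/ s = -1.
  have : (s - 1) * (s + 1) = 0 by have -> : (s - 1) * (s + 1) = s * s - 1 by [ring]; rewrite ss subrr.
  by move=> /eqP; rewrite mulf_eq0 subr_eq0 addr_eq0 => /orP[] /eqP; [left|right].
case: s1 => ->; first exact: A1.
rewrite half_section_opp //.
have ib : Im (ibelow (L 0 / 2)) = - (L 0 / 2) by rewrite /ibelow !ReImE /=; ring.
by split; [apply: lower_neq0; rewrite ib; lra | right; rewrite ib normrN gtr0_norm; lra].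
Qed.

(** In a chart at [p] there are unramified points outside [E] arbitrarily close to [p]; there [h]
    equals [h0], which is bounded near [p]. *)
Lemma agree_no_pole p : Mg p -> E p -> agree p -> ~ has_pole X1 h p.
Proof.
move=> /[dup] Mp [MNp Wp] Ep [V [oV Vp] hV] hpole; have [r r0 hr] := Wall_open Wp.
have [t0 [d [zc [zt [d0 hpar e0 hc hnz]]]]] := MN_exists_chart b1_gt0 MNp r0.
have [_ /(_ p Mp)[V1 [oV1 V1p] hV1]] := discE.
have t0d : cball t0 d t0 by rewrite /cball /= subrr cabs0.
have [cz ct Mt Wt] := hc _ t0d.
have ch0 := hol_ccont (hol_h0 cz ct Mt (hr _ Wt)).
have [d1 d10 h1] := ch0 _ ltr01.
have [V2 [oV2 V2p] hV2] := hpole (cabs (h0 p) + 1).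
have ent (V' : set pt) : open V' -> V' p -> exists2 d : R, 0 < d & forall s, cabs (s - t0) < d -> V' (chart zc zt s).
  by move=> oV' V'p; apply: chart_enters => //; [exact: hol_ccont | move=> l; exact: hol_ccont | rewrite e0].
have [k1 k10 hk1] := ent V oV Vp; have [k2 k20 hk2] := ent V1 oV1 V1p; have [k3 k30 hk3] := ent V2 oV2 V2p.
have [j1 j10 hj1] := min2_gt0 k10 k20; have [j2 j20 hj2] := min2_gt0 k30 d10.
have [j3 j30 hj3] := min2_gt0 j10 j20; have [j j0 hj] := min2_gt0 j30 d0.
pose s := t0 + (j / 2)%:C.
have cs : cabs (s - t0) = j / 2 by rewrite /s addrC addKr cabs_pos; lra.
have st : s != t0 by rewrite -subr_eq0 -cabs_gt0 cs; lra.
have [|/hj3[/hj1[s1 s2] /hj2[s3 s4]] s5] := hj (cabs (s - t0)); first by rewrite cs; lra.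
have [_ _ _ inj _] := hpar d (lexx d).
have qp : chart zc zt s <> p by rewrite -e0 => /(inj s t0 s5 t0d) e; rewrite e eqxx in st.
have [_ _ Ms _] := hc s s5.
have nE : ~ E (chart zc zt s) by move=> Es; apply: qp; exact: hV1 (conj Es (hk2 s s2)).
have us : unramified (chart zc zt s) by move=> l; rewrite /= mxE; exact: hnz.
have := hV2 _ Ms (hk3 s s3) qp; rewrite cabsE ltcR (hV _ Ms (hk1 s s1) nE us).
have := h1 s s4; rewrite e0; have := cabsD (h0 (chart zc zt s) - h0 p) (h0 p); rewrite subrK; lra.
Qed.

End Resonances.

Section Base.
Variables (R : realType) (X1 : rank_one_space R) (N : nat).
Local Notation C := R[i].
Local Notation ii := (imag_unit R).
Local Notation Re := complex.Re.
Local Notation Im := complex.Im.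
Local Notation L := (Lval X1).
Local Notation pt := (surface_point R N).
Hypothesis b1_gt0 : 0 < blen X1.
Variables (rr dd : R -> R).
Hypothesis discs : disc_data X1 rr dd.
Local Notation Wall := (Wall X1 N dd).

Lemma offaxis_offcut (z : C) : offaxis X1 z -> ~ neg_imag_cut X1 z.
Proof.
move=> [_ h] [r0 i0]; case: h => // h; have := ler_norm (- Im z); rewrite normrN; lra.
Qed.

(** A lift is prescribed on the principal section only; the point is that all points of the surface
    near the base point lie on this section. *)
Lemma agree_base (h h0 : pt -> C) (E : set pt) (k : C -> C) : lifts_off X1 dd E h k ->
  (forall z, Wall z -> offaxis X1 z -> h0 (sigma X1 (all_plus N) z) = k z) ->
  agree X1 h h0 E (half_section X1 1 (fun=> false) (ibelow (L 0 / 2))).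
Proof.
move=> hl h0E; set z0 := ibelow _; have L0 := Lval_gt0 b1_gt0 0.
have ib : Im z0 = - (L 0 / 2) by rewrite /z0 /ibelow !ReImE /=; ring.
have oz : offaxis X1 z0.
  by split; [apply: lower_neq0; rewrite ib; lra | right; rewrite ib normrN gtr0_norm; lra].
have Wz : Wall z0.
  apply: (Wall_below b1_gt0 discs); first lra.
  by have := Lval_le b1_gt0 (leq0n N.+1); lra.
have ns (l : 'I_N.+1) : ~ slit (upt X1 l z0) by exact: offaxis_slit.
have [r1 r10 hr1] := Wall_open Wz; have [r2 r20 hr2] := offaxis_near oz.
have [|l|d1 d10 h1] := @fin_min R _ (fun (l : 'I_N.+1) d => d <= cabs (zeta_plus X1 l z0) / 2 /\
    forall w, cabs (w - z0) < d -> cabs (zeta_plus X1 l w - zeta_plus X1 l z0) < cabs (zeta_plus X1 l z0) / 2).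
- move=> l d d' dd' [a1 a2]; split; first exact: le_trans dd' a1.
  by move=> w hw; apply: a2; exact: lt_le_trans hw dd'.
- have c2 : 0 < cabs (zeta_plus X1 l z0) / 2 by rewrite divr_gt0 // cabs_gt0; exact: zs_neq0 (ns l).
  have [d d0 hd] := hol_ccont (hol_near_hol (holn_zeta oz.1 (ns l))) c2.
  have [e e0 he] := min2_gt0 d0 c2; have [|e1 e2] := he (e / 2); first lra.
  exists (e / 2); first lra.
  split; first exact: ltW.
  by move=> w hw; apply: hd; exact: lt_trans hw e1.
have [k1 k10 hk1] := min2_gt0 r10 r20; have [d d0 hd] := min2_gt0 k10 d10.
have [V [oV Vp] hV] := @surf_open_near R N (half_section X1 1 (fun=> false) z0) d d0.
exists V => // q Mq Vq nEq _; have [q1 q2] := hV _ Vq.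
have [/hk1[/hr1 Wq /hr2 oq] q1d] := hd _ q1.
have Eq : q = sigma X1 (all_plus N) q.1.
  apply: injective_projections => //; apply/rowP => l; rewrite mxE ffunE mul1r.
  have [//|e] := MN_zeta l Mq; exfalso.
  have [_ b1] := hd _ (q2 l); have [a1 a2] := h1 l; have a3 := a2 _ q1d.
  move: b1; rewrite /= mxE rmorph1 !mul1r -/(zeta_plus X1 l z0) e => b1.
  have := cabsD (- zeta_plus X1 l q.1 - zeta_plus X1 l z0) (zeta_plus X1 l q.1 - zeta_plus X1 l z0).
  have -> : - zeta_plus X1 l q.1 - zeta_plus X1 l z0 + (zeta_plus X1 l q.1 - zeta_plus X1 l z0) =
    - (2 * zeta_plus X1 l z0) by ring.
  have c2 : cabs (2 : C) = 2 by have := cabs_pos (ler0n R 2); rewrite rmorph_nat.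
  rewrite cabsN cabsM c2; have := cabs_ge0 (zeta_plus X1 l z0); lra.
rewrite Eq h0E // hl //; first exact: offaxis_offcut.
by rewrite -Eq.
Qed.

End Base.

Theorem theorem25 (R : realType) (X1 X2 : rank_one_space R)
    (m1_odd : odd (mult_beta X1)) (m2_even : ~~ odd (mult_beta X2))
    (mu : {measure set (borelT X1 X2) -> \bar R}) (mu_haar : haar_measure mu)
    (phi : R[i] -> R[i] ->
           ambient X1 X2 -> R[i])
    (phi_spherical : spherical_family phi)
    (kappa : R[i])
    (Rs H : (ambient X1 X2 -> R[i]) ->
            ambient X1 X2 -> R[i] -> R[i])
    (Rs_resolvent : resolvent_family mu kappa Rs)
    (x0 y0 : R) (x0_gt0 : 0 < x0) (y0_gt0 : 0 < y0)
    (HH : H_family mu phi x0 y0 Rs H)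
    (rr dd : R -> R) (discs : disc_data X1 rr dd)
    (discs_small : forall N : nat, (0 < N)%N -> small_discs X1 N dd)
    (Fm : (ambient X1 X2 -> R[i]) ->
          ambient X1 X2 -> int -> R[i] -> R[i])
    (HFm : Fm_family mu phi rr dd Fm) :
  (forall (f : ambient X1 X2 -> R[i])
          (y : ambient X1 X2) (N : nat),
     Cc_infty f -> prodG y -> (0 < N)%N ->
     exists Ft : surface_point R N -> R[i],
       [/\ holomorphic_on_surf X1 (Mgamma X1 dd) Ft,
           lifts X1 dd Ft (Ffun mu phi f y),
           forall (m : int) (eps : {ffun 'I_N.+1 -> bool}) (p : surface_point R N),
             -1 <= m <= N%:Z ->
             (Uvee X1 dd m eps `|` Ueps X1 dd m eps) p ->
             Ft p = Fm f y m p.1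
               + 2 * (\sum_(l < N.+1 | l%:Z <= m)
                        Gfun mu phi f y l p.1 (p.2 0 l))
               + 2 * (\sum_(l < N.+1 | (m < l%:Z) && eps l)
                        (Gfun mu phi f y l p.1 (p.2 0 l)
                         - Gfun mu phi f y l p.1 (- p.2 0 l))) &
           let Rt := fun p : surface_point R N =>
             H f y p.1 + imag_unit R * pi%:C * Ft p in
           holomorphic_on_surf X1 (Mgamma X1 dd) Rt /\
           lifts X1 dd Rt (Rs f y)]) /\
  (forall (N : nat) (p : surface_point R N), (0 < N)%N ->
     Mgamma X1 dd p -> ~ resonance dd Rs p).
Proof.
have b1_gt0 : 0 < blen X1 by exact: small_discs_blen (discs_small 1 isT).
have Rt_chart (f : ambient X1 X2 -> R[i]) (y : ambient X1 X2) (N : nat) (hf : Cc_infty f) (hy : prodG y)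
    (zc : R[i] -> R[i]) (zt : 'I_N.+1 -> R[i] -> R[i]) (s : R[i]) :
    hol zc s -> (forall l, hol (zt l) s) -> MN X1 (chart zc zt s) -> Wall X1 N dd (zc s) ->
    hol (fun s => H f y (chart zc zt s).1 +
      imag_unit R * pi%:C * Ftilde mu phi f y dd Fm (chart zc zt s)) s.
  move=> hz hzt hM Wz; apply: holD.
    apply: (hol_comp hz); apply/derivable_hol; have [hH _] := HH _ _ hf hy; apply: hH; right.
    exact: (Wall_lower b1_gt0 discs Wz).
  apply: holM => //.
  exact: (hol_Ftilde_chart mu_haar phi_spherical hf hy b1_gt0 m1_odd m2_even discs HFm).
have F_plus (f : ambient X1 X2 -> R[i]) (y : ambient X1 X2) (N : nat) (hf : Cc_infty f) (hy : prodG y)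
    (z : R[i]) : Wall X1 N dd z -> offaxis X1 z ->
    Ftilde mu phi f y dd Fm (sigma X1 (all_plus N) z) = Ffun mu phi f y z.
  exact: (Ftilde_plus mu_haar phi_spherical hf hy b1_gt0 m1_odd m2_even discs HFm).
have R_plus (f : ambient X1 X2 -> R[i]) (y : ambient X1 X2) (N : nat) (hf : Cc_infty f) (hy : prodG y)
    (z : R[i]) : Wall X1 N dd z -> offaxis X1 z ->
    H f y z + imag_unit R * pi%:C * Ftilde mu phi f y dd Fm (sigma X1 (all_plus N) z) = Rs f y z.
  move=> Wz oz; have iz := Wall_lower b1_gt0 discs Wz.
  rewrite (F_plus _ _ _ hf hy _ Wz oz).
  rewrite (Rs_continuation mu_haar phi_spherical hf hy b1_gt0 Rs_resolvent x0_gt0 y0_gt0 HH iz (offaxis_offcut oz)).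
  by rewrite [imag_unit R * _]mulrC.
split=> [f y N hf hy N0|N p N0 Mp [f [y [Rt [E [[hf hy] dE hRt lRt [Ep pole]]]]]]].
  exists (Ftilde mu phi f y dd Fm (N := N)); split.
  - apply: (holomorphic_on_charts b1_gt0 (@Wall_open _ X1 dd N)) => zc zt s hz hzt hM Wz.
    exact: (hol_Ftilde_chart mu_haar phi_spherical hf hy b1_gt0 m1_odd m2_even discs HFm).
  - move=> z Wz nc _; apply: F_plus => //; apply: offcut_offaxis nc; exact: (Wall_lower b1_gt0 discs Wz).
  - move=> m eps p; exact: (Ftilde_sheet mu_haar phi_spherical hf hy b1_gt0 m1_odd m2_even discs HFm).
  - split.
      by apply: (holomorphic_on_charts b1_gt0 (@Wall_open _ X1 dd N)) => zc zt s; exact: Rt_chart.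
    move=> z Wz nc _; apply: R_plus => //; apply: offcut_offaxis nc; exact: (Wall_lower b1_gt0 discs Wz).
pose h0 (q : surface_point R N) := H f y q.1 + imag_unit R * pi%:C * Ftilde mu phi f y dd Fm q.
have hol0 := Rt_chart f y N hf hy.
(* Here [h0] is the holomorphic extension of the resolvent, against which an arbitrary meromorphic
   continuation is compared. *)
apply: (agree_no_pole (h0 := h0) b1_gt0 dE hol0 Mp Ep) pole.
apply: (agree_all b1_gt0 discs dE hRt hol0) Mp.
by apply: (agree_base b1_gt0 discs lRt) => z Wz oz; exact: (R_plus _ _ _ hf hy _ Wz oz).
Qed.
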